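(* Let $\rho\in(0,1)$, $a\in\mathbb R$, $T>0$, $\chi(\rho)=\rho(1-\rho)$, and let $\{\mathcal Y_t;t\in[0,T]\}$ be the stationary solution of the infinite-dimensional Ornstein-Uhlenbeck equation with drift $$d\mathcal Y_t=\tfrac12\Delta\mathcal Y_t\,dt+a(1-2\rho)\nabla\mathcal Y_t\,dt+\sqrt{\chi(\rho)}\,\nabla d\mathcal M_t .$$ For $\varepsilon\in(0,1)$ and $t\in[0,T]$ define $\mathcal Z^\varepsilon_t=\int_0^t\mathcal Y_s(i_\varepsilon)\,ds$, where $i_\varepsilon(y)=\varepsilon^{-1}\mathbf 1(0<y\le\varepsilon)$. Then, as $\varepsilon\to0$, the processes $\{\mathcal Z^\varepsilon_t;t\in[0,T]\}$ converge in distribution with respect to the uniform topology of $\mathcal C([0,T];\mathbb R)$ to a Gaussian process $\{\mathcal Z_t;t\in[0,T]\}$ of stationary increments, satisfying $$\mathbb E[\mathcal Z_t^2]=\chi(\rho)\sqrt{\frac2\pi}\int_0^t\frac{(t-s)e^{-(a(1-2\rho))^2s/2}}{\sqrt s}\,ds .$$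
   Context: For $D,\sigma>0$ and $v\in\mathbb R$, an $\mathcal S'(\mathbb R)$-valued process $\{\mathcal Y_t;t\in[0,T]\}$ with continuous trajectories is a solution of $d\mathcal Y_t = D\Delta\mathcal Y_t\,dt+v\nabla\mathcal Y_t\,dt+\sigma\nabla d\mathcal M_t$ if for any smooth trajectory $t\mapsto u_t$ from $[0,T]$ to the Schwartz space $\mathcal S(\mathbb R)$ the process $\mathcal Y_t(u_t)-\mathcal Y_0(u_0)-\int_0^t\mathcal Y_s((\partial_s+D\Delta-v\nabla)u_s)\,ds$ is a martingale of quadratic variation $\sigma^2\int_0^t\|\nabla u_s\|^2ds$ ($\|\cdot\|$ the $L^2(\mathbb R)$-norm). The solution is stationary if $\mathcal Y_0$ is a white noise of variance $\sigma^2/2D$ (here equal to $\chi(\rho)$), i.e. $\mathcal Y_0(u)$ is normal with mean zero and variance $\frac{\sigma^2}{2D}\|u\|^2$ for each $u\in\mathcal S(\mathbb R)$. For a stationary solution $\mathcal Y_t(u)$ is defined for $u\in L^2(\mathbb R)$ as the $L^2(\mathbb P)$-limit of $\mathcal Y_t(u^n)$ with $u^n\in\mathcal S(\mathbb R)$, $u^n\to u$ in $L^2(\mathbb R)$. *)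

(* Defs.v *)
From HB Require Import structures.
From mathcomp Require Import all_boot all_order all_algebra.
From mathcomp Require Import all_classical all_reals all_analysis.

Set Implicit Arguments.
Unset Strict Implicit.
Unset Printing Implicit Defensive.

Import Order.TTheory GRing.Theory Num.Theory.
Import numFieldNormedType.Exports.

Local Open Scope classical_set_scope.
Local Open Scope ring_scope.

Local Notation "f ^` ()" := (derive1 f) : ring_scope.
Local Notation "f ^` ( n )" := (derive1n n f) : ring_scope.

Section schwartz_space.
Context {R : realType}.
Implicit Types f g : R -> R.

Definition is_schwartz f : Prop :=
  (forall n x, derivable (f^`(n)) x 1) /\
  (forall k n, exists C, forall x, `|x ^+ k * (f^`(n)) x| <= C).

Definition schwartz_pred : pred (R -> R) := fun f => `[< is_schwartz f >].

Record schwartz := Schwartz {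
  schwartz_fun :> R -> R ;
  schwartz_funP : schwartz_pred schwartz_fun }.

HB.instance Definition _ := [isSub for schwartz_fun].
HB.instance Definition _ := [Choice of schwartz by <:].

Lemma derive1n_lin (a : R) f g : is_schwartz f -> is_schwartz g ->
  forall n, (a *: f + g)^`(n) = a *: f^`(n) + g^`(n).
Proof.
move=> [df _] [dg _]; elim=> [//|n IH].
rewrite !derive1nS IH; apply/funext => x.
have daf : derivable (a *: f^`(n)) x 1 by exact/derivableZ/df.
by rewrite derive1E deriveD// deriveZ// [RHS]/= -!derive1E.
Qed.

Lemma is_schwartz0 : is_schwartz 0.
Proof.
have d0 n : (0 : R -> R)^`(n) = 0.
  elim: n => [//|n IH]; rewrite derive1nS IH; apply/funext => x.
  by rewrite derive1E derive_cst.
split=> [n x|k n]; first by rewrite d0; exact: derivable_cst.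
by exists 0 => x; rewrite d0 mulr0 normr0.
Qed.

Lemma is_schwartz_lin (a : R) f g :
  is_schwartz f -> is_schwartz g -> is_schwartz (a *: f + g).
Proof.
move=> Sf Sg; have D := derive1n_lin a Sf Sg.
split=> [n x|k n].
  rewrite D; apply: derivableD; last by case: Sg.
  by apply: derivableZ; case: Sf.
have [_ /(_ k n)[C hC]] := Sf; have [_ /(_ k n)[C' hC']] := Sg.
exists (`|a| * C + C') => x.
rewrite D -[(_ + _) x]/(a * (f^`(n)) x + (g^`(n)) x) mulrDr.
rewrite (le_trans (ler_normD _ _))// lerD// mulrCA normrM.
exact: ler_wpM2l.
Qed.

Lemma schwartz_submod_closed : submod_closed schwartz_pred.
Proof.
split=> [|a f g]; first exact/asboolP/is_schwartz0.
by move=> /asboolP Sf /asboolP Sg; exact/asboolP/is_schwartz_lin.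
Qed.

HB.instance Definition _ :=
  GRing.isSubmodClosed.Build R (R -> R) schwartz_pred schwartz_submod_closed.
HB.instance Definition _ := [SubChoice_isSubLmodule of schwartz by <:].

Lemma is_schwartz_derive1 f : is_schwartz f -> is_schwartz f^`().
Proof.
move=> [df bf]; split=> [n x|k n]; first by rewrite -derive1Sn; exact: df.
by have [C hC] := bf k n.+1; exists C => x; rewrite -derive1Sn; exact: hC.
Qed.

Definition sgrad (u : schwartz) : schwartz :=
  Schwartz (asboolT (is_schwartz_derive1 (asboolW (schwartz_funP u)))).

Definition slap (u : schwartz) : schwartz := sgrad (sgrad u).

(* The usual Frechet topology: the coarsest one for which every map
   u |-> x^k u^(n)(x) is continuous into the bounded functions with the
   supremum distance. *)
Definition schwartz_seminorms (u : schwartz) :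
    prod_topology (fun _ : nat * nat => {uniform R -> R}) :=
  fun kn => fun x : R => x ^+ kn.1 * ((u : R -> R)^`(kn.2)) x.

HB.instance Definition _ :=
  Uniform.copy schwartz (initial_topology schwartz_seminorms).

Record tempered := Tempered {
  pairing :> {linear schwartz -> R} ;
  pairing_continuous : continuous (pairing : schwartz -> R) }.

HB.instance Definition _ := gen_eqMixin tempered.
HB.instance Definition _ := gen_choiceMixin tempered.

(* The weak-* topology. *)
HB.instance Definition _ := Uniform.copy tempered
  (initial_topology (fun L : tempered => (L : schwartz -> R) : {ptws schwartz -> R})).

End schwartz_space.

Arguments schwartz R : clear implicits.
Arguments tempered R : clear implicits.

(* The derivative is the limit of the difference quotients in the topology of
   the Schwartz space; it is one-sided at 0 and T. *)
Definition is_time_derivative {R : realType} (T : R) (u du : R -> schwartz R) :=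
  forall t, t \in `[0, T] ->
    (s - t)^-1 *: (u s - u t) @[s --> within `[0, T]%classic t^'] --> du t.

Definition smooth_trajectory {R : realType} (T : R) (u : R -> schwartz R) :=
  exists D : nat -> R -> schwartz R,
    D 0%N = u /\ forall n, is_time_derivative T (D n) (D n.+1).

Section martingales.
Context {R : realType} {d : measure_display} {Omega : measurableType d}.
Variable P : probability Omega R.
Implicit Types (F : R -> set (set Omega)) (M A : R -> Omega -> R).

Definition adapted F (T : R) M :=
  forall t, t \in `[0, T] ->
    forall B : set R, measurable B -> F t (M t @^-1` B).

Definition martingale F (T : R) M :=
  [/\ adapted F T M,
      (forall t, t \in `[0, T] -> P.-integrable setT (EFin \o M t)) &
      (* E[M_t | F_s] = M_s *)
      forall s t, 0 <= s -> s <= t -> t <= T -> forall E, F s E ->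
        (\int[P]_(w in E) (M t w)%:E = \int[P]_(w in E) (M s w)%:E)%E].

(* The increasing process of the Doob-Meyer decomposition of M^2. *)
Definition quadratic_variation F (T : R) M A :=
  [/\ (forall w, A 0 w = 0),
      adapted F T A,
      (forall w, {within `[0, T], continuous (A ^~ w)}),
      (forall w, {in `[0, T] &, {homo A ^~ w : s t / s <= t}}) &
      martingale F T (fun t w => M t w ^+ 2 - A t w)].

End martingales.

Section gaussian.
Context {R : realType} {d : measure_display} {Omega : measurableType d}.
Variable P : probability Omega R.

(* [v] is the variance, whereas the second argument of [normal_prob] is the
   standard deviation, which has to be nonzero. *)
Definition normal_rv (X : Omega -> R) (m v : R) :=
  [/\ 0 <= v, measurable_fun setT X &
      forall B : set R, measurable B ->
        P (X @^-1` B) =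
          if v == 0 then \d_m B else normal_prob m (Num.sqrt v) B].

Definition gaussian_process (T : R) (Z : R -> Omega -> R) :=
  forall n (t c : 'I_n -> R), (forall i, t i \in `[0, T]) ->
    exists m v, normal_rv (fun w => \sum_(i < n) c i * Z (t i) w) m v.

Definition stationary_increments (T : R) (Z : R -> Omega -> R) :=
  forall (h : R) n (t : 'I_n -> R), 0 <= h ->
    (forall i, 0 <= t i /\ t i + h <= T) ->
    forall B : set (n.-tuple R), measurable B ->
      P ((fun w => [tuple Z (t i + h) w - Z h w | i < n]) @^-1` B) =
      P ((fun w => [tuple Z (t i) w - Z 0 w | i < n]) @^-1` B).

End gaussian.

Section path_space.
Context {R : realType}.

(* A path is represented by any function on R which extends it; the topology of
   [{uniform` `[0, T] -> R}] only sees the restriction to [0,T]. *)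
Definition C0T (T : R) : set {uniform` `[0, T]%classic -> R} :=
  [set f | {within `[0, T], continuous (f : R -> R)}].

Local Arguments C0T T f : clear implicits.

Definition continuous_process {d : measure_display} {Omega : measurableType d}
    (T : R) (X : R -> Omega -> R) :=
  (forall t, t \in `[0, T] -> measurable_fun setT (X t)) /\
  (forall w, C0T T (X ^~ w)).

Definition cvg_distribution_C0T (T : R) {I : Type} (G : set_system I)
    {d : measure_display} {Omega : measurableType d} (P : probability Omega R)
    (X : I -> R -> Omega -> R)
    {d' : measure_display} {Omega' : measurableType d'}
    (P' : probability Omega' R) (Z : R -> Omega' -> R) :=
  [/\ (\forall i \near G, continuous_process T (X i)),
      continuous_process T Z &
      forall Phi : {uniform` `[0, T]%classic -> R} -> R,
        {within C0T T, continuous Phi} ->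
        (exists C, forall f, C0T T f -> `|Phi f| <= C) ->
        ('E_P[fun w => Phi (X i ^~ w)])%E @[i --> G] -->
          ('E_P'[fun w => Phi (Z ^~ w)])%E].

End path_space.

Arguments C0T {R} T f.

Section ornstein_uhlenbeck.
Context {R : realType} {d : measure_display} {Omega : measurableType d}.
Variable P : probability Omega R.
Implicit Types Y : R -> Omega -> tempered R.
Local Notation mu := lebesgue_measure.

Definition natural_filtration Y (t : R) : set (set Omega) :=
  <<s [set E | exists s (u : schwartz R) (B : set R),
        [/\ s \in `[0, t], measurable B & E = (fun w => Y s w u) @^-1` B] ]>>.

Definition OU_martingale (D v : R) Y (u du : R -> schwartz R) (t : R) (w : Omega)
    : R :=
  Y t w (u t) - Y 0 w (u 0)
  - \int[mu]_(s in `[0, t]) Y s w (du s + D *: slap (u s) - v *: sgrad (u s)).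

Definition L2sq (f : R -> R) : R := \int[mu]_x f x ^+ 2.

Definition OU_solution (T D v sigma : R) Y :=
  [/\ (forall t u, t \in `[0, T] -> measurable_fun setT (fun w => Y t w u)),
      (forall w, {within `[0, T], continuous (Y ^~ w)}) &
      forall u du : R -> schwartz R,
        smooth_trajectory T u -> is_time_derivative T u du ->
        let M := OU_martingale D v Y u du in
        martingale P (natural_filtration Y) T M /\
        quadratic_variation P (natural_filtration Y) T M
          (fun t _ => sigma ^+ 2 * \int[mu]_(s in `[0, t]) L2sq (sgrad (u s)))].

Definition stationary_OU_solution (T D v sigma : R) Y :=
  OU_solution T D v sigma Y /\
  forall u : schwartz R,
    normal_rv P (fun w => Y 0 w u) 0 (sigma ^+ 2 / (2 * D) * L2sq u).

(* [X] is the value at [f], in L^2(R), of the extension of a random tempered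
   distribution [L] by L^2(P)-limits. *)
Definition L2_extension (L : Omega -> tempered R) (f : R -> R) (X : Omega -> R) :=
  measurable_fun setT X /\
  forall u_ : nat -> schwartz R,
    ('N[mu]_2%:E[EFin \o (fun x => u_ n x - f x)%R])%E @[n --> \oo] --> 0%E ->
    ('N[P]_2%:E[EFin \o (fun w => L w (u_ n) - X w)%R])%E @[n --> \oo] --> 0%E.

(* Each Y_t(f) is only defined almost surely; integrating in time requires a
   jointly measurable version with integrable trajectories. *)
Definition L2_version (T : R) Y (f : R -> R) (V : R -> Omega -> R) :=
  [/\ measurable_fun (`[0, T]%classic `*` [set: Omega])
        (fun p : R * Omega => V p.1 p.2),
      (forall w, mu.-integrable `[0, T] (fun s => (V s w)%:E)) &
      forall t, t \in `[0, T] -> L2_extension (Y t) f (V t)].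

(* The process Y_t(f) for f in L^2(R).  The version is picked by choice: two
   versions have almost surely the same time integrals.  As with [lim], the
   default value is returned when no version exists. *)
Definition L2_process (T : R) Y (f : R -> R) : R -> Omega -> R :=
  xget (fun _ _ => 0) [set V | L2_version T Y f V].

Definition i_eps (eps y : R) : R := eps^-1 * \1_(`]0, eps]%classic : set R) y.

Definition Z_eps (T : R) Y (eps t : R) (w : Omega) : R :=
  \int[mu]_(s in `[0, t]) L2_process T Y (i_eps eps) s w.

End ornstein_uhlenbeck.

Definition chi {R : realType} (rho : R) : R := rho * (1 - rho).

(* Main.v *)
Require Import Defs.
From mathcomp Require Import all_boot all_order all_algebra.
From mathcomp Require Import all_classical all_reals all_analysis.
From mathcomp Require Import measurable_realfun ring lra.

(** The process Y is identified first. Put c = rho (1 - rho) and v = a (1 - 2 rho), and let S_r be the semigroup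
    of the operator 1/2 Laplacian - v gradient, that is [heat v r]: S_r u (x) is the mean of u (x - v r + sqrt r
    N) for a standard normal N. The martingale problem is needed for test functions u that are constant in time
    only. By Levy's characterisation [levy], the increment over [s, t] of the corresponding continuous
    martingale is independent of the past and normal of variance c |grad u|^2 (t - s). Freezing the solution r
    -> S_(t-r) u of the backward equation on the intervals of a fine grid and adding up these increments gives
    Y_t(u) - Y_s(S_(t-s) u) in the limit [duhamel_path], which is therefore independent of the past and normal
    of variance c (|u|^2 - |S_(t-s) u|^2) [ou_duhamel]. As Y_0 is a white noise, all finite sums of values
    Y_t(u) are centred Gaussian [ysum_gaussian], with E[Y_s(h) Y_t(u)] = c <h, S_(t-s) u> for s <= t
    [ou_covariance]. Closing this linear family for convergence in probability yields a Gaussian space, in which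
    convergence in probability amounts to convergence in mean square [gclos_L2]; it contains the values of the
    extension of Y to square-integrable functions, their time integrals and the limit process.

    The moments come from the heat kernel. If u and w are nonnegative of mass at most 1, then <u, S_r w> lies
    between 0 and (2 pi r)^(-1/2), which is integrable at 0. Hence the integral of Y(u) over [a, b] has a second
    moment of order (b - a)^(3/2), uniformly in u [tint_bound]; and when u and w shrink to the origin the
    covariance of their integrals converges to the integral over [0, b - a] of 2 c (b - a - s) p_s, where p_s is
    the value at v s of the normal density of variance s [tint_limit]. Approximation by Schwartz functions
    transfers both statements to Z^eps [Z_eps_increment_le, Z_eps_covariance_cvg]. By the second one, Z^eps_t is
    Cauchy in mean square as eps tends to 0.

    Since the exponent 3/2 exceeds 1, chaining over the dyadic times improves this to uniform convergence: the
    mean of sup_t |Z^e_t - Z^e'_t|^2 tends to 0 with e and e' [sup_dist_cauchy]. Along scales that decrease fast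
    enough the paths converge uniformly, almost surely, to a continuous process Z on the same probability space
    [limit_process], and dominated convergence gives the convergence in distribution [uniform_cvg_distribution].
    The increments of Z are in the Gaussian space and their variances depend on the length of the interval only
    [limit_increment]. Polarisation gives the covariances of increments, which are invariant under time shifts;
    as a centred Gaussian vector is determined by its covariances [vector_law], the increments are stationary.
    The formula for the variance of Z_t is the integral of 2 c (t - s) p_s written out [limit_varianceE]. *)

Set Implicit Arguments.
Unset Strict Implicit.
Unset Printing Implicit Defensive.

Import Order.TTheory GRing.Theory Num.Theory.
Import numFieldNormedType.Exports.

Local Open Scope classical_set_scope.
Local Open Scope ring_scope.

Local Notation measT := (measurable_fun setT) (only parsing).
Local Notation L1 m f := (m.-integrable setT (EFin \o f)) (only parsing).
Local Notation intZ := (integrableZl measurableT) (only parsing).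
Local Notation intD := (integrableD measurableT) (only parsing).
Local Notation intB := (integrableB measurableT) (only parsing).
Local Notation RintZ := (RintegralZl _ measurableT) (only parsing).
Local Notation RintD := (RintegralD measurableT) (only parsing).
Local Notation RintB := (RintegralB measurableT) (only parsing).

(** * Limits of sequences and of integrals *)

Lemma cvg_eqr {R : realType} (f : nat -> R) (l l' : R) : f n @[n --> \oo] --> l -> l = l' -> f n @[n --> \oo] --> l'.
Proof. by move=> fl <-. Qed.

Lemma cvgr_unique {R : realType} (f g : nat -> R) (l l' : R) :
  f n @[n --> \oo] --> l -> g n @[n --> \oo] --> l' -> (forall n, f n = g n) -> l = l'.
Proof.
move=> fl gl fg; have e : f = g by apply/funext. rewrite e in fl; rewrite -(cvg_lim (@Rhausdorff R) fl).
exact: (cvg_lim (@Rhausdorff R) gl).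
Qed.

Lemma cvg_dist_le {R : realType} (f g : nat -> R) (l : R) : (forall n, `|f n - l| <= g n) -> g n @[n --> \oo] --> 0 ->
  f n @[n --> \oo] --> l.
Proof.
move=> fg g0; apply/cvgrPdist_le => e e0. move/cvgr0Pnorm_le : g0 => /(_ e e0); apply: filterS => n gn.
by rewrite distrC (le_trans (fg n))// (le_trans _ gn)// ler_norm.
Qed.

Arguments cvg_eqr {R f} l {l'}.
Arguments cvg_dist_le {R f} g {l}.

Lemma cvg_harmonic_dist {R : realType} (f : nat -> R) (l : R) :
  (forall n, `|f n - l| <= n.+1%:R^-1) -> f n @[n --> \oo] --> l.
Proof. by move=> fl; exact: cvg_dist_le _ fl cvg_harmonic. Qed.

Lemma cvg0_harmonic {R : realType} (f : nat -> R) : (forall n, 0 <= f n <= n.+1%:R^-1) -> f n @[n --> \oo] --> 0.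
Proof. by move=> f0; apply: cvg_harmonic_dist => n; have /andP[? ?] := f0 n; rewrite subr0 ger0_norm. Qed.

Lemma cvg_ge_lim {R : realType} (f : nat -> R) (a l : R) : f n @[n --> \oo] --> l -> (forall n, a <= f n) -> a <= l.
Proof.
move=> fl af; rewrite -(cvg_lim (@Rhausdorff R) fl); apply: limr_ge.
  by apply/cvg_ex; exists l.
exact: nearW.
Qed.

Lemma cvg_le_lim {R : realType} (f : nat -> R) (a l : R) : f n @[n --> \oo] --> l -> (forall n, f n <= a) -> l <= a.
Proof.
move=> fl af; rewrite -(cvg_lim (@Rhausdorff R) fl); apply: limr_le.
  by apply/cvg_ex; exists l.
exact: nearW.
Qed.

Lemma cvg_addn {R : realType} (f : nat -> R) (l : R) k : f n @[n --> \oo] --> l -> f (k + n)%N @[n --> \oo] --> l.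
Proof.
move=> fl; apply: (cvg_comp (fun n => (k + n)%N) f _ fl).
by move=> A [N _ NA]; exists N => // n /= Nn; apply: NA => /=; rewrite (leq_trans Nn)// leq_addl.
Qed.

Lemma cvg_of_tail {R : realType} (a b : nat -> R) (M : nat) :
  (forall m l, (M <= m)%N -> `|a (m + l)%N - a m| <= b m) -> b m @[m --> \oo] --> 0 ->
  exists2 l, a m @[m --> \oo] --> l & forall m, (M <= m)%N -> `|l - a m| <= b m.
Proof.
move=> ab b0. have /cvg_ex[l al] : cvg (a m @[m --> \oo]).
  apply: cauchy_cvg; apply: cauchy_exP => e e0. move/cvgr0_norm_lt : b0 => /(_ e e0)[N _ bN].
  exists (a (maxn N M)); exists (maxn N M) => // n /= Nn.
  rewrite /ball/= distrC -(subnKC Nn) (le_lt_trans (ab _ _ _)) ?leq_maxr//.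
  by rewrite (le_lt_trans (ler_norm _))//; apply: bN; rewrite /= leq_maxl.
exists l => // m Mm. have c : `|a (m + n)%N - a m| @[n --> \oo] --> `|l - a m|.
  apply: cvg_norm; apply: cvgB; last exact: cvg_cst. exact: cvg_addn.
by apply: (cvg_le_lim c) => n; exact: ab.
Qed.

Section integration_toolkit.
Context {d : measure_display} {T : measurableType d} {R : realType}.
Variable mu : {measure set T -> \bar R}.

Lemma integrable_dominated (D : set T) (f g : T -> R) : measurable D ->
  measurable_fun D f -> (forall x, D x -> `|f x| <= g x) ->
  mu.-integrable D (EFin \o g) -> mu.-integrable D (EFin \o f).
Proof.
move=> mD mf fg ig; apply: (le_integrable mD _ _ ig).
  exact/measurable_EFinP.
by move=> x Dx /=; rewrite lee_fin (le_trans (fg x Dx)) ?ler_norm.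
Qed.

Lemma le_normr_Rintegral_dominated (D : set T) (f g : T -> R) : measurable D ->
  measurable_fun D f -> (forall x, D x -> `|f x| <= g x) -> mu.-integrable D (EFin \o g) ->
  `|\int[mu]_(x in D) f x| <= \int[mu]_(x in D) g x.
Proof.
move=> mD mf fg ig. have If := integrable_dominated mD mf fg ig. apply: le_trans (le_normr_Rintegral mD If) _.
apply: le_Rintegral => //. by apply: (integrable_dominated mD _ _ ig) => [|x Dx];
  [exact: measurableT_comp|rewrite normr_id fg].
Qed.

Lemma Rintegral_dominated_cvg (D : set T) (f_ : nat -> T -> R) (f g : T -> R) :
  measurable D -> (forall n, measurable_fun D (f_ n)) -> (forall x, D x -> f_ n x @[n --> \oo] --> f x) ->
  mu.-integrable D (EFin \o g) -> (forall n x, D x -> `|f_ n x| <= g x) -> mu.-integrable D (EFin \o f) /\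
  \int[mu]_(x in D) f_ n x @[n --> \oo] --> \int[mu]_(x in D) f x.
Proof.
move=> mD mf cf ig fg. have mflim : measurable_fun D f by exact: measurable_fun_cvg mf cf.
have cfE : {ae mu, forall x, D x -> (EFin \o f_ n) x @[n --> \oo] --> (EFin \o f) x}.
  by apply: aeW => x Dx; apply: cvg_EFin; [exact: nearW|exact: cf].
have bE : {ae mu, forall x n, D x -> (`|(EFin \o f_ n) x| <= (EFin \o g) x)%E}.
  by apply: aeW => x n Dx; rewrite lee_fin fg.
have [If _ cI] := @dominated_convergence _ _ _ mu D mD (fun n => EFin \o f_ n)
   (EFin \o f) (EFin \o g) (fun n => (measurable_EFinP _ _).2 (mf n)) ((measurable_EFinP _ _).2 mflim) cfE ig bE.
split=> //; apply: fine_cvg; rewrite fineK//; exact: integrable_fin_num.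
Qed.

Lemma Rintegral_fatou (D : set T) (f_ : nat -> T -> R) (f : T -> R) (c : R) :
  measurable D -> (forall n, measurable_fun D (f_ n)) -> (forall n x, D x -> 0 <= f_ n x) ->
  (forall n, mu.-integrable D (EFin \o f_ n)) -> (forall n, \int[mu]_(x in D) f_ n x <= c) ->
  (forall x, D x -> f_ n x @[n --> \oo] --> f x) -> mu.-integrable D (EFin \o f) /\ \int[mu]_(x in D) f x <= c.
Proof.
move=> mD mf f0 If Ic fl. have mfl : measurable_fun D f by exact: measurable_fun_cvg mf fl.
have fl0 x : D x -> 0 <= f x.
  by move=> Dx; apply: (cvg_ge_lim (fl x Dx)) => n; exact: f0.
have le_c : (\int[mu]_(x in D) (f x)%:E <= c%:E)%E.
  have -> : (\int[mu]_(x in D) (f x)%:E = \int[mu]_(x in D) limn_einf (fun n => (f_ n x)%:E))%E.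
    apply: eq_integral => x /set_mem Dx. have h : (f_ n x)%:E @[n --> \oo] --> (f x)%:E.
      by apply: cvg_EFin; [exact: nearW|exact: fl].
    by have [-> _] := cvg_limn_einf_sup h.
  apply: (@le_trans _ _ (limn_einf (fun n => \int[mu]_(x in D) (f_ n x)%:E)%E)).
    have fE0 n x : D x -> (0 <= (f_ n x)%:E)%E by move=> Dx; rewrite lee_fin f0.
    exact: (@fatou _ _ _ mu D mD (fun n x => (f_ n x)%:E) (fun n => (measurable_EFinP _ _).2 (mf n)) fE0).
  apply: (@le_trans _ _ (limn_einf (fun n : nat => c%:E))).
    rewrite limn_einf_lim (@le_trans _ _ c%:E)//; last first.
      have h : c%:E @[n --> \oo] --> c%:E by exact: cvg_cst. by have [-> _] := cvg_limn_einf_sup h.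
    apply: lime_le; first exact: is_cvg_einfs.
    apply: nearW => n; apply: (@le_trans _ _ (\int[mu]_(x in D) (f_ n x)%:E)%E).
      by apply: ereal_inf_lbound; exists n => /=.
    have := Ic n; rewrite -lee_fin /Rintegral fineK//. exact: (integrable_fin_num mD (If n)).
  have h : c%:E @[n --> \oo] --> c%:E by exact: cvg_cst. by have [-> _] := cvg_limn_einf_sup h.
have ifl : mu.-integrable D (EFin \o f).
  apply/integrableP; split; first exact/measurable_EFinP. apply: le_lt_trans (ltry c); apply: le_trans le_c.
  rewrite le_eqVlt; apply/orP; left; apply/eqP; apply: eq_integral => x /set_mem Dx. by rewrite gee0_abs// lee_fin fl0.
split => //; rewrite -lee_fin /Rintegral fineK//. exact: (integrable_fin_num mD ifl).
Qed.

End integration_toolkit.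
Arguments integrable_dominated {d T R} mu {D f} g.

Lemma measurable_itvR {R : realType} (i : interval R) : measurable ([set` i] : set (measurableTypeR R)).
Proof. exact: measurable_itv. Qed.

Section bounded_integrands.
Context {d : measure_display} {T : measurableType d} {R : realType}.
Variable P : {finite_measure set T -> \bar R}.

Lemma integrable_bounded (f : T -> R) (C : R) : measT f -> (forall x, `|f x| <= C) -> L1 P f.
Proof.
move=> mf fC; apply: (integrable_dominated _ (cst C)) => //. by have := finite_measure_integrable_cst P C measurableT.
Qed.

Lemma Rintegral_bounded_cvg (f_ : nat -> T -> R) (f : T -> R) (C : R) : (forall n, measT (f_ n)) ->
  (forall x, f_ n x @[n --> \oo] --> f x) -> (forall n x, `|f_ n x| <= C) ->
  \int[P]_x f_ n x @[n --> \oo] --> \int[P]_x f x.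
Proof.
move=> mf cf fC. have iC : L1 P (cst C).
  by have := finite_measure_integrable_cst P C measurableT.
have [] := @Rintegral_dominated_cvg _ _ _ P setT f_ f (cst C) measurableT mf (fun x _ => cf x) iC (fun n x _ => fC n x).
by [].
Qed.

End bounded_integrands.
Arguments integrable_bounded {d T R} P {f} C.
Arguments Rintegral_bounded_cvg {d T R} P {f_ f} C.

(** * Recovering a law from its characteristic function *)

Lemma measurable_cos {R : realType} : measurable_fun [set: R] (@cos R).
Proof. by apply: continuous_measurable_fun; exact: continuous_cos. Qed.

Lemma measurable_sin {R : realType} : measurable_fun [set: R] (@sin R).
Proof. by apply: continuous_measurable_fun; exact: continuous_sin. Qed.

Lemma cos_shift {R : realType} (x a : R) : cos (x + (a - pi / 2)) = sin (x + a).
Proof. by rewrite addrA cosB cos_pihalf sin_pihalf mulr0 mulr1 add0r. Qed.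

Lemma norm_cos_le1 {R : realType} (x : R) : `|cos x| <= 1.
Proof. by rewrite ler_norml cos_geN1 cos_le1. Qed.

Lemma norm_sin_le1 {R : realType} (x : R) : `|sin x| <= 1.
Proof. by rewrite ler_norml sin_geN1 sin_le1. Qed.

(** This cubic maps [0, 1] to itself and fixes 0, 1/2 and 1; its iterates push every other point of [0, 1] to 0
    or to 1. *)
Definition smoothstep {R : realType} (y : R) : R := 3 * y ^+ 2 - 2 * y ^+ 3.

Lemma smoothstep_itv {R : realType} (y : R) : 0 <= y <= 1 -> 0 <= smoothstep y <= 1.
Proof.
move=> /andP[y0 y1]; rewrite /smoothstep. have -> : 3 * y ^+ 2 - 2 * y ^+ 3 = y ^+ 2 * (3 - 2 * y) by ring.
have h : 1 - y ^+ 2 * (3 - 2 * y) = (1 - y) ^+ 2 * (1 + 2 * y) by ring.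
apply/andP; split; first by apply: mulr_ge0; [exact: sqr_ge0|lra].
by rewrite -subr_ge0 h; apply: mulr_ge0; [exact: sqr_ge0|lra].
Qed.

Lemma iter_smoothstep_itv {R : realType} (y : R) n : 0 <= y <= 1 -> 0 <= iter n smoothstep y <= 1.
Proof. by move=> y01; elim: n => [//|n IH]; exact: smoothstep_itv. Qed.

Lemma smoothstep_cvg0 {R : realType} (y : R) : 0 <= y < 1/2 -> iter n smoothstep y @[n --> \oo] --> 0.
Proof.
move=> /andP[y0 y1]; pose c := y * (3 - 2 * y). have c0 : 0 <= c by apply: mulr_ge0 => //; lra.
have c1 : c < 1 by rewrite /c; nra. have h n : 0 <= iter n smoothstep y <= c ^+ n * y.
  elim: n => [|n /andP[z0 IH]]; first by rewrite expr0 mul1r y0 lexx. set z := iter n smoothstep y in z0 IH *.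
  have cn1 : c ^+ n <= 1 by rewrite exprn_ile1 // ltW. have zy : z <= y by apply: le_trans IH _; rewrite ler_piMl.
  rewrite iterS -/z. have -> : smoothstep z = z * (3 - 2 * z) * z by rewrite /smoothstep; ring.
  have zc : z * (3 - 2 * z) <= c by rewrite /c; nra. have zc0 : 0 <= z * (3 - 2 * z) by apply: mulr_ge0 => //; lra.
  apply/andP; split; first exact: mulr_ge0. by rewrite exprS -[leRHS]mulrA; apply: ler_pM.
apply: (cvg_dist_le (fun n => c ^+ n * y)).
  by move=> n; have /andP[? ?] := h n; rewrite subr0 ger0_norm.
apply: (cvg_eqr (0 * y)); last by rewrite mul0r. by apply: cvgM; [apply: cvg_expr; rewrite ger0_norm|exact: cvg_cst].
Qed.

Lemma smoothstep_onem {R : realType} (y : R) : smoothstep (1 - y) = 1 - smoothstep y.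
Proof. by rewrite /smoothstep; ring. Qed.

Lemma iter_smoothstep_onem {R : realType} (y : R) n : iter n smoothstep (1 - y) = 1 - iter n smoothstep y.
Proof. by elim: n => [//|n IH]; rewrite !iterS IH smoothstep_onem. Qed.

Definition half_step {R : realType} (y : R) : R := if y < 0 then 0 else if y == 0 then 1 / 2 else 1.

Lemma smoothstep_cvg {R : realType} (y : R) : -1 <= y <= 1 ->
  iter n smoothstep ((1 + y) / 2) @[n --> \oo] --> half_step y.
Proof.
move=> /andP[y0 y1]; rewrite /half_step; case: ltgtP => y00 /=.
- by apply: smoothstep_cvg0; apply/andP; split; lra.
- have -> : (1 + y) / 2 = 1 - (1 - y) / 2 by field. under eq_cvg do rewrite iter_smoothstep_onem.
  apply: (cvg_eqr (1 - 0)); last by rewrite subr0. apply: cvgB; first exact: cvg_cst.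
  by apply: smoothstep_cvg0; apply/andP; split; lra.
- rewrite y00 addr0; apply: cvg_near_cst; apply: nearW => n.
  elim: n => [//|n IH]; by rewrite iterS IH /smoothstep; field.
Qed.

Section law_from_characteristic_function.
Context {R : realType} {d d' : measure_display} {T : measurableType d} {T' : measurableType d'}.
Variables (P : {finite_measure set T -> \bar R}) (P' : {finite_measure set T' -> \bar R}).
Variables (X W : T -> R) (X' W' : T' -> R) (CW : R).
Hypotheses (mX : measT X) (mW : measT W) (mX' : measT X') (mW' : measT W')
  (W_le : forall x, `|W x| <= CW) (W'_le : forall x, `|W' x| <= CW).

(** The weights W and W' make it possible to invert the characteristic function of a random vector one
    coordinate after the other. *)
Definition agree (g : R -> R) := \int[P]_x (W x * g (X x)) = \int[P']_x (W' x * g (X' x)).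

Let bmf (g : R -> R) := measT g /\ exists C : R, forall x, `|g x| <= C.

Let intW g : bmf g -> L1 P (fun x => W x * g (X x)).
Proof.
move=> [mg [C gC]]; apply: (integrable_bounded _ (CW * C)).
  by apply: measurable_funM => //; exact: measurableT_comp mg mX.
by move=> x; rewrite normrM ler_pM.
Qed.

Let intW' g : bmf g -> L1 P' (fun x => W' x * g (X' x)).
Proof.
move=> [mg [C gC]]; apply: (integrable_bounded _ (CW * C)).
  by apply: measurable_funM => //; exact: measurableT_comp mg mX'.
by move=> x; rewrite normrM ler_pM.
Qed.

Lemma agree_lin (a b : R) f g : bmf f -> bmf g -> agree f -> agree g -> agree (fun y => a * f y + b * g y).
Proof.
move=> bf bg Af Ag; rewrite /agree. under eq_Rintegral do rewrite mulrDr mulrCA (mulrCA _ b).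
under [RHS]eq_Rintegral do rewrite mulrDr mulrCA (mulrCA _ b). have Z c h : bmf h ->
    L1 P (fun x => c * (W x * h (X x))) /\ L1 P' (fun x => c * (W' x * h (X' x))).
  by move=> bh; split; [have := intZ c (intW bh) |have := intZ c (intW' bh)].
have [? ?] := Z a f bf; have [? ?] := Z b g bg. rewrite !RintegralD// !RintegralZl//; first by rewrite Af Ag.
all: by [exact: intW|exact: intW'].
Qed.

Lemma agree_cvg (g_ : nat -> R -> R) g C : (forall n, measT (g_ n)) ->
  (forall n x, `|g_ n x| <= C) -> (forall x, g_ n x @[n --> \oo] --> g x) -> (forall n, agree (g_ n)) -> agree g.
Proof.
move=> mg gC gcvg Ag. have c1 : \int[P]_x (W x * g_ n (X x)) @[n --> \oo] --> \int[P]_x (W x * g (X x)).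
  apply: (Rintegral_bounded_cvg _ (CW * C)).
  - by move=> n; apply: measurable_funM => //; exact: measurableT_comp (mg n) mX.
  - by move=> x; apply: cvgMr; exact: gcvg.
  - by move=> n x; rewrite normrM ler_pM.
have c2 : \int[P']_x (W' x * g_ n (X' x)) @[n --> \oo] --> \int[P']_x (W' x * g (X' x)).
  apply: (Rintegral_bounded_cvg _ (CW * C)).
  - by move=> n; apply: measurable_funM => //; exact: measurableT_comp (mg n) mX'.
  - by move=> x; apply: cvgMr; exact: gcvg.
  - by move=> n x; rewrite normrM ler_pM.
by apply: (cvgr_unique c1 c2) => n; exact: Ag.
Qed.

Hypothesis cosE : forall t, agree (fun y => cos (t * y)).
Hypothesis sinE : forall t, agree (fun y => sin (t * y)).

Let bmf_cos t a : bmf (fun y => cos (t * y + a)).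
Proof.
split; last by exists 1 => x; exact: norm_cos_le1. apply: (measurableT_comp measurable_cos).
by apply: measurable_funD => //; exact: measurable_funM.
Qed.

Let phaseE t a : agree (fun y => cos (t * y + a)).
Proof.
have -> : (fun y : R => cos (t * y + a)) = (fun y => cos a * cos (t * y) + (- sin a) * sin (t * y)).
  by apply/funext => y; rewrite cosD; ring.
apply: agree_lin => //.
  by have := bmf_cos t 0; under eq_fun do rewrite addr0.
split; last by exists 1 => x; exact: norm_sin_le1. by apply: (measurableT_comp measurable_sin); exact: measurable_funM.
Qed.

(** Product formulas turn a cosine times a power of another cosine into a linear combination of cosines. *)
Let polyE (p : {poly R}) l c t a : bmf (fun y => cos (t * y + a) * p.[cos (l * y + c)]) /\
  agree (fun y => cos (t * y + a) * p.[cos (l * y + c)]).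
Proof.
elim/poly_ind: p t a => [|p e IH] t a.
  under eq_fun do rewrite horner0 mulr0; split.
    by split => //; exists 0 => x; rewrite normr0.
  by rewrite /agree; under eq_Rintegral do rewrite mulr0;
     under [RHS]eq_Rintegral do rewrite mulr0; rewrite !Rintegral_cst// !mul0r.
have [b1 A1] := IH (t + l) (a + c); have [b2 A2] := IH (t - l) (a - c).
have -> : (fun y => cos (t * y + a) * (p * 'X + e%:P).[cos (l * y + c)]) =
  (fun y => 1 * (1 / 2 * (cos ((t + l) * y + (a + c)) * p.[cos (l * y + c)]) +
             1 / 2 * (cos ((t - l) * y + (a - c)) * p.[cos (l * y + c)])) + e * cos (t * y + a)).
  apply/funext => y; rewrite hornerMXaddC. have -> : (t + l) * y + (a + c) = (t * y + a) + (l * y + c) by ring.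
  have -> : (t - l) * y + (a - c) = (t * y + a) - (l * y + c) by ring. move: (t * y + a) (l * y + c) => A B.
  by rewrite (cosD A B) (cosB A B); field.
have bl a1 a2 f g : bmf f -> bmf g -> bmf (fun y => a1 * f y + a2 * g y).
  move=> [mf [C fC]] [mg [C' gC]]; split.
    by apply: measurable_funD; apply: measurable_funM.
  exists (`|a1| * C + `|a2| * C') => x; rewrite (le_trans (ler_normD _ _))//. by rewrite !normrM lerD// ler_wpM2l.
split; first by do 2 apply: (bl) => //. apply: agree_lin => //; first exact: bl. exact: agree_lin.
Qed.

(** The iterates of the cubic at (1 + sin ((y - a) / n)) / 2 are polynomials in a cosine. They converge to the
    half step of sin ((y - a) / n), which is that of y - a once |y - a| < n pi. *)
Lemma agree_half_step a : agree (fun y => half_step (y - a)).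
Proof.
pose S (n : nat) (y : R) : R := (1 + sin (n.+1%:R^-1 * (y - a))) / 2.
have s_itv (y : R) : -1 <= sin y <= 1 by rewrite sin_geN1 sin_le1. have S01 n y : 0 <= S n y <= 1.
  have /andP[] := s_itv (n.+1%:R^-1 * (y - a)); rewrite /S => ? ?. by apply/andP; split; lra.
have SE n y : S n y = (1 + cos (n.+1%:R^-1 * y + (- (n.+1%:R^-1 * a) - pi / 2))) / 2.
  rewrite /S; congr ((1 + _) / _). by rewrite addrA -mulrBr cosB cos_pihalf sin_pihalf; ring.
have mS n : measT (S n).
  apply: measurable_funM => //; apply: measurable_funD => //.
  apply: (measurableT_comp measurable_sin); apply: measurable_funM => //. exact: measurable_funD.
have mss : measT (@smoothstep R).
  by apply: measurable_funB; apply: measurable_funM => //; exact: measurable_funX.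
have mit n k : measT (fun y => iter k smoothstep (S n y)).
  elim: k => [|k IH]; first exact: mS. exact: measurableT_comp mss IH.
have Ait n k : agree (fun y => iter k smoothstep (S n y)).
  have [p pE] : exists p : {poly R}, forall y, iter k smoothstep ((1 + y) / 2) = p.[y].
    elim: k => [|k [p pE]].
      by exists ((2^-1)%:P * (1%:P + 'X)) => y; rewrite /= !hornerE; field.
    exists ((3%:P) * p ^+ 2 - 2%:P * p ^+ 3) => y. by rewrite iterS pE /smoothstep !hornerE.
  have [_] := polyE p (n.+1%:R^-1) (- (n.+1%:R^-1 * a) - pi / 2) 0 0.
  rewrite /agree; under eq_Rintegral do rewrite mul0r addr0 cos0 mul1r -pE -SE.
  by under [in X in _ = X -> _]eq_Rintegral do rewrite mul0r addr0 cos0 mul1r -pE -SE.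
have it1 n k x : `|iter k smoothstep (S n x)| <= 1.
  by have /andP[h0 h1] := iter_smoothstep_itv k (S01 n x); rewrite ger0_norm.
have As n : agree (fun y => half_step (sin (n.+1%:R^-1 * (y - a)))).
  apply: (@agree_cvg (fun k y => iter k smoothstep (S n y)) _ 1) => //. by move=> y; exact: smoothstep_cvg.
apply: (@agree_cvg (fun n y => half_step (sin (n.+1%:R^-1 * (y - a)))) _ 1) => //.
- move=> n; apply: (@measurable_fun_cvg _ _ _ _ (fun k y => iter k smoothstep (S n y))) => // y _.
  exact: smoothstep_cvg.
- move=> n x; rewrite /half_step; case: ifP => _; first by rewrite normr0. by case: ifP => _; rewrite ger0_norm//; lra.
- move=> y; apply: cvg_near_cst. have c0 : n.+1%:R^-1 * (y - a) @[n --> \oo] --> 0.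
    apply: (cvg_eqr (0 * (y - a))); last by rewrite mul0r. apply: cvgM; last exact: cvg_cst. exact: cvg_harmonic.
  have : \forall n \near \oo, `|n.+1%:R^-1 * (y - a)| < pi.
    move/cvgr0_norm_lt : c0; apply; exact: pi_gt0.
  apply: filterS => n hn; rewrite /half_step. have n0 : 0 < n.+1%:R^-1 :> R by rewrite invr_gt0.
  have [ya|ya|->] := ltgtP y a; last by rewrite subrr mulr0 sin0 ltxx eqxx.
  + have ya' : y - a < 0 by lra. have yn : n.+1%:R^-1 * (y - a) < 0 by rewrite nmulr_llt0.
    rewrite ya'; have -> // : sin (n.+1%:R^-1 * (y - a)) < 0.
    rewrite -[X in sin X]opprK sinN oppr_lt0; apply: sin_gt0_pi. by rewrite oppr_gt0 yn -ltr0_norm.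
  + have ya' : 0 < y - a by lra. have yn : 0 < n.+1%:R^-1 * (y - a) by rewrite mulr_gt0.
    have sn : 0 < sin (n.+1%:R^-1 * (y - a)).
      by apply: sin_gt0_pi; rewrite yn -[X in X < _]gtr0_norm.
    by rewrite (lt_gtF sn) (gt_eqF sn) (lt_gtF ya') (gt_eqF ya').
Qed.

(** With thresholds a + 1/n that decrease to a, the value 1/2 at the threshold disappears in the limit. *)
Lemma agree_gt a : agree (fun y => (a < y)%R%:R).
Proof.
apply: (@agree_cvg (fun n y => half_step (y - (a + n.+1%:R^-1))) _ 1).
- move=> n; rewrite /half_step; apply: measurable_fun_ifT => //.
    by apply: measurable_fun_ltr => //; exact: measurable_funB.
  apply: measurable_fun_ifT => //. by apply: measurable_fun_eqr => //; exact: measurable_funB.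
- move=> n x; rewrite /half_step; case: ifP => _; first by rewrite normr0. by case: ifP => _; rewrite ger0_norm//; lra.
- move=> y; apply: cvg_near_cst; have [ya|ya] := ltP a y.
    have : \forall n \near \oo, n.+1%:R^-1 < y - a.
      have := @cvg_harmonic R; move/cvgr_lt; apply; lra.
    apply: filterS => n; rewrite /harmonic /=; move: (n.+1%:R^-1) => e hn.
    rewrite /half_step; have h : 0 < y - (a + e) by lra. by rewrite (lt_gtF h) (gt_eqF h).
  apply: nearW => n; rewrite /half_step. have : 0 < n.+1%:R^-1 :> R by rewrite invr_gt0.
  by move: (n.+1%:R^-1) => e e0; have -> : y - (a + e) < 0 by lra.
- by move=> n; exact: agree_half_step.
Qed.

End law_from_characteristic_function.

(** * Taylor bounds and Gaussian integration by parts *)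

Section derivative_toolkit.
Context {R : realType}.
Implicit Types (f g : R -> R) (x : R).

Lemma is_derive_funM f g x (a b : R) : is_derive x 1 f a -> is_derive x 1 g b ->
  is_derive x 1 (fun y => f y * g y) (a * g x + f x * b).
Proof.
move=> df dg; apply: (is_derive_eq (is_deriveM df dg)). by rewrite /GRing.scale/= addrC mulrC.
Qed.

Lemma is_derive_funD f g x (a b : R) : is_derive x 1 f a -> is_derive x 1 g b ->
  is_derive x 1 (fun y => f y + g y) (a + b).
Proof. by move=> df dg; exact: (is_deriveD df dg). Qed.

Lemma is_derive_funB f g x (a b : R) : is_derive x 1 f a -> is_derive x 1 g b ->
  is_derive x 1 (fun y => f y - g y) (a - b).
Proof. by move=> df dg; exact: (is_deriveB df dg). Qed.

Lemma is_derive_funZ (c : R) f x (a : R) : is_derive x 1 f a -> is_derive x 1 (fun y => c * f y) (c * a).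
Proof. by move=> df; exact: (is_deriveZ c df). Qed.

Lemma is_derive_affine (c e : R) x : is_derive x 1 (fun y => c * y + e) c.
Proof.
have h1 : is_derive x 1 (fun y : R => c * y) (c * 1).
  by apply: (@is_derive_funZ c id); exact: is_derive_id.
apply: (is_derive_eq (is_derive_funD h1 (is_derive_cst e x 1))). by rewrite addr0 mulr1.
Qed.

Lemma is_derive_continuous f x (a : R) : is_derive x 1 f a -> {for x, continuous f}.
Proof. by move=> [df _]; exact/differentiable_continuous/derivable1_diffP. Qed.

Lemma is_derive_derive1 f x (a : R) : is_derive x 1 f a -> derive1 f x = a.
Proof. by move=> df; rewrite derive1E; exact: derive_val. Qed.

(** Unlike the limit of difference quotients, a quadratic bound on the remainder survives integration over a
    parameter; this is how derivatives are taken under integral signs below. *)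
Lemma is_derive_quadratic f x (l C : R) : (forall h, `|f (x + h) - f x - h * l| <= C * h ^+ 2) -> is_derive x 1 f l.
Proof.
move=> H. have cl : (fun h : R => h^-1 *: (f (h *: 1%R + x) - f x)) @ 0^' --> l.
  apply/cvgrPdist_le => e e0. have C1 : 0 < `|C| + 1 by rewrite ltr_pwDr. near=> h.
  have h0 : h != 0 by near: h; exact: nbhs_dnbhs_neq. have hn : `|h| <= e / (`|C| + 1).
    near: h; apply: dnbhs0_le; exact: divr_gt0.
  rewrite /GRing.scale/= mulr1 (addrC h). have -> : l - h^-1 * (f (x + h) - f x) = - (h^-1 * (f (x + h) - f x - h * l)).
    by field.
  rewrite normrN normrM normfV ler_pdivrMl ?normr_gt0//. apply: (le_trans (H h)).
  have -> : h ^+ 2 = `|h| * `|h| by rewrite -normrM ger0_norm ?sqr_ge0. rewrite mulrCA ler_wpM2l//.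
  apply: (@le_trans _ _ ((`|C| + 1) * `|h|)).
    by apply: ler_wpM2r => //; apply: (le_trans (ler_norm C)); rewrite lerDl.
  by rewrite mulrC -ler_pdivlMr.
by split; [apply/cvg_ex; exists l; exact: cl|apply: cvg_lim => //; exact: cl].
Unshelve. all: by end_near. Qed.

Lemma MVT_le f (df : R -> R) (C : R) (x h : R) : (forall y : R, is_derive y 1 f (df y)) ->
  (forall y, `|y - x| <= `|h| -> `|df y| <= C) -> `|f (x + h) - f x| <= C * `|h|.
Proof.
move=> fd dC. have cf a b : {within `[a, b], continuous f}.
  apply: continuous_subspaceT => y; exact: is_derive_continuous (fd y).
have [h0|h0|->] := ltgtP h 0; last by rewrite addr0 subrr normr0 mulr0.
- have xh : x + h < x by lra. rewrite distrC; have [c] := MVT xh (fun y _ => fd y) (cf (x + h) x).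
  rewrite in_itv/= => /andP[c1 c2] ->. rewrite normrM; have -> : x - (x + h) = - h by ring.
  rewrite normrN ler_wpM2r// dC// (ltr0_norm h0) ltr0_norm; lra.
- have xh : x < x + h by lra. have [c] := MVT xh (fun y _ => fd y) (cf x (x + h)).
  rewrite in_itv/= => /andP[c1 c2] ->. rewrite normrM; have -> : x + h - x = h by ring.
  rewrite ler_wpM2r// dC// (gtr0_norm h0) gtr0_norm; lra.
Qed.

Lemma taylor1_le f (df ddf : R -> R) (C : R) (x h : R) :
  (forall y : R, is_derive y 1 f (df y)) -> (forall y : R, is_derive y 1 df (ddf y)) ->
  (forall y, `|y - x| <= `|h| -> `|ddf y| <= C) -> `|f (x + h) - f x - h * df x| <= C * h ^+ 2.
Proof.
move=> fd dfd ddC. have C0 : 0 <= C by apply: (le_trans _ (ddC x _)); rewrite ?subrr ?normr0.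
have gd (y : R) : is_derive y 1 (fun z => f z - (df x * z + 0)) (df y - df x).
  exact: is_derive_funB (fd y) (is_derive_affine _ _ y).
have := @MVT_le _ _ (C * `|h|) x h gd. have -> : f (x + h) - (df x * (x + h) + 0) - (f x - (df x * x + 0)) =
  f (x + h) - f x - h * df x by ring.
rewrite -mulrA -normrM -expr2 (ger0_norm (sqr_ge0 h)); apply => y yx. have {1}-> : y = x + (y - x) by ring.
apply: (@le_trans _ _ (C * `|y - x|)); last exact: ler_wpM2l.
apply: (MVT_le dfd) => z zx; apply: ddC; exact: le_trans zx yx.
Qed.

Lemma taylor2_le f (df ddf dddf : R -> R) (C : R) (x h : R) :
  (forall y : R, is_derive y 1 f (df y)) -> (forall y : R, is_derive y 1 df (ddf y)) ->
  (forall y : R, is_derive y 1 ddf (dddf y)) -> (forall y, `|y - x| <= `|h| -> `|dddf y| <= C) ->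
  `|f (x + h) - f x - h * df x - h ^+ 2 / 2 * ddf x| <= C * `|h| ^+ 3.
Proof.
move=> fd dfd ddfd dddC. have C0 : 0 <= C by apply: (le_trans _ (dddC x _)); rewrite ?subrr ?normr0.
pose g z := f z - (df x * z + (0 : R)) - ddf x / 2 * (z - x) ^+ 2.
have gd (y : R) : is_derive y 1 g (df y - df x - ddf x * (y - x)).
  have h1 : is_derive y 1 (fun z : R => z - x) 1.
    by have := is_derive_affine 1 (- x) y; under eq_fun do rewrite mul1r.
  have h2 := is_derive_funZ (ddf x / 2) (is_derive_funM h1 h1).
  apply: (is_derive_eq (is_derive_funB (is_derive_funB (fd y) (is_derive_affine _ _ y)) h2)). by field.
have := @MVT_le _ _ (C * `|h| ^+ 2) x h gd. have -> : g (x + h) - g x = f (x + h) - f x - h * df x - h ^+ 2 / 2 * ddf x.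
  by rewrite /g; field.
have -> : C * `|h| ^+ 2 * `|h| = C * `|h| ^+ 3 by ring. move=> H; apply: H => y yx.
rewrite (mulrC (ddf x)) -[in df y](subrKC x y). apply: (@le_trans _ _ (C * (y - x) ^+ 2)).
  apply: (taylor1_le dfd ddfd) => z zx; apply: dddC; exact: le_trans zx yx.
by rewrite ler_wpM2l// -[leLHS]ger0_norm ?sqr_ge0// normrX lerXn2r ?nnegrE.
Qed.

End derivative_toolkit.

Section line_integrals.
Context {R : realType}.
Local Notation mu := (@lebesgue_measure R).

Lemma Rintegral_itv_cvg (f : R -> R) : L1 mu f -> \int[mu]_(x in `[- n%:R, n%:R]) f x @[n --> \oo] --> \int[mu]_x f x.
Proof.
move=> If; have mf : measT f.
  by apply/measurable_EFinP; exact: measurable_int If.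
under eq_cvg do rewrite Rintegral_mkcond. have [] // := @Rintegral_dominated_cvg _ _ _ mu setT
  (fun n => f \_ `[- n%:R, n%:R]) f (fun x => `|f x|) measurableT.
- by move=> n; apply/(measurable_restrictT _ _).1 => //; exact: measurable_funTS.
- move=> x _; apply: cvg_near_cst. have := nbhs_infty_ger `|x|; apply: filterS => n xn.
  by rewrite patchE mem_set//= in_itv/= -ler_norml.
- exact: integrable_norm.
- move=> n x _; rewrite patchE; case: ifP => // _; by rewrite normr0.
Qed.

Lemma Rintegral_derive_eq0 (F f : R -> R) : (forall x : R, is_derive x 1 F (f x)) -> continuous f -> L1 mu f ->
  F n%:R @[n --> \oo] --> 0 -> F (- n%:R) @[n --> \oo] --> 0 -> \int[mu]_x f x = 0.
Proof.
move=> dF cf If F1 F2. have c1 := Rintegral_itv_cvg If. have c2 : F n.+1%:R - F (- n.+1%:R) @[n --> \oo] --> (0 : R).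
  apply: (cvg_eqr (0 - 0)); last by rewrite subr0. by apply: cvgB; [have := F1|have := F2]; rewrite -(cvg_shiftS).
have c1' : \int[mu]_(x in `[- n.+1%:R, n.+1%:R]) f x @[n --> \oo] --> \int[mu]_x f x.
  by have := c1; rewrite -(cvg_shiftS).
apply: (cvgr_unique c1' c2) => n. rewrite /Rintegral (@continuous_FTC2 _ f F)//.
- by rewrite -subr_gt0 opprK -mulr2n mulrn_wgt0.
- exact: continuous_subspaceT.
- split=> [x _||]; first by case: (dF x).
  + by apply: cvg_at_right_filter; exact: is_derive_continuous (dF _).
  + by apply: cvg_at_left_filter; exact: is_derive_continuous (dF _).
- by move=> x _; exact: is_derive_derive1.
Qed.

End line_integrals.

Section normal_integrals.
Context {R : realType}.
Local Notation mu := (@lebesgue_measure R).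
Variables (m s : R).
Hypothesis s0 : s != 0.
Local Notation N := (normal_prob m s).
Local Notation pdf := (normal_pdf m s).

Lemma ge0_integral_normal_prob (f : R -> \bar R) : (forall x, 0 <= f x)%E -> measT f ->
  (\int[N]_x f x = \int[mu]_x (f x * (pdf x)%:E))%E.
Proof.
move=> f0 mf; have dom := normal_prob_dominates m s. rewrite -(Radon_Nikodym_SigmaFinite.change_of_variables dom)//.
have iRN := Radon_Nikodym_SigmaFinite.f_integrable dom. have mpdf : measT (EFin \o pdf).
  by apply/measurable_EFinP; exact: measurable_normal_pdf.
apply: ae_eq_integral => //.
- by apply: emeasurable_funM => //; exact: measurable_int iRN.
- exact: emeasurable_funM.
- apply: ae_eqe_mul2l => /=. apply: integral_ae_eq => // E _ mE. by rewrite -Radon_Nikodym_SigmaFinite.f_integral.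
Qed.

Lemma integrable_normal_prob (f : R -> R) : measT f -> L1 N f <-> L1 mu (fun x => f x * pdf x).
Proof.
move=> mf. have e : (\int[N]_x `|(f x)%:E| = \int[mu]_x `|(f x * pdf x)%:E|)%E.
  rewrite (@ge0_integral_normal_prob (fun x => `|(f x)%:E|)%E)//; last first.
    by apply: measurableT_comp => //; exact/measurable_EFinP.
  apply: eq_integral => x _; rewrite EFinM abseM. by rewrite [in RHS](@gee0_abs _ (pdf x)%:E)// lee_fin normal_pdf_ge0.
split=> /integrableP[_ h]; apply/integrableP; split => //.
- apply/measurable_EFinP/measurable_funM => //; exact: measurable_normal_pdf.
- by move: h; rewrite /= e.
- exact/measurable_EFinP.
- by move: h; rewrite /= e.
Qed.

Lemma Rintegral_normal_prob (f : R -> R) : L1 N f -> \int[N]_x f x = \int[mu]_x (f x * pdf x).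
Proof.
move=> If; have mf : measT (EFin \o f) := measurable_int _ If. have mf' : measT f by exact/measurable_EFinP.
have If' := (integrable_normal_prob mf').1 If. have mp : measT f^\+ by exact: measurable_funrpos.
have mn : measT f^\- by exact: measurable_funrneg. have e (g : R -> R) : (forall x, 0 <= g x) -> measT g ->
    \int[N]_x g x = \int[mu]_x (g x * pdf x).
  move=> g0 mg; rewrite /Rintegral; congr fine. rewrite (@ge0_integral_normal_prob (fun x => (g x)%:E))//.
  by apply/measurable_EFinP.
have fE x : f x = f^\+ x - f^\- x by rewrite -[LHS](congr1 (@^~ x) (funrposBneg f)).
have pI : L1 N (f^\+) by exact: integrable_funrpos. have nI : L1 N (f^\-) by exact: integrable_funrneg.
under eq_Rintegral do rewrite fE. rewrite RintegralB//. rewrite !e//. have pI' := (integrable_normal_prob mp).1 pI.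
have nI' := (integrable_normal_prob mn).1 nI. rewrite -RintegralB//; apply: eq_Rintegral => x _.
by rewrite [in RHS]fE; ring.
Qed.

Lemma exprn_le_expR (k : nat) (x : R) : 0 <= x -> x ^+ k <= k%:R ^+ k * expR x.
Proof.
case: k => [|k] x0.
  by rewrite !expr0 mul1r -[leLHS]addr0 (le_trans _ (expR_ge1Dx x))// lerD2l.
have k0 : 0 < k.+1%:R :> R by []. have h : x / k.+1%:R <= expR (x / k.+1%:R).
  by apply: le_trans (expR_ge1Dx _); rewrite lerDr.
have -> : expR x = expR (x / k.+1%:R) ^+ k.+1.
  by rewrite -expRM_natl mulrC divfK ?gt_eqF.
rewrite -exprMn lerXn2r ?nnegrE ?mulr_ge0 ?expR_ge0//. by rewrite mulrC -ler_pdivrMr.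
Qed.

(** A power of |y - m| is dominated by exp ((y - m)^2 / (4 s^2)), whose product with the density is a multiple
    of the normal density of variance 2 s^2. *)
Lemma integrable_normal_moment k : L1 N (fun y => `|y - m| ^+ k).
Proof.
have msub : measT (fun y : R => `|y - m|).
  by apply: measurableT_comp => //; exact: measurable_funB.
have mk j : measT (fun y : R => `|y - m| ^+ j) by exact: measurable_funX. apply: (integrable_dominated N
   (fun y => 1 + (4 * s ^+ 2 * k%:R) ^+ k * expR ((y - m) ^+ 2 / (4 * s ^+ 2)))) => //.
- exact: mk.
- move=> y _; rewrite normrX normr_id. have s2 : 0 < 4 * s ^+ 2 by rewrite mulr_gt0// exprn_even_gt0//= s0.
  apply: (@le_trans _ _ (1 + `|y - m| ^+ (k * 2))).
    have [y1|y1] := leP `|y - m| 1.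
      apply: (@le_trans _ _ 1); first exact: exprn_ile1. by rewrite lerDl exprn_ge0.
    apply: (@le_trans _ _ (`|y - m| ^+ (k * 2))); last by rewrite lerDr.
    by apply: ler_weXn2l; [exact: ltW|rewrite leq_pmulr].
  rewrite lerD2l mulnC exprM. have -> : `|y - m| ^+ 2 = (4 * s ^+ 2) * ((y - m) ^+ 2 / (4 * s ^+ 2)).
    rewrite mulrC divfK ?gt_eqF//. by rewrite -normrX ger0_norm ?sqr_ge0.
  rewrite exprMn [in leRHS]exprMn -[leRHS]mulrA; apply: ler_wpM2l.
    by rewrite exprn_ge0 ?ltW.
  by apply: exprn_le_expR; rewrite divr_ge0 ?sqr_ge0 ?ltW.
- have mexp : measT (fun y : R => expR ((y - m) ^+ 2 / (4 * s ^+ 2))).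
  apply: measurableT_comp => //; apply: measurable_funM => //. by apply: measurable_funX; exact: measurable_funB.
apply/integrable_normal_prob.
  by apply: measurable_funD => //; exact: measurable_funM.
have s0' : Num.sqrt 2 * s != 0 :> R by rewrite mulf_neq0// gt_eqF// sqrtr_gt0. apply: (integrable_dominated mu
   (fun y => pdf y + (4 * s ^+ 2 * k%:R) ^+ k * (normal_peak s / normal_peak (Num.sqrt 2 * s) *
     normal_pdf m (Num.sqrt 2 * s) y))) => //.
- apply: measurable_funM; last exact: measurable_normal_pdf. by apply: measurable_funD => //; exact: measurable_funM.
- move=> y _; rewrite ger0_norm; last first.
    rewrite mulr_ge0 ?normal_pdf_ge0// addr_ge0// mulr_ge0 ?expR_ge0// exprn_ge0//.
    by rewrite mulr_ge0// mulr_ge0// sqr_ge0.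
  rewrite mulrDl mul1r lerD2l -mulrA; apply: ler_wpM2l.
    by rewrite exprn_ge0// mulr_ge0// mulr_ge0// sqr_ge0.
  rewrite /normal_pdf (negbTE s0) (negbTE s0') mulrCA -mulrA.
  rewrite [leRHS](_ : _ = normal_peak s * normal_fun m (Num.sqrt 2 * s) y); last first.
    by rewrite (mulrA _ (normal_peak _)) mulVf ?mul1r// gt_eqF// normal_peak_gt0.
  rewrite ler_wpM2l ?normal_peak_ge0// /normal_fun -expRD ler_expR exprMn.
  rewrite sqr_sqrtr// le_eqVlt; apply/orP; left; apply/eqP. by rewrite -!(mulr_natl (_ ^+ _)); field.
- have i1 := integrable_normal_pdf m s. have i2 := integrable_normal_pdf m (Num.sqrt 2 * s).
  have := @integrableD _ _ _ mu setT measurableT _ _ i1 (intZ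
    ((4 * s ^+ 2 * k%:R) ^+ k) (intZ (normal_peak s / normal_peak (Num.sqrt 2 * s)) i2)).
  by apply: eq_integrable => // x _ /=; rewrite -!EFinM.
Qed.

Lemma is_derive_normal_pdf (x : R) : is_derive x 1 pdf (- (x - m) / s ^+ 2 * pdf x).
Proof.
rewrite /normal_pdf (negbTE s0).
have h1 : is_derive x 1 (fun y : R => - (y - m) ^+ 2 / (s ^+ 2 *+ 2)) (- (x - m) / s ^+ 2).
  have h := is_derive_affine 1 (- m) x. have := is_derive_funZ (- (s ^+ 2 *+ 2)^-1) (is_derive_funM h h).
  have -> : - (s ^+ 2 *+ 2)^-1 * (1 * (1 * x + - m) + (1 * x + - m) * 1) = - (x - m) / s ^+ 2.
    by rewrite -!(mulr_natl (_ ^+ _)); field.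
  congr (is_derive _ _ _ _); apply/funext => y. by rewrite -!(mulr_natl (_ ^+ _)); field.
have h2 := is_derive1_comp (is_derive_expR _) h1. have := is_derive_funZ (normal_peak s) h2.
congr (is_derive _ _ _ _); rewrite /= /normal_fun; ring.
Qed.

Lemma normal_pdf_cvg0 (e : R) : `|e| = 1 -> pdf (e * n%:R) @[n --> \oo] --> 0.
Proof.
move=> e1; rewrite /normal_pdf (negbTE s0). apply: (cvg_eqr (normal_peak s * 0)); last by rewrite mulr0.
apply: cvgM; first exact: cvg_cst. pose u (n : nat) := (e * n%:R - m) ^+ 2 / (s ^+ 2 *+ 2).
have hu : u n @[n --> \oo] --> +oo.
  apply/cvgryPge => A. have := @nbhs_infty_ger R (A * (s ^+ 2 *+ 2) + `|m| + 1). apply: filterS => n hn.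
  have s2 : 0 < s ^+ 2 *+ 2 by rewrite pmulrn_lgt0// exprn_even_gt0//= s0.
  rewrite ler_pdivlMr//; apply: (@le_trans _ _ (n%:R - `|m| - 1)); first by lra.
  apply: (@le_trans _ _ (`|e * n%:R - m| - 1)).
    rewrite lerD2r (le_trans _ (lerB_dist _ _))// normrM e1 mul1r. by rewrite ger0_norm.
  have -> : (e * n%:R - m) ^+ 2 = `|e * n%:R - m| ^+ 2.
    by rewrite -normrX ger0_norm ?sqr_ge0.
  by move: `|_| => z; have := sqr_ge0 (z - 1); nra.
have -> : (fun n : nat => normal_fun m s (e * n%:R)) = (fun z => expR (- z)) \o u.
  by apply/funext => n; rewrite /normal_fun /= mulNr.
exact: cvg_comp hu (@cvgr_expR R).
Qed.

(** The derivative of the density is - (x - m) / s^2 times the density. *)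
Lemma normal_by_parts (f df : R -> R) (C : R) : (forall x : R, is_derive x 1 f (df x)) ->
  continuous df -> (forall x : R, `|f x| <= C) -> (forall x, `|df x| <= C) ->
  \int[N]_x ((x - m) * f x) = s ^+ 2 * \int[N]_x df x.
Proof.
move=> dfd cdf fC dfC. have cf : continuous f by move=> x; exact: is_derive_continuous (dfd x).
have mf : measT f by exact: continuous_measurable_fun. have mdf : measT df by exact: continuous_measurable_fun.
have i1 : L1 N df by exact: (integrable_bounded N C). have mm : measT (fun x : R => (x - m) * f x).
  by apply: measurable_funM => //; exact: measurable_funB.
have i2 : L1 N (fun x => (x - m) * f x).
  apply: (integrable_dominated N (fun x => `|x - m| ^+ 1 * C)) => //.
    by move=> x _; rewrite normrM expr1 ler_wpM2l.
  by have := integrableZr measurableT C (integrable_normal_moment 1).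
have j1 := (integrable_normal_prob mdf).1 i1. have j2 := (integrable_normal_prob mm).1 i2. pose F x := f x * pdf x.
pose F' x := df x * pdf x - (s ^+ 2)^-1 * ((x - m) * f x * pdf x). have dF (x : R) : is_derive x 1 F (F' x).
  apply: (is_derive_eq (is_derive_funM (dfd x) (is_derive_normal_pdf x))). by rewrite /F'; field.
have iZ : L1 mu (fun x => (s ^+ 2)^-1 * ((x - m) * f x * pdf x)).
  by have := intZ (s ^+ 2)^-1 j2.
have iF' : L1 mu F'.
  by have := intB j1 iZ; apply: eq_integrable.
have cF0 (e : R) : `|e| = 1 -> F (e * n%:R) @[n --> \oo] --> 0.
  move=> e1; apply: (cvg_dist_le (fun n => C * pdf (e * n%:R))).
    move=> n; rewrite subr0 /F normrM (ger0_norm (normal_pdf_ge0 _ _ _)). by rewrite ler_wpM2r ?normal_pdf_ge0.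
  apply: (cvg_eqr (C * 0)); last by rewrite mulr0. by apply: cvgM; [exact: cvg_cst|exact: normal_pdf_cvg0].
have cpdf : continuous pdf by exact: continuous_normal_pdf. have := Rintegral_derive_eq0 dF _ iF' _ _.
have -> : \int[mu]_x F' x = \int[mu]_x (df x * pdf x) - (s ^+ 2)^-1 * \int[mu]_x ((x - m) * f x * pdf x).
  by rewrite RintegralB// RintegralZl.
rewrite !Rintegral_normal_prob// => h. have /eqP : \int[mu]_x (df x * pdf x) - (s ^+ 2)^-1 *
    \int[mu]_x ((x - m) * f x * pdf x) = 0.
  apply: h.
  - move=> x; apply: cvgB; first by apply: cvgM; [exact: cdf|exact: cpdf]. apply: cvgM; first exact: cvg_cst.
    apply: cvgM; last exact: cpdf. apply: cvgM; last exact: cf. by apply: cvgB; [exact: cvg_id|exact: cvg_cst].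
  - by have := @cF0 1 (normr1 _); under eq_cvg do rewrite mul1r.
  - by have := @cF0 (-1) (normrN1 _); under eq_cvg do rewrite mulN1r.
rewrite subr_eq0 => /eqP ->; rewrite mulrA divff ?mul1r//. by rewrite sqrf_eq0.
Qed.

End normal_integrals.

Section normal_characteristic_function.
Context {R : realType}.
Variables (m s : R).
Hypothesis s0 : s != 0.
Local Notation N := (normal_prob m s).

Lemma taylor1_cos_le (x h : R) : `|cos (x + h) - cos x - h * (- sin x)| <= h ^+ 2.
Proof.
have b (y : R) : `|y - x| <= `|h| -> `|- cos y| <= 1.
  by rewrite normrN norm_cos_le1.
have := @taylor1_le _ (@cos R) (fun y => - sin y) (fun y => - cos y) 1 x h
  (fun y => is_derive_cos y) (fun y => is_deriveN (is_derive_sin y)) b.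
by rewrite mul1r.
Qed.

Lemma measurable_normal_cos (t a : R) : measT (fun y : R => cos (t * (y - m) + a)).
Proof.
apply: (measurableT_comp measurable_cos); apply: measurable_funD => //.
by apply: measurable_funM => //; exact: measurable_funB.
Qed.

Lemma measurable_normal_sin (t a : R) : measT (fun y : R => sin (t * (y - m) + a)).
Proof.
apply: (measurableT_comp measurable_sin); apply: measurable_funD => //.
by apply: measurable_funM => //; exact: measurable_funB.
Qed.

Let Psi (a t : R) := \int[N]_y cos (t * (y - m) + a).

Let is_derive_Psi a (t : R) : is_derive t 1 (Psi a) (- (s ^+ 2 * t * Psi a t)).
Proof.
have icos t' : L1 N (fun y : R => cos (t' * (y - m) + a)).
  apply: (integrable_bounded N 1); first exact: measurable_normal_cos. by move=> x; exact: norm_cos_le1.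
have isin : L1 N (fun y : R => (y - m) * sin (t * (y - m) + a)).
  apply: (integrable_dominated N (fun x => `|x - m| ^+ 1)) => //.
  - by apply: measurable_funM; [exact: measurable_funB|exact: measurable_normal_sin].
  - by move=> x _; rewrite normrM expr1 ler_piMr// norm_sin_le1.
  - exact: integrable_normal_moment.
have D : \int[N]_y ((y - m) * sin (t * (y - m) + a)) = s ^+ 2 * t * Psi a t.
  have -> : s ^+ 2 * t * Psi a t = s ^+ 2 * \int[N]_y (t * cos (t * (y - m) + a)).
    by rewrite RintegralZl// mulrA.
  apply: (@normal_by_parts _ m s s0 _ (fun y => t * cos (t * (y - m) + a)) (1 + `|t|)).
  - move=> x; have h := is_derive_affine t (- (t * m) + a) x. have := is_derive1_comp (is_derive_sin _) h.
    have e y : t * y + (- (t * m) + a) = t * (y - m) + a by ring.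
    have -> : (fun y => sin (t * (y - m) + a)) = sin \o (fun y => t * y + (- (t * m) + a)).
      by apply/funext => y /=; rewrite e.
    by move=> h'; apply: (is_derive_eq h'); rewrite e mulrC.
  - move=> x; apply: cvgM; first exact: cvg_cst. apply: continuous_comp; last exact: continuous_cos.
    apply: cvgD; last exact: cvg_cst. apply: cvgM; first exact: cvg_cst. by apply: cvgB; [exact: cvg_id|exact: cvg_cst].
  - by move=> x; rewrite (le_trans (norm_sin_le1 _))// lerDl.
  - move=> x; rewrite normrM (@le_trans _ _ `|t|)//; last by rewrite lerDr. by rewrite ler_piMr// norm_cos_le1.
apply: (@is_derive_quadratic _ _ _ _ (\int[N]_y (`|y - m| ^+ 2))) => h. have im2 := integrable_normal_moment m s0 2.
have i3 : L1 N (fun y : R => h * ((y - m) * sin (t * (y - m) + a))).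
  by have := intZ h isin.
have i4 : L1 N (fun y : R => cos ((t + h) * (y - m) + a) - cos (t * (y - m) + a)).
  by have := intB (icos (t + h)) (icos t).
rewrite -D mulrN opprK -(RintegralZl h measurableT isin) /Psi.
rewrite -(RintB (icos (t + h)) (icos t)). rewrite -(RintD i4 i3).
rewrite -(RintegralZr _ measurableT im2). apply: le_normr_Rintegral_dominated => //.
- apply: measurable_funD; first by apply: measurable_funB; exact: measurable_normal_cos. apply: measurable_funM => //.
  by apply: measurable_funM; [exact: measurable_funB|exact: measurable_normal_sin].
- move=> y _; have := taylor1_cos_le (t * (y - m) + a) (h * (y - m)).
  have -> : t * (y - m) + a + h * (y - m) = (t + h) * (y - m) + a by ring.
  rewrite mulrN opprK mulrA exprMn -normrX (ger0_norm (sqr_ge0 _)) mulrC. by rewrite (mulrC (_ ^+ 2)).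
- by have := integrableZr measurableT (h ^+ 2) im2.
Qed.

(** The product of the integral with exp (t^2 s^2 / 2) has derivative 0. *)
Lemma normal_cos t a : \int[N]_y cos (t * (y - m) + a) = cos a * expR (- (t ^+ 2 * s ^+ 2 / 2)).
Proof.
pose G t := Psi a t * expR (t ^+ 2 * s ^+ 2 / 2). have dG (x : R) : is_derive x 1 G 0.
  have h1 : is_derive x 1 (fun t : R => t ^+ 2 * s ^+ 2 / 2) (x * s ^+ 2).
    have hid : is_derive x 1 (fun y : R => y) 1 by exact: is_derive_id.
    have := is_derive_funZ (s ^+ 2 / 2) (is_derive_funM hid hid).
    have -> : s ^+ 2 / 2 * (1 * x + x * 1) = x * s ^+ 2 by field.
    by congr (is_derive _ _ _ _); apply/funext => y; field.
  have := is_derive_funM (is_derive_Psi a x) (is_derive1_comp (is_derive_expR _) h1).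
  by congr (is_derive _ _ _ _) => /=; ring.
have : G t = G 0 by exact: is_derive_0_is_cst. rewrite /G expr0n/= mul0r mul0r expR0 mulr1 => e.
have -> : \int[N]_y cos (t * (y - m) + a) = Psi a t * expR (t ^+ 2 * s ^+ 2 / 2) * expR (- (t ^+ 2 * s ^+ 2 / 2)).
  by rewrite -mulrA -expRD subrr expR0 mulr1.
rewrite e; congr (_ * _); rewrite /Psi. under eq_Rintegral do rewrite mul0r add0r.
by rewrite Rintegral_cst//= (@probability_setT _ _ _ N)/= mulr1.
Qed.

End normal_characteristic_function.

Section equal_laws.
Context {R : realType} {d d' : measure_display} {T : measurableType d} {T' : measurableType d'}.
Variables (P : {finite_measure set T -> \bar R}) (P' : {finite_measure set T' -> \bar R}).
Variables (X : T -> R) (X' : T' -> R).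
Hypotheses (mX : measT X) (mX' : measT X').

Lemma same_law_Rintegral (f : R -> R) (C : R) : (forall B, measurable B -> P (X @^-1` B) = P' (X' @^-1` B)) ->
  measT f -> (forall x, `|f x| <= C) -> \int[P]_x f (X x) = \int[P']_x f (X' x).
Proof.
move=> law mf fC; rewrite /Rintegral; congr fine. have i1 : L1 P (fun x => f (X x)).
  by apply: (integrable_bounded _ C) => //; exact: measurableT_comp mf mX.
have i2 : L1 P' (fun x => f (X' x)) by apply: (integrable_bounded _ C) => //; exact: measurableT_comp mf mX'.
have mfE : measT (EFin \o f) by exact/measurable_EFinP. have := integral_pushforward mX mfE i1 measurableT.
have := integral_pushforward mX' mfE i2 measurableT. rewrite !preimage_setT => <- <-.
by apply: eq_measure_integral => B mB _; exact: law.
Qed.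

(** The half lines ]a, +oo[, to which [agree_gt] applies, are stable under intersection and generate the Borel
    sets. *)
Lemma characteristic_function_law : (forall t, \int[P]_x cos (t * X x) = \int[P']_x cos (t * X' x)) ->
  (forall t, \int[P]_x sin (t * X x) = \int[P']_x sin (t * X' x)) ->
  forall B, measurable B -> P (X @^-1` B) = P' (X' @^-1` B).
Proof.
move=> cosE sinE B mB. have mA e (S : measurableType e) (V : S -> R) a : measT V -> measurable (V @^-1` `]a, +oo[).
  by move=> mV; rewrite -[X in measurable X]setTI; exact: mV.
have h a : P (X @^-1` `]a, +oo[) = P' (X' @^-1` `]a, +oo[).
  have e1 e (S : measurableType e) (Q : {finite_measure set S -> \bar R}) (V : S -> R) : measT V ->
      Q (V @^-1` `]a, +oo[) = (\int[Q]_x ((1 : R) * (a < V x)%R%:R))%:E.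
    move=> mV; rewrite -[LHS]fineK ?fin_num_measure//; last exact: mA.
    rewrite -[in LHS](setIT (V @^-1` _)) -integral_indic//; last exact: mA. congr EFin; apply: eq_Rintegral => x _.
    by rewrite mul1r indicE; congr (_ %:R); congr nat_of_bool; apply/idP/idP; rewrite inE /= in_itv/= andbT.
  have b1 e (S : measurableType e) (x : S) : `|cst (1 : R) x| <= 1 by rewrite normr1.
  rewrite !e1//; congr EFin; apply: (@agree_gt _ _ _ _ _ P P' X (cst 1) X' (cst 1) 1) => // t; rewrite /agree;
    under eq_Rintegral do rewrite mul1r; under [RHS]eq_Rintegral do rewrite mul1r; [exact: cosE|exact: sinE].
pose m1 := pushforward P X; pose m2 := pushforward P' X'.
apply: (@measure_unique _ R _ (@RGenOInfty.G R) (fun k => `]- k%:R, +oo[%classic) _ _ _ _ m1 m2) => //.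
- exact: RGenOInfty.measurableE.
- move=> A B' [a ->] [b ->]; exists (Num.max a b). apply/seteqP; split => x /=; rewrite !in_itv/= !andbT gt_max.
    by move=> [-> ->].
  by move=> /andP[].
- by move=> k; exists (- k%:R).
- apply/seteqP; split => // x _; exists (Num.bound `|x|) => //=; rewrite in_itv/= andbT.
  rewrite ltrNl (le_lt_trans _ (archi_boundP (normr_ge0 x)))//. by rewrite -normrN ler_norm.
- by move=> A [a ->]; exact: h.
- by move=> k; rewrite /m1 /pushforward ltey_eq fin_num_measure//; exact: mA.
Qed.

End equal_laws.

(** * Centred Gaussian variables *)

(** Characteristic functions are what martingale arguments and limits produce. *)
Definition centered_gaussian {R : realType} {d : measure_display}
    {T : measurableType d} (P : probability T R) (X : T -> R) (v : R) := [/\ measT X, 0 <= v &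
    forall t, \int[P]_x cos (t * X x) = expR (- (t ^+ 2 * v / 2)) /\ \int[P]_x sin (t * X x) = 0].

Lemma measurable_cos_affine {R : realType} (t a : R) : measT (fun z : R => cos (t * z + a)).
Proof.
apply: (measurableT_comp measurable_cos). by apply: measurable_funD => //; exact: measurable_funM.
Qed.

Lemma Rintegral_probability_cst {R : realType} {d : measure_display}
  {T : measurableType d} (P : probability T R) (c : R) : \int[P]_x c = c.
Proof. by rewrite Rintegral_cst//= probability_setT mulr1. Qed.

Section centered_gaussian_variables.
Context {R : realType} {d : measure_display} {T : measurableType d}.
Variable P : probability T R.
Implicit Types (X : T -> R) (v : R).

Lemma measurable_cosM X t : measT X -> measT (fun x => cos (t * X x)).
Proof.
by move=> mX; apply: (measurableT_comp measurable_cos); exact: measurable_funM.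
Qed.

Lemma measurable_sinM X t : measT X -> measT (fun x => sin (t * X x)).
Proof.
by move=> mX; apply: (measurableT_comp measurable_sin); exact: measurable_funM.
Qed.

Lemma measurable_cos_mul t : measT (fun y : R => cos (t * y)).
Proof. by apply: (measurableT_comp measurable_cos); exact: measurable_funM. Qed.

Lemma measurable_sin_mul t : measT (fun y : R => sin (t * y)).
Proof. by apply: (measurableT_comp measurable_sin); exact: measurable_funM. Qed.

Lemma normal_law_characteristic_function v : 0 <= v -> exists2 m : {finite_measure set (measurableTypeR R) -> \bar R},
    forall B : set R, m B = if v == 0 then \d_(0 : R) B else normal_prob 0 (Num.sqrt v) B &
    forall t, \int[m]_y cos (t * y) = expR (- (t ^+ 2 * v / 2)) /\ \int[m]_y sin (t * y) = 0.
Proof.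
move=> v0; have [->|vn0] := eqVneq v 0.
  pose D : {finite_measure set (measurableTypeR R) -> \bar R} := dirac (0 : measurableTypeR R).
  exists D => // t; have h (f : R -> R) : measT f -> \int[D]_y f y = f 0.
    by move=> mf; rewrite /Rintegral integral_dirac ?diracT ?mul1e//; exact/measurable_EFinP.
  rewrite !h ?mulr0 ?mul0r ?oppr0 ?expR0 ?cos0 ?sin0//; [exact: measurable_sin_mul|exact: measurable_cos_mul].
exists (normal_prob 0 (Num.sqrt v)) => // t; have s0 : Num.sqrt v != 0 by rewrite sqrtr_eq0 -ltNge lt_neqAle eq_sym vn0.
split; first have := normal_cos 0 s0 t 0; last have := normal_cos 0 s0 t (- (pi / 2)).
  by rewrite cos0 mul1r sqr_sqrtr// => <-; apply: eq_Rintegral => y _; rewrite subr0 addr0.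
rewrite cosN cos_pihalf mul0r => h; rewrite -[RHS]h; apply: eq_Rintegral => y _.
by rewrite subr0 cosB cos_pihalf sin_pihalf mulr0 add0r mulr1.
Qed.

Lemma centered_gaussianP X v : centered_gaussian P X v <-> normal_rv P X 0 v.
Proof.
have mid := @measurable_id _ (measurableTypeR R) setT.
split=> [[mX v0 cf]|[v0 mX law]]; have [m mE mcf] := normal_law_characteristic_function v0; split=> //.
  move=> B mB; rewrite -mE; apply: (characteristic_function_law mX mid) => // t.
    by rewrite (cf t).1 (mcf t).1.
  by rewrite (cf t).2 (mcf t).2.
move=> t; have l B : measurable B -> P (X @^-1` B) = m (id @^-1` B) by move=> mB; rewrite mE law.
have [<- <-] := mcf t; split; [pose f := @cos R|pose f := @sin R];
  apply: (@same_law_Rintegral _ _ _ _ _ P m X id mX mid (fun y => f (t * y)) 1 l).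
- exact: measurable_cos_mul.
- by move=> x; exact: norm_cos_le1.
- exact: measurable_sin_mul.
- by move=> x; exact: norm_sin_le1.
Qed.

Lemma onem_expRN_le (x : R) : 0 <= x -> x - x ^+ 2 <= 1 - expR (- x) <= x.
Proof.
move=> x0; apply/andP; split; last first.
  by have := expR_ge1Dx (- x); lra.
have h : expR (- x) <= (1 + x)^-1.
  rewrite expRN lef_pV2 ?posrE ?expR_gt0//; [exact: expR_ge1Dx|lra].
have : (1 + x)^-1 <= 1 - x + x ^+ 2.
  rewrite -div1r ler_pdivrMr; last lra. have -> : (1 - x + x ^+ 2) * (1 + x) = 1 + x ^+ 3 by ring.
  by rewrite lerDl exprn_ge0.
lra.
Qed.

Lemma norm_sin_le (x : R) : `|sin x| <= `|x| /\ `|sin x - x| <= x ^+ 2.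
Proof.
have ds (y : R) : is_derive y 1 sin (cos y) by exact: is_derive_sin.
have dc (y : R) : is_derive y 1 cos (- sin y) by exact: is_derive_cos.
have bs (y : R) : `|- sin y| <= 1 by rewrite normrN norm_sin_le1.
have := @MVT_le _ _ _ _ 0 x ds (fun y _ => norm_cos_le1 y). have := @taylor1_le _ _ _ _ _ 0 x ds dc (fun y _ => bs y).
by rewrite add0r sin0 cos0 !subr0 mulr1 !mul1r.
Qed.

(** The functions (2 sin (t X / 2) / t)^2 = 2 (1 - cos (t X)) / t^2 are below X^2 and converge to it as t tends
    to 0, and the characteristic function gives their integrals. Fatou's lemma yields the integrability of X^2,
    then dominated convergence the value. *)
Lemma centered_gaussian_variance X v : centered_gaussian P X v -> L1 P (fun x => X x ^+ 2) /\ \int[P]_x X x ^+ 2 = v.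
Proof.
move=> [mX v0 cf]; pose t (n : nat) : R := n.+1%:R^-1. have t0 n : 0 < t n by rewrite /t invr_gt0.
have tc (b : R) : t n * b @[n --> \oo] --> 0.
  by apply: (cvg_eqr (0 * b)); [apply: cvgM; [exact: cvg_harmonic|exact: cvg_cst]|rewrite mul0r].
pose s n x := 2 / t n * sin (t n / 2 * X x). have sE n x : s n x ^+ 2 = 2 / t n ^+ 2 * (1 - cos (t n * X x)).
  have -> : t n * X x = t n / 2 * X x + t n / 2 * X x by field.
  rewrite cosD -!expr2 cos2sin2 /s; field. by rewrite gt_eqF.
have ms n : measT (s n).
  by apply: measurable_funM => //; exact: measurable_sinM.
have sle n x : `|s n x| <= `|X x|.
  have -> : X x = 2 / t n * (t n / 2 * X x) by field; rewrite gt_eqF.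
  by rewrite normrM [leRHS]normrM ler_wpM2l//; have [] := norm_sin_le (t n / 2 * X x).
have sc x : s n x ^+ 2 @[n --> \oo] --> X x ^+ 2.
  have c : s n x @[n --> \oo] --> X x; last by rewrite expr2; apply: cvgM.
  apply: (cvg_dist_le (fun n => t n * (X x ^+ 2 / 2))); last exact: tc.
  move=> n; have -> : s n x - X x = 2 / t n * (sin (t n / 2 * X x) - t n / 2 * X x) by rewrite /s; field; rewrite gt_eqF.
  have n2 : 0 < 2 / t n by rewrite divr_gt0. rewrite normrM (gtr0_norm n2) -ler_pdivlMl//.
  apply: le_trans (norm_sin_le _).2 _; rewrite le_eqVlt; apply/orP; left; apply/eqP; field. by rewrite gt_eqF.
have cI n : \int[P]_x s n x ^+ 2 = 2 / t n ^+ 2 * (1 - expR (- (t n ^+ 2 * v / 2))).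
  have i1 : L1 P (fun x => cos (t n * X x)).
    by apply: (integrable_bounded P 1); [exact: measurable_cosM|move=> x; exact: norm_cos_le1].
  have i0 : L1 P (fun=> 1 : R) by apply: (integrable_bounded P 1) => // x; rewrite normr1.
  under eq_Rintegral do rewrite sE. have i2 := intB i0 i1.
  by rewrite RintegralZl// RintegralB// Rintegral_probability_cst (cf (t n)).1.
have dist n : v - t n * (t n * (v ^+ 2 / 2)) <= \int[P]_x s n x ^+ 2 <= v.
  pose x := t n ^+ 2 * v / 2. have x0 : 0 <= x by rewrite divr_ge0// mulr_ge0// sqr_ge0.
  have /andP[h1 h2] := onem_expRN_le x0. have t2 : 0 < 2 / t n ^+ 2 by rewrite divr_gt0// exprn_gt0.
  have e1 : v = 2 / t n ^+ 2 * x by rewrite /x; field; rewrite gt_eqF.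
  have e2 : v - t n * (t n * (v ^+ 2 / 2)) = 2 / t n ^+ 2 * (x - x ^+ 2) by rewrite /x; field; rewrite gt_eqF.
  by apply/andP; rewrite cI -/x e2; split; last rewrite [leRHS]e1; rewrite ler_pM2l.
have is2 n : L1 P (fun x => s n x ^+ 2).
  apply: (integrable_bounded P ((2 / t n) ^+ 2)); first exact: measurable_funX.
  by move=> x; rewrite /s exprMn normrM !normrX (real_normK (num_real (2 / t n))) ler_piMr ?sqr_ge0// exprn_ile1//
    norm_sin_le1.
have [iX _] := @Rintegral_fatou _ _ _ P setT (fun n x => s n x ^+ 2) (fun x => X x ^+ 2) v measurableT
  (fun n => measurable_funX 2 (ms n)) (fun n x _ => sqr_ge0 _) is2 (fun n => proj2 (andP (dist n))) (fun x _ => sc x).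
split=> //; have sX n x : setT x -> `|s n x ^+ 2| <= X x ^+ 2.
  by move=> _; rewrite normrX -(real_normK (num_real (X x))) lerXn2r// nnegrE.
have [_ c2] := Rintegral_dominated_cvg measurableT (fun n => measurable_funX 2 (ms n)) (fun x _ => sc x) iX sX.
apply: (cvgr_unique c2) (fun=> erefl); apply: (cvg_dist_le (fun n => t n * (t n * (v ^+ 2 / 2)))) => [n|].
  by have /andP[h1 h2] := dist n; rewrite ler0_norm ?subr_le0// opprB lerBlDl -lerBlDr.
by apply: (cvg_eqr (0 * 0)); [apply: cvgM; [exact: cvg_harmonic|exact: tc]|rewrite mul0r].
Qed.

(** The variances are read off the values at 1 of the characteristic functions; as the variances are bounded,
    the limit of these values is positive and has a logarithm. *)
Lemma centered_gaussian_cvg (X_ : nat -> T -> R) (v_ : nat -> R) X (C : R) :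
  measT X -> (forall n, centered_gaussian P (X_ n) (v_ n)) -> (forall n, v_ n <= C) ->
  (forall t, \int[P]_x cos (t * X_ n x) @[n --> \oo] --> \int[P]_x cos (t * X x)) ->
  (forall t, \int[P]_x sin (t * X_ n x) @[n --> \oo] --> \int[P]_x sin (t * X x)) ->
  exists v, centered_gaussian P X v /\ v_ n @[n --> \oo] --> v.
Proof.
move=> mX GX vC cc cs. have aE n : expR (- (v_ n / 2)) = \int[P]_x cos (1 * X_ n x).
  by have [_ _ /(_ 1)[-> _]] := GX n; rewrite expr1n mul1r.
have c1 : expR (- (v_ n / 2)) @[n --> \oo] --> \int[P]_x cos (1 * X x).
  by under eq_cvg do rewrite aE; exact: cc.
set A := \int[P]_x cos (1 * X x) in c1. have A0 : 0 < A.
  apply: (@lt_le_trans _ _ (expR (- (C / 2)))); first exact: expR_gt0. apply: (cvg_ge_lim c1) => n.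
  by rewrite ler_expR lerN2 ler_pM2r.
have vc : v_ n @[n --> \oo] --> (-2 * ln A).
  have -> : v_ = (fun n => -2 * ln (expR (- (v_ n / 2)))).
    by apply/funext => n; rewrite expRK; field.
  apply: cvgM; first exact: cvg_cst. by apply: (@cvg_comp _ _ _ _ (@ln R) _ _ _ c1); exact: continuous_ln.
exists (-2 * ln A); split => //; split => //.
  by apply: (cvg_ge_lim vc) => n; have [] := GX n.
move=> t; split; last first.
  apply: (cvgr_unique (cs t) (cvg_cst (0 : R))) => n. by have [_ _ /(_ t)[]] := GX n.
have ce : expR (- (t ^+ 2 * v_ n / 2)) @[n --> \oo] --> expR (- (t ^+ 2 * (-2 * ln A) / 2)).
  apply: (@cvg_comp _ _ _ (fun n => - (t ^+ 2 * v_ n / 2)) (@expR R)); last exact: continuous_expR.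
  apply: cvgN; apply: cvgM; last exact: cvg_cst. by apply: cvgM => //; exact: cvg_cst.
by apply: (cvgr_unique (cc t) ce) => n; have [_ _ /(_ t)[]] := GX n.
Qed.

End centered_gaussian_variables.

Section real_fubini.
Context {R : realType} {d1 d2 : measure_display} {T1 : measurableType d1} {T2 : measurableType d2}.

Lemma Rintegral_fubini (m1 : {sigma_finite_measure set T1 -> \bar R})
    (m2 : {sigma_finite_measure set T2 -> \bar R}) (f : T1 * T2 -> R) : (m1 \x m2)%E.-integrable setT (EFin \o f) ->
  (forall x, m2.-integrable setT (EFin \o (fun y => f (x, y)))) ->
  (forall y, m1.-integrable setT (EFin \o (fun x => f (x, y)))) ->
  \int[m1]_x \int[m2]_y f (x, y) = \int[m2]_y \int[m1]_x f (x, y) /\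
  \int[m1]_x \int[m2]_y f (x, y) = \int[(m1 \x m2)%E]_z f z.
Proof.
move=> If I2 I1. have e1 : (\int[m1]_x (\int[m2]_y f (x, y))%R%:E = \int[m1]_x \int[m2]_y (f (x, y))%:E)%E.
  apply: eq_integral => x _; rewrite /Rintegral fineK//. exact: (integrable_fin_num measurableT (I2 x)).
have e2 : (\int[m2]_y (\int[m1]_x f (x, y))%R%:E = \int[m2]_y \int[m1]_x (f (x, y))%:E)%E.
  apply: eq_integral => y _; rewrite /Rintegral fineK//. exact: (integrable_fin_num measurableT (I1 y)).
split.
  by rewrite [LHS]/Rintegral e1 [RHS]/Rintegral e2 (Fubini If).
by rewrite [LHS]/Rintegral e1 (integral12_prod_meas1 If).
Qed.

Lemma Rintegral_fubini_bounded (P : subprobability T1 R) (Q : subprobability T2 R)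
    (f : T1 * T2 -> R) (C : R) : measT f -> (forall z, `|f z| <= C) ->
  \int[P]_x \int[Q]_y f (x, y) = \int[Q]_y \int[P]_x f (x, y) /\
  \int[P]_x \int[Q]_y f (x, y) = \int[product_subprobability (P, Q)]_z f z.
Proof.
move=> mf fC; apply: Rintegral_fubini.
- exact: (@integrable_bounded _ _ _ (product_subprobability (P, Q)) _ C).
- move=> x; apply: (integrable_bounded Q C) => //. exact: measurableT_comp mf (pair1_measurable x).
- move=> y; apply: (integrable_bounded P C) => //. exact: measurableT_comp mf (pair2_measurable y).
Qed.

End real_fubini.

(** Both sides integrate f against laws that have the same characteristic function. *)
Lemma normal_convolution {R : realType} (a b c : R) (f : R -> R) (C : R) : c ^+ 2 = a ^+ 2 + b ^+ 2 ->
  measT f -> (forall x, `|f x| <= C) -> let N := normal_prob (0 : R) 1 in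
  \int[N]_x \int[N]_y f (a * x + b * y) = \int[N]_x f (c * x).
Proof.
move=> cab mf fC N. pose S (p : measurableTypeR R * measurableTypeR R) : R := a * p.1 + b * p.2.
have mS : measT S by apply: measurable_funD; apply: measurable_funM.
have mc : measT (fun x : R => c * x) by exact: measurable_funM.
have F (g : R -> R) : measT g -> (exists D, forall x, `|g x| <= D) -> \int[N]_x \int[N]_y g (a * x + b * y) =
    \int[product_subprobability (N : subprobability _ R, N : subprobability _ R)]_z g (S z).
  move=> mg [D gD]. by have [_ ->] := @Rintegral_fubini_bounded _ _ _ _ _ (N : subprobability _ R)
    (N : subprobability _ R) (g \o S) D (measurableT_comp mg mS) (fun z => gD (S z)).
rewrite F//; last by exists C. have n1 : (1 : R) != 0 by [].
have cosN t al : \int[N]_y cos (t * y + al) = cos al * expR (- (t ^+ 2 / 2)).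
  have := normal_cos 0 n1 t al; rewrite expr1n mulr1 => <-. by apply: eq_Rintegral => y _; rewrite subr0.
have cosS t al : \int[product_subprobability (N : subprobability _ R, N : subprobability _ R)]_z cos (t * S z + al) =
   \int[N]_y cos (t * (c * y) + al).
  rewrite -(F (fun z => cos (t * z + al)) (measurable_cos_affine t al)); last first.
    by exists (1 : R) => x; exact: norm_cos_le1.
  transitivity (\int[N]_x (cos (t * a * x + al) * expR (- ((t * b) ^+ 2 / 2)))).
    apply: eq_Rintegral => x _; rewrite -(cosN (t * b) (t * a * x + al)).
    by apply: eq_Rintegral => y _; congr cos; ring.
  rewrite RintegralZr//; last first.
    apply: (integrable_bounded N 1); last by move=> x; exact: norm_cos_le1. exact: measurable_cos_affine.
  rewrite cosN -mulrA -expRD. under [RHS]eq_Rintegral do rewrite mulrA. rewrite cosN; congr (_ * expR _).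
  by rewrite !exprMn cab; field.
apply: (@same_law_Rintegral _ _ _ _ _ _ N S (fun x => c * x) mS mc f C _ mf fC); apply: (@characteristic_function_law _ _ _ _ _ _ N S _ mS mc).
- move=> t; have := cosS t 0. under eq_Rintegral do rewrite addr0.
  by under [in X in _ = X -> _]eq_Rintegral do rewrite addr0.
- move=> t; have := cosS t (- (pi / 2)). have e (z : R) : cos (z - pi / 2) = sin z.
    by rewrite cosB cos_pihalf sin_pihalf mulr0 add0r mulr1.
  under eq_Rintegral do rewrite e. by under [in X in _ = X -> _]eq_Rintegral do rewrite e.
Qed.

(** * The heat semigroup on Schwartz functions *)

Section schwartz_calculus.
Context {R : realType}.
Implicit Types (u w : schwartz R) (k n : nat).

Lemma schwartzP u : is_schwartz (u : R -> R).
Proof. exact: (asboolW (schwartz_funP u)). Qed.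

Lemma schwartz_eqP u w : (forall x, u x = w x) -> u = w.
Proof. by move=> uw; apply: val_inj; apply/funext. Qed.

Lemma is_derive_schwartz u n (x : R) : is_derive x 1 (derive1n n u) (derive1n n.+1 u x).
Proof.
have [d _] := schwartzP u. have : is_derive x 1 (derive1n n u) ('D_1 (derive1n n u) x) by exact/derivableP.
by move=> h; apply: (is_derive_eq h); rewrite derive1nS derive1E.
Qed.

Lemma continuous_schwartz u n : continuous (derive1n n u).
Proof. by move=> x; exact: is_derive_continuous (is_derive_schwartz u n x). Qed.

Lemma measurable_schwartz u n : measT (derive1n n u).
Proof. by apply: continuous_measurable_fun; exact: continuous_schwartz. Qed.

Lemma schwartz_linE (a : R) u w x : (a *: u + w) x = a * u x + w x.
Proof. by []. Qed.

Lemma derive1n_schwartz_lin (a : R) u w n x :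
  derive1n n (a *: u + w : schwartz R) x = a * derive1n n u x + derive1n n w x.
Proof.
have := derive1n_lin a (schwartzP u) (schwartzP w) n. by move/(congr1 (@^~ x)).
Qed.

Lemma derive1n_schwartz0 n x : derive1n n (0 : schwartz R) x = 0.
Proof.
elim: n x => [//|n IH] x; rewrite derive1nS.
have -> : derive1n n (0 : schwartz R) = cst 0 by apply/funext => y; exact: IH. by rewrite derive1_cst.
Qed.

Lemma derive1n_schwartzZ (a : R) u n x : derive1n n (a *: u : schwartz R) x = a * derive1n n u x.
Proof. by rewrite -[a *: u]addr0 derive1n_schwartz_lin derive1n_schwartz0 addr0. Qed.

Lemma derive1n_schwartzD u w n x : derive1n n (u + w : schwartz R) x = derive1n n u x + derive1n n w x.
Proof. by rewrite -{1}[u]scale1r derive1n_schwartz_lin mul1r. Qed.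

Lemma derive1n_schwartzB u w n x : derive1n n (u - w : schwartz R) x = derive1n n u x - derive1n n w x.
Proof. by rewrite derive1n_schwartzD -scaleN1r derive1n_schwartzZ mulN1r. Qed.

Lemma derive1n_sgrad u n x : derive1n n (sgrad u) x = derive1n n.+1 u x.
Proof. by rewrite derive1Sn. Qed.

Lemma derive1n_slap u n x : derive1n n (slap u) x = derive1n n.+2 u x.
Proof. by rewrite /slap !derive1n_sgrad. Qed.

(** The weights 1 + |x| are submultiplicative under translations, as powers of |x| are not. *)
Definition wnorm k n u : R := sup (range (fun x => (1 + `|x|) ^+ k * `|derive1n n u x|)).

Lemma onem_norm_exp_le k (x : R) : (1 + `|x|) ^+ k <= 2 ^+ k * (1 + `|x ^+ k|).
Proof.
have x0 := normr_ge0 x; rewrite normrX. have [x1|x1] := leP `|x| 1.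
  apply: (@le_trans _ _ (2 ^+ k)); first by rewrite lerXn2r ?nnegrE//; lra.
  by rewrite ler_peMr ?exprn_ge0// lerDl exprn_ge0.
apply: (@le_trans _ _ (2 ^+ k * `|x| ^+ k)).
  by rewrite -exprMn lerXn2r ?nnegrE//; lra.
by rewrite ler_pM2l ?exprn_gt0// lerDr.
Qed.

Lemma wnorm_has_sup k n u : has_sup (range (fun x => (1 + `|x|) ^+ k * `|derive1n n u x|)).
Proof.
split; first by exists ((1 + `|0 : R|) ^+ k * `|derive1n n u 0|); exists 0.
have [_ b] := schwartzP u; have [C hC] := b k n; have [C' hC'] := b 0 n. exists (2 ^+ k * (C' + C)) => _ [x _ <-].
apply: (@le_trans _ _ (2 ^+ k * (1 + `|x ^+ k|) * `|derive1n n u x|)).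
  by rewrite ler_wpM2r// onem_norm_exp_le.
rewrite -mulrA ler_pM2l ?exprn_gt0// mulrDl mul1r lerD//.
  by have := hC' x; rewrite expr0 mul1r.
by rewrite -normrM.
Qed.

Lemma wnorm_ub k n u x : (1 + `|x|) ^+ k * `|derive1n n u x| <= wnorm k n u.
Proof. by apply: sup_upper_bound; [exact: wnorm_has_sup|exists x]. Qed.

Lemma wnorm_le k n u C : (forall x, (1 + `|x|) ^+ k * `|derive1n n u x| <= C) -> wnorm k n u <= C.
Proof.
move=> h; apply: ge_sup; last by move=> _ [x _ <-]. by exists ((1 + `|0 : R|) ^+ k * `|derive1n n u 0|); exists 0.
Qed.

Lemma wnorm_ge0 k n u : 0 <= wnorm k n u.
Proof.
apply: le_trans (wnorm_ub k n u 0). by rewrite mulr_ge0// exprn_ge0// addr_ge0.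
Qed.

Lemma le1_weight k (x : R) : 1 <= (1 + `|x|) ^+ k.
Proof. by rewrite exprn_ege1// lerDl. Qed.

Lemma weight_gt0 k (x : R) : 0 < (1 + `|x|) ^+ k.
Proof. exact: lt_le_trans ltr01 (le1_weight k x). Qed.

Lemma wnorm0_ub n u x : `|derive1n n u x| <= wnorm 0 n u.
Proof. by have := wnorm_ub 0 n u x; rewrite expr0 mul1r. Qed.

Lemma wnormD k n u w : wnorm k n (u + w) <= wnorm k n u + wnorm k n w.
Proof.
apply: wnorm_le => x; rewrite derive1n_schwartzD.
apply: (le_trans (ler_wpM2l _ (ler_normD _ _))); first exact/ltW/weight_gt0. by rewrite mulrDr lerD// wnorm_ub.
Qed.

Lemma wnormZ k n (a : R) u : wnorm k n (a *: u) <= `|a| * wnorm k n u.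
Proof.
apply: wnorm_le => x; rewrite derive1n_schwartzZ normrM mulrCA ler_wpM2l//. exact: wnorm_ub.
Qed.

Lemma wnorm_sgrad k n u : wnorm k n (sgrad u) = wnorm k n.+1 u.
Proof. by congr sup; congr (_ @` _); apply/funext => x; rewrite derive1n_sgrad. Qed.

Lemma wnorm_slap k n u : wnorm k n (slap u) = wnorm k n.+2 u.
Proof. by rewrite /slap !wnorm_sgrad. Qed.

(** Functions linked by Taylor expansions with quadratic remainders are successive derivatives. These
    inequalities pass to averages and to pointwise limits, so that no limit has to be exchanged with a
    derivative later. *)
Lemma taylor_chain_schwartz (g : nat -> R -> R) (C : nat -> R) (B : nat -> nat -> R) :
  (forall n x h, `|g n (x + h) - g n x - h * g n.+1 x| <= C n * h ^+ 2) ->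
  (forall k n x, (1 + `|x|) ^+ k * `|g n x| <= B k n) -> is_schwartz (g 0) /\ forall n, derive1n n (g 0) = g n.
Proof.
move=> gC gB. have dg n (x : R) : is_derive x 1 (g n) (g n.+1 x) by exact: is_derive_quadratic.
have e n : derive1n n (g 0) = g n.
  elim: n => [//|n IH]; rewrite derive1nS IH; apply/funext => x. exact: is_derive_derive1.
split => //; split.
  by move=> n x; rewrite e; case: (dg n x).
move=> k n; exists (B k n) => x; rewrite e. apply: le_trans (gB k n x); rewrite normrM ler_wpM2r// normrX.
by rewrite lerXn2r ?nnegrE ?addr_ge0// lerDr.
Qed.

End schwartz_calculus.

Section heat_semigroup.
Context {R : realType}.
Variable v : R.
Implicit Types (u w : schwartz R) (k n : nat).
Local Notation gam := (normal_prob (0 : R) 1).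

(** Displacement at time r of a Brownian motion of drift - v, in terms of a standard normal variable. *)
Definition heat_shift (r y : R) : R := Num.sqrt r * y - v * r.

Lemma measurable_heat_shift r : measT (heat_shift r).
Proof. by apply: measurable_funB => //; exact: measurable_funM. Qed.

Lemma measurable_heat_integrand u n r x : measT (fun y => derive1n n u (x + heat_shift r y)).
Proof.
apply: (measurableT_comp (measurable_schwartz u n)). by apply: measurable_funD => //; exact: measurable_heat_shift.
Qed.

Definition heat_fun r u n (x : R) := \int[gam]_y derive1n n u (x + heat_shift r y).

Definition gauss_moment k : R := \int[gam]_y (1 + `|y|) ^+ k.

Lemma integrable_gauss_moment k : L1 gam (fun y : R => (1 + `|y|) ^+ k).
Proof.
have n1 : (1 : R) != 0 by []. have mk j : measurable_fun [set: R] (fun y : R => `|y| ^+ j).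
  by apply: measurable_funX; exact: normr_measurable.
apply: (integrable_dominated gam (fun y => 2 ^+ k * (1 + `|y - 0| ^+ k))) => //.
- by apply: measurable_funX; apply: measurable_funD => //; exact: normr_measurable.
- move=> y _; rewrite ger0_norm ?exprn_ge0 ?addr_ge0//. by rewrite subr0 -normrX onem_norm_exp_le.
- have i1 : L1 gam (fun=> 1 : R).
    by apply: (integrable_bounded gam 1) => // x; rewrite normr1.
  have := intZ (2 ^+ k) (intD i1 (integrable_normal_moment 0 n1 k)). by apply: eq_integrable.
Qed.

Lemma integrable_heat_integrand u n r x : L1 gam (fun y => derive1n n u (x + heat_shift r y)).
Proof.
apply: (integrable_bounded gam (wnorm 0 n u)).
  exact: measurable_heat_integrand.
by move=> y; exact: wnorm0_ub.
Qed.

Definition heat_const (r0 : R) : R := (1 + `|v| * Num.sqrt r0) * (1 + Num.sqrt r0).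

Lemma heat_shift_le r0 r y : 0 <= r <= r0 -> `|heat_shift r y| <= heat_const r0 * Num.sqrt r * (1 + `|y|) /\
  1 + `|heat_shift r y| <= heat_const r0 * (1 + `|y|).
Proof.
move=> /andP[r_ge0 rr0]. have s0 := sqrtr_ge0 r; have s1 := sqrtr_ge0 r0.
have s2 : Num.sqrt r <= Num.sqrt r0 by rewrite ler_sqrt// (le_trans r_ge0).
have v0 := normr_ge0 v; have y0 := normr_ge0 y. have b1 : `|heat_shift r y| <= Num.sqrt r * (`|y| + `|v| * Num.sqrt r).
  rewrite /heat_shift (le_trans (ler_normB _ _))// mulrDr normrM (ger0_norm s0) lerD2l.
  by rewrite normrM (ger0_norm r_ge0) mulrCA -expr2 sqr_sqrtr.
move: b1 s0 s1 s2 v0 y0; rewrite /heat_const.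
move: (Num.sqrt r) (Num.sqrt r0) `|v| `|y| `|heat_shift r y| => s t a b z b1 s0 s1 s2 v0 y0.
have as0 : a * s <= a * t by rewrite ler_wpM2l. have at0 : 0 <= a * t by exact: mulr_ge0.
have b2 : b + a * s <= (1 + a * t) * (1 + b).
  have : 0 <= a * t * b by rewrite mulr_ge0. nra.
have b3 : z <= s * ((1 + a * t) * (1 + b)) by apply: le_trans b1 _; rewrite ler_wpM2l.
have c0 : 0 <= (1 + a * t) * (1 + b) by rewrite mulr_ge0// addr_ge0. have c1 : 1 <= (1 + a * t) * (1 + b).
  by have : 0 <= a * t * b; [rewrite mulr_ge0|nra].
split.
  apply: le_trans b3 _; rewrite -subr_ge0. have -> : (1 + a * t) * (1 + t) * s * (1 + b) - s * ((1 + a * t) * (1 + b)) =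
    s * t * ((1 + a * t) * (1 + b)) by ring.
  by rewrite mulr_ge0// mulr_ge0.
have b4 : z <= t * ((1 + a * t) * (1 + b)) by apply: le_trans b3 _; rewrite ler_wpM2r.
have -> : (1 + a * t) * (1 + t) * (1 + b) = (1 + a * t) * (1 + b) + t * ((1 + a * t) * (1 + b)) by ring. exact: lerD.
Qed.

Lemma weight_shift k (x z : R) : (1 + `|x|) ^+ k <= (1 + `|x + z|) ^+ k * (1 + `|z|) ^+ k.
Proof.
rewrite -exprMn lerXn2r ?nnegrE ?mulr_ge0 ?addr_ge0//. have h : `|x| <= `|x + z| + `|z|.
  by have := ler_normB (x + z) z; rewrite addrK.
have : 0 <= `|x + z| * `|z| by rewrite mulr_ge0. by move: h; move: `|x| `|x + z| `|z| => a b c; nra.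
Qed.

Lemma heat_fun_wbound r0 r u k n x : 0 <= r <= r0 -> (1 + `|x|) ^+ k * `|heat_fun r u n x| <=
  heat_const r0 ^+ k * gauss_moment k * wnorm k n u.
Proof.
move=> rr0; rewrite /heat_fun -[X in X * _]gtr0_norm ?weight_gt0// -normrM.
rewrite -RintegralZl//; last exact: integrable_heat_integrand.
have -> : heat_const r0 ^+ k * gauss_moment k * wnorm k n u =
    \int[gam]_y (heat_const r0 ^+ k * wnorm k n u * (1 + `|y|) ^+ k).
  by rewrite (RintZ (integrable_gauss_moment k)) [RHS]mulrAC.
apply: le_normr_Rintegral_dominated => //.
- by apply: measurable_funM => //; exact: measurable_heat_integrand.
- move=> y _; rewrite normrM gtr0_norm ?weight_gt0//. have [_ h2] := heat_shift_le y rr0.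
  apply: (@le_trans _ _ ((1 + `|x + heat_shift r y|) ^+ k * (1 + `|heat_shift r y|) ^+ k *
     `|derive1n n u (x + heat_shift r y)|)).
    by rewrite ler_wpM2r// weight_shift.
  rewrite mulrAC; apply: (@le_trans _ _ (wnorm k n u * (1 + `|heat_shift r y|) ^+ k)).
    by rewrite ler_wpM2r ?exprn_ge0 ?addr_ge0// wnorm_ub.
  rewrite -[leRHS]mulrA mulrCA ler_wpM2l ?wnorm_ge0// -exprMn lerXn2r// nnegrE ?addr_ge0//.
  exact: le_trans (addr_ge0 ler01 (normr_ge0 _)) h2.
- by have := intZ (heat_const r0 ^+ k * wnorm k n u) (integrable_gauss_moment k).
Qed.

Lemma heat_fun_taylor r u n x h : `|heat_fun r u n (x + h) - heat_fun r u n x - h * heat_fun r u n.+1 x| <=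
  wnorm 0 n.+2 u * h ^+ 2.
Proof.
have i0 := integrable_heat_integrand u n r (x + h). have i1 := integrable_heat_integrand u n r x.
have i2 := integrable_heat_integrand u n.+1 r x. have i3 := intB i0 i1. have i4 := intZ h i2.
rewrite /heat_fun -(RintegralZl h measurableT i2) -(RintB i0 i1).
rewrite -(RintB i3 i4). rewrite -[leRHS](Rintegral_probability_cst (gam : probability _ R)).
apply: le_normr_Rintegral_dominated => //.
- by apply/measurable_EFinP; have := measurable_int _ (intB i3 i4).
- move=> y _; have -> : x + h + heat_shift r y = x + heat_shift r y + h by ring.
  apply: (@taylor1_le R (derive1n n u) (derive1n n.+1 u) (derive1n n.+2 u)).
  + by move=> z; exact: is_derive_schwartz.
  + by move=> z; exact: is_derive_schwartz.
  + by move=> z _; exact: wnorm0_ub.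
- by apply: (integrable_bounded gam `|wnorm 0 n.+2 u * h ^+ 2|).
Qed.

Lemma heat_fun_schwartz r u : 0 <= r ->
  is_schwartz (heat_fun r u 0) /\ forall n, derive1n n (heat_fun r u 0) = heat_fun r u n.
Proof.
move=> r0; apply: (@taylor_chain_schwartz _ (heat_fun r u)).
  exact: heat_fun_taylor.
by move=> k n x; apply: (@heat_fun_wbound r); rewrite r0 lexx.
Qed.

(** The semigroup of the operator 1/2 Laplacian - v gradient. The value u at negative times is a convention. *)
Definition heat r u : schwartz R := match pselect (0 <= r) with
  | left r0 => Schwartz (asboolT (heat_fun_schwartz u r0).1) | right _ => u end.

Lemma heatE r u n x : 0 <= r -> derive1n n (heat r u) x = heat_fun r u n x.
Proof.
move=> r0; rewrite /heat; case: pselect => // r0'. by rewrite (heat_fun_schwartz u r0').2.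
Qed.

Lemma wnorm_heat r0 r u k n : 0 <= r <= r0 -> wnorm k n (heat r u) <= heat_const r0 ^+ k * gauss_moment k * wnorm k n u.
Proof.
move=> rr0; apply: wnorm_le => x; rewrite heatE; last by case/andP : rr0. exact: heat_fun_wbound.
Qed.

Lemma heat_sgrad r u : 0 <= r -> sgrad (heat r u) = heat r (sgrad u).
Proof.
move=> r0; apply: schwartz_eqP => x.
rewrite -[LHS]/(derive1n 0 (sgrad (heat r u)) x) -[RHS]/(derive1n 0 (heat r (sgrad u)) x).
by rewrite derive1n_sgrad !heatE.
Qed.

Lemma heat_slap r u : 0 <= r -> slap (heat r u) = heat r (slap u).
Proof. by move=> r0; rewrite /slap !heat_sgrad. Qed.

Lemma heat_lin r (a : R) u w : 0 <= r -> heat r (a *: u + w) = a *: heat r u + heat r w.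
Proof.
move=> r0; apply: schwartz_eqP => x. rewrite schwartz_linE -[LHS]/(derive1n 0 (heat r (a *: u + w)) x).
rewrite -[heat r u x]/(derive1n 0 (heat r u) x) -[heat r w x]/(derive1n 0 (heat r w) x). rewrite !heatE// /heat_fun.
have i1 := integrable_heat_integrand u 0 r x. have i2 := integrable_heat_integrand w 0 r x.
rewrite -(RintegralZl a measurableT i1) -RintegralD//. by have := intZ a i1.
Qed.

Lemma heatZ r (a : R) u : 0 <= r -> heat r (a *: u) = a *: heat r u.
Proof.
move=> r0; have z : heat r 0 = 0.
  have := heat_lin 1 0 0 r0; rewrite scale1r addr0 scale1r => e. by apply: (addrI (heat r 0)); rewrite -e addr0.
by have := heat_lin a u 0 r0; rewrite z !addr0.
Qed.

Lemma heatB r u w : 0 <= r -> heat r (u - w) = heat r u - heat r w.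
Proof.
by move=> r0; rewrite addrC -scaleN1r heat_lin// scaleN1r addrC.
Qed.

Lemma heat0 u : heat 0 u = u.
Proof.
apply: schwartz_eqP => x; rewrite -[LHS]/(derive1n 0 (heat 0 u) x) heatE// /heat_fun.
under eq_Rintegral do rewrite /heat_shift sqrtr0 mul0r mulr0 subr0 addr0.
by rewrite (Rintegral_probability_cst (gam : probability _ R)).
Qed.

(** Independent normal variables of variances r and h have a normal sum, of variance r + h. *)
Lemma heat_heat r h u : 0 <= r -> 0 <= h -> heat r (heat h u) = heat (r + h) u.
Proof.
move=> r0 h0; apply: schwartz_eqP => x.
rewrite -[LHS]/(derive1n 0 (heat r (heat h u)) x) -[RHS]/(derive1n 0 (heat (r + h) u) x).
rewrite !heatE ?addr_ge0// /heat_fun. pose f z : R := u (x - v * (r + h) + z). have mf : measT f.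
  apply: (measurableT_comp (measurable_schwartz u 0)). exact: measurable_funD.
have := @normal_convolution R (Num.sqrt r) (Num.sqrt h) (Num.sqrt (r + h)) f (wnorm 0 0 u) _ mf _.
have e : Num.sqrt (r + h) ^+ 2 = Num.sqrt r ^+ 2 + Num.sqrt h ^+ 2.
  by rewrite !sqr_sqrtr// addr_ge0.
move=> /(_ e (fun z => wnorm0_ub 0 u _)) H.
transitivity (\int[gam]_y0 \int[gam]_y f (Num.sqrt r * y0 + Num.sqrt h * y)).
  apply: eq_Rintegral => y _. rewrite heatE//; apply: eq_Rintegral => z _.
  by rewrite /f /heat_shift /=; congr (schwartz_fun u _); ring.
rewrite H; apply: eq_Rintegral => y _. by rewrite /f /heat_shift /=; congr (schwartz_fun u _); ring.
Qed.

Definition gen u : schwartz R := (1 / 2) *: slap u - v *: sgrad u.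

Lemma derive1n_gen u n x : derive1n n (gen u) x = 1 / 2 * derive1n n.+2 u x - v * derive1n n.+1 u x.
Proof. by rewrite derive1n_schwartzB !derive1n_schwartzZ derive1n_slap derive1n_sgrad. Qed.

Lemma heat_gen r u : 0 <= r -> gen (heat r u) = heat r (gen u).
Proof.
by move=> r0; rewrite /gen heatB// !heatZ// heat_slap// heat_sgrad//.
Qed.

Lemma gauss_mean : \int[gam]_y y = 0.
Proof.
have n1 : (1 : R) != 0 by []. have b1 (x : R) : `|(1 : R)| <= 1 by rewrite normr1.
have b0 (x : R) : `|(0 : R)| <= 1 by rewrite normr0. have := @normal_by_parts R 0 1 n1 (fun=> 1) (fun=> 0) 1
  (fun x => is_derive_cst (1 : R) x 1) (fun x => cvg_cst (0 : R)) b1 b0.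
rewrite Rintegral_cst// mul0r mulr0 => h.
transitivity (\int[gam]_y ((y - 0) * 1)); last by apply: h => x; exact: nbhs_filter.
by apply: eq_Rintegral => y _; rewrite /= subr0 mulr1.
Qed.

Lemma gauss_second_moment : L1 gam (fun y : R => y ^+ 2) /\ \int[gam]_y (y ^+ 2) = 1.
Proof.
have G : centered_gaussian (gam : probability (measurableTypeR R) R) (fun y => y) 1.
  apply/centered_gaussianP; split=> // B mB; by rewrite oner_eq0 sqrtr1.
exact: centered_gaussian_variance G.
Qed.

Lemma weighted_sup_near k n u (x z y : R) : `|y - x| <= `|z| ->
  `|derive1n n u y| <= wnorm k n u * (1 + `|z|) ^+ k / (1 + `|x|) ^+ k.
Proof.
move=> yx; rewrite ler_pdivlMr ?weight_gt0//. have h1 := weight_shift k x (y - x); rewrite subrKC in h1.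
apply: (@le_trans _ _ (`|derive1n n u y| * ((1 + `|y|) ^+ k * (1 + `|y - x|) ^+ k))).
  by rewrite ler_wpM2l.
rewrite mulrA (mulrC _ ((1 + `|y|) ^+ k)); apply: ler_pM.
- by rewrite mulr_ge0// exprn_ge0// addr_ge0.
- by rewrite exprn_ge0// addr_ge0.
- exact: wnorm_ub.
- by rewrite lerXn2r ?nnegrE ?addr_ge0// lerD2l.
Qed.

Lemma wnorm_heat_sub r0 r u k n : 0 <= r <= r0 -> wnorm k n (heat r u - u) <=
  heat_const r0 ^+ k.+1 * gauss_moment k.+1 * Num.sqrt r * wnorm k n.+1 u.
Proof.
move=> rr0; have r_ge0 : 0 <= r by case/andP : rr0.
apply: wnorm_le => x; rewrite derive1n_schwartzB heatE// /heat_fun. have i0 := integrable_heat_integrand u n r x.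
have i1 : L1 gam (fun=> derive1n n u x).
  by apply: (integrable_bounded gam `|derive1n n u x|).
have i2 := intB i0 i1. rewrite -[derive1n n u x](Rintegral_probability_cst (gam : probability _ R)).
rewrite -(RintB i0 i1) -[X in X * _]gtr0_norm ?weight_gt0// -normrM.
rewrite -(RintZ i2). pose K := heat_const r0 ^+ k.+1 * Num.sqrt r * wnorm k n.+1 u.
have -> : heat_const r0 ^+ k.+1 * gauss_moment k.+1 * Num.sqrt r * wnorm k n.+1 u =
    \int[gam]_y (K * (1 + `|y|) ^+ k.+1).
  rewrite (RintZ (integrable_gauss_moment k.+1)) /K /gauss_moment; ring.
apply: le_normr_Rintegral_dominated => //.
- by apply/measurable_EFinP; have := measurable_int _ (intZ ((1 + `|x|) ^+ k) i2).
- move=> y _; rewrite normrM gtr0_norm ?weight_gt0//.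
  have [h1 h2] := heat_shift_le y rr0; set z := heat_shift r y in h1 h2 *.
  have := @MVT_le R (derive1n n u) (derive1n n.+1 u) (wnorm k n.+1 u * (1 + `|z|) ^+ k / (1 + `|x|) ^+ k) x z
    (is_derive_schwartz u n) (fun y => @weighted_sup_near k n.+1 u x z y).
  rewrite mulrAC ler_pdivlMr ?weight_gt0// mulrC => /le_trans; apply. rewrite /K -!mulrA [leRHS]mulrC -!mulrA.
  have c0 : 0 <= heat_const r0 by rewrite mulr_ge0 ?addr_ge0 ?mulr_ge0 ?sqrtr_ge0.
  rewrite (mulrC (Num.sqrt r)) -!mulrA ler_wpM2l ?wnorm_ge0//.
  apply: (@le_trans _ _ ((heat_const r0 * (1 + `|y|)) ^+ k * (heat_const r0 * Num.sqrt r * (1 + `|y|)))).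
    apply: ler_pM => //. by rewrite lerXn2r ?nnegrE ?addr_ge0// mulr_ge0// addr_ge0.
  rewrite le_eqVlt; apply/orP; left; apply/eqP. by rewrite exprMn !exprS; ring.
- by have := intZ K (integrable_gauss_moment k.+1).
Qed.

Lemma cross_sum_le (a b s w z : R) : 0 <= a -> 0 <= b -> 0 <= s -> 0 <= w -> 0 <= z ->
  a * s * z + b * s * w <= (a + b) * s * (w + z).
Proof.
move=> a0 b0 s0 w0 z0; rewrite -subr_ge0.
have -> : (a + b) * s * (w + z) - (a * s * z + b * s * w) = a * s * w + b * s * z by ring.
by apply: addr_ge0; apply: mulr_ge0 => //; exact: mulr_ge0.
Qed.

(** Taylor expansion of order 2: the displacement has mean - v r and second moment r + (v r)^2, and its third
    moment is of order r sqrt r. *)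
Lemma wnorm_heat_step r0 k n : exists A, 0 <= A /\ forall r u, 0 <= r <= r0 ->
  wnorm k n (heat r u - u - r *: gen u) <= A * (r * Num.sqrt r) * (wnorm k n.+2 u + wnorm k n.+3 u).
Proof.
have c0 : 0 <= heat_const r0 by rewrite mulr_ge0 ?addr_ge0 ?mulr_ge0 ?sqrtr_ge0.
pose A1 := heat_const r0 ^+ (k + 3) * gauss_moment (k + 3). have A10 : 0 <= A1.
  by rewrite mulr_ge0 ?exprn_ge0// Rintegral_ge0.
pose A2 := v ^+ 2 / 2 * Num.sqrt r0. have A20 : 0 <= A2 by rewrite mulr_ge0 ?sqrtr_ge0// divr_ge0// sqr_ge0.
exists (A1 + A2); split; first exact: addr_ge0. move=> r u rr0; have r_ge0 : 0 <= r by case/andP : rr0.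
have sr : Num.sqrt r <= Num.sqrt r0.
  by have /andP[_ ?] := rr0; rewrite ler_sqrt// (le_trans r_ge0).
have srr : Num.sqrt r ^+ 2 = r by rewrite sqr_sqrtr. have s0 := sqrtr_ge0 r. apply: wnorm_le => x.
rewrite !derive1n_schwartzB derive1n_schwartzZ derive1n_gen heatE// /heat_fun.
set f := derive1n n u; set f1 := derive1n n.+1 u; set f2 := derive1n n.+2 u. pose z := heat_shift r.
have i0 := integrable_heat_integrand u n r x; rewrite -/f in i0 *. have icst (c : R) : L1 gam (fun=> c).
  by apply: (integrable_bounded gam `|c|).
have [iy2 y2] := gauss_second_moment. have iy : L1 gam (fun y : R => y).
  apply: (integrable_dominated gam (fun y => (1 + `|y|) ^+ 1)) => //.
    by move=> y _; rewrite expr1 lerDr.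
  exact: integrable_gauss_moment.
have isy := intZ (Num.sqrt r) iy. have iz : L1 gam z.
  by have := intB isy (icst (v * r)).
have zI : \int[gam]_y z y = - (v * r).
  rewrite /z /heat_shift (RintB isy (icst (v * r))). rewrite (RintZ iy) gauss_mean mulr0 sub0r.
  by rewrite (Rintegral_probability_cst (gam : probability _ R)).
have z2E y : z y ^+ 2 = r * y ^+ 2 - (2 * (v * r) * Num.sqrt r * y - (v * r) ^+ 2).
  have -> : r * y ^+ 2 = Num.sqrt r ^+ 2 * y ^+ 2 by rewrite srr. by rewrite /z /heat_shift; ring.
have iry2 := intZ r iy2. have icy := intZ (2 * (v * r) * Num.sqrt r) iy.
have icy' := intB icy (icst ((v * r) ^+ 2)). have iz2 : L1 gam (fun y => z y ^+ 2).
  have := intB iry2 icy'. by apply: eq_integrable => // y _ /=; rewrite z2E.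
have z2I : \int[gam]_y (z y ^+ 2) = r + (v * r) ^+ 2.
  under eq_Rintegral do rewrite z2E. rewrite (RintB iry2 icy') (RintB icy (icst _)).
  rewrite (RintZ iy2) (RintZ iy) y2 gauss_mean.
  by rewrite (Rintegral_probability_cst (gam : probability _ R)) mulr0 sub0r opprK mulr1.
have j1 := intB i0 (icst (f x)). have iz1 := integrableZr measurableT (f1 x) iz.
have iz2' := integrableZr measurableT (f2 x / 2) iz2. have j2 := intB j1 iz1. have j3 := intB j2 iz2'.
pose D := \int[gam]_y (f (x + z y) - f x - z y * f1 x - z y ^+ 2 * (f2 x / 2)).
have DE : D = \int[gam]_y f (x + z y) - f x + v * r * f1 x - (r + (v * r) ^+ 2) * (f2 x / 2).
  rewrite /D (RintB j2 iz2') (RintB j1 iz1). rewrite (RintB i0 (icst (f x))).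
  rewrite (RintegralZr _ measurableT iz) (RintegralZr _ measurableT iz2) zI z2I.
  by rewrite (Rintegral_probability_cst (gam : probability _ R)) mulNr opprK.
have -> : \int[gam]_y f (x + heat_shift r y) - f x - r * (1 / 2 * f2 x - v * f1 x) = D + (v * r) ^+ 2 * (f2 x / 2).
  by rewrite DE; field.
apply: (le_trans (ler_wpM2l _ (ler_normD _ _))); first exact/ltW/weight_gt0. rewrite mulrDr.
have B2 : (1 + `|x|) ^+ k * `|(v * r) ^+ 2 * (f2 x / 2)| <= A2 * (r * Num.sqrt r) * wnorm k n.+2 u.
  have -> : (v * r) ^+ 2 * (f2 x / 2) = v ^+ 2 / 2 * r ^+ 2 * f2 x by field.
  rewrite normrM ger0_norm; last by rewrite mulr_ge0 ?sqr_ge0// divr_ge0 ?sqr_ge0. rewrite mulrCA; apply: ler_pM.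
  - by rewrite mulr_ge0 ?sqr_ge0// divr_ge0 ?sqr_ge0.
  - by rewrite mulr_ge0// exprn_ge0// addr_ge0.
  - rewrite /A2 -[leRHS]mulrA; apply: ler_wpM2l.
      by rewrite divr_ge0 ?sqr_ge0.
    have -> : r ^+ 2 = Num.sqrt r * (r * Num.sqrt r).
      by rewrite mulrCA -expr2 srr -expr2.
    by rewrite ler_wpM2r// mulr_ge0.
  - exact: wnorm_ub.
have B1 : (1 + `|x|) ^+ k * `|D| <= A1 * (r * Num.sqrt r) * wnorm k n.+3 u.
  pose G y := f (x + z y) - f x - z y * f1 x - z y ^+ 2 * (f2 x / 2). have j3' : L1 gam G by exact: j3.
  have -> : (1 + `|x|) ^+ k * `|D| = `|\int[gam]_y ((1 + `|x|) ^+ k * G y)|.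
    by rewrite (RintZ j3') normrM (gtr0_norm (weight_gt0 k x)).
  pose K := heat_const r0 ^+ (k + 3) * (r * Num.sqrt r) * wnorm k n.+3 u.
  have -> : A1 * (r * Num.sqrt r) * wnorm k n.+3 u = \int[gam]_y (K * (1 + `|y|) ^+ (k + 3)).
    rewrite (RintZ (integrable_gauss_moment (k + 3))) /K /A1 /gauss_moment; ring.
  apply: le_normr_Rintegral_dominated => //.
  - by apply/measurable_EFinP; have := measurable_int _ (intZ ((1 + `|x|) ^+ k) j3').
  - move=> y _; rewrite normrM gtr0_norm ?weight_gt0//. have [h1 h2] := heat_shift_le y rr0; rewrite -/(z y) in h1 h2.
    have := @taylor2_le R f f1 f2 (derive1n n.+3 u) (wnorm k n.+3 u * (1 + `|z y|) ^+ k / (1 + `|x|) ^+ k) x (z y)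
      (is_derive_schwartz u n) (is_derive_schwartz u n.+1) (is_derive_schwartz u n.+2)
      (fun y' => @weighted_sup_near k n.+3 u x (z y) y').
    have -> : z y ^+ 2 / 2 * f2 x = z y ^+ 2 * (f2 x / 2) by field.
    move=> H0; apply: (@le_trans _ _ (wnorm k n.+3 u * (1 + `|z y|) ^+ k * `|z y| ^+ 3)).
      rewrite mulrC -ler_pdivlMr ?weight_gt0//; apply: le_trans H0 _. by rewrite mulrAC.
    apply: (@le_trans _ _ (wnorm k n.+3 u * (heat_const r0 * (1 + `|y|)) ^+ k *
        (heat_const r0 * Num.sqrt r * (1 + `|y|)) ^+ 3)).
      apply: ler_pM.
      + by rewrite mulr_ge0 ?wnorm_ge0// exprn_ge0// addr_ge0.
      + by rewrite exprn_ge0.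
      + rewrite ler_wpM2l ?wnorm_ge0//. by rewrite lerXn2r ?nnegrE ?addr_ge0// mulr_ge0// addr_ge0.
      + by rewrite lerXn2r ?nnegrE ?mulr_ge0// ?addr_ge0// mulr_ge0.
    rewrite le_eqVlt; apply/orP; left; apply/eqP.
    have rE : r * Num.sqrt r = Num.sqrt r ^+ 3 by rewrite -{1}srr -exprSr. by rewrite /K rE !exprMn !exprD; ring.
  - by have := intZ K (integrable_gauss_moment (k + 3)).
have rs : 0 <= r * Num.sqrt r by exact: mulr_ge0. apply: (le_trans (lerD B1 B2)).
exact: (cross_sum_le A10 A20 rs (wnorm_ge0 _ _ _) (wnorm_ge0 _ _ _)).
Qed.

End heat_semigroup.

(** * Inner product and dissipation of energy *)

Section schwartz_inner_product.
Context {R : realType}.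
Implicit Types (u w : schwartz R) (k n : nat).
Local Notation mu := (@lebesgue_measure R).

Definition ip u w : R := \int[mu]_x (u x * w x).

Let q (x : R) := (1 + x ^+ 2)^-1.

Let q_ge0 (x : R) : 0 <= q x.
Proof. by rewrite invr_ge0 addr_ge0// sqr_ge0. Qed.

Let continuous_q : continuous q.
Proof.
move=> x; apply: cvgV; first by rewrite gt_eqF// ltr_pwDl// sqr_ge0.
by apply: cvgD; [exact: cvg_cst|exact: sqr_continuous].
Qed.

Lemma integrable_inv_oneDsqr : L1 mu q /\ \int[mu]_x q x <= pi.
Proof.
have mq : measT q by exact: continuous_measurable_fun. pose qn (n : nat) := q \_ `[- n.+1%:R, n.+1%:R].
have Iq n : mu.-integrable `[- n.+1%:R, n.+1%:R] (EFin \o q).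
  apply: continuous_compact_integrable; first exact: segment_compact. exact: continuous_subspaceT.
have Iqn n : L1 mu (qn n).
  rewrite -restrict_EFin; apply/integrable_restrict => //=. by rewrite setTI.
apply: (@Rintegral_fatou _ _ _ mu setT qn q pi measurableT) => //.
- by move=> n; apply/measurable_EFinP; exact: measurable_int (Iqn n).
- by move=> n x _; rewrite /qn patchE; case: ifP.
- move=> n; rewrite /qn -Rintegral_mkcond /Rintegral. rewrite (@continuous_FTC2 _ q (@atan R)).
  + rewrite /= atanN opprK; have := atan_ltpi2 (n.+1%:R : R); lra.
  + by rewrite -subr_gt0 opprK -mulr2n mulrn_wgt0.
  + exact: continuous_subspaceT.
  + split=> [x _||].
    * by have := is_derive1_atan x; case.
    * by apply: cvg_at_right_filter; exact: continuous_atan.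
    * by apply: cvg_at_left_filter; exact: continuous_atan.
  + by move=> x _; rewrite (is_derive_derive1 (is_derive1_atan x)).
- move=> x _; apply: cvg_near_cst. have := nbhs_infty_ger `|x|; apply: filterS => n xn.
  rewrite /qn patchE mem_set//= in_itv/= -ler_norml (le_trans xn)//. by rewrite ler_nat.
Qed.

Lemma product_weight_le u w i j (x : R) : `|derive1n i u x * derive1n j w x| <= wnorm 2 i u * wnorm 0 j w * q x.
Proof.
rewrite normrM mulrAC; apply: ler_pM => //; last exact: wnorm0_ub.
rewrite ler_pdivlMr; last by rewrite ltr_pwDl// sqr_ge0. apply: le_trans (wnorm_ub 2 i u x); rewrite mulrC ler_wpM2r//.
have -> : x ^+ 2 = `|x| ^+ 2 by rewrite -normrX ger0_norm ?sqr_ge0.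
by rewrite sqrrD expr1n mul1r addrAC lerDl mulrn_wge0.
Qed.

Lemma integrable_schwartz_product u w i j : L1 mu (fun x => derive1n i u x * derive1n j w x).
Proof.
have [iq _] := integrable_inv_oneDsqr.
apply: (integrable_dominated mu (fun x => wnorm 2 i u * wnorm 0 j w * q x)) => //.
- by apply: measurable_funM; exact: measurable_schwartz.
- by move=> x _; exact: product_weight_le.
- by have := intZ (wnorm 2 i u * wnorm 0 j w) iq.
Qed.

Lemma ip_le u w : `|ip u w| <= wnorm 2 0 u * wnorm 0 0 w * pi.
Proof.
have [iq qpi] := integrable_inv_oneDsqr. apply: (@le_trans _ _ (\int[mu]_x (wnorm 2 0 u * wnorm 0 0 w * q x))).
  apply: le_normr_Rintegral_dominated => //.
  - by apply: measurable_funM; [exact: (measurable_schwartz u 0)|exact: (measurable_schwartz w 0)].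
  - by move=> x _; exact: (product_weight_le u w 0 0).
  - by have := intZ (wnorm 2 0 u * wnorm 0 0 w) iq.
rewrite (RintZ iq) ler_wpM2l// mulr_ge0 ?wnorm_ge0//.
Qed.

Lemma ipC u w : ip u w = ip w u.
Proof. by apply: eq_Rintegral => x _; rewrite mulrC. Qed.

Lemma ip_linl (a : R) u1 u2 w : ip (a *: u1 + u2) w = a * ip u1 w + ip u2 w.
Proof.
have i1 := integrable_schwartz_product u1 w 0 0. have i2 := integrable_schwartz_product u2 w 0 0.
have i3 := intZ a i1. rewrite /ip -(RintegralZl a measurableT i1) -(RintD i3 i2).
by apply: eq_Rintegral => x _; rewrite schwartz_linE mulrDl mulrA.
Qed.

Lemma ipZl (a : R) u w : ip (a *: u) w = a * ip u w.
Proof.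
have := ip_linl a u 0 w; rewrite addr0 => ->. rewrite [X in _ + X](_ : _ = 0) ?addr0//.
by have := ip_linl (-1) w w w; rewrite scaleN1r addNr => ->; rewrite mulN1r addNr.
Qed.

Lemma ipDl u1 u2 w : ip (u1 + u2) w = ip u1 w + ip u2 w.
Proof. by have := ip_linl 1 u1 u2 w; rewrite scale1r mul1r. Qed.

Lemma ipNl u w : ip (- u) w = - ip u w.
Proof. by rewrite -scaleN1r ipZl mulN1r. Qed.

Lemma ipDr u w1 w2 : ip u (w1 + w2) = ip u w1 + ip u w2.
Proof. by rewrite ipC ipDl !(ipC u). Qed.

Lemma ipZr (a : R) u w : ip u (a *: w) = a * ip u w.
Proof. by rewrite ipC ipZl (ipC u). Qed.

Lemma ipNr u w : ip u (- w) = - ip u w.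
Proof. by rewrite ipC ipNl (ipC u). Qed.

Lemma ip_ge0 u : 0 <= ip u u.
Proof. by apply: Rintegral_ge0 => x _; rewrite -expr2 sqr_ge0. Qed.

Lemma L2sq_ip u : L2sq u = ip u u.
Proof. by apply: eq_Rintegral => x _; rewrite expr2. Qed.

Lemma schwartz_cvg0 u w (e : R) : `|e| = 1 -> u (e * n%:R) * w (e * n%:R) @[n --> \oo] --> 0.
Proof.
move=> e1; apply: (cvg_dist_le (fun n => wnorm 1 0 u * wnorm 0 0 w * n.+1%:R^-1)).
  move=> n; rewrite subr0 normrM mulrAC; apply: ler_pM => //; last exact: (wnorm0_ub 0 w).
  rewrite ler_pdivlMr// mulrC; have := wnorm_ub 1 0 u (e * n%:R).
  by rewrite expr1 normrM e1 mul1r ger0_norm// addrC natr1.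
apply: (cvg_eqr (wnorm 1 0 u * wnorm 0 0 w * 0)); last by rewrite mulr0.
by apply: cvgM; [exact: cvg_cst|exact: cvg_harmonic].
Qed.

Lemma ip_by_parts u w : ip (sgrad u) w = - ip u (sgrad w).
Proof.
have i1 := integrable_schwartz_product u w 1 0. have i2 := integrable_schwartz_product u w 0 1.
pose F' x := derive1n 1 u x * w x + u x * derive1n 1 w x. have iF : L1 mu F' by have := intD i1 i2.
have dF (x : R) : is_derive x 1 (fun x => u x * w x) (F' x).
  exact: is_derive_funM (is_derive_schwartz u 0 x) (is_derive_schwartz w 0 x).
have cF : continuous F'.
  move=> x; exact: (cvgD (cvgM (@continuous_schwartz _ u 1 x) (@continuous_schwartz _ w 0 x))
    (cvgM (@continuous_schwartz _ u 0 x) (@continuous_schwartz _ w 1 x))).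
have := Rintegral_derive_eq0 dF cF iF. rewrite /F' (RintD i1 i2) => h.
apply/eqP; rewrite -addr_eq0; apply/eqP; apply: h.
  by have := schwartz_cvg0 u w (normr1 R); under eq_cvg do rewrite mul1r.
by have := schwartz_cvg0 u w (normrN1 R); under eq_cvg do rewrite mulN1r.
Qed.

Variable v : R.

(** The drift does not contribute, since <grad u, u> = 0. *)
Lemma ip_gen u : 2 * ip (gen v u) u = - ip (sgrad u) (sgrad u).
Proof.
rewrite /gen ipDl ipNl !ipZl /slap.
have -> : ip (sgrad (sgrad u)) u = - ip (sgrad u) (sgrad u) by rewrite ip_by_parts. have : ip (sgrad u) u = 0.
  have := ip_by_parts u u; rewrite (ipC u) => /eqP. by rewrite -subr_eq0 opprK -mulr2n mulrn_eq0 => /eqP.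
by move=> ->; field.
Qed.

Lemma ip_energy_expand u w g (r e : R) : e = - (2 * ip g u) ->
  ip w w - ip u u + r * e = r * ip g (w - u) + ip (w - u - r *: g) (w + u).
Proof.
move=> ->; rewrite !(ipDl, ipDr, ipNl, ipNr, ipZl) (ipC u w).
move: (ip w w) (ip u u) (ip w u) (ip g w) (ip g u) => a1 a2 a3 a4 a5. by ring.
Qed.

(** Expansion of S_r u to first order together with [ip_gen]. The constant depends on finitely many weighted
    norms of u only, so that it is the same all along the semigroup. *)
Lemma energy_step (r0 B : R) : exists C, 0 <= C /\ forall r u, 0 <= r <= r0 ->
  (forall k n, (k <= 2)%N -> (n <= 5)%N -> wnorm k n u <= B) ->
  `|ip (heat v r u) (heat v r u) - ip u u + r * ip (sgrad u) (sgrad u)| <= C * (r * Num.sqrt r).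
Proof.
have [A [A0 step]] := wnorm_heat_step v r0 2 0. pose c k := heat_const v r0 ^+ k * gauss_moment k.
have hc0 : 0 <= heat_const v r0 by rewrite mulr_ge0 ?addr_ge0 ?mulr_ge0 ?sqrtr_ge0.
have c0 k : 0 <= c k by rewrite mulr_ge0 ?exprn_ge0// Rintegral_ge0. pose B' : R := `|B|.
have B0 : 0 <= B' by exact: normr_ge0. pose G : R := B' + `|v| * B'. have G0 : 0 <= G by rewrite addr_ge0// mulr_ge0.
exists (G * (c 1%N * B') * pi + A * (B' + B') * (c 0%N * B' + B') * pi); split.
  by repeat first [assumption | exact: pi_ge0 | exact: c0 | apply: mulr_ge0 | apply: addr_ge0].
move=> r u rr0 uB; have r_ge0 : 0 <= r by case/andP : rr0.
have {}uB k n : (k <= 2)%N -> (n <= 5)%N -> wnorm k n u <= B'.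
  by move=> k2 n5; rewrite (le_trans (uB _ _ k2 n5))// ler_norm.
set S := heat v r u. pose rho := S - u - r *: gen v u. have rs0 : 0 <= r * Num.sqrt r by rewrite mulr_ge0 ?sqrtr_ge0.
have Grho : wnorm 2 0 rho <= A * (B' + B') * (r * Num.sqrt r).
  rewrite mulrAC; apply: (le_trans (step r u rr0)). by rewrite ler_wpM2l ?mulr_ge0// lerD// uB.
have Sd : wnorm 0 0 (S - u) <= c 1%N * Num.sqrt r * B'.
  apply: (le_trans (wnorm_heat_sub v u 0 0 rr0)). by rewrite ler_wpM2l ?uB// mulr_ge0 ?sqrtr_ge0//; exact: c0.
have Gg : wnorm 2 0 (gen v u) <= G.
  rewrite /gen (le_trans (wnormD _ _ _ _))// -scaleNr.
  have h1 := wnormZ 2 0 (1 / 2) (slap u); have h2 := wnormZ 2 0 (- v) (sgrad u).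
  rewrite normrN in h2; rewrite ger0_norm ?divr_ge0// in h1. rewrite wnorm_slap in h1; rewrite wnorm_sgrad in h2.
  have u2 : wnorm 2 2 u <= B' by exact: uB. have u1 : wnorm 2 1 u <= B' by exact: uB.
  apply: (le_trans (lerD h1 h2)); apply: lerD; last exact: ler_wpM2l.
  apply: le_trans u2; apply: ler_piMl; first exact: wnorm_ge0. by rewrite ler_pdivrMr// mul1r ler1n.
have SS : wnorm 0 0 (S + u) <= c 0%N * B' + B'.
  apply: (le_trans (wnormD _ _ _ _)); apply: lerD; last exact: uB. apply: (le_trans (wnorm_heat v u 0 0 rr0)).
  by rewrite ler_wpM2l ?uB//; exact: c0.
have -> : ip S S - ip u u + r * ip (sgrad u) (sgrad u) = r * ip (gen v u) (S - u) + ip rho (S + u).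
  by apply: ip_energy_expand; rewrite ip_gen opprK.
apply: (le_trans (ler_normD _ _)); rewrite mulrDl; apply: lerD.
  rewrite normrM (ger0_norm r_ge0). apply: (@le_trans _ _ (r * (G * (c 1%N * Num.sqrt r * B') * pi))).
    rewrite ler_wpM2l//; apply: (le_trans (ip_le _ _)). by rewrite ler_wpM2r ?pi_ge0// ler_pM ?wnorm_ge0.
  by rewrite le_eqVlt; apply/orP; left; apply/eqP; ring.
apply: (le_trans (ip_le _ _)). have -> : A * (B' + B') * (c 0%N * B' + B') * pi * (r * Num.sqrt r) =
   A * (B' + B') * (r * Num.sqrt r) * (c 0%N * B' + B') * pi by ring.
by rewrite ler_wpM2r ?pi_ge0// ler_pM ?wnorm_ge0.
Qed.

End schwartz_inner_product.

(** * Topology of the Schwartz space and uniform boundedness *)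

Section schwartz_topology.
Context {R : realType}.
Implicit Types (u w : schwartz R) (k n : nat).

Lemma initial_cvg {S : choiceType} {T : topologicalType} {I : Type} (f : S -> T)
    (F : set_system I) (g : I -> S) (s : S) : Filter F ->
  f (g i) @[i --> F] --> f s -> g i @[i --> F] --> (s : initial_topology f).
Proof.
move=> FF h A; rewrite nbhsE => -[B [[C oC CB] Bs] BA].
have : nbhs (f s) C by apply: open_nbhs_nbhs; split => //; rewrite -CB in Bs.
move=> /h; apply: (@filterS _ F FF) => i Ci; apply: BA. by rewrite -CB.
Qed.

Lemma schwartz_cvg (f_ : nat -> schwartz R) u : (forall k n, wnorm k n (f_ m - u) @[m --> \oo] --> 0) ->
  f_ m @[m --> \oo] --> u.
Proof.
move=> h; apply: initial_cvg; apply/cvg_sup => -[k n]. apply: initial_cvg; move=> A /uniform_nbhs [E [[e /= e0 eE] EA]].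
have := h k n; move/cvgr0Pnorm_le => /(_ (e / 2) (divr_gt0 e0 (ltr0Sn _ 1))).
apply: filterS => m hm; apply: EA => x _; apply: eE => /=. rewrite /schwartz_seminorms /= distrC -mulrBr.
have -> : derive1n n (f_ m) x - derive1n n u x = derive1n n (f_ m - u) x.
  by rewrite derive1n_schwartzB.
apply: (@le_lt_trans _ _ (e / 2)); last by rewrite ltr_pdivrMr// ltr_pMr// ltr1n.
apply: le_trans hm; rewrite (ger0_norm (wnorm_ge0 _ _ _)).
apply: le_trans (wnorm_ub k n _ x); rewrite normrM ler_wpM2r// normrX. by rewrite lerXn2r ?nnegrE ?addr_ge0// lerDr.
Qed.

Lemma pairing_cvg (L : tempered R) (f_ : nat -> schwartz R) u :
  (forall k n, wnorm k n (f_ m - u) @[m --> \oo] --> 0) -> L (f_ m) @[m --> \oo] --> L u.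
Proof.
by move=> /schwartz_cvg h; apply: (cvg_comp _ _ h); exact: pairing_continuous.
Qed.

Lemma tempered_eval_continuous u : continuous (fun L : tempered R => L u).
Proof.
move=> L; apply: (@continuous_comp _ _ _ (fun L : tempered R => (L : schwartz R -> R) : {ptws schwartz R -> R}) (fun f => f u)).
  exact: initial_continuous.
exact: (@proj_continuous (schwartz R) (fun=> R) u).
Qed.

(** Completeness, in the form used by the gliding hump below; [taylor_chain_schwartz] identifies the limits of
    the derivatives. *)
Lemma schwartz_series (f_ : nat -> schwartz R) :
  (forall j k n, (k <= j)%N -> (n <= j)%N -> wnorm k n (f_ j) <= 2^-1 ^+ j) ->
  exists u, forall k n, wnorm k n (\sum_(j < m) f_ j - u) @[m --> \oo] --> 0.
Proof.
move=> fle. pose S m := \sum_(j < m) f_ j. have h2 j : 0 <= 2^-1 ^+ j :> R by rewrite exprn_ge0// invr_ge0.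
have SS m : S m.+1 = S m + f_ m by rewrite /S big_ord_recr.
have tail k n m l : (maxn k n <= m)%N -> wnorm k n (S (m + l)%N - S m) <= 2 * (2^-1 ^+ m - 2^-1 ^+ (m + l)).
  move=> km; elim: l => [|l IH].
    rewrite addn0 !subrr mulr0; apply: wnorm_le => x. by rewrite derive1n_schwartz0 normr0 mulr0.
  rewrite addnS SS addrAC (le_trans (wnormD _ _ _ _))//. have h : wnorm k n (f_ (m + l)%N) <= 2^-1 ^+ (m + l).
    by apply: fle; apply: leq_trans (leq_addr _ _); apply: leq_trans km; rewrite ?leq_maxl ?leq_maxr.
  apply: (le_trans (lerD IH h)); rewrite exprS. by move: (2^-1 ^+ m) (2^-1 ^+ (m + l)) => a b; lra.
have tail' k n m l : (maxn k n <= m)%N -> wnorm k n (S (m + l)%N - S m) <= 2 * 2^-1 ^+ m.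
  by move=> km; apply: (le_trans (tail k n m l km)); rewrite ler_pM2l// gerBl.
have half0 : 2 * 2^-1 ^+ m @[m --> \oo] --> (0 : R).
  apply: (cvg_eqr (2 * 0)); last by rewrite mulr0. apply: cvgM; first exact: cvg_cst.
  by apply: cvg_expr; rewrite ger0_norm ?invr_ge0// invf_lt1// ltr1n.
have ptail k n x m l : (maxn k n <= m)%N ->
    (1 + `|x|) ^+ k * `|derive1n n (S (m + l)%N) x - derive1n n (S m) x| <= 2 * 2^-1 ^+ m.
  move=> km; rewrite -derive1n_schwartzB. exact: le_trans (wnorm_ub k n _ x) (tail' k n m l km).
have gex n x : exists l : R, derive1n n (S m) x @[m --> \oo] --> l.
  have [m l nm|l gl _] := @cvg_of_tail _ (fun m => derive1n n (S m) x) (fun m => 2 * 2^-1 ^+ m) n _ half0.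
    by have := @ptail 0%N n x m l; rewrite max0n expr0 mul1r; apply.
  by exists l.
pose g n (x : R) : R := xget 0 [set l | derive1n n (S m) x @[m --> \oo] --> l].
have gcvg n x : derive1n n (S m) x @[m --> \oo] --> g n x.
  by rewrite /g; case: xgetP => [l _ //|nol]; have [l hl] := gex n x; case: (nol l).
have gtail k n x m : (maxn k n <= m)%N -> (1 + `|x|) ^+ k * `|g n x - derive1n n (S m) x| <= 2 * 2^-1 ^+ m.
  move=> km; have c : (1 + `|x|) ^+ k * `|derive1n n (S (m + l)%N) x - derive1n n (S m) x| @[l --> \oo]
      --> (1 + `|x|) ^+ k * `|g n x - derive1n n (S m) x|.
    apply: cvgM; first exact: cvg_cst. apply: cvg_norm; apply: cvgB; last exact: cvg_cst.
    exact: (@cvg_addn _ (fun l => derive1n n (S l) x)).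
  by apply: (cvg_le_lim c) => l; exact: ptail.
pose B k n := wnorm k n (S (maxn k n)) + 2 * 2^-1 ^+ (maxn k n). have gB k n x : (1 + `|x|) ^+ k * `|g n x| <= B k n.
  have -> : g n x = derive1n n (S (maxn k n)) x + (g n x - derive1n n (S (maxn k n)) x) by ring.
  apply: (le_trans (ler_wpM2l _ (ler_normD _ _))); first exact/ltW/weight_gt0. by rewrite mulrDr lerD ?wnorm_ub// gtail.
have SB n m : (n <= m)%N -> wnorm 0 n (S m) <= B 0%N n.
  move=> nm; rewrite /B max0n -(subnKC nm).
  have -> : S (n + (m - n))%N = S n + (S (n + (m - n))%N - S n) by rewrite subrKC.
  by rewrite (le_trans (wnormD _ _ _ _))// lerD2l tail'// max0n.
have gC n x h : `|g n (x + h) - g n x - h * g n.+1 x| <= B 0%N n.+2 * h ^+ 2.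
  have c : `|derive1n n (S (n.+2 + m)%N) (x + h) - derive1n n (S (n.+2 + m)%N) x - h * derive1n n.+1 (S (n.+2 + m)%N) x|
      @[m --> \oo] --> `|g n (x + h) - g n x - h * g n.+1 x|.
    apply: cvg_norm; apply: cvgB; first apply: cvgB.
    - exact: (@cvg_addn _ (fun l => derive1n n (S l) (x + h))).
    - exact: (@cvg_addn _ (fun l => derive1n n (S l) x)).
    - apply: cvgM; first exact: cvg_cst. exact: (@cvg_addn _ (fun l => derive1n n.+1 (S l) x)).
  apply: (cvg_le_lim c) => m.
  apply: (@taylor1_le R _ (derive1n n.+1 (S (n.+2 + m)%N)) (derive1n n.+2 (S (n.+2 + m)%N))).
  - by move=> y; exact: is_derive_schwartz.
  - by move=> y; exact: is_derive_schwartz.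
  - by move=> y _; rewrite (le_trans (wnorm0_ub _ _ _))// SB// leq_addr.
have [sg dg] := taylor_chain_schwartz gC gB. exists (Schwartz (asboolT sg)) => k n.
have b m : (maxn k n <= m)%N -> wnorm k n (S m - Schwartz (asboolT sg)) <= 2 * 2^-1 ^+ m.
  move=> km; apply: wnorm_le => x; rewrite derive1n_schwartzB /= dg distrC. exact: gtail.
apply/cvgr0Pnorm_le => e e0; near=> m.
rewrite ger0_norm ?wnorm_ge0// (le_trans (b m _))//; first by near: m; exists (maxn k n).
rewrite -[leLHS]ger0_norm ?mulr_ge0//. by near: m; move/cvgr0Pnorm_le : half0; apply.
Unshelve. all: by end_near. Qed.

End schwartz_topology.

(** Each index is chosen after the earlier ones, so far out that the diagonal entry exceeds the bounds of the
    earlier columns and that the entries in the earlier rows are small. *)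
Lemma gliding_hump {R : realType} (a : nat -> nat -> R) (b : nat -> R) :
  (forall i, a i N @[N --> \oo] --> 0) -> (forall N, N%:R <= a N N) ->
  exists t : nat -> nat, [/\ forall j, (j <= t j)%N, forall j, j%:R + \sum_(i < j) b (t i) <= a (t j) (t j) &
    forall i j, (i < j)%N -> `|a (t i) (t j)| <= 2^-1 ^+ j].
Proof.
move=> a0 aN. have step (l : seq nat) : exists N, [/\ (size l <= N)%N, (size l)%:R + \sum_(i <- l) b i <= a N N &
    forall i, i \in l -> `|a i N| <= 2^-1 ^+ size l].
  have e0 : 0 < 2^-1 ^+ size l :> R by rewrite exprn_gt0.
  have h : \forall N \near \oo, forall i, i \in l -> `|a i N| <= 2^-1 ^+ size l.
    move: (2^-1 ^+ size l) e0 => e e0. elim: l => [|i l IH]; first by apply: nearW.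
    move/cvgr0Pnorm_le : (a0 i) => /(_ _ e0) h2.
    by apply: filterS2 IH h2 => N h1 h2 i'; rewrite inE => /orP[/eqP->|/h1].
  have h' : \forall N \near \oo, (size l <= N)%N by exists (size l).
  have h'' := @nbhs_infty_ger R ((size l)%:R + \sum_(i <- l) b i).
  have [N [[p1 p2] p3]] := filter_ex (filterI (filterI h h') h''). by exists N; split => //; exact: le_trans p3 (aN N).
have [f fP] := choice step. pose L := fix L j := if j is j'.+1 then rcons (L j') (f (L j')) else [::].
have sL j : size (L j) = j by elim: j => // j IH; rewrite /= size_rcons IH. pose t j := f (L j).
have LE j : L j = [seq t i | i <- iota 0 j].
  elim: j => // j IH. have -> : iota 0 j.+1 = rcons (iota 0 j) j by rewrite -[j.+1]addn1 iotaD cats1 add0n.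
  by rewrite map_rcons -IH.
exists t; split=> [j|j|i j ij]; have [p1 p2 p3] := fP (L j).
- by rewrite sL in p1.
- have eS : \sum_(i <- L j) b i = \sum_(i < j) b (t i).
    by rewrite LE big_map -(big_mkord xpredT (fun i => b (t i))) /index_iota subn0.
  by move: p2; rewrite sL eS.
- by move: (p3 (t i)); rewrite sL; apply; rewrite LE map_f// mem_iota.
Qed.

Section uniform_boundedness.
Context {R : realType} {I : Type} (A : set I) (L : I -> tempered R).
Implicit Types (u : schwartz R) (k n : nat).

Definition pnorm (N : nat) u := \sum_(k < N.+1) \sum_(n < N.+1) wnorm k n u.

Lemma wnorm_le_pnorm N k n u : (k <= N)%N -> (n <= N)%N -> wnorm k n u <= pnorm N u.
Proof.
move=> kN nN; rewrite /pnorm (bigD1 (Ordinal (kN : (k < N.+1)%N)))//= (bigD1 (Ordinal (nN : (n < N.+1)%N)))//=.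
rewrite -addrA lerDl addr_ge0// ?sumr_ge0// => *; rewrite ?wnorm_ge0//. by rewrite sumr_ge0// => *; rewrite wnorm_ge0.
Qed.

Lemma pnorm_ge0 N u : 0 <= pnorm N u.
Proof. by rewrite sumr_ge0// => k _; rewrite sumr_ge0// => n _; rewrite wnorm_ge0. Qed.

Lemma pnormZ N (c : R) u : 0 <= c -> pnorm N (c *: u) <= c * pnorm N u.
Proof.
move=> c0; rewrite /pnorm mulr_sumr; apply: ler_sum => k _. rewrite mulr_sumr; apply: ler_sum => n _.
by rewrite (le_trans (wnormZ _ _ _ _))// ger0_norm.
Qed.

Lemma pnorm_eq0 N u : pnorm N u = 0 -> u = 0.
Proof.
move=> h; apply: schwartz_eqP => x; apply/eqP; rewrite -normr_le0. apply: (le_trans (wnorm0_ub 0 u x)); rewrite -h.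
exact: wnorm_le_pnorm.
Qed.

(** The Banach-Steinhaus theorem. Otherwise there are f_N of norm at most 2^(-N) with |L_N f_N| >= N, and along
    a suitable subsequence the sum of the f_N has images that are not bounded. *)
Lemma uniform_boundedness : (forall u, exists C : R, forall s, A s -> `|L s u| <= C) ->
  exists N (C : R), 0 <= C /\ forall s u, A s -> `|L s u| <= C * pnorm N u.
Proof.
move=> Lbd; apply: contrapT => H. have H' N : exists s u, [/\ A s, pnorm N u <= 2^-1 ^+ N & N%:R <= `|L s u|].
  apply: contrapT => nh; apply: H; exists N, (N%:R * 2 ^+ N); split.
    by rewrite mulr_ge0// exprn_ge0.
  move=> s u As; rewrite leNgt; apply/negP => lt. have p0 : 0 < pnorm N u.
    rewrite lt_neqAle pnorm_ge0 andbT eq_sym; apply/negP => /eqP /pnorm_eq0 u0.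
    move: lt; rewrite u0 linear0 normr0 ltNge => /negP; apply. by rewrite mulr_ge0// ?pnorm_ge0// mulr_ge0// exprn_ge0.
  apply: nh; exists s, ((2^-1 ^+ N / pnorm N u) *: u); split => //.
    have c0 : 0 <= 2^-1 ^+ N / pnorm N u by rewrite divr_ge0 ?exprn_ge0 ?invr_ge0// ltW.
    by rewrite (le_trans (pnormZ _ _ c0))// divfK// gt_eqF.
  rewrite linearZ /= normrM ger0_norm; last by rewrite divr_ge0 ?exprn_ge0 ?invr_ge0// ltW.
  rewrite mulrAC ler_pdivlMr// exprVn ler_pdivlMl ?exprn_gt0// mulrCA mulrA. exact: ltW.
have [s /choice[f hf]] := choice H'. have As N : A (s N) by have [] := hf N.
have f_small N : pnorm N (f N) <= 2^-1 ^+ N by have [] := hf N.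
have f_big N : N%:R <= `|L (s N) (f N)| by have [] := hf N. have [b hb] := choice (fun N => Lbd (f N)).
have half0 : 2^-1 ^+ m @[m --> \oo] --> (0 : R).
  by apply: cvg_expr; rewrite ger0_norm ?invr_ge0// invf_lt1// ltr1n.
have a0 i : `|L (s i) (f N)| @[N --> \oo] --> 0.
  apply: (cvg_eqr `|L (s i) 0|); last by rewrite linear0 normr0. apply: cvg_norm; apply: pairing_cvg => k n.
  apply/cvgr0Pnorm_le => e e0; near=> N. rewrite subr0 ger0_norm ?wnorm_ge0//. apply: (@le_trans _ _ (pnorm N (f N))).
    by apply: wnorm_le_pnorm; [near: N; exists k|near: N; exists n].
  apply: (le_trans (f_small N)). rewrite -[leLHS]ger0_norm ?exprn_ge0 ?invr_ge0//.
  by near: N; move/cvgr0Pnorm_le : half0; apply.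
have [t [tj td ts]] := gliding_hump b a0 f_big.
have gser j k n : (k <= j)%N -> (n <= j)%N -> wnorm k n (f (t j)) <= 2^-1 ^+ j.
  move=> kj nj; apply: (@le_trans _ _ (pnorm (t j) (f (t j)))).
    by apply: wnorm_le_pnorm; [exact: leq_trans kj (tj j)|exact: leq_trans nj (tj j)].
  apply: (le_trans (f_small _)); rewrite ler_wiXn2l ?invr_ge0//. by rewrite invf_le1// ler1n.
(* In the image of the sum by L_(t j), the terms before the j-th are absorbed by the bound on the diagonal and
   those after it add up to at most 2; this contradicts the bound C as soon as j > C + 2. *)
have [phi hphi] := schwartz_series gser. have [C hC] := Lbd phi. pose j := (Num.bound `|C|).+3.
have cj : `|L (s (t j)) (\sum_(i < m) f (t i))| @[m --> \oo] --> `|L (s (t j)) phi|.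
  by apply: cvg_norm; exact: pairing_cvg.
have lb : j%:R - 2 <= `|L (s (t j)) phi|.
  have cj' : `|L (s (t j)) (\sum_(i < j.+1 + m) f (t i))| @[m --> \oo] --> `|L (s (t j)) phi|.
    exact: (@cvg_addn _ (fun m => `|L (s (t j)) (\sum_(i < m) f (t i))|)).
  apply: (cvg_ge_lim cj') => m. have LD x y : L (s (t j)) (x + y) = L (s (t j)) x + L (s (t j)) y by exact: linearD.
  rewrite big_split_ord /= big_ord_recr /= !LD !linear_sum.
  set X := \sum_(i < j) _; set D := L _ (f (t j)); set Z := \sum_(i < m) _. have hX : `|X| <= \sum_(i < j) b (t i).
    apply: (le_trans (ler_norm_sum _ _ _)); apply: ler_sum => i _. by apply: hb; exact: As.
  have hD : j%:R + \sum_(i < j) b (t i) <= `|D| by exact: td. have hZ : `|Z| <= 2.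
    apply: (@le_trans _ _ (\sum_(i < m) 2^-1 ^+ i)).
      apply: (le_trans (ler_norm_sum _ _ _)); apply: ler_sum => i _.
      have ji : (j < j.+1 + i)%N by rewrite addSn ltnS leq_addr.
      have := ts j (j.+1 + i)%N ji; rewrite normr_id => /le_trans; apply.
      rewrite ler_wiXn2l ?invr_ge0//; last by rewrite leq_addl. by rewrite invf_le1// ler1n.
    have e : \sum_(i < m) 2^-1 ^+ i = 2 - 2 * 2^-1 ^+ m :> R.
      elim: m {Z} => [|m IH]; first by rewrite big_ord0 expr0 mulr1 subrr. by rewrite big_ord_recr /= IH exprS; field.
    by rewrite e gerBl mulr_ge0// exprn_ge0// invr_ge0.
  have := lerB_dist (X + D) (- Z); rewrite opprK normrN. have := lerB_dist D (- X); rewrite opprK normrN (addrC D).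
  by move: `|D| `|X| `|Z| `|X + D| `|X + D + Z| hX hD hZ => d x z xd xdz hX hD hZ; lra.
have := hC (s (t j)) (As _). have : `|C| < (Num.bound `|C|)%:R by exact: archi_boundP.
have := ler_norm C; move: lb; rewrite /j -!natr1. by move: (`|L _ phi|) => z; lra.
Unshelve. all: by end_near. Qed.

End uniform_boundedness.

(** * Orthogonality to a sigma-algebra, square-integrable variables *)

Section sub_sigma_algebra.
Context {R : realType} {d : measure_display} {Omega : measurableType d}.
Variable P : probability Omega R.
Implicit Types (g : set (set Omega)) (X Y : Omega -> R).

Definition gmeas g X := measurable_fun [set: g_sigma_algebraType g] (X : g_sigma_algebraType g -> R).

Lemma gmeas_sub g g' X : g `<=` <<s g' >> -> gmeas g X -> gmeas g' X.
Proof.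
move=> gg' mX _ B mB; have := mX measurableT B mB; rewrite !setTI => h. have : <<s g >> (X @^-1` B) by exact: h.
by apply: smallest_sub => //; exact: smallest_sigma_algebra.
Qed.

Lemma gmeas_measurable g X : g `<=` measurable -> gmeas g X -> measT X.
Proof.
move=> gm mX _ B mB; have := mX measurableT B mB; rewrite !setTI => h. have : <<s g >> (X @^-1` B) by exact: h.
by apply: smallest_sub => //; exact: sigma_algebra_measurable.
Qed.

Lemma gmeas_set g X (B : set R) : gmeas g X -> measurable B -> <<s g >> (X @^-1` B).
Proof. by move=> mX mB; have := mX measurableT B mB; rewrite setTI. Qed.

Definition ind (b : bool) : R := if b then 1 else 0.

Lemma ind01 b : 0 <= ind b <= 1. Proof. by rewrite /ind; case: b; rewrite !lexx ?ler01. Qed.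

Lemma measurable_ind {d'} {T : measurableType d'} (p : T -> bool) : measT p -> measT (fun w => ind (p w)).
Proof. by move=> mp; apply: measurable_fun_ifT. Qed.

Lemma Rintegral_sum n (f : nat -> Omega -> R) : (forall k, (k < n)%N -> L1 P (f k)) ->
  L1 P (fun w => \sum_(k < n) f k w) /\ \sum_(k < n) \int[P]_w f k w = \int[P]_w \sum_(k < n) f k w.
Proof.
elim: n => [|n IH] fi.
  have -> : (fun w => \sum_(k < 0) f k w) = (fun _ => 0).
    by apply/funext => w; rewrite big_ord0.
  rewrite big_ord0 Rintegral_probability_cst; split => //. by apply: (integrable_bounded P 0) => // w; rewrite normr0.
have [IH1 IH2] := IH (fun k km => fi k (ltnW km)).
have -> : (fun w => \sum_(k < n.+1) f k w) = (fun w => \sum_(k < n) f k w + f n w).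
  by apply/funext => w; rewrite big_ord_recr.
rewrite big_ord_recr /= IH2; split.
  by have := intD IH1 (fi n (leqnn _)).
by rewrite (RintD IH1 (fi n (leqnn _))).
Qed.

Lemma layer_cake (x : R) n : 0 <= x <= n%:R ->
  \sum_(k < n) ind (k.+1%:R <= x) <= x <= \sum_(k < n) ind (k.+1%:R <= x) + 1.
Proof.
elim: n x => [|n IH] x /andP[x0 xn]; first by rewrite big_ord0 x0 add0r (le_trans xn).
rewrite big_ord_recl; have e (k : 'I_n) : ind ((lift ord0 k).+1%:R <= x) = ind (k.+1%:R <= x - 1).
  by rewrite lerBrDr natr1.
under eq_bigr do rewrite e. rewrite (_ : ind _ = ind (1 <= x))//; rewrite -natr1 in xn; have [x1|x1] := leP 1 x.
  have /IH : 0 <= x - 1 <= n%:R by lra. by move: (\sum_(_ < n) _) => S; rewrite /ind; lra.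
rewrite big1 => [|k _]; first by rewrite /ind; lra.
have k0 : 0 <= k.+1%:R :> R by []. by rewrite /ind; case: ifP => // h; exfalso; lra.
Qed.

(** Up to a constant Y is nonnegative, and m Y is at distance at most 1 from a finite sum of indicators of sets
    {m Y >= k} of the sigma-algebra. Hence m times the integral is bounded in m. *)
Lemma orthogonal_bounded g X Y (B : R) : g `<=` measurable -> L1 P X ->
  (forall E, <<s g >> E -> \int[P]_(w in E) X w = 0) ->
  gmeas g Y -> (forall w, `|Y w| <= B) -> \int[P]_w (Y w * X w) = 0.
Proof.
move=> gm iX X0 gY YB. have mX : measT X by apply/measurable_EFinP; exact: measurable_int iX.
have iX' : L1 P (fun w => `|X w|) by exact: (integrable_norm iX).
have IB (V : Omega -> R) b : measT V -> (forall w, `|V w| <= b) -> L1 P (fun w => V w * X w).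
  move=> mV Vb; apply: (integrable_dominated P (fun w => b * `|X w|)) => //.
  - exact: measurable_funM.
  - by move=> w _; rewrite normrM ler_wpM2r.
  - by have := intZ b iX'.
pose y w := Y w + B. have gy : gmeas g y by exact: measurable_funD.
have y0 w : 0 <= y w <= 2 * B by have := YB w; rewrite ler_norml /y => /andP[]; lra.
have iy : L1 P (fun w => y w * X w).
  apply: (IB _ (2 * B)); first exact: gmeas_measurable gm gy. by move=> w; have /andP[h1 h2] := y0 w; rewrite ger0_norm.
have bd m : m.+1%:R * `|\int[P]_w (y w * X w)| <= \int[P]_w `|X w|.
  pose N := Num.bound (2 * B * m.+1%:R). pose e (k : nat) w : R := ind (k.+1%:R <= m.+1%:R * y w).
  have gk : gmeas g (fun w => m.+1%:R * y w) by exact: measurable_funM.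
  have ie (k : nat) : (k < N)%N -> L1 P (fun w => e k w * X w).
    move=> _; apply: (IB _ 1) => [|w]; last by rewrite /e /ind; case: ifP; rewrite ?normr1 ?normr0.
    by apply: measurable_ind; apply: measurable_fun_ler => //; exact: gmeas_measurable gm gk.
  have e0 k : \int[P]_w (e k w * X w) = 0.
    pose E := [set w | k.+1%:R <= m.+1%:R * y w]. have gE : <<s g >> E.
      have := gmeas_set gk (@measurable_itv R `[k.+1%:R, +oo[).
      by congr (<<s g >> _); apply/seteqP; split => w /=; rewrite in_itv/= andbT.
    rewrite -(X0 E gE) [RHS]Rintegral_mkcond; apply: eq_Rintegral => w _.
    have -> : e k w = ind (w \in E) by congr ind; apply/idP/idP; rewrite inE.
    by rewrite patchE /ind; case: ifP; rewrite ?mul1r ?mul0r.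
  have [iS IS] := Rintegral_sum ie. have iy' : L1 P (fun w => m.+1%:R * (y w * X w)).
    by have := intZ m.+1%:R iy.
  have -> : m.+1%:R * `|\int[P]_w (y w * X w)| = `|\int[P]_w (m.+1%:R * (y w * X w) - \sum_(k < N) e k w * X w)|.
    by rewrite RintegralB// -IS big1// subr0 RintegralZl// normrM normr_nat.
  apply: le_normr_Rintegral_dominated => //.
    by apply/measurable_EFinP; exact: measurable_int (intB iy' iS).
  move=> w _; rewrite -mulr_suml mulrA -mulrBl normrM ler_piMl//. have h : 0 <= m.+1%:R * y w <= N%:R.
    have /andP[h1 h2] := y0 w; rewrite mulr_ge0//= mulrC (le_trans (ler_wpM2r _ h2))//.
    by rewrite ltW// archi_boundP// mulr_ge0// (le_trans h1).
  by have := layer_cake h; rewrite ler_norml; lra.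
have I0 : \int[P]_w (y w * X w) = 0.
  apply/eqP; rewrite -normr_le0; have c : n.+1%:R^-1 * \int[P]_w `|X w| @[n --> \oo] --> 0.
    by apply: (cvg_eqr (0 * _)); [apply: cvgM; [exact: cvg_harmonic|exact: cvg_cst]|rewrite mul0r].
  by apply: (cvg_ge_lim c) => n; rewrite ler_pdivlMl.
have gT : <<s g >> setT by exact: (@measurableT _ (g_sigma_algebraType g)).
have XT : \int[P]_w X w = 0 by have := X0 setT gT. have iB := intZ B iX.
have -> : \int[P]_w (Y w * X w) = \int[P]_w (y w * X w - B * X w) by apply: eq_Rintegral => w _; rewrite /y; ring.
by rewrite RintegralB// RintegralZl// I0 XT mulr0 subr0.
Qed.

End sub_sigma_algebra.

Section square_integrable.
Context {R : realType} {d : measure_display} {T : measurableType d}.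
Variable P : probability T R.
Implicit Types X Y : T -> R.

Definition sqint X := measT X /\ L1 P (fun w => X w ^+ 2).

Lemma norm_mul_le_sqr (x y : R) : `|x * y| <= x ^+ 2 + y ^+ 2.
Proof.
rewrite normrM -(real_normK (num_real x)) -(real_normK (num_real y)).
have := sqr_ge0 (`|x| - `|y|); have := normr_ge0 x; have := normr_ge0 y.
move: (`|x|) (`|y|) => p q q0 p0 h; have := mulr_ge0 p0 q0; nra.
Qed.

Lemma sqint_integrable_mul X Y : sqint X -> sqint Y -> L1 P (fun w => X w * Y w).
Proof.
move=> [mX iX] [mY iY]. apply: (integrable_dominated P (fun w => X w ^+ 2 + Y w ^+ 2)) => //.
- exact: measurable_funM.
- by move=> w _; exact: norm_mul_le_sqr.
- by have := intD iX iY.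
Qed.

Lemma sqint_bounded X C : measT X -> (forall w, `|X w| <= C) -> sqint X.
Proof.
move=> mX XC; split=> //; apply: (integrable_bounded P (C ^+ 2)).
  exact: measurable_funX.
move=> w; rewrite normrX lerXn2r// ?nnegrE//; exact: le_trans (XC w).
Qed.

Lemma sqint_integrable X : sqint X -> L1 P X.
Proof.
move=> sX; have s1 : sqint (fun _ => 1) by apply: (@sqint_bounded _ 1) => // w; rewrite normr1.
by have := sqint_integrable_mul sX s1; under [X in EFin \o X]eq_fun do rewrite mulr1.
Qed.

Lemma sqintM_bounded X Y C : measT Y -> (forall w, `|Y w| <= C) -> sqint X -> sqint (fun w => Y w * X w).
Proof.
move=> mY YC [mX iX]; split; first exact: measurable_funM.
apply: (integrable_dominated P (fun w => C ^+ 2 * X w ^+ 2)) => //.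
- by apply: measurable_funX; exact: measurable_funM.
- move=> w _; rewrite exprMn normrM !normrX (real_normK (num_real (X w))). apply: ler_wpM2r; first exact: sqr_ge0.
  rewrite lerXn2r// ?nnegrE//; exact: le_trans (YC w).
- by have := intZ (C ^+ 2) iX.
Qed.

Lemma sqintZ (c : R) X : sqint X -> sqint (fun w => c * X w).
Proof. by move=> sX; apply: (@sqintM_bounded X (fun _ => c) `|c|). Qed.

Lemma sqr_add_le (x y : R) : (x + y) ^+ 2 <= 2 * x ^+ 2 + 2 * y ^+ 2.
Proof. by have := sqr_ge0 (x - y); nra. Qed.

Lemma sqintD X Y : sqint X -> sqint Y -> sqint (fun w => X w + Y w).
Proof.
move=> [mX iX] [mY iY]; split; first exact: measurable_funD. have i1 := intZ 2 iX; have i2 := intZ 2 iY.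
apply: (integrable_dominated P (fun w => 2 * X w ^+ 2 + 2 * Y w ^+ 2)) => //.
- by apply: measurable_funX; exact: measurable_funD.
- by move=> w _; rewrite ger0_norm ?sqr_ge0//; exact: sqr_add_le.
- by have := intD i1 i2.
Qed.

Lemma sqintB X Y : sqint X -> sqint Y -> sqint (fun w => X w - Y w).
Proof.
move=> sX sY; have := sqintD sX (sqintZ (-1) sY). by under eq_fun do rewrite mulN1r.
Qed.

End square_integrable.

(** * Levy characterisation in discrete time *)

Section discrete_levy.
Context {R : realType} {d : measure_display} {Omega : measurableType d}.
Variable P : probability Omega R.
Local Open Scope ring_scope.

Definition cos_remainder (x h : R) := cos (x + h) - cos x + h * sin x + h ^+ 2 / 2 * cos x.

Lemma cos_remainder_cube (x h : R) : `|cos_remainder x h| <= `|h| ^+ 3.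
Proof.
have b (y : R) : `|y - x| <= `|h| -> `|sin y| <= 1 by rewrite norm_sin_le1.
have dm (y : R) : is_derive y 1 (fun y => - cos y) (sin y).
  by have := is_deriveN (is_derive_cos y); rewrite opprK.
have := @taylor2_le _ (@cos R) (fun y => - sin y) (fun y => - cos y) (@sin R) 1 x h
  (fun y => is_derive_cos y) (fun y => is_deriveN (is_derive_sin y)) dm b.
by rewrite mul1r /cos_remainder !mulrN !opprK.
Qed.

Lemma cos_remainder_square (x h : R) : `|cos_remainder x h| <= 2 * h ^+ 2.
Proof.
have h1 := taylor1_cos_le x h; have h2 : `|h ^+ 2 / 2 * cos x| <= h ^+ 2.
  rewrite normrM -[leRHS]mulr1; apply: ler_pM => //; last exact: norm_cos_le1.
  by have := sqr_ge0 h => h0; rewrite ger0_norm; lra.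
have -> : cos_remainder x h = (cos (x + h) - cos x - h * (- sin x)) + h ^+ 2 / 2 * cos x.
  by rewrite /cos_remainder; ring.
rewrite (le_trans (ler_normD _ _))//; lra.
Qed.

Lemma geometric_recursion (p e : nat -> R) (q : R) n : 0 <= q <= 1 ->
  (forall k, (k < n)%N -> `|p k.+1 - q * p k| <= e k) -> `|p n - q ^+ n * p 0%N| <= \sum_(k < n) e k.
Proof.
move=> /andP[q0 q1]; elim: n => [|n IH] H; first by rewrite expr0 mul1r subrr normr0 big_ord0.
rewrite big_ord_recr /= exprS.
have -> : p n.+1 - q * q ^+ n * p 0%N = q * (p n - q ^+ n * p 0%N) + (p n.+1 - q * p n) by ring.
rewrite (le_trans (ler_normD _ _))// lerD//; last exact: H.
rewrite normrM (ger0_norm q0) (le_trans _ (IH _))//; first by rewrite ler_piMl. by move=> k kn; apply: H; rewrite ltnW.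
Qed.

Variables (G : nat -> set (set Omega)) (M : nat -> Omega -> R) (n : nat) (c : R).
Hypothesis Gm : forall k, G k `<=` measurable.
Hypothesis GS : forall k, G k `<=` <<s G k.+1 >>.
Hypothesis gM : forall k, (k <= n)%N -> gmeas (G k) (M k).
Hypothesis iM : forall k, (k <= n)%N -> L1 P (fun w => M k w ^+ 2).
Hypothesis c0 : 0 <= c.
Hypothesis O1 : forall k E, (k < n)%N -> <<s G k >> E -> \int[P]_(w in E) (M k.+1 w - M k w) = 0.
Hypothesis O2 : forall k l E, (k <= l)%N -> (l <= n)%N -> <<s G k >> E ->
  \int[P]_(w in E) (M l w ^+ 2 - M k w ^+ 2 - (l - k)%:R * c) = 0.

Let X k w := M k.+1 w - M k w.

Let sM k : (k <= n)%N -> sqint P (M k).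
Proof. by move=> kn; split; [exact: gmeas_measurable (gM kn)|exact: iM]. Qed.

Let sX k : (k < n)%N -> sqint P (X k).
Proof. by move=> kn; apply: sqintB; apply: sM => //; exact: ltnW. Qed.

Let gM' k : (k < n)%N -> gmeas (G k.+1) (M k).
Proof. by move=> kn; apply: gmeas_sub (@GS k) _; apply: gM; exact: ltnW. Qed.

Let gX k : (k < n)%N -> gmeas (G k.+1) (X k).
Proof. by move=> kn; apply: measurable_funB; [exact: gM|exact: gM']. Qed.

Let isq k l : (k <= l)%N -> (l <= n)%N -> L1 P (fun w => M l w ^+ 2 - M k w ^+ 2 - (l - k)%:R * c).
Proof.
move=> kl ln; have i1 := intB (iM ln) (iM (leq_trans kl ln)). have i2 : L1 P (fun _ => (l - k)%:R * c).
  by apply: (integrable_bounded P `|(l - k)%:R * c|).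
by have := intB i1 i2.
Qed.

Lemma increment_orthogonal k (eta : Omega -> R) B : (k < n)%N -> gmeas (G k) eta ->
  (forall w, `|eta w| <= B) -> \int[P]_w (eta w * X k w) = 0.
Proof.
move=> kn ge eB; apply: (orthogonal_bounded (@Gm k) _ _ ge eB).
  exact: (sqint_integrable (sX kn)).
by move=> E gE; exact: O1.
Qed.

Lemma square_increment_orthogonal k l (eta : Omega -> R) B : (k <= l)%N -> (l <= n)%N ->
  gmeas (G k) eta -> (forall w, `|eta w| <= B) -> \int[P]_w (eta w * (M l w ^+ 2 - M k w ^+ 2 - (l - k)%:R * c)) = 0.
Proof.
move=> kl ln ge eB; apply: (orthogonal_bounded (@Gm k) _ _ ge eB); first exact: isq. by move=> E gE; exact: O2.
Qed.

Let cross_orthogonal k (eta : Omega -> R) B : (k < n)%N -> gmeas (G k) eta ->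
  (forall w, `|eta w| <= B) -> \int[P]_w (eta w * M k w * X k w) = 0.
Proof.
move=> kn ge eB. have B0 : 0 <= B by exact: le_trans (eB point). have me := gmeas_measurable (@Gm k) ge.
have mM := (sM (ltnW kn)).1; have mX := (sX kn).1. have gMk := gM (ltnW kn).
pose t (m : nat) w : R := ind (`|M k w| <= m%:R). have gt m : gmeas (G k) (t m).
  by apply: measurable_ind; apply: measurable_fun_ler => //; exact: measurableT_comp gMk.
have t01 m w : 0 <= t m w <= 1 by exact: ind01. have DC := @Rintegral_dominated_cvg _ _ _ P setT
  (fun m w => eta w * (t m w * M k w) * X k w) (fun w => eta w * M k w * X k w)
  (fun w => B * `|M k w * X k w|) measurableT.
have Hm m : measT (fun w => eta w * (t m w * M k w) * X k w).
  apply: measurable_funM => //; apply: measurable_funM => //; apply: measurable_funM => //.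
  exact: gmeas_measurable (gt m).
have Hc w : setT w -> eta w * (t m w * M k w) * X k w @[m --> \oo] --> eta w * M k w * X k w.
  move=> _; apply: cvg_near_cst; exists (Num.bound (M k w)) => // m /= mb.
  rewrite /t /ind ifT ?mul1r//; have := archi_boundP (normr_ge0 (M k w)).
  have -> : Num.bound `|M k w| = Num.bound (M k w) by rewrite /Num.bound; rewrite normr_id.
  by move=> /ltW /le_trans; apply; rewrite ler_nat.
have Hi : L1 P (fun w => B * `|M k w * X k w|).
  have := integrable_norm (sqint_integrable_mul (sM (ltnW kn)) (sX kn)). by move=> i1; have := intZ B i1.
have Hb m w : setT w -> `|eta w * (t m w * M k w) * X k w| <= B * `|M k w * X k w|.
  have /andP[t0 t1] := t01 m w. move=> _; rewrite -mulrA normrM ler_pM// -mulrA normrM ler_piMl//. by rewrite ger0_norm.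
have [_ H] := DC Hm Hc Hi Hb. apply: (cvgr_unique H (cvg_cst 0)) => m. under eq_Rintegral do rewrite /=.
apply: (@increment_orthogonal k (fun w => eta w * (t m w * M k w)) (B * m%:R) kn).
  by apply: measurable_funM => //; apply: measurable_funM; [exact: gt|exact: gMk].
move=> w; rewrite normrM ler_pM// normrM /t /ind; case: ifPn => h.
  by rewrite normr1 mul1r.
by rewrite normr0 mul0r.
Qed.

(** X_k^2 is M_(k+1)^2 - M_k^2 up to a multiple of M_k X_k, which is orthogonal to the past. *)
Lemma increment_variance k (eta : Omega -> R) B : (k < n)%N -> gmeas (G k) eta -> (forall w, `|eta w| <= B) ->
  \int[P]_w (eta w * X k w ^+ 2) = c * \int[P]_w eta w.
Proof.
move=> kn ge eB. have me := gmeas_measurable (@Gm k) ge.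
have h1 := @square_increment_orthogonal k k.+1 eta B (leqnSn _) kn ge eB. have h2 := @cross_orthogonal k eta B kn ge eB.
have i1 : L1 P (fun w => eta w * (M k.+1 w ^+ 2 - M k w ^+ 2 - (k.+1 - k)%:R * c)).
  have [mI] : measT (fun w => (M k.+1 w ^+ 2 - M k w ^+ 2 - (k.+1 - k)%:R * c)) /\
      L1 P (fun w => M k.+1 w ^+ 2 - M k w ^+ 2 - (k.+1 - k)%:R * c).
    by split; [apply/measurable_EFinP; apply: measurable_int; apply: isq|apply: isq].
  move=> /integrable_norm iI.
  apply: (integrable_dominated P (fun w => B * `|M k.+1 w ^+ 2 - M k w ^+ 2 - (k.+1 - k)%:R * c|)) => //.
  - exact: measurable_funM.
  - by move=> w _; rewrite normrM ler_wpM2r.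
  - by have := intZ B iI.
have i2 : L1 P (fun w => eta w * M k w * X k w).
  exact: (sqint_integrable_mul (sqintM_bounded me eB (sM (ltnW kn))) (sX kn)).
have i3 : L1 P eta by exact: integrable_bounded _ _ me eB. have i4 := intZ c i3; have i5 := intZ 2 i2.
have -> : \int[P]_w (eta w * X k w ^+ 2) = \int[P]_w (eta w * (M k.+1 w ^+ 2 - M k w ^+ 2 - (k.+1 - k)%:R * c) -
      2 * (eta w * M k w * X k w) + c * eta w).
  by apply: eq_Rintegral => w _; rewrite subSnn /X; ring.
have i6 := intB i1 i5. rewrite (RintD i6 i4) (RintB i1 i5) h1. by rewrite (RintZ i2) h2 (RintZ i3) mulr0 subrr add0r.
Qed.

(* jmp is at least 1 if some increment exceeds del, and bad if this happens or if M exceeds K at some time; the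
   error is bounded in terms of their expectations. *)
Variables (del K : R) (jmp bad : Omega -> R).
Hypothesis del0 : 0 <= del.
Hypothesis K0 : 0 <= K.
Hypothesis mj : measT jmp.
Hypothesis mb : measT bad.
Hypothesis j01 : forall w, 0 <= jmp w <= 1.
Hypothesis b02 : forall w, 0 <= bad w <= 2.
Hypothesis Hj : forall w, (forall k, (k < n)%N -> `|X k w| <= del) \/ 1 <= jmp w.
Hypothesis Hb : forall w, ((forall k, (k < n)%N -> `|X k w| <= del) /\
  (forall k, (k <= n)%N -> `|M k w| <= K)) \/ 1 <= bad w.

(** Indicator that up to time k no increment exceeds del and M stays below K. It depends on the past only, hence
    stops the martingale. *)
Fixpoint good k w : R := if k is k'.+1 then
  good k' w * ind (`|X k' w| <= del) * ind (`|M k w| <= K) else ind (`|M 0%N w| <= K).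

(** Indicator that the first increment above del is the k-th one, M having stayed below K until then. These
    events are disjoint. *)
Let jumps k w := good k w * (1 - ind (`|X k w| <= del)).

Let good01 k w : 0 <= good k w <= 1.
Proof.
elim: k => [|k /andP[IH0 IH1]]; first exact: ind01.
have /andP[a0 a1] := @ind01 R (`|X k w| <= del); have /andP[b0 b1] := @ind01 R (`|M k.+1 w| <= K).
by rewrite /= !mulr_ge0// mulr_ile1// ?mulr_ile1// mulr_ge0.
Qed.

Let jumps01 k w : 0 <= jumps k w <= 1.
Proof.
have /andP[g0 g1] := good01 k w; have /andP[a0 a1] := @ind01 R (`|X k w| <= del).
by rewrite /jumps mulr_ge0 ?subr_ge0// mulr_ile1// ?subr_ge0// lerBlDr lerDl.
Qed.

Let ggood k : (k <= n)%N -> gmeas (G k) (good k).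
Proof.
elim: k => [|k IH] kn.
  by apply: measurable_ind; apply: measurable_fun_ler => //; apply: measurableT_comp => //; exact: gM.
have g1 : gmeas (G k.+1) (good k) by apply: gmeas_sub (@GS k) _; apply: IH; exact: ltnW.
apply: measurable_funM; first apply: measurable_funM => //.
  by apply: measurable_ind; apply: measurable_fun_ler => //; apply: measurableT_comp => //; exact: gX.
by apply: measurable_ind; apply: measurable_fun_ler => //; apply: measurableT_comp => //; exact: gM.
Qed.

Let gjumps k : (k < n)%N -> gmeas (G k.+1) (jumps k).
Proof.
move=> kn; have g1 : gmeas (G k.+1) (good k) by apply: gmeas_sub (@GS k) _; apply: ggood; exact: ltnW.
apply: measurable_funM => //; apply: measurable_funB => //.
by apply: measurable_ind; apply: measurable_fun_ler => //; apply: measurableT_comp => //; exact: gX.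
Qed.

Let good_bad k w : (k <= n)%N -> 1 - good k w <= bad w.
Proof.
move=> kn; have /andP[g0 g1] := good01 k w; have /andP[b0 _] := b02 w. case: (Hb w) => [[h1 h2]|h]; last by lra.
suff -> : good k w = 1 by rewrite subrr. elim: k kn {g0 g1} => [|k IH] kn; first by rewrite /= /ind h2.
by rewrite /= IH ?(ltnW kn)// /ind h1// h2// !mul1r.
Qed.

Let sum_jumps w : \sum_(k < n) jumps k w <= jmp w.
Proof.
have /andP[j0 j1] := j01 w. case: (Hj w) => [h|h].
  rewrite big1 // => k _; rewrite /jumps /ind h ?subrr ?mulr0//.
apply: le_trans h; suff : forall m, \sum_(k < m) jumps k w + good m w <= 1.
  by move=> /(_ n); have /andP[g0 _] := good01 n w; lra.
elim=> [|m IH]; first by rewrite big_ord0 add0r; have /andP[] := good01 0 w.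
rewrite big_ord_recr /= (le_trans _ IH)// -addrA lerD2l /jumps. have /andP[g0 g1] := good01 m w.
have /andP[a0 a1] := @ind01 R (`|X m w| <= del); have /andP[b0 b1] := @ind01 R (`|M m.+1 w| <= K).
have := mulr_ge0 (mulr_ge0 g0 a0) (_ : 0 <= 1 - ind (`|M m.+1 w| <= K)); rewrite subr_ge0 => /(_ b1).
move: (good m w) (ind _) (ind _) => x y z; lra.
Qed.

Let good_norm k w : good k w = 0 \/ `|M k w| <= K.
Proof. by case: k => [|k]; rewrite /= {1}/ind; case: (leP _ K) => h; [right|left|right|left; rewrite mulr0]. Qed.

Let square_split k w : (k < n)%N -> `|X k w| > del ->
  X k w ^+ 2 <= X k w ^+ 2 * (1 - good k w) + (2 * (jumps k w * M k.+1 w ^+ 2) + 2 * K ^+ 2 * jumps k w).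
Proof.
move=> kn Xd; have -> : jumps k w = good k w by rewrite /jumps /ind leNgt Xd /= subr0 mulr1.
have /andP[g0 g1] := good01 k w. suff : good k w * X k w ^+ 2 <= good k w * (2 * M k.+1 w ^+ 2 + 2 * K ^+ 2) by lra.
case: (good_norm k w) => [->|gK]; first by rewrite !mul0r. apply: ler_wpM2l => //.
have h : M k w ^+ 2 <= K ^+ 2 by rewrite -(real_normK (num_real (M k w))) lerXn2r// nnegrE.
rewrite /X; have := sqr_add_le (M k.+1 w) (- M k w); rewrite sqrrN; lra.
Qed.

(** Increments below del contribute at most del X_k^2. A larger one from a good state has X_k^2 <= 2 M_(k+1)^2 +
    2 K^2, where M_(k+1)^2 is replaced by M_n^2 since M^2 is a submartingale; as first jumps are disjoint, the
    sum over k is bounded by the expectations for the event of some jump. *)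
Lemma remainder_bound (theta alpha : R) :
  \sum_(k < n) \int[P]_w `|cos_remainder (theta * M k w + alpha) (theta * X k w)| <=
  `|theta| ^+ 3 * del * (n%:R * c) + 2 * theta ^+ 2 * (n%:R * c * \int[P]_w bad w +
    2 * \int[P]_w (jmp w * M n w ^+ 2) + 2 * K ^+ 2 * \int[P]_w jmp w).
Proof.
have th0 : 0 <= 2 * theta ^+ 2 by apply: mulr_ge0 => //; exact: sqr_ge0.
have td0 : 0 <= `|theta| ^+ 3 * del by apply: mulr_ge0 => //; exact: exprn_ge0.
have K20 : 0 <= 2 * K ^+ 2 by apply: mulr_ge0 => //; exact: sqr_ge0. pose Q k w := X k w ^+ 2 * (1 - good k w).
pose S k w := jumps k w * M k.+1 w ^+ 2. have mg k : (k <= n)%N -> measT (good k).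
  by move=> kn; exact: gmeas_measurable (ggood kn).
have mju k : (k < n)%N -> measT (jumps k).
  by move=> kn; exact: gmeas_measurable (gjumps kn).
have iX k : (k < n)%N -> L1 P (fun w => X k w ^+ 2).
  by move=> kn; exact: (sX kn).2.
have imul (f g : Omega -> R) : measT f -> (forall w, 0 <= f w <= 1) -> L1 P (fun w => g w ^+ 2) -> measT g ->
    L1 P (fun w => f w * g w ^+ 2).
  move=> mf f01 ig mg'; apply: (integrable_dominated P (fun w => g w ^+ 2)) => //.
  - by apply: measurable_funM => //; exact: measurable_funX.
  - move=> w _; have /andP[f0 f1] := f01 w. rewrite ger0_norm; last by apply: mulr_ge0 => //; exact: sqr_ge0.
    by rewrite -[leRHS]mul1r; apply: ler_wpM2r => //; exact: sqr_ge0.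
have iQ k : (k < n)%N -> L1 P (Q k).
  move=> kn; have := imul (fun w => 1 - good k w) (X k) _ _ (iX k kn) (sX kn).1.
  rewrite /Q; under [X in EFin \o X]eq_fun do rewrite mulrC; apply.
    by apply: measurable_funB => //; apply: mg; exact: ltnW.
  by move=> w; have := good01 k w; lra.
have iS k : (k < n)%N -> L1 P (S k).
  by move=> kn; apply: imul (mju k kn) (jumps01 k) (iM kn) (sM kn).1.
have iJ k : (k < n)%N -> L1 P (jumps k).
  move=> kn; apply: (integrable_bounded P 1 (mju k kn)) => w. by have /andP[h0 h1] := jumps01 k w; rewrite ger0_norm.
have ijM : L1 P (fun w => jmp w * M n w ^+ 2).
  by apply: imul => //; [exact: iM|exact: (sM (leqnn n)).1].
have ij : L1 P jmp.
  by apply: (integrable_bounded P 1 mj) => w; have /andP[h0 h1] := j01 w; rewrite ger0_norm.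
have ib : L1 P bad.
  by apply: (integrable_bounded P 2 mb) => w; have /andP[h0 h1] := b02 w; rewrite ger0_norm.
have step k : (k < n)%N -> \int[P]_w `|cos_remainder (theta * M k w + alpha) (theta * X k w)| <=
    `|theta| ^+ 3 * del * c + 2 * theta ^+ 2 * (c * \int[P]_w bad w +
      (2 * \int[P]_w (jumps k w * M n w ^+ 2) + 2 * K ^+ 2 * \int[P]_w jumps k w)).
  move=> kn. have j1 := intZ (`|theta| ^+ 3 * del) (iX k kn).
  have j2 := intZ 2 (iS k kn). have j3 := intZ (2 * K ^+ 2) (iJ k kn).
  have j4 := intD j2 j3. have j5 := intD (iQ k kn) j4. have j6 := intZ (2 * theta ^+ 2) j5. have j7 := intD j1 j6.
  have mr : measT (fun w => cos_remainder (theta * M k w + alpha) (theta * X k w)).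
    have mM := (sM (ltnW kn)).1; have mX := (sX kn).1. have m1 : measT (fun w => theta * M k w + alpha).
      by apply: measurable_funD => //; exact: measurable_funM.
    have m2 : measT (fun w => theta * X k w) by exact: measurable_funM. apply: measurable_funD; last first.
      by apply: measurable_funM; [apply: measurable_funM => //; exact: measurable_funX|exact: measurableT_comp measurable_cos m1].
    apply: measurable_funD; last first.
      by apply: measurable_funM => //; exact: measurableT_comp measurable_sin m1.
    by apply: measurable_funB; apply: measurableT_comp measurable_cos _ => //; exact: measurable_funD.
  have := @le_normr_Rintegral_dominated _ _ _ P setT (fun w => `|cos_remainder (theta * M k w + alpha) (theta * X k w)|)
    (fun w => `|theta| ^+ 3 * del * X k w ^+ 2 + 2 * theta ^+ 2 * (Q k w + (2 * S k w + 2 * K ^+ 2 * jumps k w)))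
    measurableT (measurableT_comp (@normr_measurable _ _) mr) _ j7.
  move=> H; apply: (le_trans (ler_norm _)); apply: (le_trans (H _)).
    move=> w _; rewrite normr_id. have S0 : 0 <= S k w by rewrite mulr_ge0 ?sqr_ge0//; have /andP[] := jumps01 k w.
    have Q0 : 0 <= Q k w by rewrite mulr_ge0 ?sqr_ge0//; have := good01 k w; lra. have J0 : 0 <= 2 * K ^+ 2 * jumps k w.
      by apply: mulr_ge0; [apply: mulr_ge0 => //; exact: sqr_ge0|have /andP[] := jumps01 k w].
    case: (leP (`|X k w|) del) => Xd.
      rewrite (le_trans (cos_remainder_cube _ _))// ler_wpDr//.
        apply: mulr_ge0; first by apply: mulr_ge0 => //; exact: sqr_ge0.
        by apply: addr_ge0 => //; apply: addr_ge0 => //; exact: mulr_ge0.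
      rewrite normrM exprMn -mulrA ler_wpM2l// exprS (real_normK (num_real _)). by rewrite ler_wpM2r ?sqr_ge0.
    rewrite (le_trans (cos_remainder_square _ _))// ler_wpDl//.
      by apply: mulr_ge0 => //; exact: sqr_ge0.
    by rewrite exprMn mulrA; apply: ler_wpM2l => //; exact: square_split.
  rewrite (RintD j1 j6) (RintZ (iX k kn)). rewrite (RintZ j5) (RintD (iQ k kn) j4).
  rewrite (RintD j2 j3) (RintZ (iS k kn)). rewrite (RintZ (iJ k kn)). have V1 : \int[P]_w X k w ^+ 2 = c.
    have := @increment_variance k (fun _ => 1) 1 kn; rewrite Rintegral_probability_cst mulr1.
    under eq_Rintegral do rewrite mul1r; apply => //.
      exact: (measurable_cst (1:R)).
    by move=> w; rewrite normr1.
  have V2 : \int[P]_w Q k w <= c * \int[P]_w bad w.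
    have gg : gmeas (G k) (fun w => 1 - good k w).
      by apply: measurable_funB => //; apply: ggood; exact: ltnW.
    have := @increment_variance k (fun w => 1 - good k w) 1 kn gg.
    rewrite /Q; under [in X in _ -> X]eq_Rintegral do rewrite mulrC.
    move=> ->; last by move=> w; have := good01 k w; rewrite ler_norml; lra.
    apply: ler_wpM2l => //; apply: le_Rintegral => //.
      apply: (integrable_bounded P 1); first exact: gmeas_measurable gg.
      by move=> w; have := good01 k w; rewrite ler_norml; lra.
    by move=> w _; apply: good_bad; exact: ltnW.
  have V3 : \int[P]_w S k w <= \int[P]_w (jumps k w * M n w ^+ 2).
    have := @square_increment_orthogonal k.+1 n (jumps k) 1 kn (leqnn n) (gjumps kn).
    have i1 : L1 P (fun w => jumps k w * M n w ^+ 2).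
      by apply: imul (mju k kn) (jumps01 k) (iM (leqnn n)) (sM (leqnn n)).1.
    have i3 := intZ ((n - k.+1)%:R * c) (iJ k kn). have i2 := intB i1 (iS k kn).
    have -> : \int[P]_w (jumps k w * (M n w ^+ 2 - M k.+1 w ^+ 2 - (n - k.+1)%:R * c)) =
      \int[P]_w (jumps k w * M n w ^+ 2 - S k w - (n - k.+1)%:R * c * jumps k w).
      by apply: eq_Rintegral => w _; rewrite /S; ring.
    rewrite (RintB i2 i3) (RintB i1 (iS k kn)).
    rewrite (RintZ (iJ k kn)). have J0 : 0 <= (n - k.+1)%:R * c * \int[P]_w jumps k w.
      apply: mulr_ge0; first exact: mulr_ge0. by apply: Rintegral_ge0 => w _; have /andP[] := jumps01 k w.
    have jb w : `|jumps k w| <= 1 by have /andP[h0 h1] := jumps01 k w; rewrite ger0_norm. by move=> /(_ jb); lra.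
  rewrite V1; apply: lerD => //; apply: ler_wpM2l; first by [].
  by apply: lerD => //; apply: lerD => //; apply: ler_wpM2l.
apply: le_trans (ler_sum _ (fun (k : 'I_n) _ => step k (ltn_ord k))) _.
rewrite big_split /= sumr_const card_ord -mulr_sumr big_split /= sumr_const card_ord.
rewrite big_split /= -!mulr_sumr. have [s1 ->] := Rintegral_sum iJ.
have iJM k : (k < n)%N -> L1 P (fun w => jumps k w * M n w ^+ 2).
  by move=> kn; apply: imul (mju k kn) (jumps01 k) (iM (leqnn n)) (sM (leqnn n)).1.
have [s2 ->] := Rintegral_sum iJM. rewrite -mulrnAr -(mulr_natl c); apply: lerD => //.
apply: ler_wpM2l => //; rewrite -addrA; apply: lerD; first by rewrite -mulrnAl mulr_natl. apply: lerD.
  apply: ler_wpM2l => //; apply: le_Rintegral => // w _. by rewrite -mulr_suml ler_wpM2r ?sqr_ge0.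
apply: ler_wpM2l => //. by apply: le_Rintegral => // w _; exact: sum_jumps.
Qed.

(** Up to the remainders, the expansion of the cosine to second order multiplies its expectation by 1 - theta^2
    c / 2 at each step. *)
Lemma discrete_levy (theta alpha : R) (xi : Omega -> R) :
  gmeas (G 0) xi -> (forall w, `|xi w| <= 1) -> theta ^+ 2 * c / 2 <= 1 ->
  `|\int[P]_w (xi w * cos (theta * M n w + alpha)) - (1 - theta ^+ 2 * c / 2) ^+ n *
     \int[P]_w (xi w * cos (theta * M 0 w + alpha))| <=
  `|theta| ^+ 3 * del * (n%:R * c) + 2 * theta ^+ 2 * (n%:R * c * \int[P]_w bad w +
    2 * \int[P]_w (jmp w * M n w ^+ 2) + 2 * K ^+ 2 * \int[P]_w jmp w).
Proof.
move=> gxi xi1 small. have G0 k : gmeas (G k) xi by elim: k => // k; exact: gmeas_sub (@GS k).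
have mxi : measT xi := gmeas_measurable (@Gm 0%N) gxi.
have b0 : 0 <= theta ^+ 2 * c / 2 by apply: divr_ge0 => //; apply: mulr_ge0 => //; exact: sqr_ge0.
pose p k := \int[P]_w (xi w * cos (theta * M k w + alpha)). apply: le_trans (remainder_bound theta alpha).
apply: (@geometric_recursion p (fun k => \int[P]_w `|cos_remainder (theta * M k w + alpha) (theta * X k w)|)
  (1 - theta ^+ 2 * c / 2) n); first by move: (theta ^+ 2 * c / 2) b0 small => b ? ?; lra.
move=> k kn; rewrite /p. pose co w := cos (theta * M k w + alpha); pose si w := sin (theta * M k w + alpha).
have gaff : gmeas (G k) (fun w => theta * M k w + alpha).
  apply: measurable_funD => //; apply: measurable_funM => //; apply: gM; exact: ltnW.
have gco : gmeas (G k) (fun w => xi w * co w).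
  apply: measurable_funM; [exact: G0|exact: measurableT_comp measurable_cos gaff].
have gsi : gmeas (G k) (fun w => xi w * si w).
  apply: measurable_funM; [exact: G0|exact: measurableT_comp measurable_sin gaff].
have bco w : `|xi w * co w| <= 1 by rewrite normrM mulr_ile1// norm_cos_le1.
have bsi w : `|xi w * si w| <= 1 by rewrite normrM mulr_ile1// norm_sin_le1.
have mco := gmeas_measurable (@Gm k) gco; have msi := gmeas_measurable (@Gm k) gsi.
have V := increment_variance kn gco bco; have O := increment_orthogonal kn gsi bsi.
have i0 : L1 P (fun w => xi w * co w) by exact: integrable_bounded _ _ mco bco.
have i1 : L1 P (fun w => xi w * si w * X k w).
  exact: (sqint_integrable_mul (sqint_bounded P msi bsi) (sX kn)).
have i2 : L1 P (fun w => xi w * co w * X k w ^+ 2).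
  apply: (integrable_dominated P (fun w => X k w ^+ 2)) => //; last exact: (sX kn).2.
    by apply: measurable_funM => //; apply: measurable_funX; exact: (sX kn).1.
  by move=> w _; rewrite normrM (ger0_norm (sqr_ge0 _)) ler_piMl ?sqr_ge0.
pose r w := cos_remainder (theta * M k w + alpha) (theta * X k w).
have mco' : measT (fun w => xi w * cos (theta * M k.+1 w + alpha)).
  apply: measurable_funM => //; apply: measurableT_comp measurable_cos _.
  by apply: measurable_funD => //; apply: measurable_funM => //; exact: (sM kn).1.
have i4 : L1 P (fun w => xi w * cos (theta * M k.+1 w + alpha)).
  by apply: (integrable_bounded P 1 mco') => w; rewrite normrM mulr_ile1// norm_cos_le1.
have j1 := intZ theta i1. have j2 := intZ (theta ^+ 2 / 2) i2. have j3 := intB i4 i0. have j4 := intD j3 j1.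
have j5 := intD j4 j2. have Er w : xi w * r w = xi w * cos (theta * M k.+1 w + alpha) - xi w * co w +
    theta * (xi w * si w * X k w) + theta ^+ 2 / 2 * (xi w * co w * X k w ^+ 2).
  rewrite /r /cos_remainder; have -> : theta * M k w + alpha + theta * X k w = theta * M k.+1 w + alpha.
    by rewrite /X; ring.
  rewrite /co /si; move: (cos _) (cos _) (sin _) (xi w) (X k w) => a1 a2 a3 a4 a5; ring.
have -> : \int[P]_w (xi w * cos (theta * M k.+1 w + alpha)) -
    (1 - theta ^+ 2 * c / 2) * \int[P]_w (xi w * cos (theta * M k w + alpha)) = \int[P]_w (xi w * r w).
  under [RHS]eq_Rintegral do rewrite Er. rewrite (RintD j4 j2) (RintD j3 j1) (RintB i4 i0).
  rewrite (RintZ i1) (RintZ i2) V O /co. move: (\int[P]_w _) (\int[P]_w _) => a1 a2; by field.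
have ixr : L1 P (fun w => xi w * r w).
  by have -> : (fun w => xi w * r w) = (fun w => xi w * cos (theta * M k.+1 w + alpha) - xi w * co w +
    theta * (xi w * si w * X k w) + theta ^+ 2 / 2 * (xi w * co w * X k w ^+ 2)) by apply/funext.
have mr : measT r.
  have mM := (sM (ltnW kn)).1; have mX := (sX kn).1. have m1 : measT (fun w => theta * M k w + alpha).
    by apply: measurable_funD => //; exact: measurable_funM.
  have m2 : measT (fun w => theta * X k w) by exact: measurable_funM. apply: measurable_funD; last first.
    by apply: measurable_funM; [apply: measurable_funM => //; exact: measurable_funX|exact: measurableT_comp measurable_cos m1].
  apply: measurable_funD; last first.
    by apply: measurable_funM => //; exact: measurableT_comp measurable_sin m1.
  by apply: measurable_funB; apply: measurableT_comp measurable_cos _ => //; exact: measurable_funD.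
have ir : L1 P (fun w => `|r w|).
  have jX := intZ (2 * theta ^+ 2) (sX kn).2.
  apply: (integrable_dominated P (fun w => 2 * theta ^+ 2 * X k w ^+ 2)) => //.
    exact: measurableT_comp.
  move=> w _; rewrite normr_id (le_trans (cos_remainder_square _ _))// exprMn mulrA//.
apply: le_normr_Rintegral_dominated => //; first exact: measurable_funM. by move=> w _; rewrite normrM ler_piMl.
Qed.

End discrete_levy.

(** * Levy characterisation of continuous martingales *)

Section paths.
Context {R : realType}.
Variable T : R.
Hypothesis T0 : 0 <= T.
Implicit Types (f g : R -> R) (t : R).

(** Paths on [0, T] are extended to the line, where continuity and measurability need no relative notions. *)
Definition clamp (t : R) : R := Num.max 0 (Num.min t T).

Lemma clamp_itv t : 0 <= clamp t <= T.
Proof. by rewrite /clamp le_max lexx /= ge_max T0 ge_min lexx orbT. Qed.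

Lemma clamp_in t : clamp t \in `[0, T].
Proof. by rewrite in_itv/=; exact: clamp_itv. Qed.

Lemma clamp_id t : t \in `[0, T] -> clamp t = t.
Proof. by rewrite in_itv/= => /andP[h1 h2]; rewrite /clamp min_l// max_r. Qed.

Lemma clamp_lip t s : `|clamp t - clamp s| <= `|t - s|.
Proof.
wlog ts : t s / t <= s.
  by move=> H; case: (leP t s) => [/H//|/ltW /H]; rewrite distrC (distrC s).
have h : clamp t <= clamp s by rewrite /clamp; case: (leP t T) => ?; case: (leP s T) => ?; case: (leP 0 t) => ?; case: (leP 0 s) => ?; case: (leP 0 T) => ?; lra.
rewrite !ler0_norm ?subr_le0// !opprB.
rewrite /clamp; case: (leP t T) => ?; case: (leP s T) => ?; case: (leP 0 t) => ?; case: (leP 0 s) => ?; case: (leP 0 T) => ?; lra.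
Qed.

Lemma within_clamp f : {within `[0, T], continuous f} -> continuous (fun t => f (clamp t)).
Proof.
move=> /subspace_continuousP cf t; apply/cvgrPdist_lt => e e0.
have /cvgrPdist_lt /(_ e e0) := cf (clamp t) (clamp_in t).
rewrite near_withinE /= => /nbhs_ballP[r /= r0 rb]; near=> s. apply: rb; last exact: clamp_in.
by rewrite /ball/= (le_lt_trans (clamp_lip _ _))//; near: s; exact: cvgr_dist_lt.
Unshelve. all: by end_near. Qed.

Lemma modulus g (a b e : R) : continuous g -> 0 < e ->
  exists2 r : R, 0 < r & forall x y, a <= x <= b -> `|x - y| < r -> `|g x - g y| < e.
Proof.
move=> cg e0. have /compact_near_coveringP := @segment_compact R a b.
move=> /(_ R (0 : R)^'+ (fun r x => forall y, `|x - y| < r -> `|g x - g y| < e) _). case.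
  move=> x xab; have e20 : 0 < e / 2 by lra. have /cvgrPdist_lt /(_ _ e20) /nbhs_ballP[r /= r0 rb] := cg x.
  exists ([set z | `|x - z| < r / 2], [set z | 0 < z < r / 2]).
    split; first by apply/nbhs_ballP; exists (r / 2) => //=; lra.
    rewrite /=; near=> z; apply/andP; split; near: z; first exact: nbhs_right_gt. by apply: nbhs_right_lt; lra.
  move=> [z q] /= [xz /andP[q0 qr]] y zy. have h1 : `|g x - g z| < e / 2 by apply: rb; rewrite /ball/=; lra.
  have h2 : `|g x - g y| < e / 2.
    apply: rb; rewrite /ball/= (le_lt_trans (ler_distD z _ _))//; lra.
  by rewrite (le_lt_trans (ler_distD (g x) _ _))// distrC; lra.
move=> r /= r0 H. have r2 : 0 < r / 2 by lra. exists (r / 2) => // x y xab xy.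
have hr : ball 0 r (r / 2) by rewrite /ball/= sub0r normrN ger0_norm; lra.
by apply: (H (r / 2) hr r2 x) => //; rewrite /= in_itv.
Unshelve. all: by end_near. Qed.

Lemma continuous_bounded g (a b : R) : continuous g -> exists C : R, forall x, a <= x <= b -> `|g x| <= C.
Proof.
move=> cg; have cg' : {within `[a, b], continuous g} by exact: continuous_subspaceT.
have [C [_ HC]] := compact_bounded (continuous_compact cg' (@segment_compact R a b)).
exists (C + 1) => x xab; apply: (HC (C + 1)); first by rewrite ltrDl. by exists x => //=; rewrite in_itv.
Qed.

End paths.

Section continuous_levy.
Context {R : realType} {d : measure_display} {Omega : measurableType d}.
Variable P : probability Omega R.
Variables (F : R -> set (set Omega)) (T kap : R) (M : R -> Omega -> R).
Hypothesis T0 : 0 <= T.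
Hypothesis kap0 : 0 <= kap.
Hypothesis Fm : forall t, t <= T -> F t `<=` measurable.
Hypothesis Fs : forall t, <<s F t >> = F t.
Hypothesis Finc : forall s t, s <= t -> F s `<=` F t.
Hypothesis cM : forall w, {within `[0, T], continuous (M ^~ w)}.
Hypothesis mart : martingale P F T M.
Hypothesis mart2 : martingale P F T (fun t w => M t w ^+ 2 - kap * t).

Let gM t : 0 <= t <= T -> gmeas (F t) (M t).
Proof.
move=> tT _ B mB; rewrite setTI; have [ad _ _] := mart. by apply: sub_sigma_algebra; apply: ad => //; rewrite in_itv.
Qed.

Let mM t : 0 <= t <= T -> measT (M t).
Proof. by move=> tT; apply: gmeas_measurable (gM tT); apply: Fm; case/andP: tT. Qed.

Let martR (N : R -> Omega -> R) s t E : martingale P F T N -> 0 <= s -> s <= t -> t <= T ->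
  F s E -> \int[P]_(w in E) (N t w - N s w) = 0.
Proof.
move=> [_ iN mN] s0 st tT FE; have mE := Fm (le_trans st tT) FE.
have iS r : 0 <= r <= T -> P.-integrable E (EFin \o N r).
  by move=> rT; apply: (integrableS measurableT mE) => //; apply: iN; rewrite in_itv.
have it : P.-integrable E (EFin \o N t) by apply: iS; rewrite tT (le_trans s0).
have is' : P.-integrable E (EFin \o N s) by apply: iS; rewrite s0 (le_trans st).
by rewrite (RintegralB mE it is') /Rintegral (mN s t)// subrr.
Qed.

Let iM2 t : 0 <= t <= T -> L1 P (fun w => M t w ^+ 2).
Proof.
move=> tT; have [_ iN _] := mart2. have i1 : L1 P (fun w => M t w ^+ 2 - kap * t).
  by apply: iN; rewrite in_itv.
have i2 : L1 P (fun _ => kap * t).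
  by apply: (integrable_bounded P `|kap * t|).
have := intD i1 i2. by apply: eq_integrable => // w _ /=; rewrite -EFinD subrK.
Qed.

Section one_interval.
Variables (s t : R).
Hypothesis s0 : 0 <= s.
Hypothesis st : s < t.
Hypothesis tT : t <= T.

Let p n k : R := s + (minn k n.+1)%:R / n.+1%:R * (t - s).
Let c n : R := kap * ((t - s) / n.+1%:R).

Let pmono n k l : (k <= l)%N -> p n k <= p n l.
Proof.
move=> kl; rewrite /p lerD2l; apply: ler_wpM2r; first by rewrite subr_ge0 ltW.
by apply: ler_wpM2r => //; rewrite ler_nat leq_min geq_minr andbT (leq_trans (geq_minl _ _)).
Qed.

Let p_first n : p n 0 = s. Proof. by rewrite /p min0n mul0r mul0r addr0. Qed.

Let p_last n : p n n.+1 = t.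
Proof. by rewrite /p minnn divff ?mul1r; [rewrite addrC subrK|rewrite pnatr_eq0]. Qed.

Let p_itv n k : s <= p n k <= t.
Proof.
rewrite -{1}(p_first n) (pmono n (leq0n k)) /=. have -> : p n k = p n (minn k n.+1) by rewrite /p -minnA minnn.
by rewrite -(p_last n); apply: pmono; exact: geq_minr.
Qed.

Let p_itvT n k : 0 <= p n k <= T.
Proof. by have /andP[h1 h2] := p_itv n k; rewrite (le_trans s0)//= (le_trans h2). Qed.

Let p_step n k : (k <= n.+1)%N -> p n k = s + k%:R * ((t - s) / n.+1%:R).
Proof. by move=> kn; rewrite /p (minn_idPl kn) mulrAC mulrA. Qed.

Let excess (K : R) : set Omega := \bigcup_n \bigcup_k [set w | K < `|M (p n k) w|].

Let mexcess K : measurable (excess K).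
Proof.
apply: bigcup_measurable => n _; apply: bigcup_measurable => k _. have mMp := mM (p_itvT n k).
have mN : measT (fun w => `|M (p n k) w|) by exact: measurableT_comp.
have := mN measurableT `]K, +oo[%classic (measurable_itv _).
by rewrite setTI; congr measurable; apply/seteqP; split => w /=; rewrite in_itv/= andbT.
Qed.

Let jump n (del : R) w : R := 1 - \prod_(k < n.+1) ind (`|M (p n k.+1) w - M (p n k) w| <= del).

Let mjump n del : measT (jump n del).
Proof.
apply: measurable_funB => //; apply: measurable_prod => k _. apply: measurable_ind; apply: measurable_fun_ler => //.
by apply: measurableT_comp => //; apply: measurable_funB; exact: mM.
Qed.

Let jump01 n del w : 0 <= jump n del w <= 1.
Proof.
rewrite /jump subr_ge0 lerBlDr lerDl; apply/andP; split; last first.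
  by apply: prodr_ge0 => k _; have /andP[] := @ind01 R (`|M (p n k.+1) w - M (p n k) w| <= del).
by apply: prodr_ile1 => k _; exact: ind01.
Qed.

Let jump_alt n del w : (forall k, (k < n.+1)%N -> `|M (p n k.+1) w - M (p n k) w| <= del) \/ jump n del w = 1.
Proof.
have [/forallP h|/forallPn[k hk]] := boolP [forall k : 'I_n.+1, `|M (p n k.+1) w - M (p n k) w| <= del].
  by left => k kn; exact: (h (Ordinal kn)).
by right; rewrite /jump (bigD1 k) //= {1}/ind (negbTE hk) mul0r subr0.
Qed.

Let jump_cvg (del : R) w : 0 < del -> jump n del w @[n --> \oo] --> 0.
Proof.
move=> del0; apply: cvg_near_cst. have [r r0 Hr] := @modulus _ _ 0 T del (within_clamp T0 (@cM w)) del0.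
have tsr : 0 < r / (t - s) by rewrite divr_gt0// subr_gt0. exists (Num.bound ((t - s) / r)) => // n /= nb.
rewrite /jump big1 ?subrr// => k _; rewrite /ind ifT//. have kn := ltn_ord k.
have h1 := p_itvT n k.+1; have h2 := p_itvT n k.
have := Hr (p n k.+1) (p n k) h1; rewrite !clamp_id ?in_itv// => H; apply/ltW/H. rewrite !p_step ?(ltnW kn)// -natr1.
have -> : s + (k%:R + 1) * ((t - s) / n.+1%:R) - (s + k%:R * ((t - s) / n.+1%:R)) = (t - s) / n.+1%:R.
  by move: (_ / _) => z; ring.
rewrite gtr0_norm ?divr_gt0 ?subr_gt0// ltr_pdivrMr// mulrC -ltr_pdivrMr//.
apply: lt_le_trans (archi_boundP _) _; first by rewrite divr_ge0 ?ltW ?subr_gt0. by rewrite ler_nat (leq_trans nb).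
Qed.

Let one_step_bound (theta alpha : R) (xi : Omega -> R) : gmeas (F s) xi ->
  (forall w, `|xi w| <= 1) -> forall (del K : R) n, 0 < del -> 0 <= K -> theta ^+ 2 * c n / 2 <= 1 ->
  `|\int[P]_w (xi w * cos (theta * M t w + alpha)) - (1 - theta ^+ 2 * c n / 2) ^+ n.+1 *
     \int[P]_w (xi w * cos (theta * M s w + alpha))| <= `|theta| ^+ 3 * del * (kap * (t - s)) + 2 * theta ^+ 2 *
    (kap * (t - s) * \int[P]_w (jump n del w + \1_(excess K) w) +
    2 * \int[P]_w (jump n del w * M t w ^+ 2) + 2 * K ^+ 2 * \int[P]_w jump n del w).
Proof.
move=> gxi xi1 del K n del0 K0 small.
have Hd := @discrete_levy _ _ _ P (fun k => F (p n k)) (fun k => M (p n k)) n.+1 (c n).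
have e1 : n.+1%:R * c n = kap * (t - s).
  rewrite /c; have := @pnatr_eq0 R n.+1; move: n.+1%:R => N N0; field; by rewrite N0.
rewrite -e1 -{1 2}(p_last n) -{1}(p_first n); apply: Hd => //.
- by move=> k; apply: Fm; have /andP[] := p_itvT n k.
- by move=> k; rewrite Fs; apply: Finc; exact: pmono.
- by move=> k _; exact: gM.
- by move=> k _; exact: iM2.
- by rewrite /c mulr_ge0// divr_ge0// subr_ge0 ltW.
- move=> k E kn; rewrite Fs => FE; have /andP[h1 _] := p_itvT n k.
  by apply: (martR mart) => //; [exact: pmono|have /andP[] := p_itvT n k.+1].
- move=> k l E kl ln; rewrite Fs => FE; have /andP[h1 _] := p_itvT n k. have /andP[_ h2] := p_itvT n l.
  rewrite -(martR mart2 h1 (pmono n kl) h2 FE); apply: eq_Rintegral => w _.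
  rewrite !p_step// ?(leq_trans kl)// natrB// /c; ring.
- exact: ltW.
- by apply: measurable_funD => //; exact: measurable_indic.
- move=> w; have /andP[j0 j1] := jump01 n del w.
  have : 0 <= (\1_(excess K) w : R) <= 1 by rewrite indicE; case: (_ \in _); rewrite ?ler01 lexx.
  by move: (\1_(excess K) w) => z; lra.
- by move=> w; case: (jump_alt n del w) => h; [left|right; rewrite h].
- move=> w; have z0 : 0 <= (\1_(excess K) w : R) by rewrite indicE.
  case: (jump_alt n del w) => h; last by right; rewrite h lerDl. have [wE|wE] := pselect (excess K w); last first.
    left; split => // k kn; rewrite leNgt; apply/negP => hk; apply: wE. by exists n => //; exists k.
  right; rewrite indicE mem_set//; have /andP[j0 j1] := jump01 n del w. by rewrite lerDr.
- by rewrite p_first.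
Qed.

Lemma excess_cvg : \int[P]_w \1_(excess m%:R) w @[m --> \oo] --> (0 : R).
Proof.
apply: (cvg_eqr (\int[P]_w 0)); last by rewrite Rintegral_probability_cst. apply: (Rintegral_bounded_cvg P 1).
- by move=> m; exact: measurable_indic.
- move=> w; apply: cvg_near_cst. have [C HC] := @continuous_bounded _ _ 0 T (within_clamp T0 (@cM w)).
  exists (Num.bound C) => // m /= mC; rewrite indicE memNset//. move=> [n _ [k _ /=]]; apply/negP; rewrite -leNgt.
  have := HC (p n k) (p_itvT n k); rewrite clamp_id ?in_itv//; last exact: p_itvT.
  move=> /le_trans; apply; apply: le_trans (ler_norm C) _; apply/ltW.
  apply: lt_le_trans (archi_boundP (normr_ge0 _)) _; rewrite /Num.bound normr_id. by rewrite ler_nat.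
- by move=> m w; rewrite indicE; case: (_ \in _); rewrite ?normr1 ?normr0.
Qed.

Let c_cvg (theta : R) : n.+1%:R * (theta ^+ 2 * c n / 2) ^+ 2 @[n --> \oo] --> 0.
Proof.
pose b := theta ^+ 2 * kap * (t - s) / 2.
have -> : (fun n => n.+1%:R * (theta ^+ 2 * c n / 2) ^+ 2) = (fun n => b ^+ 2 * n.+1%:R^-1).
  by apply/funext => n; rewrite /c /b; have := @pnatr_eq0 R n.+1; move: n.+1%:R => N N0; field; rewrite N0.
apply: (cvg_eqr (b ^+ 2 * 0)); last by rewrite mulr0. by apply: cvgM; [exact: cvg_cst|exact: cvg_harmonic].
Qed.

(** In [one_step_bound] first the mesh tends to 0, then del to 0 and K to infinity. The cubes of the increments
    vanish with del, the jumps with the mesh because paths are continuous, and the excess with 1 / K because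
    they are bounded. *)
Lemma levy_strict (theta alpha : R) (xi : Omega -> R) : gmeas (F s) xi -> (forall w, `|xi w| <= 1) ->
  \int[P]_w (xi w * cos (theta * M t w + alpha)) =
  expR (- (theta ^+ 2 * (kap * (t - s)) / 2)) * \int[P]_w (xi w * cos (theta * M s w + alpha)).
Proof.
move=> gxi xi1. set It := \int[P]_w _; set Is := \int[P]_w (xi w * cos (theta * M s w + alpha)). set E := expR _.
have mxi := gmeas_measurable (Fm (le_trans (ltW st) tT)) gxi. have sT : 0 <= s <= T by rewrite s0 (le_trans (ltW st)).
have tT' : 0 <= t <= T by rewrite tT (le_trans s0 (ltW st)). have Is1 : `|Is| <= 1.
  have := @le_normr_Rintegral_dominated _ _ _ P setT (fun w => xi w * cos (theta * M s w + alpha)) (fun _ => 1) measurableT.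
  rewrite Rintegral_probability_cst; apply.
  - apply: measurable_funM => //; apply: measurableT_comp measurable_cos _.
    by apply: measurable_funD => //; apply: measurable_funM => //; exact: mM.
  - by move=> w _; rewrite normrM mulr_ile1// norm_cos_le1.
  - by apply: (integrable_bounded P 1) => // w; rewrite normr1.
pose x n := theta ^+ 2 * c n / 2. have x0 n : 0 <= x n.
  apply: divr_ge0 => //; apply: mulr_ge0; first exact: sqr_ge0. by rewrite /c mulr_ge0// divr_ge0// subr_ge0 ltW.
have Ex n : E = expR (- x n) ^+ n.+1.
  rewrite -expRM_natl /E /x /c; congr expR; have := @pnatr_eq0 R n.+1; move: n.+1%:R => N N0; field; by rewrite N0.
have pow n : x n <= 1 -> `|E - (1 - x n) ^+ n.+1| <= n.+1%:R * x n ^+ 2.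
  move=> x1. have H := @geometric_recursion R (fun k => expR (- x n) ^+ k) (fun _ => x n ^+ 2) (1 - x n) n.+1.
  rewrite /= expr0 mulr1 sumr_const card_ord -(mulr_natl (x n ^+ 2)) -Ex in H; apply: H.
    by have := x0 n; move: (x n) x1 => z *; lra.
  move=> k _; rewrite exprS -mulrBl normrM -[leRHS]mulr1; apply: ler_pM => //.
    by have /andP[] := onem_expRN_le (x0 n); move: (expR _) => e h1 h2; rewrite ler_norml; lra.
  rewrite normrX exprn_ile1// ger0_norm ?expR_ge0//. by rewrite -expR0 ler_expR oppr_le0.
have small : \forall n \near \oo, x n <= 1.
  pose b := theta ^+ 2 * kap * (t - s) / 2. exists (Num.bound b) => // n /= nb.
  have -> : x n = b / n.+1%:R by rewrite /x /b /c; have := @pnatr_eq0 R n.+1; move: n.+1%:R => N N0; field; rewrite N0.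
  rewrite ler_pdivrMr// mul1r; apply/ltW; apply: le_lt_trans (ler_norm b) _.
  apply: lt_le_trans (archi_boundP (normr_ge0 _)) _; rewrite /Num.bound normr_id ler_nat. exact: (leq_trans nb).
have main (del : R) (m : nat) : 0 < del -> `|It - E * Is| <= `|theta| ^+ 3 * del * (kap * (t - s)) + 2 * theta ^+ 2 *
    (kap * (t - s) * \int[P]_w \1_(excess m%:R) w).
  move=> del0; set rhs := (X in _ <= X). pose rest n := 2 * theta ^+ 2 * (kap * (t - s) * \int[P]_w jump n del w +
    2 * \int[P]_w (jump n del w * M t w ^+ 2) + 2 * m%:R ^+ 2 * \int[P]_w jump n del w) + n.+1%:R * x n ^+ 2.
  have ij n : L1 P (jump n del).
    apply: (integrable_bounded P 1) => // w. by have /andP[h0 h1] := jump01 n del w; rewrite ger0_norm.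
  have j0 : \int[P]_w jump n del w @[n --> \oo] --> 0.
    apply: (cvg_eqr (\int[P]_w 0)); last by rewrite Rintegral_probability_cst.
    apply: (Rintegral_bounded_cvg P 1) => //; first by move=> w; exact: jump_cvg.
    by move=> n w; have /andP[h0 h1] := jump01 n del w; rewrite ger0_norm.
  have j2 : \int[P]_w (jump n del w * M t w ^+ 2) @[n --> \oo] --> 0.
    apply: (cvg_eqr (\int[P]_w 0)); last by rewrite Rintegral_probability_cst.
    have [] // := @Rintegral_dominated_cvg _ _ _ P setT (fun n w => jump n del w * M t w ^+ 2)
      (fun _ => 0) (fun w => M t w ^+ 2) measurableT.
    - by move=> n; apply: measurable_funM => //; apply: measurable_funX; exact: mM.
    - move=> w _; apply: (cvg_eqr (0 * M t w ^+ 2)); last by rewrite mul0r.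
      by apply: cvgM; [exact: jump_cvg|exact: cvg_cst].
    - exact: iM2.
    - move=> n w _; have /andP[h0 h1] := jump01 n del w.
      rewrite ger0_norm; last by apply: mulr_ge0 => //; exact: sqr_ge0. by apply: ler_piMl => //; exact: sqr_ge0.
  have rest0 : rest n @[n --> \oo] --> 0.
    apply: (cvg_eqr (2 * theta ^+ 2 * (kap * (t - s) * 0 + 2 * 0 + 2 * m%:R ^+ 2 * 0) + 0)).
      apply: cvgD; last exact: c_cvg. apply: cvgM; first exact: cvg_cst.
      by do !apply: cvgD; apply: cvgM => //; exact: cvg_cst.
    by rewrite !mulr0 !addr0 mulr0.
  have [N _ HN] := small. have bnd n : `|It - E * Is| - rest (N + n)%N <= rhs.
    have xN : x (N + n)%N <= 1 by apply: HN; rewrite /= leq_addr. move: (N + n)%N xN => {}n xn.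
    have mK : 0 <= m%:R :> R by []. have h1 := @one_step_bound theta alpha xi gxi xi1 del m%:R n del0 mK xn.
    have iE : L1 P (\1_(excess m%:R)).
      apply: (integrable_bounded P 1); first exact: measurable_indic.
      by move=> w; rewrite indicE; case: (_ \in _); rewrite ?normr1 ?normr0.
    rewrite (RintD (ij n) iE) in h1. have h2 : `|(E - (1 - x n) ^+ n.+1) * Is| <= n.+1%:R * x n ^+ 2.
      rewrite normrM -[leRHS]mulr1; apply: ler_pM => //; exact: pow.
    have h3 : `|It - E * Is| <= `|It - (1 - x n) ^+ n.+1 * Is| + `|(E - (1 - x n) ^+ n.+1) * Is|.
      have -> : It - E * Is = (It - (1 - x n) ^+ n.+1 * Is) - (E - (1 - x n) ^+ n.+1) * Is.
        by move: (_ ^+ n.+1) => z; ring.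
      exact: ler_normB.
    rewrite /rest /rhs lerBlDr; apply: le_trans h3 _. apply: le_trans (lerD h1 h2) _; rewrite -/(x n).
    move: (\int[P]_w _) (\int[P]_w _) (\int[P]_w _) (n.+1%:R * _) (`|theta| ^+ 3 * _ * _).
    move=> a1 a2 a3 a4 a5; rewrite le_eqVlt; apply/orP; left; apply/eqP; ring.
  have cv : `|It - E * Is| - rest (N + n)%N @[n --> \oo] --> `|It - E * Is|.
    apply: (cvg_eqr (`|It - E * Is| - 0)); last by rewrite subr0. by apply: cvgB; [exact: cvg_cst|exact: cvg_addn].
  exact: (cvg_le_lim cv).
apply/eqP; rewrite -subr_eq0 -normr_le0. pose r m := `|theta| ^+ 3 * m.+1%:R^-1 * (kap * (t - s)) + 2 * theta ^+ 2 *
    (kap * (t - s) * \int[P]_w \1_(excess m%:R) w).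
have r0 : r m @[m --> \oo] --> 0.
  apply: (cvg_eqr (`|theta| ^+ 3 * 0 * (kap * (t - s)) + 2 * theta ^+ 2 * (kap * (t - s) * 0))).
    apply: cvgD; first by apply: cvgM; [apply: cvgM; [exact: cvg_cst|exact: cvg_harmonic]|exact: cvg_cst].
    by apply: cvgM; [exact: cvg_cst|apply: cvgM; [exact: cvg_cst|exact: excess_cvg]].
  by rewrite !mulr0 mul0r addr0.
by apply: (cvg_ge_lim r0) => m; apply: main.
Qed.

End one_interval.

(** The expansion of the cosine of a difference moves the terms in M_s to the weight, which is measurable for
    the past. *)
Lemma levy (s t theta alpha : R) (xi : Omega -> R) : 0 <= s -> s <= t -> t <= T ->
  gmeas (F s) xi -> (forall w, `|xi w| <= 1) -> \int[P]_w (xi w * cos (theta * (M t w - M s w) + alpha)) =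
  expR (- (theta ^+ 2 * (kap * (t - s)) / 2)) * cos alpha * \int[P]_w xi w.
Proof.
move=> s0; rewrite le_eqVlt => /orP[/eqP <-|st] tT gxi xi1.
  rewrite subrr mulr0 mulr0 mul0r oppr0 expR0 mul1r. under eq_Rintegral do rewrite subrr mulr0 add0r mulrC.
  rewrite RintegralZl//; apply: integrable_bounded _ _ _ xi1; exact: gmeas_measurable (Fm tT) gxi.
have sT : 0 <= s <= T by rewrite s0 (le_trans (ltW st)). have tT' : 0 <= t <= T by rewrite tT (le_trans s0 (ltW st)).
have Fms := Fm (le_trans (ltW st) tT). have mxi := gmeas_measurable Fms gxi.
have gth : gmeas (F s) (fun w => theta * M s w).
  by apply: measurable_funM => //; exact: gM.
have gc : gmeas (F s) (fun w => xi w * cos (theta * M s w)).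
  by apply: measurable_funM => //; exact: measurableT_comp measurable_cos gth.
have gs : gmeas (F s) (fun w => xi w * sin (theta * M s w)).
  by apply: measurable_funM => //; exact: measurableT_comp measurable_sin gth.
have bc w : `|xi w * cos (theta * M s w)| <= 1 by rewrite normrM mulr_ile1// norm_cos_le1.
have bs w : `|xi w * sin (theta * M s w)| <= 1 by rewrite normrM mulr_ile1// norm_sin_le1.
have h1 := levy_strict s0 st tT theta alpha gc bc. have h2 := levy_strict s0 st tT theta (alpha - pi / 2) gs bs.
have ib (f g : Omega -> R) : measT f -> measT g -> (forall w, `|f w| <= 1) -> L1 P (fun w => f w * cos (g w)).
  move=> mf mg f1; apply: (integrable_bounded P 1).
    by apply: measurable_funM => //; exact: measurableT_comp measurable_cos mg.
  by move=> w; rewrite normrM mulr_ile1// norm_cos_le1.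
have maff r al : 0 <= r <= T -> measT (fun w => theta * M r w + al).
  by move=> rT; apply: measurable_funD => //; apply: measurable_funM => //; exact: mM.
have mc := gmeas_measurable Fms gc; have ms := gmeas_measurable Fms gs. have i1 := ib _ _ mc (maff t alpha tT') bc.
have i2 := ib _ _ ms (maff t (alpha - pi / 2) tT') bs. have i3 := ib _ _ mc (maff s alpha sT) bc.
have i4 := ib _ _ ms (maff s (alpha - pi / 2) sT) bs.
have -> : \int[P]_w (xi w * cos (theta * (M t w - M s w) + alpha)) =
  \int[P]_w (xi w * cos (theta * M s w) * cos (theta * M t w + alpha) +
    xi w * sin (theta * M s w) * cos (theta * M t w + (alpha - pi / 2))).
  apply: eq_Rintegral => w _; rewrite cos_shift.
  have -> : theta * (M t w - M s w) + alpha = theta * M t w + alpha - theta * M s w by ring. by rewrite cosB; ring.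
rewrite (RintD i1 i2) h1 h2 -mulrDr -(RintD i3 i4) -[RHS]mulrA.
congr (_ * _); rewrite -RintegralZl//; last exact: integrable_bounded _ _ _ xi1.
apply: eq_Rintegral => w _; rewrite cos_shift.
have -> : cos alpha = cos (theta * M s w + alpha - theta * M s w) by congr cos; ring. by rewrite cosB; ring.
Qed.

End continuous_levy.

(** * Duhamel formula along a path of tempered distributions *)

Section interval_integrals.
Context {R : realType}.
Local Notation mu := (@lebesgue_measure R).
Implicit Types (f g : R -> R) (a b c C : R).

Lemma integrable_itv_continuous g a b : continuous g -> mu.-integrable `[a, b] (EFin \o g).
Proof.
move=> cg; apply: continuous_compact_integrable; first exact: segment_compact. exact: continuous_subspaceT.
Qed.

Lemma Rintegral_itv_cst a b c : a <= b -> \int[mu]_(x in `[a, b]) c = c * (b - a).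
Proof.
move=> ab; have mab := measurable_itvR `[a, b]. rewrite (@Rintegral_cst _ _ _ mu _ mab); congr (c * _).
have := @lebesgue_measure_itv R `[a, b]; rewrite /= lte_fin => ->; case: ltP => // ba.
have -> : a = b by apply/eqP; rewrite eq_le ab. by rewrite subrr.
Qed.

Lemma Rintegral_itv_cat f a b c : a <= b -> b <= c -> mu.-integrable `[a, c] (EFin \o f) ->
  \int[mu]_(x in `[a, c]) f x = \int[mu]_(x in `[a, b]) f x + \int[mu]_(x in `[b, c]) f x.
Proof.
move=> ab bc fi; have := @Rintegral_itvB _ f (BLeft a) (BRight c) b fi. rewrite !bnd_simp => /(_ ab bc) h.
rewrite -(@Rintegral_itv_obnd_cbnd _ b (BRight c) f).
  by rewrite -h addrC subrK.
by apply: integrableS fi => //; apply: subset_itvr; rewrite bnd_simp.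
Qed.

Lemma Rintegral_itv_le g a b C : a <= b -> measurable_fun `[a, b] g ->
  (forall x, a <= x <= b -> `|g x| <= C) -> `|\int[mu]_(x in `[a, b]) g x| <= C * (b - a).
Proof.
move=> ab mg gC; rewrite -Rintegral_itv_cst//.
apply: (@le_normr_Rintegral_dominated _ _ _ mu `[a, b]%classic g (fun _ => C)) => //.
by apply: integrable_itv_continuous; exact: cst_continuous.
Qed.

Lemma Rintegral_itv_partition f (p : nat -> R) n : (forall k l, (k <= l)%N -> p k <= p l) ->
  mu.-integrable `[p 0%N, p n] (EFin \o f) ->
  \int[mu]_(x in `[p 0%N, p n]) f x = \sum_(k < n) \int[mu]_(x in `[p k, p k.+1]) f x.
Proof.
move=> pm; elim: n => [|n IH] fi.
  by rewrite big_ord0 set_itv1 Rintegral_set1.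
rewrite big_ord_recr /= -IH; last first.
  by apply: integrableS fi => //; apply: subset_itvl; rewrite bnd_simp pm.
by apply: Rintegral_itv_cat => //; exact: pm.
Qed.

Definition grid a b n k : R := a + k%:R * ((b - a) / n.+1%:R).

Lemma grid_mono a b n k l : a <= b -> (k <= l)%N -> grid a b n k <= grid a b n l.
Proof.
move=> ab kl; rewrite /grid lerD2l ler_wpM2r ?ler_nat// divr_ge0// subr_ge0//.
Qed.

Lemma grid0 a b n : grid a b n 0 = a.
Proof. by rewrite /grid mul0r addr0. Qed.

Lemma grid_last a b n : grid a b n n.+1 = b.
Proof. by rewrite /grid mulrC divfK ?pnatr_eq0// addrC subrK. Qed.

Lemma gridS a b n k : grid a b n k.+1 - grid a b n k = (b - a) / n.+1%:R.
Proof. by rewrite /grid -natr1; move: (_ / _) => z; ring. Qed.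

Lemma grid_itv a b n k : a <= b -> (k <= n.+1)%N -> a <= grid a b n k <= b.
Proof.
move=> ab kn; apply/andP; split; first by rewrite -[leLHS](grid0 a b n); exact: grid_mono.
by rewrite -[leRHS](grid_last a b n); exact: grid_mono.
Qed.

Lemma mesh_cvg a b : (b - a) / n.+1%:R @[n --> \oo] --> 0.
Proof.
apply: (cvg_eqr ((b - a) * 0)); last by rewrite mulr0. by apply: cvgM; [exact: cvg_cst|exact: cvg_harmonic].
Qed.

Lemma mesh_small a b r : 0 < r -> \forall n \near \oo, `|(b - a) / n.+1%:R| < r.
Proof. by move=> r0; have /cvgr0_norm_lt := mesh_cvg a b; apply. Qed.

Lemma riemann_cvg g a b : a <= b -> continuous g ->
  \sum_(k < n.+1) (b - a) / n.+1%:R * g (grid a b n k) @[n --> \oo] --> \int[mu]_(x in `[a, b]) g x.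
Proof.
move=> ab cg; apply/cvgrPdist_le => e e0. have e1 : 0 < e / (b - a + 1) by rewrite divr_gt0// ltr_pwDr// subr_ge0.
have [r r0 Hr] := @modulus _ g a b _ cg e1. have := mesh_small a b r0; apply: filterS => n nr.
have {1}-> : `[a, b]%classic = `[grid a b n 0, grid a b n n.+1]%classic by rewrite grid0 grid_last.
rewrite Rintegral_itv_partition; first last.
- exact: integrable_itv_continuous.
- by move=> k l; exact: grid_mono.
rewrite -sumrB; apply: le_trans (ler_norm_sum _ _ _) _.
have step (k : 'I_n.+1) : `|\int[mu]_(x in `[grid a b n k, grid a b n k.+1]) g x -
    (b - a) / n.+1%:R * g (grid a b n k)| <= e / (b - a + 1) * ((b - a) / n.+1%:R).
  have kk : grid a b n k <= grid a b n k.+1 by exact: grid_mono.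
  rewrite -(gridS a b n k) [X in _ - X]mulrC -Rintegral_itv_cst//.
  have i1 : mu.-integrable `[grid a b n k, grid a b n k.+1] (EFin \o g) by exact: integrable_itv_continuous.
  have i2 : mu.-integrable `[grid a b n k, grid a b n k.+1] (EFin \o (fun _ => g (grid a b n k))).
    by apply: integrable_itv_continuous; exact: cst_continuous.
  have mI := measurable_itvR `[grid a b n k, grid a b n k.+1].
  rewrite -(@RintegralB _ _ _ mu _ _ _ mI i1 i2); apply: Rintegral_itv_le => //.
    by apply/measurable_EFinP; apply: measurable_int (integrableB mI i1 i2).
  move=> x /andP[x1 x2]; rewrite distrC; apply/ltW/Hr.
    by apply: grid_itv => //; apply/ltnW/ltn_ord.
  rewrite distrC ger0_norm ?subr_ge0//; apply: le_lt_trans nr.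
  by rewrite -(gridS a b n k); apply: le_trans (ler_norm _); rewrite lerD2r.
apply: le_trans (ler_sum _ (fun k _ => step k)) _.
have key (q z N : R) : N != 0 -> q * (z / N) * N = q * z by move=> N0; field.
rewrite sumr_const card_ord -[leLHS]mulr_natr key ?pnatr_eq0//.
by rewrite mulrAC ler_pdivrMr ?ltr_pwDr ?subr_ge0// ler_wpM2l ?(ltW e0)// lerDl.
Qed.

End interval_integrals.

Section duhamel_path.
Context {R : realType}.
Variables (v T : R) (L : R -> tempered R).
Hypothesis T0 : 0 <= T.
Hypothesis cL : {within `[0, T], continuous L}.
Local Notation mu := (@lebesgue_measure R).
Local Notation heat := (heat v).
Local Notation gen := (gen v).
Implicit Types (u h w : schwartz R).

Lemma pairing_within u : {within `[0, T], continuous (fun r => L r u)}.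
Proof.
apply/subspace_continuousP => x Ax; have /subspace_continuousP /(_ x Ax) cx := cL.
exact: (cvg_comp L (fun K : tempered R => K u) cx (@tempered_eval_continuous R u (L x))).
Qed.

Lemma pairing_clamp u : continuous (fun r => L (clamp T r) u).
Proof. exact: (within_clamp T0 (@pairing_within u)). Qed.

(** A path that is continuous for pointwise convergence is pointwise bounded on [0, T]. *)
Lemma pairing_bounded : exists N (C : R), 0 <= C /\ forall r u, 0 <= r <= T -> `|L r u| <= C * pnorm N u.
Proof.
have [|N [C [C0 H]]] := @uniform_boundedness _ _ [set r : R | 0 <= r <= T] L.
  move=> u; have [C HC] := @continuous_bounded _ _ 0 T (@pairing_clamp u).
  by exists C => r rT; have := HC r rT; rewrite clamp_id// in_itv.
by exists N, C; split => // r u rT; exact: H.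
Qed.

Lemma pnorm_family {I : Type} (D : set I) (f : I -> schwartz R) (g : I -> R) N :
  (forall k n, exists C : R, 0 <= C /\ forall i, D i -> wnorm k n (f i) <= C * g i) ->
  exists C : R, 0 <= C /\ forall i, D i -> pnorm N (f i) <= C * g i.
Proof.
move=> H; pose c k n := sval (cid (H k n)). have cP k n : 0 <= c k n /\ forall i, D i -> wnorm k n (f i) <= c k n * g i.
  by rewrite /c; case: cid.
exists (\sum_(k < N.+1) \sum_(n < N.+1) c k n); split.
  by apply: sumr_ge0 => k _; apply: sumr_ge0 => n _; case: (cP k n).
move=> i Di; rewrite /pnorm mulr_suml; apply: ler_sum => k _.
by rewrite mulr_suml; apply: ler_sum => n _; apply: (cP k n).2.
Qed.

Lemma wnorm_heat_le k n u : exists C : R, 0 <= C /\ forall r, 0 <= r <= T -> wnorm k n (heat r u) <= C.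
Proof.
exists (heat_const v T ^+ k * gauss_moment k * wnorm k n u); split; last first.
  by move=> r rT; exact: wnorm_heat.
have := @wnorm_heat _ v T 0 u k n; rewrite lexx T0 => /(_ isT). by apply: le_trans; exact: wnorm_ge0.
Qed.

Lemma wnorm_heat_lip k n u : exists C : R, 0 <= C /\ forall rq : R * R, 0 <= rq.1 /\ rq.1 <= rq.2 /\ rq.2 <= T ->
  wnorm k n (heat rq.2 u - heat rq.1 u) <= C * Num.sqrt (rq.2 - rq.1).
Proof.
have [C1 [C10 H1]] : exists C : R, 0 <= C /\ forall r u, 0 <= r <= T -> wnorm k n (heat r u) <= C * wnorm k n u.
  exists (Num.max 0 (heat_const v T ^+ k * gauss_moment k)); split; first by rewrite le_max lexx.
  move=> r w rT; apply: le_trans (wnorm_heat _ w k n rT) _.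
  by apply: ler_wpM2r; [exact: wnorm_ge0|rewrite le_max lexx orbT].
pose C2 := heat_const v T ^+ k.+1 * gauss_moment k.+1 * wnorm k n.+1 u.
have H2 r : 0 <= r <= T -> wnorm k n (heat r u - u) <= `|C2| * Num.sqrt r.
  move=> rT; apply: le_trans (wnorm_heat_sub v u k n rT) _.
  by rewrite mulrAC; apply: ler_wpM2r; [exact: sqrtr_ge0|exact: ler_norm].
exists (C1 * `|C2|); split; first by rewrite mulr_ge0. move=> [r q] /= [r0 [rq qT]].
have qr : 0 <= q - r <= T by rewrite subr_ge0 rq /= lerBlDr (le_trans qT)// lerDl.
have -> : heat q u - heat r u = heat r (heat (q - r) u - u).
  by rewrite heatB// heat_heat ?subr_ge0//; congr (heat _ u - _); rewrite addrC subrK.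
apply: le_trans (H1 _ _ _) _; first by rewrite r0 (le_trans rq). by rewrite -mulrA; apply: ler_wpM2l => //; exact: H2.
Qed.

Lemma wnorm_heat_step_le k n u : exists C : R, 0 <= C /\ forall rq : R * R, 0 <= rq.1 <= T /\ 0 <= rq.2 <= T ->
  wnorm k n (heat rq.1 (heat rq.2 u) - heat rq.2 u - rq.1 *: gen (heat rq.2 u)) <= C * (rq.1 * Num.sqrt rq.1).
Proof.
have [A [A0 HA]] := wnorm_heat_step v T k n. have [B2 [B20 H2]] := wnorm_heat_le k n.+2 u.
have [B3 [B30 H3]] := wnorm_heat_le k n.+3 u. exists (A * (B2 + B3)); split; first by rewrite mulr_ge0// addr_ge0.
move=> [r q] /= [rT qT]; apply: le_trans (HA r _ rT) _.
rewrite [leRHS]mulrAC; apply: ler_wpM2l; last exact: lerD (H2 q qT) (H3 q qT).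
by rewrite !mulr_ge0 ?sqrtr_ge0//; case/andP: rT.
Qed.

(** The functions S_t h, t in [0, T], form a compact set on which the functionals L r are equicontinuous. *)
Lemma heat_pairing_equicontinuous h (e : R) : 0 < e -> exists2 dl : R, 0 < dl &
  forall r q t, 0 <= r <= T -> 0 <= q <= T -> 0 <= t <= T -> `|r - q| < dl -> `|L r (heat t h) - L q (heat t h)| <= e.
Proof.
move=> e0; have [N [C [C0 HC]]] := pairing_bounded.
have [C' [C'0 HC']] := pnorm_family N (fun k n => wnorm_heat_lip k n h). have e3 : 0 < e / 3 by lra.
have lip r t1 t2 : 0 <= r <= T -> 0 <= t1 <= T -> 0 <= t2 <= T ->
    `|L r (heat t1 h) - L r (heat t2 h)| <= C * C' * Num.sqrt `|t1 - t2|.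
  wlog t12 : t1 t2 / t1 <= t2.
    move=> H rT t1T t2T; case: (leP t1 t2) => [/H|/ltW /H]; first exact.
    by move=> /(_ rT t2T t1T); rewrite distrC (distrC t2).
  move=> rT /andP[t10 t1T] /andP[t20 t2T]. rewrite distrC -linearB (le_trans (HC _ _ rT))// -mulrA ler_wpM2l//.
  by have := HC' (t1, t2) (conj t10 (conj t12 t2T)); rewrite distrC ger0_norm ?subr_ge0.
have sq0 : 0 < (e / 3 / (C * C' + 1)) ^+ 2.
  by rewrite exprn_gt0// divr_gt0// ltr_pwDr// mulr_ge0.
have /compact_near_coveringP := @segment_compact R 0 T.
move=> /(_ R (0 : R)^'+ (fun dl t => 0 <= t <= T -> forall r q, 0 <= r <= T -> 0 <= q <= T -> `|r - q| < dl ->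
  `|L r (heat t h) - L q (heat t h)| <= e) _).
case.
  move=> t0 /=; rewrite in_itv/= => t0T. have [dl dl0 Hdl] := @modulus _ _ 0 T _ (@pairing_clamp (heat t0 h)) e3.
  exists ([set z | `|t0 - z| < (e / 3 / (C * C' + 1)) ^+ 2], [set z | 0 < z < dl]).
    split; first by apply/nbhs_ballP; exists ((e / 3 / (C * C' + 1)) ^+ 2).
    rewrite /=; near=> z; apply/andP; split; near: z; first exact: nbhs_right_gt. exact: nbhs_right_lt.
  move=> [t z] /= [tt0 /andP[z0 zdl]] tT r q rT qT rq.
  have small s : 0 <= s <= T -> `|L s (heat t h) - L s (heat t0 h)| <= e / 3.
    move=> sT; apply: le_trans (lip _ _ _ sT tT t0T) _. have hs : Num.sqrt `|t - t0| <= e / 3 / (C * C' + 1).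
      rewrite -(ler_pXn2r (n := 2))// ?nnegrE ?sqrtr_ge0//.
        by rewrite sqr_sqrtr// distrC ltW.
      by rewrite divr_ge0 ?(ltW e3)// addr_ge0// mulr_ge0.
    have CC0 : 0 <= C * C' by rewrite mulr_ge0. apply: le_trans (ler_wpM2l CC0 hs) _.
    rewrite mulrCA ger_pMr// ler_pdivrMr ?mul1r ?lerDl//. by rewrite ltr_pwDr.
  have mid : `|L r (heat t0 h) - L q (heat t0 h)| < e / 3.
    by have := Hdl r q rT (lt_trans rq zdl); rewrite !clamp_id// in_itv.
  have := small r rT; have := small q qT; move: mid. move: (L r _) (L q _) (L r _) (L q _) => x3 x4 x1 x2 m1 m2 m3.
  have -> : x3 - x4 = (x3 - x1) + (x1 - x2) + (x2 - x4) by ring. rewrite (le_trans (ler_normD _ _))// (distrC x2).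
  have := ler_normD (x3 - x1) (x1 - x2). lra.
move=> r /= r0 H; exists (r / 2); first by lra.
have hr : ball 0 r (r / 2) by rewrite /ball/= sub0r normrN ger0_norm; lra. have r2 : 0 < r / 2 by lra.
move=> s q t sT qT tT sq; apply: (H (r / 2) hr r2 t) => //=; by rewrite in_itv.
Unshelve. all: by end_near. Qed.

(** Increment over [s, t] of the martingale attached to a test function that is constant in time. *)
Definition incr u s t := L t u - L s u - \int[mu]_(r in `[s, t]) L r (gen u).

Lemma integrable_pairing u s t : 0 <= s -> t <= T -> mu.-integrable `[s, t] (EFin \o (fun r => L r u)).
Proof.
move=> s0 tT; have := @integrable_itv_continuous _ _ s t (@pairing_clamp u).
apply: eq_integrable => // r; rewrite inE /= in_itv/= => /andP[sr rt].
by rewrite clamp_id// in_itv/= (le_trans s0 sr) (le_trans rt).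
Qed.

(** With w_r = S_(t-r) u, the difference L_t(w_t) - L_s(w_s) is a telescoping sum over the grid. On each
    interval w solves the backward equation up to an error of the order of the mesh to the power 3/2, and the
    oscillation of L_r(gen w) over the interval is uniformly small. *)
Lemma duhamel_path u s t : 0 <= s -> s <= t -> t <= T ->
  \sum_(k < n.+1) incr (heat (t - grid s t n k.+1) u) (grid s t n k) (grid s t n k.+1)
    @[n --> \oo] --> L t u - L s (heat (t - s) u).
Proof.
move=> s0 st tT. have [N [C [C0 HC]]] := pairing_bounded.
have [A [A0 HA]] := pnorm_family N (fun k n => wnorm_heat_step_le k n u). apply/cvgrPdist_le => e e0.
have e1 : 0 < e / 2 / (t - s + 1) by rewrite !divr_gt0// ltr_pwDr// subr_ge0.
have [dl dl0 Hdl] := heat_pairing_equicontinuous (gen u) e1. have sq0 : 0 < (e / 2 / ((t - s) * (C * A) + 1)) ^+ 2.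
  by rewrite exprn_gt0// !divr_gt0// ltr_pwDr// !mulr_ge0// subr_ge0.
near=> n. have Ddl : (t - s) / n.+1%:R < dl by apply: le_lt_trans (ler_norm _) _; near: n; exact: mesh_small.
have Dsq : (t - s) / n.+1%:R <= (e / 2 / ((t - s) * (C * A) + 1)) ^+ 2.
  by apply: le_trans (ler_norm _) _; apply: ltW; near: n; exact: mesh_small.
set D := (t - s) / n.+1%:R in Ddl Dsq *. have D0 : 0 <= D by rewrite /D divr_ge0// subr_ge0. have DT : D <= T.
  rewrite /D ler_pdivrMr//; apply: le_trans (_ : T * 1 <= _); last by rewrite ler_wpM2l// ler1n.
  by rewrite mulr1 lerBlDr (le_trans tT)// lerDl.
have {}Dsq : Num.sqrt D <= e / 2 / ((t - s) * (C * A) + 1).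
  rewrite -(ler_pXn2r (n := 2))// ?nnegrE ?sqrtr_ge0//.
    by rewrite sqr_sqrtr.
  by rewrite !divr_ge0 ?(ltW e0)// addr_ge0// !mulr_ge0// subr_ge0.
pose w k := heat (t - grid s t n k) u. have gT k : (k <= n.+1)%N -> 0 <= grid s t n k <= T.
  by move=> kn; have /andP[h1 h2] := grid_itv st kn; rewrite (le_trans s0) ?(le_trans h2).
have wT k : (k <= n.+1)%N -> 0 <= t - grid s t n k <= T.
  move=> kn; have /andP[h1 h2] := grid_itv st kn; have /andP[h3 h4] := gT k kn.
  by rewrite subr_ge0 h2 /= lerBlDr (le_trans tT)// lerDl.
have tele : L t u - L s (heat (t - s) u) = \sum_(k < n.+1) (L (grid s t n k.+1) (w k.+1) - L (grid s t n k) (w k)).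
  have := @telescope_sumr _ 0 n.+1 (fun k => L (grid s t n k) (w k)) (leq0n _).
  by rewrite big_mkord => ->; rewrite /w grid0 grid_last subrr heat0.
rewrite tele -sumrB; apply: le_trans (ler_norm_sum _ _ _) _.
have step (k : 'I_n.+1) : `|L (grid s t n k.+1) (w k.+1) - L (grid s t n k) (w k) -
    incr (w k.+1) (grid s t n k) (grid s t n k.+1)| <= e / 2 / (t - s + 1) * D + C * A * (D * Num.sqrt D).
  have kn := ltn_ord k; have k1 := gT _ kn; have k0 := gT _ (ltnW kn). have w1 := wT _ kn; have /andP[w10 _] := w1.
  have kk : grid s t n k <= grid s t n k.+1 by exact: grid_mono. have wk : w k = heat D (w k.+1).
    rewrite /w heat_heat//; congr (heat _ u); rewrite /D -(gridS s t n k); ring.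
  have rem : `|L (grid s t n k) (w k - w k.+1 - D *: gen (w k.+1))| <= C * A * (D * Num.sqrt D).
    apply: le_trans (HC _ _ k0) _; rewrite -mulrA ler_wpM2l// wk.
    by have := HA (D, t - grid s t n k.+1); apply; rewrite /= D0.
  have i1 : mu.-integrable `[grid s t n k, grid s t n k.+1] (EFin \o (fun r => L r (gen (w k.+1)))).
    by apply: integrable_pairing; [case/andP: k0|case/andP: k1].
  have i2 : mu.-integrable `[grid s t n k, grid s t n k.+1] (EFin \o (fun _ => L (grid s t n k) (gen (w k.+1)))).
    by apply: integrable_itv_continuous; exact: cst_continuous.
  have osc : `|\int[mu]_(r in `[grid s t n k, grid s t n k.+1]) L r (gen (w k.+1)) -
      D * L (grid s t n k) (gen (w k.+1))| <= e / 2 / (t - s + 1) * D.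
    rewrite [X in _ - X]mulrC /D -(gridS s t n k) -Rintegral_itv_cst//.
    have mI := measurable_itvR `[grid s t n k, grid s t n k.+1].
  rewrite -(@RintegralB _ _ _ mu _ _ _ mI i1 i2); apply: Rintegral_itv_le => //.
      by apply/measurable_EFinP; apply: measurable_int (integrableB mI i1 i2).
    move=> r /andP[r1 r2]; rewrite /w heat_gen//; apply: Hdl => //.
      by have /andP[h1 _] := k0; have /andP[_ h2] := k1; rewrite (le_trans h1) ?(le_trans r2).
    rewrite ger0_norm ?subr_ge0//; apply: le_lt_trans Ddl. by rewrite /D -(gridS s t n k) lerD2r.
  have linL (f1 f2 g : schwartz R) : L (grid s t n k) (f1 - f2 - D *: g) =
      L (grid s t n k) f1 - L (grid s t n k) f2 - D * L (grid s t n k) g.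
    by rewrite 2!linearB linearZ.
  move: rem; rewrite linL /incr -/(w k.+1).
  move: (e / 2 / _ * D) (C * A * _) osc; move: (\int[mu]_(r in _) _) (L _ (gen _)) => I0 l0.
  move: (L _ _) (L _ _) (L _ _) => l1 l2 l3 B1 B2 h1 h2.
  have -> : l1 - l3 - (l1 - l2 - I0) = (I0 - D * l0) - (l3 - l2 - D * l0) by ring.
  by apply: le_trans (ler_normB _ _) _; exact: lerD.
apply: le_trans (ler_sum _ (fun k _ => step k)) _. rewrite sumr_const card_ord -[leLHS]mulr_natr.
have De : D * n.+1%:R = t - s by rewrite /D divfK ?pnatr_eq0.
have key (q B r m : R) : (q * D + B * (D * r)) * m = q * (D * m) + D * m * B * r by ring. rewrite key De.
have b1 : e / 2 / (t - s + 1) * (t - s) <= e / 2.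
  rewrite -mulrA ger_pMr ?divr_gt0// mulrC ler_pdivrMr ?ltr_pwDr ?subr_ge0// mul1r lerDl//.
have b2 : (t - s) * (C * A) * Num.sqrt D <= e / 2.
  have X0 : 0 <= (t - s) * (C * A) by rewrite !mulr_ge0// subr_ge0. apply: le_trans (ler_wpM2l X0 Dsq) _.
  by rewrite mulrCA ger_pMr ?divr_gt0// ler_pdivrMr ?mul1r ?lerDl// ltr_pwDr.
by apply: le_trans (lerD b1 b2) _; rewrite -splitr.
Unshelve. all: by end_near. Qed.

End duhamel_path.

(** * Gaussian spaces *)

Lemma Rintegral_linear2 {R : realType} {d : measure_display} {T : measurableType d}
    (mu : {measure set T -> \bar R}) (a b : R) (X Y : T -> R) : L1 mu X -> L1 mu Y ->
  L1 mu (fun w => a * X w + b * Y w) /\ \int[mu]_w (a * X w + b * Y w) = a * \int[mu]_w X w + b * \int[mu]_w Y w.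
Proof.
move=> iX iY. have i1 := intZ a iX; have i2 := intZ b iY. split; first by have := intD i1 i2.
by rewrite (RintD i1 i2) (RintZ iX) (RintZ iY).
Qed.

Section cauchy_schwarz.
Context {R : realType} {d : measure_display} {T : measurableType d}.
Variable P : probability T R.
Implicit Types X Y : T -> R.

Lemma Rintegral_sqrD X Y (t : R) : sqint P X -> sqint P Y -> \int[P]_w (X w + t * Y w) ^+ 2 =
  \int[P]_w X w ^+ 2 + 2 * t * \int[P]_w (X w * Y w) + t ^+ 2 * \int[P]_w Y w ^+ 2.
Proof.
move=> sX sY; have iXY := sqint_integrable_mul sX sY. have [i1 e1] := Rintegral_linear2 1 (2 * t) sX.2 iXY.
have [i2 e2] := Rintegral_linear2 1 (t ^+ 2) i1 sY.2.
rewrite -(mul1r (\int[P]_w X w ^+ 2)) -e1 -(mul1r (\int[P]_w (1 * _ + _))) -e2. by apply: eq_Rintegral => w _; ring.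
Qed.

Lemma cauchy_schwarz X Y : sqint P X -> sqint P Y ->
  (\int[P]_w (X w * Y w)) ^+ 2 <= \int[P]_w X w ^+ 2 * \int[P]_w Y w ^+ 2.
Proof.
move=> sX sY; have Q t := Rintegral_sqrD t sX sY. have Q0 t : 0 <= \int[P]_w (X w + t * Y w) ^+ 2.
  by apply: Rintegral_ge0 => w _; exact: sqr_ge0.
have A0 : 0 <= \int[P]_w X w ^+ 2 by apply: Rintegral_ge0 => w _; exact: sqr_ge0.
have B0 : 0 <= \int[P]_w Y w ^+ 2 by apply: Rintegral_ge0 => w _; exact: sqr_ge0.
move: Q Q0 A0 B0; move: (\int[P]_w X w ^+ 2) (\int[P]_w (X w * Y w)) (\int[P]_w Y w ^+ 2). move=> a m b Q Q0 a0 b0.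
have H t : 0 <= a + 2 * t * m + t ^+ 2 * b by rewrite -Q. have [b_eq|b_neq] := eqVneq b 0.
  have := H (- (a + 1) * m); have := H (- m * (a + 1)). rewrite b_eq !mulr0 addr0 => h _.
  have [->|m0] := eqVneq m 0; first by rewrite expr0n. have := H (- (a + 1) / (2 * m)); rewrite b_eq mulr0 addr0.
  have -> : 2 * (- (a + 1) / (2 * m)) * m = - (a + 1) by field. by move=> h2; exfalso; lra.
have bp : 0 < b by rewrite lt_neqAle eq_sym b_neq. have := H (- m / b).
have -> : a + 2 * (- m / b) * m + (- m / b) ^+ 2 * b = (a * b - m ^+ 2) / b by field.
by rewrite pmulr_lge0 ?invr_gt0// subr_ge0.
Qed.

Lemma Rintegral_norm_sqr X : sqint P X -> (\int[P]_w `|X w|) ^+ 2 <= \int[P]_w X w ^+ 2.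
Proof.
move=> [mX iX]; have s1 : sqint P (fun=> 1 : R).
  by apply: (@sqint_bounded _ _ _ P _ 1) => // w; rewrite normr1.
have e w : `|X w| ^+ 2 = X w ^+ 2 by rewrite real_normK// num_real. have sN : sqint P (fun w => `|X w|).
  split; first exact: measurableT_comp. by under [X in EFin \o X]eq_fun do rewrite e.
have := cauchy_schwarz sN s1. under eq_Rintegral do rewrite mulr1; under [in leRHS]eq_Rintegral do rewrite e.
by under [X in _ * X]eq_Rintegral do rewrite expr1n; rewrite Rintegral_probability_cst mulr1.
Qed.

Lemma cauchy_schwarz_cvg0 (X_ Y_ : nat -> T -> R) (C : R) : (forall n, sqint P (X_ n)) -> (forall n, sqint P (Y_ n)) ->
  \int[P]_w X_ n w ^+ 2 @[n --> \oo] --> 0 -> (forall n, \int[P]_w Y_ n w ^+ 2 <= C) ->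
  \int[P]_w (X_ n w * Y_ n w) @[n --> \oo] --> 0.
Proof.
move=> sX sY X0 YC. have h : (\int[P]_w (X_ n w * Y_ n w)) ^+ 2 @[n --> \oo] --> 0.
  apply: (cvg_dist_le (fun n => \int[P]_w X_ n w ^+ 2 * C)).
    move=> n; rewrite subr0 ger0_norm ?sqr_ge0//.
    apply: le_trans (cauchy_schwarz (sX n) (sY n)) _; apply: ler_wpM2l => //.
    by apply: Rintegral_ge0 => w _; exact: sqr_ge0.
  apply: (cvg_eqr (0 * C)); last by rewrite mul0r. by apply: cvgM => //; exact: cvg_cst.
apply/cvgr0Pnorm_le => e e0. have e2 : 0 < e ^+ 2 by rewrite exprn_gt0.
move/cvgr0Pnorm_le : h => /(_ _ e2); apply: filterS => n. by rewrite normrX ler_pXn2r// nnegrE ltW.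
Qed.

Lemma L2_cvg_mul (X_ Y_ : nat -> T -> R) X Y :
  (forall n, sqint P (X_ n)) -> (forall n, sqint P (Y_ n)) -> sqint P X -> sqint P Y ->
  \int[P]_w (X_ n w - X w) ^+ 2 @[n --> \oo] --> 0 -> \int[P]_w (Y_ n w - Y w) ^+ 2 @[n --> \oo] --> 0 ->
  \int[P]_w (X_ n w * Y_ n w) @[n --> \oo] --> \int[P]_w (X w * Y w).
Proof.
move=> sX_ sY_ sX sY X0 Y0. have sDX n : sqint P (fun w => X_ n w - X w) by exact: sqintB.
have sDY n : sqint P (fun w => Y_ n w - Y w) by exact: sqintB.
have h1 := cauchy_schwarz_cvg0 sDX (fun=> sY) X0 (fun=> lexx _).
have h2 := cauchy_schwarz_cvg0 sDY (fun=> sX) Y0 (fun=> lexx _).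
have [M HM] : exists M, forall n, \int[P]_w (Y_ n w - Y w) ^+ 2 <= M.
  have /cvg_seq_bounded [M [_ HM]] : cvg (\int[P]_w (Y_ n w - Y w) ^+ 2 @[n --> \oo]).
    by apply/cvg_ex; exists 0.
  exists (M + 1) => n; apply: le_trans (ler_norm _) _; apply: (HM (M + 1)) => //. by rewrite ltrDl.
have h3 := cauchy_schwarz_cvg0 sDX sDY X0 HM. have -> : (fun n => \int[P]_w (X_ n w * Y_ n w)) = (fun n =>
    \int[P]_w ((X_ n w - X w) * (Y_ n w - Y w)) + \int[P]_w ((X_ n w - X w) * Y w) +
    \int[P]_w ((Y_ n w - Y w) * X w) + \int[P]_w (X w * Y w)).
  apply/funext => n. have i1 := sqint_integrable_mul (sDX n) (sDY n); have i2 := sqint_integrable_mul (sDX n) sY.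
  have i3 := sqint_integrable_mul (sDY n) sX; have i4 := sqint_integrable_mul sX sY.
  have i5 := intD i1 i2; have i6 := intD i5 i3. rewrite -(RintD i1 i2) -(RintD i5 i3) -(RintD i6 i4).
  by apply: eq_Rintegral => w _; ring.
apply: (cvg_eqr (0 + 0 + 0 + \int[P]_w (X w * Y w))); last by rewrite !add0r.
by apply: cvgD; [apply: cvgD => //; exact: cvgD|exact: cvg_cst].
Qed.

End cauchy_schwarz.

Section gaussian_space.
Context {R : realType} {d : measure_display} {Omega : measurableType d}.
Variable P : probability Omega R.
Implicit Types X Y : Omega -> R.

(** The expectation of the truncated distance metrises convergence in probability. *)
Definition cap1 (x : R) : R := Num.min 1 `|x|.

Lemma cap1_itv x : 0 <= cap1 x <= 1.
Proof. by rewrite /cap1 le_min ler01 normr_ge0 ge_min lexx. Qed.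

Lemma cap1_le x : cap1 x <= `|x|.
Proof. by rewrite /cap1 ge_min lexx orbT. Qed.

Lemma cap1N x : cap1 (- x) = cap1 x.
Proof. by rewrite /cap1 normrN. Qed.

Lemma cap1D x y : cap1 (x + y) <= cap1 x + cap1 y.
Proof.
have := ler_normD x y; have := normr_ge0 x; have := normr_ge0 y. rewrite /cap1; move: (`|x + y|) (`|x|) (`|y|) => s p q.
by case: (leP 1 s) => ?; case: (leP 1 p) => ?; case: (leP 1 q) => ?; lra.
Qed.

Lemma cap1M a x : cap1 (a * x) <= (1 + `|a|) * cap1 x.
Proof.
rewrite /cap1 normrM; have := normr_ge0 a; have := normr_ge0 x. move: (`|a|) (`|x|) => p q q0 p0.
have := mulr_ge0 p0 q0; case: (leP 1 (p * q)) => ?; case: (leP 1 q) => ?; nra.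
Qed.

Lemma measurable_cap1 X : measT X -> measT (fun w => cap1 (X w)).
Proof. by move=> mX; apply: measurable_minr => //; exact: measurableT_comp. Qed.

Lemma cos_sub_cap1 x y : `|cos x - cos y| <= 2 * cap1 (x - y).
Proof.
rewrite /cap1; have h1 : `|cos x - cos y| <= 2.
  by have := norm_cos_le1 x; have := norm_cos_le1 y; rewrite !ler_norml; lra.
have h2 : `|cos x - cos y| <= `|x - y|.
  have dc (z : R) : is_derive z 1 (@cos R) (- sin z) by exact: is_derive_cos.
  have := @MVT_le _ (@cos R) (fun z => - sin z) 1 y (x - y) dc. have -> : y + (x - y) = x by ring.
  by rewrite mul1r; apply => z _; rewrite normrN; exact: norm_sin_le1.
by have h0 := normr_ge0 (x - y); case: (leP 1 `|x - y|) => h; lra.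
Qed.

Lemma sin_sub_cap1 x y : `|sin x - sin y| <= 2 * cap1 (x - y).
Proof.
have e z : sin z = cos (z - pi / 2) :> R.
  by rewrite cosB cos_pihalf sin_pihalf mulr0 mulr1 add0r.
rewrite !e; have := cos_sub_cap1 (x - pi / 2) (y - pi / 2). by have -> : x - pi / 2 - (y - pi / 2) = x - y by ring.
Qed.

Definition pdist X Y : R := \int[P]_w cap1 (X w - Y w).

Lemma integrable_cap1 X : measT X -> L1 P (fun w => cap1 (X w)).
Proof.
move=> mX; apply: (integrable_bounded P 1); first exact: measurable_cap1.
by move=> w; have /andP[h0 h1] := cap1_itv (X w); rewrite ger0_norm.
Qed.

Lemma pdist_ge0 X Y : 0 <= pdist X Y.
Proof. by apply: Rintegral_ge0 => w _; have /andP[] := cap1_itv (X w - Y w). Qed.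

Lemma pdistC X Y : pdist X Y = pdist Y X.
Proof. by apply: eq_Rintegral => w _; rewrite -cap1N opprB. Qed.

Lemma pdistB_le X1 Y1 X2 Y2 (a b : R) : measT X1 -> measT Y1 -> measT X2 -> measT Y2 ->
  pdist (fun w => a * X1 w + b * X2 w) (fun w => a * Y1 w + b * Y2 w) <=
  (1 + `|a|) * pdist X1 Y1 + (1 + `|b|) * pdist X2 Y2.
Proof.
move=> m1 n1 m2 n2. have m3 : measT (fun w => X1 w - Y1 w) by exact: measurable_funB.
have m4 : measT (fun w => X2 w - Y2 w) by exact: measurable_funB.
have i1 := integrable_cap1 m3; have i2 := integrable_cap1 m4.
have [i3 <-] := Rintegral_linear2 (1 + `|a|) (1 + `|b|) i1 i2. apply: le_Rintegral => //.
  apply: integrable_cap1; apply: measurable_funB; apply: measurable_funD; exact: measurable_funM.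
move=> w _; have -> : a * X1 w + b * X2 w - (a * Y1 w + b * Y2 w) = a * (X1 w - Y1 w) + b * (X2 w - Y2 w) by ring.
by apply: le_trans (cap1D _ _) _; apply: lerD; exact: cap1M.
Qed.

Lemma pdist_triangle X Y W : measT X -> measT Y -> measT W -> pdist X Y <= pdist X W + pdist W Y.
Proof.
move=> mX mY mW. have m1 : measT (fun w => X w - W w) by exact: measurable_funB.
have m2 : measT (fun w => W w - Y w) by exact: measurable_funB.
rewrite /pdist -(RintD (integrable_cap1 m1) (integrable_cap1 m2)). apply: le_Rintegral => //.
- by apply: integrable_cap1; exact: measurable_funB.
- by have := intD (integrable_cap1 m1) (integrable_cap1 m2).
- move=> w _; have -> : X w - Y w = (X w - W w) + (W w - Y w) by ring. exact: cap1D.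
Qed.

Lemma pdist_pointwise (X_ : nat -> Omega -> R) X : (forall n, measT (X_ n)) ->
  measT X -> (forall w, X_ n w @[n --> \oo] --> X w) -> pdist (X_ n) X @[n --> \oo] --> 0.
Proof.
move=> mX_ mX cX; apply: (cvg_eqr (\int[P]_w 0)); last by rewrite Rintegral_probability_cst.
apply: (Rintegral_bounded_cvg P 1).
- by move=> n; apply: measurable_cap1; exact: measurable_funB.
- move=> w; apply: (cvg_dist_le (fun n => `|X_ n w - X w|)).
    by move=> n; rewrite subr0 ger0_norm ?cap1_le//; have /andP[] := cap1_itv (X_ n w - X w).
  apply: (cvg_eqr `|X w - X w|); last by rewrite subrr normr0. by apply: cvg_norm; apply: cvgB => //; exact: cvg_cst.
- by move=> n w; have /andP[h0 h1] := cap1_itv (X_ n w - X w); rewrite ger0_norm.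
Qed.

Lemma pdist_L1 X Y : L1 P (fun w => X w - Y w) -> pdist X Y <= \int[P]_w `|X w - Y w|.
Proof.
move=> iXY; apply: le_Rintegral => //.
- apply: integrable_cap1; apply/measurable_EFinP; exact: measurable_int iXY.
- exact: (integrable_norm iXY).
- by move=> w _; exact: cap1_le.
Qed.

Lemma pdist_cos (t : R) X Y : measT X -> measT Y ->
  `|\int[P]_w cos (t * X w) - \int[P]_w cos (t * Y w)| <= 2 * (1 + `|t|) * pdist X Y /\
  `|\int[P]_w sin (t * X w) - \int[P]_w sin (t * Y w)| <= 2 * (1 + `|t|) * pdist X Y.
Proof.
move=> mX mY. have mXY : measT (fun w => X w - Y w) by exact: measurable_funB.
have it := integrable_cap1 mXY; have it2 := intZ (2 * (1 + `|t|)) it.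
have ib (f : R -> R) W : measT f -> (forall x, `|f x| <= 1) -> measT W -> L1 P (fun w => f (t * W w)).
  move=> mf f1 mW; apply: (integrable_bounded P 1) => //. by apply: measurableT_comp => //; exact: measurable_funM.
have tr w : 2 * cap1 (t * X w - t * Y w) <= 2 * (1 + `|t|) * cap1 (X w - Y w).
  by rewrite -mulrBr -mulrA ler_wpM2l// cap1M.
have key (f : R -> R) : measT f -> (forall x, `|f x| <= 1) -> (forall x y, `|f x - f y| <= 2 * cap1 (x - y)) ->
    `|\int[P]_w f (t * X w) - \int[P]_w f (t * Y w)| <= 2 * (1 + `|t|) * pdist X Y.
  move=> mf f1 fl. have i1 := ib f X mf f1 mX; have i2 := ib f Y mf f1 mY. rewrite -(RintB i1 i2) /pdist -(RintZ it).
  apply: (@le_normr_Rintegral_dominated _ _ _ P setT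
    (fun w => f (t * X w) - f (t * Y w)) (fun w => 2 * (1 + `|t|) * cap1 (X w - Y w))) => //.
  - by apply: measurable_funB; apply: measurableT_comp => //; exact: measurable_funM.
  - by move=> w _; apply: le_trans (fl _ _) (tr w).
split; apply: key.
- exact: measurable_cos.
- exact: norm_cos_le1.
- exact: cos_sub_cap1.
- exact: measurable_sin.
- exact: norm_sin_le1.
- exact: sin_sub_cap1.
Qed.

Variable S : set (Omega -> R).
Hypothesis S_gauss : forall X, S X -> exists V, centered_gaussian P X V.
Hypothesis S_lin : forall (a b : R) X Y, S X -> S Y -> S (fun w => a * X w + b * Y w).

(** The closure for convergence in probability: membership is easy to prove, and the Gaussian laws turn this
    convergence into convergence in mean square. *)
Definition gclos X := measT X /\ forall e : R, 0 < e -> exists2 Y, S Y & pdist X Y <= e.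

Let S_meas X : S X -> measT X.
Proof. by move=> /S_gauss[V []]. Qed.

Lemma gclos_base X : S X -> gclos X.
Proof.
move=> SX; split; first exact: S_meas. move=> e e0; exists X => //; apply: le_trans (ltW e0).
rewrite /pdist; under eq_Rintegral do rewrite subrr /cap1 normr0 min_r//. by rewrite Rintegral_probability_cst.
Qed.

Lemma gclos_lin (a b : R) X Y : gclos X -> gclos Y -> gclos (fun w => a * X w + b * Y w).
Proof.
move=> [mX HX] [mY HY]; split; first by apply: measurable_funD; exact: measurable_funM. move=> e e0.
have a0 : 0 < 1 + `|a| by rewrite ltr_pwDl. have b0 : 0 < 1 + `|b| by rewrite ltr_pwDl.
have ea : 0 < e / 2 / (1 + `|a|) by rewrite !divr_gt0. have eb : 0 < e / 2 / (1 + `|b|) by rewrite !divr_gt0.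
have [X' SX' dX] := HX _ ea; have [Y' SY' dY] := HY _ eb. exists (fun w => a * X' w + b * Y' w); first exact: S_lin.
apply: le_trans (pdistB_le a b mX (S_meas SX') mY (S_meas SY')) _.
have h1 : (1 + `|a|) * pdist X X' <= e / 2 by rewrite mulrC -ler_pdivlMr.
have h2 : (1 + `|b|) * pdist Y Y' <= e / 2 by rewrite mulrC -ler_pdivlMr. by rewrite [leRHS]splitr lerD.
Qed.

Lemma gclosB X Y : gclos X -> gclos Y -> gclos (fun w => X w - Y w).
Proof.
by move=> gX gY; have := gclos_lin 1 (-1) gX gY; under eq_fun do rewrite mul1r mulN1r.
Qed.

Lemma gclosZ (a : R) X : gclos X -> gclos (fun w => a * X w).
Proof.
by move=> gX; have := gclos_lin a 0 gX gX; under eq_fun do rewrite mul0r addr0.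
Qed.

Lemma gclosD X Y : gclos X -> gclos Y -> gclos (fun w => X w + Y w).
Proof.
by move=> gX gY; have := gclos_lin 1 1 gX gY; under eq_fun do rewrite !mul1r.
Qed.

Lemma gclos_cvg (X_ : nat -> Omega -> R) X : (forall n, gclos (X_ n)) -> measT X ->
  pdist (X_ n) X @[n --> \oo] --> 0 -> gclos X.
Proof.
move=> gX mX dX; split => // e e0. have e2 : 0 < e / 2 by rewrite divr_gt0.
move/cvgr0Pnorm_le : dX => /(_ _ e2)[N _ /(_ N (leqnn _)) HN]. have [Y SY dY] := (gX N).2 _ e2; exists Y => //.
apply: le_trans (pdist_triangle mX (S_meas SY) (gX N).1) _.
rewrite [leRHS]splitr lerD// pdistC; exact: le_trans (ler_norm _) HN.
Qed.

(** The characteristic function of X is close to 1 near 0, which bounds the variances of the approximations. *)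
Lemma gclos_gaussian X : gclos X -> exists V, centered_gaussian P X V.
Proof.
move=> [mX HX]. have [t t0 Ht] : exists2 t : R, 0 < t & 3 / 4 <= \int[P]_w cos (t * X w).
  have c1 : \int[P]_w cos (n.+1%:R^-1 * X w) @[n --> \oo] --> (1 : R).
    apply: (cvg_eqr (\int[P]_w 1)); last by rewrite Rintegral_probability_cst. apply: (Rintegral_bounded_cvg P 1).
    - by move=> n; exact: measurable_cosM.
    - move=> w; apply: (cvg_eqr (cos 0)); last exact: cos0. apply: (continuous_cvg _ (@continuous_cos R 0)).
      apply: (cvg_eqr (0 * X w)); last by rewrite mul0r. by apply: cvgM; [exact: cvg_harmonic|exact: cvg_cst].
    - by move=> n w; exact: norm_cos_le1.
  have q0 : (0 : R) < 1 / 4 by lra. move/cvgrPdist_le : c1 => /(_ _ q0)[N _ /(_ N (leqnn _)) HN].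
  exists N.+1%:R^-1; first by rewrite invr_gt0. by move: HN; rewrite /= ler_norml; move: (\int[P]_w _) => I; lra.
have tt0 : 0 < 2 * (1 + `|t|) by rewrite mulr_gt0// ltr_pwDl.
pose e n : R := Num.min (1 / 4 / (2 * (1 + `|t|))) n.+1%:R^-1.
have e0 n : 0 < e n by rewrite /e lt_min invr_gt0 ltr0n !divr_gt0.
have /choice[Y HY] n : exists Y, S Y /\ pdist X Y <= e n.
  by have [Y SY dY] := HX _ (e0 n); exists Y.
have /choice[v Hv] n : exists v, centered_gaussian P (Y n) v by exact: S_gauss (HY n).1.
have mY n : measT (Y n) by case: (Hv n). have vle n : v n <= 2 / t ^+ 2.
  have [_ v0 /(_ t)[ec _]] := Hv n. have [h _] := pdist_cos t mX (mY n).
  have d4 : 2 * (1 + `|t|) * pdist X (Y n) <= 1 / 4.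
    rewrite mulrC -ler_pdivlMr//; apply: le_trans (HY n).2 _. by rewrite /e ge_min lexx.
  have half : 1 / 2 <= expR (- (t ^+ 2 * v n / 2)).
    rewrite -ec; move: (le_trans h d4) Ht; rewrite ler_norml. by move: (\int[P]_w _) (\int[P]_w _) => I J; lra.
  have x0 : 0 <= t ^+ 2 * v n / 2 by rewrite divr_ge0// mulr_ge0// sqr_ge0. have : t ^+ 2 * v n / 2 <= 1.
    move: half x0; move: (t ^+ 2 * v n / 2) => x half x0.
    have := expR_ge1Dx x; have : expR x * expR (- x) = 1 by rewrite -expRD subrr expR0.
    have := expR_gt0 x; move: (expR x) (expR (- x)) half => p q hq p0 pq px.
    have : p * (1 / 2) <= p * q by rewrite ler_wpM2l// ltW. lra.
  rewrite ler_pdivlMr ?exprn_gt0// mulrC; lra.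
have cv (t' : R) : 2 * (1 + `|t'|) * pdist X (Y n) @[n --> \oo] --> 0.
  apply: (cvg_eqr (2 * (1 + `|t'|) * 0)); last by rewrite mulr0. apply: cvgM; first exact: cvg_cst.
  by apply: cvg0_harmonic => n; rewrite pdist_ge0 (le_trans (HY n).2)// /e ge_min lexx orbT.
have cc t' : \int[P]_w cos (t' * Y n w) @[n --> \oo] --> \int[P]_w cos (t' * X w).
  by apply: (cvg_dist_le _ _ (cv t')) => n; rewrite distrC; exact: (pdist_cos t' mX (mY n)).1.
have cs t' : \int[P]_w sin (t' * Y n w) @[n --> \oo] --> \int[P]_w sin (t' * X w).
  by apply: (cvg_dist_le _ _ (cv t')) => n; rewrite distrC; exact: (pdist_cos t' mX (mY n)).2.
have [V [gV _]] := centered_gaussian_cvg mX Hv vle cc cs. by exists V.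
Qed.

Lemma gclos_sqint X : gclos X -> sqint P X.
Proof.
move=> gX; have [V gV] := gclos_gaussian gX; split; first by case: gX. by have [] := centered_gaussian_variance gV.
Qed.

Lemma gclos_variance X : gclos X -> centered_gaussian P X (\int[P]_w X w ^+ 2).
Proof.
by move=> gX; have [V gV] := gclos_gaussian gX; have [_ ->] := centered_gaussian_variance gV.
Qed.

(** The variance is a continuous function of the value at 1 of the characteristic function. *)
Lemma gclos_sqr_cvg0 (X_ : nat -> Omega -> R) : (forall n, gclos (X_ n)) ->
  pdist (X_ n) (fun=> 0) @[n --> \oo] --> 0 -> \int[P]_w X_ n w ^+ 2 @[n --> \oo] --> 0.
Proof.
move=> gX dX. have cE n : \int[P]_w cos (1 * X_ n w) = expR (- (\int[P]_w X_ n w ^+ 2 / 2)).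
  by have [_ _ /(_ 1)[-> _]] := gclos_variance (gX n); rewrite expr1n mul1r.
have c1 : expR (- (\int[P]_w X_ n w ^+ 2 / 2)) @[n --> \oo] --> (1 : R).
  apply: (cvg_dist_le (fun n => 2 * (1 + `|1 : R|) * pdist (X_ n) (fun=> 0))).
    move=> n; have [+ _] := pdist_cos 1 (gX n).1 (measurable_cst (0 : R)); rewrite cE.
    by under [X in _ - X]eq_Rintegral do rewrite mulr0 cos0; rewrite Rintegral_probability_cst.
  apply: (cvg_eqr (2 * (1 + `|1 : R|) * 0)); last by rewrite mulr0. by apply: cvgM => //; exact: cvg_cst.
have c2 : ln (expR (- (\int[P]_w X_ n w ^+ 2 / 2))) @[n --> \oo] --> (0 : R).
  rewrite -(@ln1 R); apply: (continuous_cvg _ (continuous_ln _) c1) => //; exact: ltr01.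
have -> : (fun n => \int[P]_w X_ n w ^+ 2) = (fun n => -2 * ln (expR (- (\int[P]_w X_ n w ^+ 2 / 2)))).
  by apply/funext => n; rewrite expRK; field.
apply: (cvg_eqr (-2 * 0)); last by rewrite mulr0. by apply: cvgM => //; exact: cvg_cst.
Qed.

Lemma gclos_L2 (X_ : nat -> Omega -> R) X : (forall n, gclos (X_ n)) -> gclos X ->
  pdist (X_ n) X @[n --> \oo] --> 0 -> \int[P]_w (X_ n w - X w) ^+ 2 @[n --> \oo] --> 0.
Proof.
move=> gX_ gX dX; apply: (@gclos_sqr_cvg0 (fun n w => X_ n w - X w)).
  by move=> n; exact: gclosB.
by have -> : (fun n => pdist (fun w => X_ n w - X w) (fun=> 0)) = (fun n => pdist (X_ n) X);
  first by apply/funext => n; apply: eq_Rintegral => w _; rewrite subr0.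
Qed.

Lemma gclos_pointwise (X_ : nat -> Omega -> R) X : (forall n, gclos (X_ n)) ->
  measT X -> (forall w, X_ n w @[n --> \oo] --> X w) -> gclos X /\ \int[P]_w (X_ n w - X w) ^+ 2 @[n --> \oo] --> 0.
Proof.
move=> gX mX cX. have dX := pdist_pointwise (fun n => (gX n).1) mX cX.
have gX' := gclos_cvg gX mX dX; split => //; exact: gclos_L2.
Qed.

End gaussian_space.

(** * Smooth approximations of the normalised indicator *)

Section flat_functions.
Context {R : realType}.
Implicit Types (x h : R).

(** The functions x^(-k) exp (-1/x), extended by 0. Their span contains all derivatives of exp (-1/x). *)
Definition flat k x : R := if 0 < x then x^-1 ^+ k * expR (- x^-1) else 0.

Lemma flat_ge0 k x : 0 <= flat k x.
Proof.
rewrite /flat; case: ifP => // x0. by rewrite mulr_ge0 ?expR_ge0// exprn_ge0// invr_ge0 ltW.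
Qed.

Lemma flat_le k x : flat k x <= k%:R ^+ k.
Proof.
rewrite /flat; case: ifP => x0; last exact: exprn_ge0. rewrite expRN ler_pdivrMr ?expR_gt0//; apply: exprn_le_expR.
by rewrite invr_ge0 ltW.
Qed.

Lemma flat_mul k j x : 0 < x -> flat (k + j) x = x^-1 ^+ j * flat k x.
Proof. by move=> x0; rewrite /flat x0 exprD; ring. Qed.

Lemma flat_le_sqr k x : flat k x <= (k + 2)%:R ^+ (k + 2) * x ^+ 2.
Proof.
case: (ltP 0 x) => x0; last first.
  by rewrite /flat ltNge x0 /= mulr_ge0 ?sqr_ge0// exprn_ge0.
have := flat_le (k + 2) x; rewrite flat_mul// exprVn mulrC ler_pdivrMr// exprn_gt0//.
Qed.

Lemma flat0 k x : x <= 0 -> flat k x = 0.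
Proof. by rewrite /flat ltNge => ->. Qed.

Lemma is_derive_funX (f : R -> R) n x (a : R) : is_derive x 1 f a ->
  is_derive x 1 (fun y => f y ^+ n) (n%:R * f x ^+ n.-1 * a).
Proof.
move=> df; elim: n => [|n IH].
  have -> : (fun y => f y ^+ 0) = cst 1 by apply/funext => y; rewrite expr0.
  by rewrite !mul0r; exact: (is_derive_cst (1 : R) x 1).
under eq_fun do rewrite exprS; apply: is_derive_eq (is_derive_funM df IH) _.
case: n {IH} => [|n]; first by rewrite !expr0; ring. by rewrite -[n.+2%:R]natr1 !exprS /=; ring.
Qed.

Lemma is_derive_flat k x : is_derive x 1 (flat k) (- k%:R * flat k.+1 x + flat k.+2 x).
Proof.
case: (ltrgtP x 0) => x0.
- rewrite !flat0 ?(ltW x0)// mulr0 addr0. have e : \near x, 0 = flat k x.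
    by near=> y; rewrite flat0//; apply: ltW; near: y; exact: lt_nbhsl.
  by apply: near_eq_is_derive e _; exact: (is_derive_cst 0 x 1).
- have e : \near x, x^-1 ^+ k * expR (- x^-1) = flat k x.
    near=> y; rewrite /flat ifT//; near: y; exact: lt_nbhsr.
  apply: near_eq_is_derive e _. have dV : is_derive x 1 (fun y : R => y^-1) (- x ^- 2).
    have := @is_deriveV R id x 1 1 (lt0r_neq0 x0) (is_derive_id x 1). by rewrite /GRing.scale /= mulr1.
  have dN : is_derive x 1 (fun y : R => expR (- y^-1)) (expR (- x^-1) * x ^- 2).
    have h : is_derive x 1 (fun y : R => - y^-1) (x ^- 2) by have := is_deriveN dV; rewrite opprK.
    exact: (@is_derive1_comp R (@expR R) (fun y : R => - y^-1) x _ _ (is_derive_expR (- x^-1)) h).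
  have dX : is_derive x 1 (fun y : R => y^-1 ^+ k) (k%:R * x^-1 ^+ k.-1 * (- x ^- 2)).
    exact: is_derive_funX dV.
  apply: is_derive_eq (is_derive_funM dX dN) _.
  rewrite /flat x0 -exprVn; move=> {dX}; case: k => [|k]; first by rewrite !mul0r oppr0 mul0r; ring.
  by rewrite /= !exprS; ring.
- rewrite x0 !flat0// mulr0 addr0. apply: (@is_derive_quadratic _ _ _ _ ((k + 2)%:R ^+ (k + 2))) => h.
  rewrite mulr0 add0r (@flat0 k 0)// !subr0 ger0_norm ?flat_ge0//; exact: flat_le_sqr.
Unshelve. all: by end_near. Qed.

Variables (eps m : R).

(** The products flat_i (m x) flat_j (m (eps - x)) span a space stable under derivation; a list of coefficients
    and exponents encodes one of its elements. *)
Definition two_flat (p : R * (nat * nat)) x : R := p.1 * (flat p.2.1 (m * x + 0) * flat p.2.2 (- m * x + m * eps)).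

Definition two_flats (l : seq (R * (nat * nat))) x : R := \sum_(p <- l) two_flat p x.

Definition two_flat_derive (p : R * (nat * nat)) : seq (R * (nat * nat)) :=
  [:: (- p.2.1%:R * m * p.1, (p.2.1.+1, p.2.2)); (m * p.1, (p.2.1.+2, p.2.2));
      (p.2.2%:R * m * p.1, (p.2.1, p.2.2.+1)); (- m * p.1, (p.2.1, p.2.2.+2))].

Lemma is_derive_two_flat p x : is_derive x 1 (two_flat p) (two_flats (two_flat_derive p) x).
Proof.
case: p => a [i j].
have d1 : is_derive x 1 (fun x => flat i (m * x + 0)) ((- i%:R * flat i.+1 (m * x + 0) + flat i.+2 (m * x + 0)) * m).
  exact: (@is_derive1_comp R (flat i) (fun y => m * y + 0) x _ _ (is_derive_flat _ _) (is_derive_affine _ _ _)).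
have d2 : is_derive x 1 (fun x => flat j (- m * x + m * eps))
    ((- j%:R * flat j.+1 (- m * x + m * eps) + flat j.+2 (- m * x + m * eps)) * - m).
  exact: (@is_derive1_comp R (flat j) (fun y => - m * y + m * eps) x _ _ (is_derive_flat _ _) (is_derive_affine _ _ _)).
apply: is_derive_eq (is_derive_funZ a (is_derive_funM d1 d2)) _.
rewrite /two_flats !big_cons big_nil /two_flat /=; ring.
Qed.

Lemma is_derive_two_flats l x : is_derive x 1 (two_flats l) (two_flats (flatten (map two_flat_derive l)) x).
Proof.
elim: l => [|p l IH].
  have -> : two_flats [::] = cst 0 by apply/funext => y; rewrite /two_flats big_nil. exact: (is_derive_cst 0 x 1).
have -> : two_flats (p :: l) = (fun y => two_flat p y + two_flats l y).
  by apply/funext => y; rewrite /two_flats big_cons.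
apply: is_derive_eq (is_derive_funD (is_derive_two_flat p x) IH) _.
rewrite map_cons (_ : flatten (two_flat_derive p :: _) =
  two_flat_derive p ++ flatten [seq two_flat_derive i | i <- l])//.
by rewrite [RHS]big_cat.
Qed.

Lemma two_flats_le l : exists C : R, forall x, `|two_flats l x| <= C.
Proof.
elim: l => [|p l [C HC]].
  by exists 0 => x; rewrite /two_flats big_nil normr0.
exists (`|p.1| * (p.2.1%:R ^+ p.2.1 * p.2.2%:R ^+ p.2.2) + C) => x.
rewrite /two_flats big_cons (le_trans (ler_normD _ _))// lerD//; last exact: HC.
rewrite /two_flat normrM ler_wpM2l// ger0_norm ?mulr_ge0 ?flat_ge0//. by apply: ler_pM; rewrite ?flat_ge0// flat_le.
Qed.

Hypothesis m0 : 0 < m.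
Hypothesis eps0 : 0 < eps.

Lemma two_flats_out l x : ~~ (0 < x < eps) -> two_flats l x = 0.
Proof.
move=> nx; rewrite /two_flats big1// => p _; rewrite /two_flat. case: (ltP 0 x) nx => [x0 /=|x0 _].
  rewrite -leNgt => ex; rewrite (@flat0 p.2.2) ?mulr0//. by rewrite mulNr addrC -mulrBr pmulr_rle0// subr_le0.
by rewrite flat0 ?mul0r ?mulr0// addr0 pmulr_rle0.
Qed.

Lemma two_flats_schwartz l : is_schwartz (two_flats l).
Proof.
pose g n := two_flats (iter n (fun l => flatten (map two_flat_derive l)) l).
have gd n x : is_derive x 1 (g n) (g n.+1 x) by exact: is_derive_two_flats.
pose B n := sval (cid (two_flats_le (iter n (fun l => flatten (map two_flat_derive l)) l))).
have gB n x : `|g n x| <= B n by rewrite /B; case: (cid _) => C /= HC; exact: HC.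
have [] // := @taylor_chain_schwartz _ g (fun n => B n.+2) (fun k n => (1 + eps) ^+ k * B n).
  move=> n x h. by apply: (@taylor1_le R (g n) (g n.+1) (g n.+2) (B n.+2) x h (gd n) (gd n.+1)) => y _; exact: gB.
move=> k n x; have B0 : 0 <= B n by exact: le_trans (gB n 0). have [/andP[x0 xe]|nx] := boolP (0 < x < eps).
  apply: ler_pM => //. by rewrite lerXn2r ?nnegrE ?addr_ge0 ?(ltW eps0)// lerD2l gtr0_norm ?ltW.
by rewrite /g two_flats_out// normr0 mulr0 mulr_ge0// exprn_ge0// addr_ge0// ltW.
Qed.

Definition bump_schwartz : schwartz R := Schwartz (asboolT (two_flats_schwartz [:: (eps^-1, (0%N, 0%N))])).

Lemma bumpE x : bump_schwartz x = eps^-1 * (flat 0 (m * x) * flat 0 (m * (eps - x))).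
Proof.
rewrite /= /two_flats big_seq1 /two_flat /= addr0; congr (_ * (_ * flat _ _)); ring.
Qed.

Lemma bump_bounds x : 0 <= bump_schwartz x <= i_eps eps x.
Proof.
have [/andP[x0 xe]|nx] := boolP (0 < x < eps).
  have e1 : 0 <= eps^-1 by rewrite invr_ge0 ltW. rewrite bumpE /i_eps indicE mem_set/= ?in_itv/= ?x0 ?(ltW xe)// mulr1.
  rewrite mulr_ge0 ?mulr_ge0 ?flat_ge0//= ler_piMr//.
  by have := flat_le 0 (m * x); have := flat_le 0 (m * (eps - x)); rewrite !expr0 => h1 h2; rewrite mulr_ile1 ?flat_ge0.
rewrite /= two_flats_out// lexx /= /i_eps mulr_ge0 ?invr_ge0 ?(ltW eps0)//.
Qed.

End flat_functions.

Section mollifier.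
Context {R : realType}.
Local Notation mu := (@lebesgue_measure R).
Variable eps : R.
Hypothesis eps0 : 0 < eps.

Lemma flat_cvg1 (x : R) : 0 < x -> flat 0 (n.+1%:R * x) @[n --> \oo] --> (1 : R).
Proof.
move=> x0; have -> : (fun n => flat 0 (n.+1%:R * x)) = (fun n => expR (- (n.+1%:R^-1 * x^-1))).
  by apply/funext => n; rewrite /flat mulr_gt0// expr0 mul1r invfM.
apply: (cvg_eqr (expR (- (0 * x^-1)))); last by rewrite mul0r oppr0 expR0.
apply: (continuous_cvg _ (@continuous_expR R _)); apply: cvgN. by apply: cvgM; [exact: cvg_harmonic|exact: cvg_cst].
Qed.

Let I := `]0, eps[%classic : set R.

Lemma mollifier_integral (f : R -> R) C : measT f -> (forall x, `|f x| <= C) ->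
  (forall x, ~~ (0 < x <= eps) -> f x = 0) -> L1 mu f /\ \int[mu]_x f x = \int[mu]_(x in I) f x.
Proof.
move=> mf fC f0. have mI := measurable_itvR `]0, eps]. have iC : mu.-integrable `]0, eps] (EFin \o (fun _ : R => C)).
  apply: (@integrableS _ _ _ mu `[0, eps]%classic) => //; first exact: subset_itv_oc_cc.
  by apply: integrable_itv_continuous; exact: cst_continuous.
have ifI : mu.-integrable `]0, eps] (EFin \o f).
  apply: (integrable_dominated mu (fun=> C)) => //; exact: measurable_funTS.
have e : f = f \_ `]0, eps].
  apply/funext => x; rewrite patchE; case: ifPn => // nx; apply: f0.
  by move: nx; rewrite notin_setE /= in_itv/= => /negP.
split.
  rewrite e; have := (@integrable_mkcond _ _ _ mu _ (EFin \o f) mI).1 ifI. by rewrite restrict_EFin.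
rewrite [in LHS]e -Rintegral_mkcond /I Rintegral_itv_bndo_bndc//. apply: integrableS ifI => //; exact: subset_itv_oo_oc.
Qed.

Definition mollifier (eta : R) (u : schwartz R) := [/\ forall x, 0 <= u x <= i_eps eps x,
      \int[mu]_x (u x - i_eps eps x) ^+ 2 <= eta & 1 - eta <= \int[mu]_x u x <= 1].

Lemma measurable_i_eps : measT (i_eps eps).
Proof. by apply: measurable_funM => //; apply: measurable_indic; exact: measurable_itv. Qed.

Lemma i_eps_bounds x : 0 <= i_eps eps x <= eps^-1.
Proof.
rewrite /i_eps indicE; have h : 0 <= eps^-1 by rewrite invr_ge0 ltW. by case: (_ \in _); rewrite ?mulr1 ?mulr0 h lexx.
Qed.

Lemma i_eps_out x : ~~ (0 < x <= eps) -> i_eps eps x = 0.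
Proof.
move=> nx; rewrite /i_eps indicE memNset ?mulr0//= in_itv/=; exact/negP.
Qed.

Lemma i_eps_integral : L1 mu (i_eps eps) /\ \int[mu]_x i_eps eps x = 1.
Proof.
have bd x : `|i_eps eps x| <= eps^-1 by have /andP[h1 h2] := i_eps_bounds x; rewrite ger0_norm.
have [h1 h2] := mollifier_integral measurable_i_eps bd i_eps_out; split => //; rewrite h2.
have mI : measurable (I : set (measurableTypeR R)) by exact: measurable_itv. transitivity (\int[mu]_(x in I) eps^-1).
  apply: eq_Rintegral => x; rewrite inE /I /= in_itv/= => /andP[x0 xe].
  by rewrite /i_eps indicE mem_set/= ?in_itv/= ?x0 ?(ltW xe)// mulr1.
rewrite (@Rintegral_cst _ _ _ mu _ mI). have := @lebesgue_measure_itv R `]0, eps[; rewrite /= lte_fin eps0 => ->.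
by rewrite -EFinD /= subr0 mulVf// gt_eqF.
Qed.

(** The function exp (-1/(m x)) exp (-1/(m (eps - x))) tends to 1 on ]0, eps[ as m grows. *)
Lemma mollifier_exists eta : 0 < eta -> exists u, mollifier eta u.
Proof.
move=> eta0. pose f n : schwartz R := bump_schwartz (ltr0Sn R n) eps0.
have fb n x : 0 <= f n x <= i_eps eps x by exact: bump_bounds.
have mf n : measT (f n : R -> R) by exact: (measurable_schwartz (f n) 0).
have fout n x : ~~ (0 < x <= eps) -> f n x = 0.
  move=> /i_eps_out e; apply/eqP; rewrite eq_le; have := fb n x; rewrite e => /andP[-> ->] //.
have fle n x : `|f n x| <= eps^-1.
  have /andP[h1 h2] := fb n x; rewrite ger0_norm//. by apply: le_trans h2 _; have /andP[] := i_eps_bounds x.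
have fc x : I x -> f n x @[n --> \oo] --> i_eps eps x.
  rewrite /I /= in_itv/= => /andP[x0 xe].
  have -> : (fun n => f n x) = (fun n => eps^-1 * (flat 0 (n.+1%:R * x) * flat 0 (n.+1%:R * (eps - x)))).
    by apply/funext => n; exact: bumpE.
  apply: (cvg_eqr (eps^-1 * (1 * 1))).
    apply: cvgM; first exact: cvg_cst. by apply: cvgM; apply: flat_cvg1; rewrite ?subr_gt0.
  by rewrite /i_eps indicE mem_set/= ?in_itv/= ?x0 ?(ltW xe)// !mulr1.
have mI : measurable (I : set (measurableTypeR R)) by exact: measurable_itv.
have iC (C : R) : mu.-integrable I (EFin \o (fun _ : R => C)).
  apply: (@integrableS _ _ _ mu `[0, eps]%classic) => //; first exact: subset_itv_oo_cc.
  by apply: integrable_itv_continuous; exact: cst_continuous.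
have c1 : \int[mu]_x f n x @[n --> \oo] --> (1 : R).
  have -> : (fun n => \int[mu]_x f n x) = (fun n => \int[mu]_(x in I) f n x).
    by apply/funext => n; exact: (mollifier_integral (mf n) (fle n) (fout n)).2.
  have bd x : `|i_eps eps x| <= eps^-1 by have /andP[h1 h2] := i_eps_bounds x; rewrite ger0_norm.
  rewrite -i_eps_integral.2 (mollifier_integral measurable_i_eps bd i_eps_out).2.
  have [] // := @Rintegral_dominated_cvg _ _ _ mu I (fun n => f n : R -> R) (i_eps eps) (fun=> eps^-1) mI.
  by move=> n; apply: measurable_funTS; exact: mf.
pose g n x := (f n x - i_eps eps x) ^+ 2. have mg n : measT (g n).
  by apply: measurable_funX; apply: measurable_funB => //; exact: measurable_i_eps.
have gle n x : `|g n x| <= eps^-1 ^+ 2.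
  have /andP[h1 h2] := fb n x; have /andP[h3 h4] := i_eps_bounds x.
  rewrite ger0_norm ?sqr_ge0// /g -sqrrN opprB lerXn2r// ?nnegrE ?subr_ge0//; last by lra. by rewrite invr_ge0 ltW.
have gout n x : ~~ (0 < x <= eps) -> g n x = 0.
  by move=> nx; rewrite /g fout// i_eps_out// subrr expr0n.
have c2 : \int[mu]_x g n x @[n --> \oo] --> (0 : R).
  have -> : (fun n => \int[mu]_x g n x) = (fun n => \int[mu]_(x in I) g n x).
    by apply/funext => n; exact: (mollifier_integral (mg n) (gle n) (gout n)).2.
  have mgI n : measurable_fun I (g n) by apply: measurable_funTS; exact: mg.
  have gc x : I x -> g n x @[n --> \oo] --> (0 : R).
    move=> Ix; apply: (cvg_eqr ((i_eps eps x - i_eps eps x) * (i_eps eps x - i_eps eps x))); last by rewrite subrr mulr0.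
    by apply: cvgM; (apply: cvgB; [exact: fc|exact: cvg_cst]).
  have [_] := @Rintegral_dominated_cvg _ _ _ mu I g (fun=> 0) (fun=> eps^-1 ^+ 2) mI mgI gc (iC _) (fun n x _ => gle n x).
  by rewrite (@Rintegral_cst _ _ _ mu _ mI) mul0r.
have [N [N1 N2]] : exists N, `|1 - \int[mu]_x f N x| <= eta /\ `|\int[mu]_x g N x| <= eta.
  move/cvgrPdist_le : c1 => /(_ _ eta0)[N1 _ H1]. move/cvgr0Pnorm_le : c2 => /(_ _ eta0)[N2 _ H2].
  by exists (maxn N1 N2); split; [apply: H1|apply: H2]; rewrite /= ?leq_maxl ?leq_maxr.
exists (f N); split.
- exact: fb.
- exact: le_trans (ler_norm _) N2.
- apply/andP; split; first by move: N1; rewrite ler_norml => /andP[_]; lra.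
  rewrite -i_eps_integral.2; apply: le_Rintegral => //.
  + exact: (mollifier_integral (mf N) (fle N) (fout N)).1.
  + exact: i_eps_integral.1.
  + by move=> x _; have /andP[] := fb N x.
Qed.

End mollifier.

(** * The heat kernel near the diagonal *)

Section heat_kernel.
Context {R : realType}.
Variable v : R.
Local Notation mu := (@lebesgue_measure R).
Local Notation heat := (heat v).
Implicit Types (u phi psi : schwartz R) (r x z : R).

Lemma integrable_schwartz u : L1 mu (u : R -> R).
Proof.
have [iq _] := @integrable_inv_oneDsqr R. have iq' := intZ (wnorm 2 0 u) iq.
apply: (integrable_dominated mu (fun x => wnorm 2 0 u * (1 + x ^+ 2)^-1)) => //.
  exact: (measurable_schwartz u 0).
move=> x _; rewrite ler_pdivlMr; last by rewrite ltr_pwDl// sqr_ge0.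
apply: le_trans (wnorm_ub 2 0 u x); rewrite mulrC ler_wpM2r//.
have -> : x ^+ 2 = `|x| ^+ 2 by rewrite -normrX ger0_norm ?sqr_ge0.
by rewrite sqrrD expr1n mul1r addrAC lerDl mulrn_wge0.
Qed.

Lemma normal_peak_sqrt r : 0 < r -> normal_peak (Num.sqrt r) = (Num.sqrt (pi *+ 2))^-1 * (Num.sqrt r)^-1.
Proof.
move=> r0; rewrite /normal_peak sqr_sqrtr ?(ltW r0)// -invfM; congr (_^-1).
by rewrite -mulrnAr mulrC sqrtrM// mulrn_wge0// pi_ge0.
Qed.

Lemma normal_pdf_affine (m s y : R) : 0 < s -> normal_pdf m s (s * y + m) * s = normal_pdf 0 1 y.
Proof.
move=> s0; have sn0 : s != 0 by rewrite gt_eqF. rewrite !normal_pdfE ?oner_neq0// /normal_fun.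
have -> : normal_peak s = normal_peak 1 * s^-1.
  rewrite /normal_peak expr1n mul1r -invfM; congr (_^-1).
  by rewrite -mulrnAr sqrtrM ?sqr_ge0// sqrtr_sqr gtr0_norm// mulrC.
have -> : - (s * y + m - m) ^+ 2 / (s ^+ 2 *+ 2) = - (y - 0) ^+ 2 / (1 ^+ 2 *+ 2).
  by rewrite -(mulr_natr (s ^+ 2)) -(mulr_natr (1 ^+ 2)); field.
by rewrite mulrAC mulfVK.
Qed.

Lemma heat_kernel r psi x : 0 < r -> (forall z, 0 <= psi z) ->
  heat r psi x = \int[mu]_z (psi z * normal_pdf (x - v * r) (Num.sqrt r) z).
Proof.
move=> r0 psi0; have s0 : 0 < Num.sqrt r by rewrite sqrtr_gt0. set m := x - v * r; set s := Num.sqrt r in s0 *.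
have sn0 : s != 0 by rewrite gt_eqF. pose F : R -> R := fun y : R => s * y + m; pose G z := psi z * normal_pdf m s z.
have dF (y : R) : is_derive y 1 F s by exact: is_derive_affine.
have F' : F^`()%classic = cst s by apply/funext => y; exact: is_derive_derive1. have cG : continuous G.
  move=> z; apply: cvgM; first exact: (@continuous_schwartz R psi 0 z). exact: continuous_normal_pdf.
have G0 z : 0 <= G z by rewrite mulr_ge0// normal_pdf_ge0.
have -> : \int[mu]_z G z = \int[mu]_y ((G \o F) * F^`()%classic) y.
  rewrite /Rintegral (@increasing_ge0_integration_by_substitutionT R F G)//.
  - by move=> y1 y2 y12; rewrite /F ltrD2r ltr_pM2l.
  - by rewrite F'; exact: cst_continuous.
  - by rewrite F'; apply/cvg_ex; exists s; exact: cvg_cst.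
  - by rewrite F'; apply/cvg_ex; exists s; exact: cvg_cst.
  - apply/cvgrNyPle => A; exists ((A - m) / s); split => [|y]; first exact: num_real.
    by rewrite ltr_pdivlMr// mulrC -lerBrDr => /ltW.
  - apply/cvgryPge => A; exists ((A - m) / s); split => [|y]; first exact: num_real.
    by rewrite ltr_pdivrMr// mulrC -lerBlDr => /ltW.
rewrite -[LHS]/(derive1n 0 (heat r psi) x) heatE ?(ltW r0)// /heat_fun.
rewrite (Rintegral_normal_prob (integrable_heat_integrand v psi 0 r x)). apply: eq_Rintegral => y _; rewrite F'.
change (psi (x + heat_shift v r y) * normal_pdf 0 1 y = psi (F y) * normal_pdf m s (F y) * s). rewrite /F.
have -> : x + heat_shift v r y = s * y + m by rewrite /heat_shift /m /s; ring. rewrite -[RHS]mulrA; congr (_ * _).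
by rewrite normal_pdf_affine.
Qed.

Lemma heat_ge0 r psi x : 0 < r -> (forall z, 0 <= psi z) -> 0 <= heat r psi x.
Proof.
move=> r0 psi0; rewrite heat_kernel//; apply: Rintegral_ge0 => z _. by rewrite mulr_ge0// normal_pdf_ge0.
Qed.

Lemma integrable_mul_pdf r psi m : 0 < r -> (forall z, 0 <= psi z) ->
  L1 mu (fun z => psi z * normal_pdf m (Num.sqrt r) z).
Proof.
move=> r0 psi0; have s0 : Num.sqrt r != 0 by rewrite gt_eqF// sqrtr_gt0.
have ip' := intZ (normal_peak (Num.sqrt r)) (integrable_schwartz psi).
apply: (integrable_dominated mu (fun z => normal_peak (Num.sqrt r) * psi z)) => //.
  apply: measurable_funM; first exact: (measurable_schwartz psi 0). exact: measurable_normal_pdf.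
move=> z _; rewrite ger0_norm ?mulr_ge0 ?normal_pdf_ge0// mulrC ler_wpM2r//. exact: normal_pdf_ub.
Qed.

Lemma heat_le_peak r psi x : 0 < r -> (forall z, 0 <= psi z) ->
  heat r psi x <= normal_peak (Num.sqrt r) * \int[mu]_z psi z.
Proof.
move=> r0 psi0; have s0 : Num.sqrt r != 0 by rewrite gt_eqF// sqrtr_gt0.
rewrite heat_kernel// -(RintZ (integrable_schwartz psi)). apply: le_Rintegral => //; first exact: integrable_mul_pdf.
  by have := intZ (normal_peak (Num.sqrt r)) (integrable_schwartz psi).
by move=> z _; rewrite mulrC ler_wpM2r//; exact: normal_pdf_ub.
Qed.

Lemma integrable_ip phi psi : L1 mu (fun x => phi x * psi x).
Proof. exact: (integrable_schwartz_product phi psi 0 0). Qed.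

(** A normal density of variance r is at most (2 pi r)^(-1/2). *)
Lemma ip_heat_bounds r phi psi : 0 < r -> (forall z, 0 <= phi z) -> (forall z, 0 <= psi z) ->
  \int[mu]_z phi z <= 1 -> \int[mu]_z psi z <= 1 -> 0 <= ip phi (heat r psi) <= normal_peak (Num.sqrt r).
Proof.
move=> r0 phi0 psi0 phi1 psi1; apply/andP; split.
  by apply: Rintegral_ge0 => x _; rewrite mulr_ge0// heat_ge0.
have p0 : 0 <= normal_peak (Num.sqrt r) by exact: normal_peak_ge0. have b x : heat r psi x <= normal_peak (Num.sqrt r).
  by apply: le_trans (heat_le_peak x r0 psi0) _; rewrite ler_piMr.
apply: (@le_trans _ _ (\int[mu]_x (normal_peak (Num.sqrt r) * phi x))).
  apply: le_Rintegral => //; first exact: integrable_ip.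
    by have := intZ (normal_peak (Num.sqrt r)) (integrable_schwartz phi).
  by move=> x _; rewrite [leRHS]mulrC ler_wpM2l.
by rewrite (RintZ (integrable_schwartz phi)) ler_piMr.
Qed.

(** The kernel of S_r on the diagonal. *)
Definition return_density r : R := normal_pdf 0 (Num.sqrt r) (v * r).

Lemma return_densityE r : 0 < r ->
  return_density r = (Num.sqrt (pi *+ 2))^-1 * (Num.sqrt r)^-1 * expR (- (v ^+ 2 * r / 2)).
Proof.
move=> r0; rewrite /return_density normal_pdfE ?gt_eqF ?sqrtr_gt0//.
rewrite normal_peak_sqrt// /normal_fun subr0 sqr_sqrtr ?(ltW r0)//.
congr (_ * expR _); rewrite -mulr_natr; field; by rewrite gt_eqF.
Qed.

Lemma mollifier_supp eps eta u x : mollifier eps eta u -> u x != 0 -> 0 < x <= eps.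
Proof.
move=> [ub _ _]; apply: contraNT => nx; have := ub x; rewrite i_eps_out// => h. by rewrite eq_le andbC.
Qed.

Lemma mollifier_ge0 eps eta u x : mollifier eps eta u -> 0 <= u x.
Proof. by move=> [ub _ _]; have /andP[] := ub x. Qed.

Lemma mollifier_le1 eps eta u : mollifier eps eta u -> \int[mu]_x u x <= 1.
Proof. by move=> [_ _ /andP[]]. Qed.

(** On the supports of phi and psi the kernel is evaluated at distance less than dl from the diagonal. *)
Lemma ip_heat_near r phi psi (e1 e2 n1 n2 dl eta : R) : 0 < r -> mollifier e1 n1 phi -> mollifier e2 n2 psi ->
  e1 < dl -> e2 < dl -> 0 <= eta ->
  (forall y, `|v * r - y| < dl -> `|normal_pdf 0 (Num.sqrt r) (v * r) - normal_pdf 0 (Num.sqrt r) y| <= eta) ->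
  `|ip phi (heat r psi) - return_density r * (\int[mu]_x phi x * \int[mu]_x psi x)| <= eta.
Proof.
move=> r0 bphi bpsi e1d e2d eta0 Hq.
have phi0 x : 0 <= phi x := mollifier_ge0 x bphi; have psi0 x : 0 <= psi x := mollifier_ge0 x bpsi.
have s0 : Num.sqrt r != 0 by rewrite gt_eqF// sqrtr_gt0. have B0 : 0 <= \int[mu]_x psi x by apply: Rintegral_ge0.
have A0 : 0 <= \int[mu]_x phi x by apply: Rintegral_ge0.
have heat_near x : phi x != 0 -> `|heat r psi x - return_density r * \int[mu]_x psi x| <= eta.
  move=> px; have /andP[x0 xe] := mollifier_supp bphi px. have i1 := integrable_mul_pdf (x - v * r) r0 psi0.
  have i2 := intZ (return_density r) (integrable_schwartz psi). have i3 := intZ eta (integrable_schwartz psi).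
  rewrite heat_kernel// -(RintZ (integrable_schwartz psi)).
  rewrite -(RintB i1 i2). apply: (@le_trans _ _ (\int[mu]_z (eta * psi z))); last first.
    rewrite (RintZ (integrable_schwartz psi)) ler_piMr//; exact: mollifier_le1 bpsi.
  apply: (@le_normr_Rintegral_dominated _ _ _ mu setT _ (fun z => eta * psi z)) => //.
    by apply/measurable_EFinP; apply: measurable_int (intB i1 i2).
  move=> z _; rewrite mulrC -mulrBl normrM (ger0_norm (psi0 z)).
  have [->|pz] := eqVneq (psi z) 0; first by rewrite !mulr0. have /andP[z0 ze] := mollifier_supp bpsi pz.
  rewrite ler_wpM2r// distrC (_ : normal_pdf (x - v * r) _ z = normal_pdf 0 (Num.sqrt r) (z - (x - v * r))).
    apply: Hq; rewrite ltr_norml; apply/andP; split; lra.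
  by rewrite !normal_pdfE// /normal_fun subr0.
have iphi := integrable_schwartz phi. have i2 := intZ (return_density r * \int[mu]_x psi x) iphi.
have i3 := intZ eta iphi. have -> : return_density r * (\int[mu]_x phi x * \int[mu]_x psi x) =
    \int[mu]_x (return_density r * \int[mu]_x psi x * phi x).
  by rewrite (RintZ iphi); ring.
rewrite /ip -(RintB (integrable_ip phi (heat r psi)) i2). apply: (@le_trans _ _ (\int[mu]_z (eta * phi z))); last first.
  rewrite (RintZ iphi) ler_piMr//; exact: mollifier_le1 bphi.
apply: (@le_normr_Rintegral_dominated _ _ _ mu setT _ (fun z => eta * phi z)) => //.
  by apply/measurable_EFinP; apply: measurable_int (intB (integrable_ip phi (heat r psi)) i2).
move=> x _; rewrite mulrC -mulrBl normrM (ger0_norm (phi0 x)).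
have [->|px] := eqVneq (phi x) 0; first by rewrite !mulr0. by rewrite ler_wpM2r//; exact: heat_near.
Qed.

Lemma ip_heat_cvg r (phi psi : nat -> schwartz R) (e1 e2 n1 n2 : nat -> R) : 0 < r ->
  (forall n, mollifier (e1 n) (n1 n) (phi n)) -> (forall n, mollifier (e2 n) (n2 n) (psi n)) ->
  e1 n @[n --> \oo] --> 0 -> e2 n @[n --> \oo] --> 0 -> n1 n @[n --> \oo] --> 0 -> n2 n @[n --> \oo] --> 0 ->
  ip (phi n) (heat r (psi n)) @[n --> \oo] --> return_density r.
Proof.
move=> r0 bphi bpsi e10 e20 n10 n20.
have mass (f : nat -> schwartz R) (e n : nat -> R) : (forall k, mollifier (e k) (n k) (f k)) ->
    n k @[k --> \oo] --> 0 -> \int[mu]_x f k x @[k --> \oo] --> (1 : R).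
  move=> bf n0; apply: cvg_dist_le _ n0 => k. by have [_ _ /andP[h1 h2]] := bf k; rewrite ler_norml; lra.
have c1 := mass _ _ _ bphi n10; have c2 := mass _ _ _ bpsi n20.
have c3 : return_density r * (\int[mu]_x phi k x * \int[mu]_x psi k x) @[k --> \oo] --> return_density r.
  apply: (cvg_eqr (return_density r * (1 * 1))); last by rewrite !mulr1. by apply: cvgM; [exact: cvg_cst|exact: cvgM].
have c4 : ip (phi k) (heat r (psi k)) - return_density r * (\int[mu]_x phi k x * \int[mu]_x psi k x) @[k --> \oo] --> 0.
  apply/cvgr0Pnorm_le => eta eta0. have s0 : Num.sqrt r != 0 by rewrite gt_eqF// sqrtr_gt0.
  have /cvgrPdist_le /(_ _ eta0) /nbhs_ballP[dl /= dl0 Hdl] := @continuous_normal_pdf R 0 (Num.sqrt r) s0 (v * r).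
  near=> k; apply: (@ip_heat_near r _ _ (e1 k) (e2 k) (n1 k) (n2 k) dl eta) => //.
  - by near: k; move/cvgr0_norm_lt : e10 => /(_ _ dl0); apply: filterS => k; apply: le_lt_trans (ler_norm _).
  - by near: k; move/cvgr0_norm_lt : e20 => /(_ _ dl0); apply: filterS => k; apply: le_lt_trans (ler_norm _).
  - exact: ltW.
have -> : (fun k => ip (phi k) (heat r (psi k))) = (fun k =>
   (ip (phi k) (heat r (psi k)) - return_density r * (\int[mu]_x phi k x * \int[mu]_x psi k x)) +
    return_density r * (\int[mu]_x phi k x * \int[mu]_x psi k x)) by apply/funext => k; rewrite subrK.
apply: (cvg_eqr (0 + return_density r)); last by rewrite add0r. exact: cvgD.
Unshelve. all: by end_near. Qed.

End heat_kernel.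

Section inverse_sqrt.
Context {R : realType}.
Local Notation mu := (@lebesgue_measure R).

(** The continuous functions (s + 1/n)^(-1/2) have the primitives 2 (s + 1/n)^(1/2), and Fatou's lemma applies
    as n grows. *)
Lemma integral_inverse_sqrt (h : R) : 0 < h -> mu.-integrable `]0, h] (EFin \o (fun s => (Num.sqrt s)^-1)) /\
  \int[mu]_(s in `]0, h]) (Num.sqrt s)^-1 <= 2 * Num.sqrt h.
Proof.
move=> h0; pose a n : R := n.+1%:R^-1. have a0 n : 0 < a n by rewrite invr_gt0.
pose f n (s : R) : R := (Num.sqrt (`|s| + a n))^-1.
have sq0 n s : Num.sqrt (`|s| + a n) != 0 by rewrite gt_eqF// sqrtr_gt0 ltr_wpDl. have cf n : continuous (f n).
  move=> s; apply: cvgV => //; apply: (continuous_cvg _ (@sqrt_continuous R _)).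
  by apply: cvgD; [exact: cvg_norm|exact: cvg_cst].
have mI := measurable_itvR `]0, h]. have iI n : mu.-integrable `]0, h] (EFin \o f n).
  apply: (@integrableS _ _ _ mu `[0, h]%classic) => //; first exact: subset_itv_oc_cc. exact: integrable_itv_continuous.
apply: (@Rintegral_fatou _ _ _ mu _ f) => //.
- by move=> n; apply: measurable_funTS; exact: continuous_measurable_fun.
- by move=> n s _; rewrite invr_ge0 sqrtr_ge0.
- move=> n; rewrite Rintegral_itv_obnd_cbnd//. pose F s := 2 * Num.sqrt (s + a n).
  have dF (s : R) : 0 < s + a n -> is_derive s 1 F (Num.sqrt (s + a n))^-1.
    move=> sa; have h1 : is_derive s 1 (fun s => s + a n) 1.
      by have := is_derive_affine 1 (a n) s; under eq_fun do rewrite mul1r.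
    have h2 := @is_derive1_comp R (@Num.sqrt R) (fun s => s + a n) s _ _ (is_derive1_sqrt sa) h1.
    apply: is_derive_eq (is_derive_funZ 2 h2) _. by field; rewrite gt_eqF// sqrtr_gt0.
  rewrite /Rintegral (@continuous_FTC2 _ (f n) F)//.
  + rewrite /= /F add0r; have h1 : Num.sqrt (h + a n) <= Num.sqrt h + Num.sqrt (a n).
      rewrite -(ler_pXn2r (n := 2))// ?nnegrE ?sqrtr_ge0 ?addr_ge0 ?sqrtr_ge0//.
      rewrite sqrrD !sqr_sqrtr ?addr_ge0 ?(ltW h0) ?(ltW (a0 n))//.
      by rewrite addrAC lerDl mulrn_wge0// mulr_ge0// sqrtr_ge0.
    by move: h1; move: (Num.sqrt _) (Num.sqrt _) (Num.sqrt _) => x y z; lra.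
  + exact: continuous_subspaceT.
  + split.
    * by move=> s; rewrite in_itv/= => /andP[s0 _]; have := dF s; case; rewrite ?addr_gt0.
    * apply: cvg_at_right_filter; apply: is_derive_continuous (dF 0 _); by rewrite add0r.
    * apply: cvg_at_left_filter; apply: is_derive_continuous (dF h _); by rewrite addr_gt0.
  + move=> s; rewrite in_itv/= => /andP[s0 _]. have -> : f n s = (Num.sqrt (s + a n))^-1 by rewrite /f gtr0_norm.
    by apply: is_derive_derive1; apply: dF; rewrite addr_gt0.
- move=> s; rewrite /= in_itv/= => /andP[s0 _]; rewrite /f gtr0_norm//.
  have ss0 : Num.sqrt s != 0 by rewrite gt_eqF// sqrtr_gt0.
  apply: cvgV => //; apply: (continuous_cvg _ (@sqrt_continuous R _)).
  apply: (cvg_eqr (s + 0)); last by rewrite addr0. by apply: cvgD; [exact: cvg_cst|exact: cvg_harmonic].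
Qed.

End inverse_sqrt.

(** * Jointly measurable limits and norms in L^2 *)

Lemma floor_grid_dist {R : realType} n (s : R) : `|(Num.floor (n.+1%:R * s))%:~R / n.+1%:R - s| <= n.+1%:R^-1.
Proof.
have n0 : (0 : R) < n.+1%:R by rewrite ltr0n.
have h1 := floor_le_tmp (n.+1%:R * s); have h2 := floorD1_gt (n.+1%:R * s).
rewrite -[in X in `|_ - X|](mulKf (lt0r_neq0 n0) s) mulrC -mulrBr normrM gtr0_norm ?invr_gt0//.
rewrite ger_pMr ?invr_gt0// distrC ger0_norm ?subr_ge0//. by move: h2; rewrite intrD; lra.
Qed.

Lemma floor_grid_cvg {R : realType} (s : R) : (Num.floor (n.+1%:R * s))%:~R / n.+1%:R @[n --> \oo] --> s.
Proof.
by apply: cvg_harmonic_dist => n; exact: floor_grid_dist.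
Qed.

Lemma measurable_floor_eq {R : realType} {d : measure_display} {T : measurableType d} (X : T -> R) n (k : int) :
  measT X -> measurable [set w | Num.floor (n.+1%:R * X w) = k].
Proof.
move=> mX; have -> : [set w | Num.floor (n.+1%:R * X w) = k] = X @^-1` `[k%:~R / n.+1%:R, (k + 1)%:~R / n.+1%:R[%classic.
  have n0 : (0 : R) < n.+1%:R by rewrite ltr0n.
  apply/seteqP; split=> w /=; rewrite in_itv/= ler_pdivrMr// ltr_pdivlMr// ![X w * _]mulrC.
    by move=> <-; rewrite floor_le_tmp floorD1_gt.
  by move/floor_def.
by rewrite -[X in measurable X]setTI; apply: mX => //; exact: measurable_itv.
Qed.

Section jointly_measurable_version.
Context {R : realType} {d : measure_display} {Omega : measurableType d}.
Variable P : probability Omega R.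
Local Notation mu := (@lebesgue_measure R).

(** With the time frozen at the points k / n the function is a countable patchwork of functions of the second
    variable. *)
Lemma measurable_continuous_fst (h : R -> Omega -> R) : (forall s, measT (h s)) -> (forall w, continuous (h ^~ w)) ->
  measT (fun p : R * Omega => h p.1 p.2).
Proof.
move=> mh ch. have conv (s : R) w : h ((Num.floor (n.+1%:R * s))%:~R / n.+1%:R) w @[n --> \oo] --> h s w.
  exact: (cvg_comp _ (h ^~ w) (@floor_grid_cvg R s) (@ch w s)).
pose h_ n (p : R * Omega) := h ((Num.floor (n.+1%:R * p.1))%:~R / n.+1%:R) p.2.
apply: (@measurable_fun_cvg _ _ _ setT h_) => [n|p _]; last by exact: conv. move=> _ B mB; rewrite setTI.
have -> : h_ n @^-1` B = \bigcup_(k : int) ([set s : measurableTypeR R | Num.floor (n.+1%:R * s) = k] `*`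
    (h (k%:~R / n.+1%:R) @^-1` B)).
  apply/seteqP; split=> [p Bp|p [k _ [/= <-]]] //. by exists (Num.floor (n.+1%:R * p.1)).
apply: countable_bigcupT_measurable => [|k]; first exact: countableP. apply: measurableX; last first.
  by rewrite -[X in measurable X]setTI; exact: mh.
exact: measurable_floor_eq.
Qed.

Variables (X : nat -> R -> Omega -> R) (T : R).
Hypothesis mX : forall m s, measT (X m s).
Hypothesis cX : forall m w, continuous (X m ^~ w).
Hypothesis dX : forall m s, L1 P (fun w => X m.+1 s w - X m s w) /\
  \int[P]_w `|X m.+1 s w - X m s w| <= 1 / (2 ^ (m + 1))%:R.

Let inT (s : R) : R := \1_(`[0, T]%classic : set (measurableTypeR R)) s.
Let D m (p : R * Omega) : R := `|X m.+1 p.1 p.2 - X m p.1 p.2| * inT p.1.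
Let G p : \bar R := (\sum_(m <oo) (D m p)%:E)%E.
Let H w : \bar R := (\int[mu]_s G (s, w))%E.

Let mfst (g : R -> R) : measT g -> measT (fun p : R * Omega => g p.1).
Proof. by move=> mg; exact: measurableT_comp mg measurable_fst. Qed.

Let minT : measT inT.
Proof. by apply: measurable_indic; exact: measurable_itv. Qed.

Let inT01 s : 0 <= inT s <= 1.
Proof. by rewrite /inT indicE; case: (_ \in _); rewrite lexx ler01. Qed.

Let mD m : measT (D m).
Proof.
apply: measurable_funM; last exact: mfst. apply: measurableT_comp => //.
by apply: measurable_funB; [exact: (measurable_continuous_fst (mX m.+1) (@cX m.+1))|exact: (measurable_continuous_fst (mX m) (@cX m))].
Qed.

Let D0 m p : 0 <= D m p.
Proof. by rewrite mulr_ge0//; case/andP: (inT01 p.1). Qed.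

Let mG : measT G.
Proof.
apply: ge0_emeasurable_sum => [m p _ _|m _]; first by rewrite lee_fin. by apply/measurable_EFinP.
Qed.

Let G0 p : (0 <= G p)%E.
Proof. by apply: nneseries_ge0 => m _ _; rewrite lee_fin. Qed.

Let EG_le s : (\int[P]_w G (s, w) <= (inT s)%:E)%E.
Proof.
have /andP[i0 i1] := inT01 s.
have mDs m : measT (fun w => D m (s, w)) by exact: measurableT_comp (mD m) (pair1_measurable s).
rewrite integral_nneseries//; last 2 first.
- by move=> m; apply/measurable_EFinP.
- by move=> m w _; rewrite lee_fin.
have bD m : (\int[P]_w (D m (s, w))%:E <= (inT s / (2 ^ (m + 1))%:R)%:E)%E.
  have [iX bX] := dX m s; have i2 := integrable_norm iX; have i3 := intZ (inT s) i2.
  under eq_integral do rewrite /D /= mulrC. rewrite -[leLHS](fineK (integrable_fin_num measurableT i3)) lee_fin.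
  rewrite -/(Rintegral _ _ _) (RintZ i2). by rewrite -[_ / _]mulr1 -mulrA; apply: ler_wpM2l => //; rewrite mulrC.
apply: (@le_trans _ _ (\sum_(m <oo) (inT s / (2 ^ (m + 1))%:R)%:E)%E).
  apply: lee_nneseries => [m _ _|m _]; last exact: bD. by apply: integral_ge0 => w _; rewrite lee_fin.
by have /cvg_lim := @cvg_geometric_eseries_half R (inT s) 0; rewrite expr0 divr1 => ->.
Qed.

Let ED_fin s : {ae P, forall w, (G (s, w) < +oo)%E}.
Proof.
have mGs : measT (fun w => G (s, w)) by exact: measurableT_comp mG (pair1_measurable s).
have iG : P.-integrable setT (fun w => G (s, w)).
  apply/integrableP; split => //; under eq_integral do rewrite gee0_abs//.
  by apply: le_lt_trans (EG_le s) _; rewrite ltry.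
have := integrable_ae measurableT iG; apply: filterS => w /(_ I); rewrite fin_numE => /andP[_ h]. by rewrite ltey.
Qed.

Let mH : measT H.
Proof. exact: (@measurable_fun_fubini_tonelli_G _ _ _ _ _ mu G mG G0). Qed.

Let H_fin : {ae P, forall w, (H w < +oo)%E}.
Proof.
have mI := measurable_itvR `[0, T]. have H0 w : (0 <= H w)%E by apply: integral_ge0. have iH : P.-integrable setT H.
  apply/integrableP; split => //; under eq_integral do rewrite gee0_abs//.
  have <- := @fubini_tonelli _ _ _ _ _ mu P G mG G0. apply: (@le_lt_trans _ _ (\int[mu]_s (inT s)%:E)%E).
    apply: ge0_le_integral => //.
    - by move=> s _; apply: integral_ge0.
    - exact: (@measurable_fun_fubini_tonelli_F _ _ _ _ _ P G mG G0).
    - by apply/measurable_EFinP; exact: minT.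
  rewrite /inT integral_indic// setIT; have := @lebesgue_measure_itv R `[0, T]; rewrite /= lte_fin => ->.
  by case: ifP => _; rewrite -?EFinB ltry.
have := integrable_ae measurableT iH; apply: filterS => w /(_ I); rewrite fin_numE => /andP[_ h]. by rewrite ltey.
Qed.

(** On this set the sequence converges, with its total variation as an integrable bound; elsewhere it is
    replaced by 0. *)
Let good (p : R * Omega) : bool := (G p < +oo)%E && (H p.2 < +oo)%E.

Let V_ m (p : R * Omega) : R := inT p.1 * (X m p.1 p.2 * (good p)%:R).

Let V p : R := lim (V_ m p @[m --> \oo]).

Let partial m p : good p -> inT p.1 = 1 -> \sum_(k < m) `|X k.+1 p.1 p.2 - X k p.1 p.2| <= fine (G p).
Proof.
move=> /andP[Gp _] i1. have fG : G p \is a fin_num by rewrite ge0_fin_numE.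
have := @nneseries_lim_ge R (fun k => (D k p)%:E) xpredT 0 m (fun k _ => _).
rewrite -/(G p) -(fineK fG) big_mkord sumEFin lee_fin => h. apply: le_trans (h _) => [|k]; last by rewrite lee_fin.
by apply: ler_sum => k _; rewrite /D i1 mulr1.
Qed.

Let V_cvg p : V_ m p @[m --> \oo] --> V p.
Proof.
apply/cvg_ex; rewrite /V_ /=.
have [i0|i1] : inT p.1 = 0 \/ inT p.1 = 1 by rewrite /inT indicE; case: (_ \in _); [right|left].
  by exists 0; rewrite i0; under eq_fun do rewrite mul0r; exact: cvg_cst.
case gp : (good p); last first.
  by exists 0; under eq_fun do rewrite mulr0 mulr0; exact: cvg_cst.
have : cvgn (series (fun k => X k.+1 p.1 p.2 - X k p.1 p.2)).
  apply: normed_cvg; apply: nondecreasing_is_cvgn.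
    apply/nondecreasing_seqP => m; rewrite [leRHS]/series /= big_nat_recr//= lerDl. exact: normr_ge0.
  exists (fine (G p)) => _ [m _ <-]; have := @partial m p gp i1.
  by rewrite -(big_mkord xpredT (fun k => `|X k.+1 p.1 p.2 - X k p.1 p.2|)).
move=> /cvg_ex[l hl]; exists (l + X 0%N p.1 p.2). rewrite i1; under eq_fun do rewrite mul1r mulr1.
have -> : (fun m => X m p.1 p.2) = (fun m => series (fun k => X k.+1 p.1 p.2 - X k p.1 p.2) m + X 0%N p.1 p.2).
  by apply/funext => m; rewrite /series /= telescope_sumr// subrK.
by apply: cvgD => //; exact: cvg_cst.
Qed.

Let V_le p : good p -> inT p.1 = 1 -> `|V p| <= `|X 0%N p.1 p.2| + fine (G p).
Proof.
move=> gp i1; have c := cvg_norm (V_cvg (p := p)). apply: (cvg_le_lim (c _)) => m; rewrite /V_ i1 mul1r gp mulr1.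
have -> : X m p.1 p.2 = X 0%N p.1 p.2 + \sum_(k < m) (X k.+1 p.1 p.2 - X k p.1 p.2).
  by rewrite -(big_mkord xpredT (fun k => X k.+1 p.1 p.2 - X k p.1 p.2)) telescope_sumr// addrC subrK.
apply: le_trans (ler_normD _ _) _; rewrite lerD2l. by apply: le_trans (ler_norm_sum _ _ _) _; exact: partial.
Qed.

(** The mean variations of the sequence are summable uniformly in time, so that at each time almost all sample
    points are good. *)
Lemma jointly_measurable_limit : exists V : R -> Omega -> R, [/\ measT (fun p : R * Omega => V p.1 p.2),
      (forall w, mu.-integrable `[0, T] (EFin \o (V ^~ w))) &
      forall s, s \in `[0, T] -> {ae P, forall w, X m s w @[m --> \oo] --> V s w}].
Proof.
have inT1 s : s \in `[0, T] -> inT s = 1 by move=> sT; rewrite /inT indicE mem_set.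
have mgood : measT (good : R * Omega -> bool).
  apply: measurable_and.
    by apply: measurable_fun_lte => //; exact: measurable_cst.
  by apply: measurable_fun_lte; [exact: measurableT_comp mH measurable_snd|exact: measurable_cst].
have mV_ m : measT (V_ m).
  apply: measurable_funM; first exact: mfst.
  apply: measurable_funM; first exact: (measurable_continuous_fst (mX m) (@cX m)).
  have -> : (fun p => (good p)%:R) = (fun p => ind (good p) : R).
    by apply/funext => p; rewrite /ind; case: (good p).
  exact: measurable_ind mgood.
have mV : measT V by exact: (@measurable_fun_cvg _ _ _ setT V_ V mV_ (fun p _ => @V_cvg p)).
have mI := measurable_itvR `[0, T]. exists (fun s w => V (s, w)); split.
- by have -> : (fun p : R * Omega => V (p.1, p.2)) = V by apply/funext => -[].
- move=> w. have mVw : measT (fun s => V (s, w)) by exact: measurableT_comp mV (pair2_measurable w).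
  have [Hw|Hw] := boolP (H w < +oo)%E; last first.
    have -> : EFin \o (fun s => V (s, w)) = cst 0%E.
      apply/funext => s /=; congr EFin; apply: (cvgr_unique (V_cvg (p := (s, w))) (cvg_cst 0)) => m.
      by rewrite /V_ /good /= (negbTE Hw) andbF !mulr0.
    exact: integrable0.
  have iG : mu.-integrable `[0, T] (fun s => G (s, w)).
    apply: (@integrableS _ _ _ mu setT) => //; apply/integrableP; split.
      exact: measurableT_comp mG (pair2_measurable w).
    by under eq_integral do rewrite gee0_abs//.
  have iX : mu.-integrable `[0, T] (EFin \o (fun s => `|X 0%N s w|)).
    by have := integrable_norm (@integrable_itv_continuous R (X 0%N ^~ w) 0 T (@cX 0%N w)).
  apply: (le_integrable mI _ _ (integrableD mI iX iG)).
    by apply/measurable_EFinP; exact: measurable_funTS.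
  move=> s sT /=; have i1 := inT1 s sT. have gt0 : (0 <= `|X 0%N s w|%:E + G (s, w))%E by apply: adde_ge0.
  rewrite gee0_abs//; have [Gs|Gs] := boolP (G (s, w) < +oo)%E; last first.
    by move: Gs; rewrite -leNgt leye_eq => /eqP ->; rewrite addey// leey.
  have fG : G (s, w) \is a fin_num by rewrite ge0_fin_numE.
  rewrite -(fineK fG) -EFinD lee_fin; apply: (@V_le (s, w)) => //. by rewrite /good Gs.
- move=> s sT; have hG := ED_fin s; have hH := H_fin; near=> w.
  have gp : good (s, w) by apply/andP; split => /=; near: w. have := V_cvg (p := (s, w)); rewrite /V_ /= gp inT1//.
  by under eq_fun do rewrite mul1r mulr1.
Unshelve. all: by end_near. Qed.

End jointly_measurable_version.

Section Lnorm2.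
Context {R : realType} {d : measure_display} {T : measurableType d}.
Variable m : {measure set T -> \bar R}.
Implicit Types g : T -> R.

Let LnormE g : ('N[m]_2%:E[EFin \o g] = (\int[m]_x (g x ^+ 2)%:E) `^ 2^-1)%E.
Proof.
rewrite unlock /Lnorm; congr (_ `^ _)%E; apply: eq_integral => x _.
by rewrite -[LHS]/((`|g x| `^ 2)%:E) powR_mulrn// real_normK// num_real.
Qed.

Lemma Lnorm2E g : L1 m (fun x => g x ^+ 2) -> ('N[m]_2%:E[EFin \o g] = (Num.sqrt (\int[m]_x (g x ^+ 2))%R)%:E)%E.
Proof.
move=> ig; rewrite LnormE -(fineK (integrable_fin_num measurableT ig)) poweR_EFin powR12_sqrt//.
by apply: fine_ge0; apply: integral_ge0 => x _; rewrite lee_fin sqr_ge0.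
Qed.

Lemma Lnorm2_lty g : measT g -> ('N[m]_2%:E[EFin \o g] < +oo)%E -> L1 m (fun x => g x ^+ 2).
Proof.
move=> mg; rewrite LnormE => h; apply/integrableP; split.
  by apply/measurable_EFinP; exact: measurable_funX.
under eq_integral do rewrite /= ger0_norm ?sqr_ge0//.
move: h; case: (\int[m]_x (g x ^+ 2)%:E)%E => [r _||_]; first exact: ltry.
  by rewrite poweRyr// invr_eq0.
by [].
Qed.

Lemma Lnorm2_cvg0 (g : nat -> T -> R) : (forall n, L1 m (fun x => g n x ^+ 2)) ->
  ('N[m]_2%:E[EFin \o g n])%E @[n --> \oo] --> 0%E <-> \int[m]_x (g n x ^+ 2) @[n --> \oo] --> 0.
Proof.
move=> ig; have -> : (fun n => 'N[m]_2%:E[EFin \o g n])%E = (fun n => (Num.sqrt (\int[m]_x (g n x ^+ 2)))%:E).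
  by apply/funext => n; rewrite Lnorm2E.
have h0 n : 0 <= \int[m]_x (g n x ^+ 2) by apply: Rintegral_ge0 => x _; exact: sqr_ge0. split=> [/fine_cvg h|h].
  have -> : (fun n => \int[m]_x (g n x ^+ 2)) = (fun n => Num.sqrt (\int[m]_x (g n x ^+ 2)) * Num.sqrt (\int[m]_x (g n x ^+ 2))).
    by apply/funext => n; rewrite -expr2 sqr_sqrtr.
  by apply: (cvg_eqr (0 * 0)); [exact: cvgM|rewrite mulr0].
apply: cvg_EFin; first exact: nearW. apply: (cvg_eqr (Num.sqrt 0)); last exact: sqrtr0.
exact: (cvg_comp _ _ h (@sqrt_continuous R 0)).
Qed.

End Lnorm2.

(** * Convergence in probability and in mean square *)

Section pdist_criteria.
Context {R : realType} {d : measure_display} {Omega : measurableType d}.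
Variable P : probability Omega R.
Implicit Types X : Omega -> R.

Lemma pdist_ae (X_ : nat -> Omega -> R) X : (forall n, measT (X_ n)) ->
  measT X -> {ae P, forall w, X_ n w @[n --> \oo] --> X w} -> pdist P (X_ n) X @[n --> \oo] --> 0.
Proof.
move=> mX_ mX cX. have mt n : measT (fun w => cap1 (X_ n w - X w)).
  by apply: measurable_cap1; exact: measurable_funB.
have i1 : L1 P (cst (1 : R)) by exact: finite_measure_integrable_cst.
have cE : {ae P, forall w, setT w -> (cap1 (X_ n w - X w))%:E @[n --> \oo] --> (0%:E : \bar R)}.
  apply: filterS cX => w h _; apply: cvg_EFin; first exact: nearW. apply: (cvg_dist_le (fun n => `|X_ n w - X w|)).
    by move=> n; rewrite subr0 ger0_norm ?cap1_le//; have /andP[] := cap1_itv (X_ n w - X w).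
  apply: (cvg_eqr `|X w - X w|); last by rewrite subrr normr0. by apply: cvg_norm; apply: cvgB => //; exact: cvg_cst.
have bE : {ae P, forall w n, setT w -> (`|(cap1 (X_ n w - X w))%:E| <= (EFin \o cst (1%R : R)) w)%E}.
  apply: aeW => w n _; rewrite lee_fin. by have /andP[h0 h1] := cap1_itv (X_ n w - X w); rewrite ger0_norm.
have [_ _] := @dominated_convergence _ _ _ P setT measurableT (fun n w => (cap1 (X_ n w - X w))%:E)
   (cst 0%:E) (EFin \o cst (1 : R)) (fun n => (measurable_EFinP _ _).2 (mt n)) (measurable_cst _) cE i1 bE.
by rewrite integral0 => /fine_cvg.
Qed.

Lemma pdist_sqr_le X Y : sqint P (fun w => X w - Y w) -> pdist P X Y ^+ 2 <= \int[P]_w (X w - Y w) ^+ 2.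
Proof.
move=> sXY; apply: le_trans (Rintegral_norm_sqr sXY). have h := pdist_L1 (sqint_integrable sXY).
by rewrite ler_pXn2r// nnegrE ?pdist_ge0// (le_trans (pdist_ge0 P X Y)).
Qed.

Lemma sqr_cvg0 (a b : nat -> R) : (forall n, a n ^+ 2 <= b n) -> b n @[n --> \oo] --> 0 -> a n @[n --> \oo] --> 0.
Proof.
move=> ab b0; apply/cvgr0Pnorm_le => e e0. have e2 : 0 < e ^+ 2 by rewrite exprn_gt0.
move/cvgr0Pnorm_le : b0 => /(_ _ e2); apply: filterS => n h.
rewrite -(@ler_pXn2r _ 2)// ?nnegrE ?(ltW e0)// -normrX ger0_norm ?sqr_ge0//.
exact: le_trans (ab n) (le_trans (ler_norm _) h).
Qed.

Lemma Rintegral_sqrB X Y : sqint P X -> sqint P Y ->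
  \int[P]_w (X w - Y w) ^+ 2 = \int[P]_w (X w * X w) + \int[P]_w (Y w * Y w) +
    (- (\int[P]_w (X w * Y w)) + - (\int[P]_w (X w * Y w))).
Proof.
move=> s1 s2; have i1 := sqint_integrable_mul s1 s1; have i2 := sqint_integrable_mul s2 s2.
have i3 := sqint_integrable_mul s1 s2; have i4 := intD i1 i2. have i5 := intD i3 i3.
rewrite -opprD -(RintD i1 i2) -(RintD i3 i3) -(RintB i4 i5). by apply: eq_Rintegral => w _; ring.
Qed.

Lemma Rintegral_mul_split X1 X2 t1 t2 : sqint P X1 -> sqint P X2 -> sqint P t1 -> sqint P t2 ->
  \int[P]_w (X1 w * X2 w) = \int[P]_w (t1 w * t2 w) - \int[P]_w ((t2 w - X2 w) * t1 w) -
   \int[P]_w ((t1 w - X1 w) * X2 w).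
Proof.
move=> s1 s2 r1 r2; have i1 := sqint_integrable_mul r1 r2.
have i2 := sqint_integrable_mul (sqintB r2 s2) r1; have i3 := sqint_integrable_mul (sqintB r1 s1) s2.
have i4 := intB i1 i2. rewrite -(RintB i1 i2) -(RintB i4 i3). by apply: eq_Rintegral => w _; ring.
Qed.

End pdist_criteria.

(** The integral is the difference of those of the positive and negative parts. *)
Lemma measurable_Rintegral_fst {R : realType} {d : measure_display} {Omega : measurableType d}
    (g : R * Omega -> R) : measT g -> measT (fun w => \int[@lebesgue_measure R]_s g (s, w)).
Proof.
move=> mg; set mu := @lebesgue_measure R. have mE : measT (EFin \o g) by exact/measurable_EFinP.
have m1 := @measurable_fun_fubini_tonelli_G _ _ _ _ _ mu _ (measurable_funepos mE) (fun p => funepos_ge0 _ p).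
have m2 := @measurable_fun_fubini_tonelli_G _ _ _ _ _ mu _ (measurable_funeneg mE) (fun p => funeneg_ge0 _ p).
apply: (measurableT_comp (fine_measurable (measurableT : measurable [set: \bar R]))).
have -> : (fun w => \int[mu]_s (g (s, w))%:E)%E =
    (fun w => \int[mu]_s (((EFin \o g)^\+)%E (s, w)) - \int[mu]_s (((EFin \o g)^\-)%E (s, w)))%E.
  apply/funext => w; rewrite [LHS]integralE; congr (_ - _)%E.
    by apply: eq_integral => s _; rewrite !funeposE.
  by apply: eq_integral => s _; rewrite !funenegE.
exact: emeasurable_funB m1 m2.
Qed.

(** * Dyadic chaining *)

Section dyadic_chaining.
Context {R : realType}.
Variable T : R.
Hypothesis T0 : 0 < T.
Implicit Types (g : R -> R) (n N k : nat) (t : R).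

Definition dyadic n k : R := k%:R / 2 ^+ n * T.

Lemma dyadic_double n k : dyadic n.+1 k.*2 = dyadic n k.
Proof.
rewrite /dyadic exprS -muln2 natrM; have : (2 : R) ^+ n != 0 by rewrite expf_neq0.
by move: (2 ^+ n) => q q0; congr (_ * T); field.
Qed.

Lemma dyadicS n k : dyadic n k.+1 - dyadic n k = T / 2 ^+ n.
Proof. by rewrite /dyadic -natr1; ring. Qed.

Lemma dyadic_bounds n k : (k <= 2 ^ n)%N -> 0 <= dyadic n k <= T.
Proof.
move=> kn; have q0 : (0 : R) < 2 ^+ n by rewrite exprn_gt0.
rewrite /dyadic mulr_ge0 ?divr_ge0 ?(ltW T0) ?(ltW q0)//= ger_pMl// ler_pdivrMr// mul1r. by rewrite -natrX ler_nat.
Qed.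

Lemma dyadicW n k : dyadic n k <= dyadic n k.+1.
Proof. by rewrite -subr_ge0 dyadicS divr_ge0 ?exprn_ge0// ltW. Qed.

Definition sqr_increments g n : R := \sum_(k < (2 ^ n)%N) (g (dyadic n k.+1) - g (dyadic n k)) ^+ 2.

Lemma sqr_increments_ge0 g n : 0 <= sqr_increments g n.
Proof. by apply: sumr_ge0 => k _; exact: sqr_ge0. Qed.

Lemma increment_le g n k : (k < 2 ^ n)%N -> `|g (dyadic n k.+1) - g (dyadic n k)| <= Num.sqrt (sqr_increments g n).
Proof.
move=> kn; rewrite -sqrtr_sqr ler_sqrt ?sqr_increments_ge0//. rewrite /sqr_increments (bigD1 (Ordinal kn)) //= lerDl.
by apply: sumr_ge0 => i _; exact: sqr_ge0.
Qed.

(** A dyadic time of level N is reached from 0 by at most one increment of each level. *)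
Lemma dyadic_level_le g N k : g 0 = 0 -> (k <= 2 ^ N)%N ->
  `|g (dyadic N k)| <= \sum_(n < N.+1) Num.sqrt (sqr_increments g n).
Proof.
move=> g0; have d0 n : dyadic n 0 = 0 by rewrite /dyadic !mul0r. elim: N k => [|N IH] k kN.
  rewrite big_ord1; case: k kN => [|[|k]] // kN; first by rewrite d0 g0 normr0 sqrtr_ge0.
  by have := @increment_le g 0 0 isT; rewrite d0 g0 subr0.
rewrite big_ord_recr /= -(odd_double_half k).
have hk : (k./2 <= 2 ^ N)%N by rewrite -leq_double -[leqRHS]mul2n -expnS; apply: leq_trans kN; rewrite -{2}(odd_double_half k) leq_addl.
have [ok|/negbTE ok] := boolP (odd k); last first.
  by rewrite add0n dyadic_double (le_trans (IH _ hk))// lerDl sqrtr_ge0.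
rewrite add1n; have -> : g (dyadic N.+1 (k./2.*2).+1) =
    g (dyadic N k./2) + (g (dyadic N.+1 (k./2.*2).+1) - g (dyadic N.+1 k./2.*2)).
  by rewrite dyadic_double; ring.
apply: le_trans (ler_normD _ _) _; apply: lerD; first exact: IH. apply: increment_le; apply: leq_trans kN.
by rewrite -{2}(odd_double_half k) ok.
Qed.

(** Cauchy-Schwarz inequality for the weights (5/4)^n, whose inverses sum to 5. *)
Lemma weighted_sum_sqr (m : nat -> R) N : (\sum_(n < N) m n) ^+ 2 <= 5 * \sum_(n < N) (5 / 4) ^+ n * m n ^+ 2.
Proof.
have W0 M : 0 <= \sum_(n < M) (5 / 4) ^+ n * m n ^+ 2.
  by apply: sumr_ge0 => n _; apply: mulr_ge0; [apply: exprn_ge0; lra|exact: sqr_ge0].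
suff h : (\sum_(n < N) m n) ^+ 2 <= 5 * (1 - (4 / 5) ^+ N) * \sum_(n < N) (5 / 4) ^+ n * m n ^+ 2.
  apply: le_trans h _; rewrite -mulrA ler_pM2l//. have q0 : (0 : R) <= (4 / 5) ^+ N by apply: exprn_ge0; lra.
  by have := W0 N; move: (\sum_(n < N) (5 / 4) ^+ n * m n ^+ 2) ((4 / 5) ^+ N) q0 => W q q0 h; nra.
elim: N => [|N IH]; first by rewrite !big_ord0 expr0n mulr0. rewrite !big_ord_recr /=; move: IH (W0 N).
have b0 : (0 : R) < (4 / 5) ^+ N by apply: exprn_gt0; lra. have b1 : (4 / 5 : R) ^+ N <= 1 by apply: exprn_ile1; lra.
have -> : (5 / 4 : R) ^+ N = ((4 / 5) ^+ N)^-1 by rewrite -exprVn; congr (_ ^+ N); field.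
have -> : (4 / 5 : R) ^+ N.+1 = (4 / 5) * (4 / 5) ^+ N by rewrite exprS.
move: (\sum_(n < N) (5 / 4) ^+ n * m n ^+ 2) (\sum_(n < N) m n) (m N) ((4 / 5) ^+ N) b0 b1.
move=> W A x b b0 b1 AW HW. have key : 0 <= b * W + 5 * (1 - b) * (b^-1 * x ^+ 2) - 2 * A * x.
  have [/eqP b1'|bn1] := boolP (b == 1).
    have A0 : A ^+ 2 <= 0 by move: AW; rewrite b1' subrr mulr0 mul0r.
    have -> : A = 0 by apply/eqP; rewrite -sqrf_eq0 eq_le A0 sqr_ge0.
    by rewrite mulr0 mul0r subr0 b1' subrr mulr0 mul0r addr0 mul1r.
  have a0 : 0 < 5 * (1 - b) by rewrite mulr_gt0// subr_gt0 lt_neqAle bn1. move: (5 * (1 - b)) a0 AW => a a0 AW.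
  have h1 : b * (A ^+ 2 / a) <= b * W by rewrite ler_pM2l// ler_pdivrMr// mulrC.
  have h2 : 0 <= (b * A - a * x) ^+ 2 / (a * b) by rewrite divr_ge0 ?sqr_ge0// mulr_ge0// ltW.
  have -> : b * W + a * (b^-1 * x ^+ 2) - 2 * A * x =
      (b * W - b * (A ^+ 2 / a)) + (b * A - a * x) ^+ 2 / (a * b) by field; rewrite !lt0r_neq0.
  by rewrite addr_ge0// subr_ge0.
have e : 5 * (1 - 4 / 5 * b) * (W + b^-1 * x ^+ 2) = 5 * (1 - b) * W + b * W + 5 * (1 - b) * (b^-1 * x ^+ 2) + x ^+ 2.
  by field; rewrite lt0r_neq0.
rewrite e; have -> : (A + x) ^+ 2 = A ^+ 2 + 2 * A * x + x ^+ 2 by ring.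
by move: AW key; move: (5 * (1 - b) * W) (b * W) (5 * (1 - b) * _) (2 * A * x) => *; lra.
Qed.

Definition max_sqr g N : R := \big[Num.max/0]_(k < (2 ^ N).+1) g (dyadic N k) ^+ 2.

Lemma max_sqr_ge0 g N : 0 <= max_sqr g N.
Proof. exact: bigmax_ge_id. Qed.

Lemma max_sqr_ge g N k : (k <= 2 ^ N)%N -> g (dyadic N k) ^+ 2 <= max_sqr g N.
Proof. by move=> kN; exact: (le_bigmax _ (fun k : 'I_(2 ^ N).+1 => g (dyadic N k) ^+ 2) (Ordinal (kN : (k < (2 ^ N).+1)%N))). Qed.

Lemma max_sqr_le g N C : 0 <= C -> (forall k, (k <= 2 ^ N)%N -> g (dyadic N k) ^+ 2 <= C) -> max_sqr g N <= C.
Proof. by move=> C0 h; apply/bigmax_leP; split => // k _; apply: h; rewrite -ltnS. Qed.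

Lemma max_sqr_nd g : {homo max_sqr g : n m / (n <= m)%N >-> n <= m}.
Proof.
apply/nondecreasing_seqP => N; apply: max_sqr_le; first exact: max_sqr_ge0.
move=> k kN; rewrite -dyadic_double; apply: max_sqr_ge. by rewrite expnS mul2n leq_double.
Qed.

Lemma max_sqr_le_increments g N : g 0 = 0 -> max_sqr g N <= 5 * \sum_(n < N.+1) (5 / 4) ^+ n * sqr_increments g n.
Proof.
move=> g0; apply: max_sqr_le.
  apply: mulr_ge0 => //; apply: sumr_ge0 => n _; apply: mulr_ge0; last exact: sqr_increments_ge0.
  by apply: exprn_ge0; lra.
move=> k kN; have h := dyadic_level_le g0 kN. have -> : \sum_(n < N.+1) (5 / 4) ^+ n * sqr_increments g n =
    \sum_(n < N.+1) (5 / 4) ^+ n * Num.sqrt (sqr_increments g n) ^+ 2.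
  by apply: eq_bigr => n _; rewrite sqr_sqrtr// sqr_increments_ge0.
apply: le_trans (@weighted_sum_sqr (fun n => Num.sqrt (sqr_increments g n)) N.+1).
rewrite -real_normK ?num_real// ler_pXn2r// nnegrE. by apply: sumr_ge0 => n _; exact: sqrtr_ge0.
Qed.

Definition sup_sqr g : R := lim (max_sqr g N @[N --> \oo]).

Lemma sup_sqrP g : {within `[0, T], continuous g} ->
  max_sqr g N @[N --> \oo] --> sup_sqr g /\ forall t, 0 <= t <= T -> g t ^+ 2 <= sup_sqr g.
Proof.
move=> cg; have cg' := within_clamp (ltW T0) cg.
have cl t : 0 <= t <= T -> clamp T t = t by move=> tT; rewrite clamp_id// in_itv.
have [C HC] := continuous_bounded 0 T cg'. have HC' t : 0 <= t <= T -> g t ^+ 2 <= C ^+ 2.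
  move=> tT; have := HC t tT; rewrite cl// => h.
  by rewrite -real_normK ?num_real// ler_pXn2r// nnegrE (le_trans (normr_ge0 (g t))).
have c1 : cvgn (max_sqr g).
  apply: nondecreasing_is_cvgn; first exact: max_sqr_nd.
  exists (C ^+ 2) => _ [N _ <-]; apply: max_sqr_le; first exact: sqr_ge0.
  by move=> k kN; apply: HC'; exact: dyadic_bounds.
split=> [|t tT]; first exact: c1.
have le_sup N : max_sqr g N <= sup_sqr g by exact: (nondecreasing_cvgn_le (@max_sqr_nd g) c1).
have /andP[t0 tle] := tT. pose k N := Num.trunc (t / T * 2 ^+ N). have q0 N : (0 : R) < 2 ^+ N by rewrite exprn_gt0.
have kP N : (k N)%:R <= t / T * 2 ^+ N < (k N).+1%:R.
  by apply: truncn_itv; rewrite mulr_ge0 ?divr_ge0// ltW.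
have kle N : (k N <= 2 ^ N)%N.
  have /andP[h _] := kP N; rewrite -(@ler_nat R) natrX; apply: le_trans h _. by rewrite ger_pMl// ler_pdivrMr// mul1r.
have dt : dyadic N (k N) @[N --> \oo] --> t.
  apply: (cvg_dist_le (fun N => T * (1 / 2) ^+ N)).
    move=> N; have /andP[h1 h2] := kP N.
    have -> : dyadic N (k N) - t = - ((t / T * 2 ^+ N - (k N)%:R) * (T * (1 / 2) ^+ N)).
      rewrite /dyadic expr_div_n expr1n; have := lt0r_neq0 (q0 N); have := lt0r_neq0 T0.
      by move: (2 ^+ N) ((k N)%:R) => q z T1 q1; field; rewrite T1 q1.
    have p0 : 0 <= T * (1 / 2) ^+ N by apply: mulr_ge0; [exact: ltW|apply: exprn_ge0; lra].
    rewrite normrN ger0_norm; last by apply: mulr_ge0 => //; rewrite subr_ge0.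
    by rewrite ler_piMl//; move: h2; rewrite -natr1; lra.
  apply: cvg_geometric; rewrite ger0_norm; lra.
have c2 : g (dyadic N (k N)) ^+ 2 @[N --> \oo] --> g t ^+ 2.
  have c3 : g (dyadic N (k N)) @[N --> \oo] --> g t.
    have := cvg_comp _ _ dt (@cg' t); rewrite cl//.
    suff -> : (fun N => g (dyadic N (k N))) = (fun t => g (clamp T t)) \o (fun N => dyadic N (k N)) by [].
    by apply/funext => N /=; rewrite cl// dyadic_bounds.
  exact: (cvgM c3 c3).
by apply: (cvg_le_lim c2) => N; apply: le_trans (max_sqr_ge g (kle N)) (le_sup N).
Qed.

End dyadic_chaining.

Section chaining_bound.
Context {R : realType} {d : measure_display} {Omega : measurableType d}.
Variable P : probability Omega R.
Variable T : R.
Hypothesis T0 : 0 < T.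
Local Notation dyadic := (dyadic T).

Lemma measurable_max_sqr (D : R -> Omega -> R) N : (forall t, 0 <= t <= T -> measT (D t)) ->
  measT (fun w => max_sqr T (D ^~ w) N).
Proof.
move=> mD; suff h m (f : nat -> Omega -> R) : (forall k, (k < m)%N -> measT (f k)) ->
    measT (fun w => \big[Num.max/0]_(k < m) f k w).
  apply: (h _ (fun k w => D (dyadic N k) w ^+ 2)) => k kN.
  by apply: measurable_funX; apply: mD; exact: (dyadic_bounds T0).
elim: m f => [|m IH] f mf.
  have -> : (fun w => \big[Num.max/0]_(k < 0) f k w) = (fun=> 0) by apply/funext => w; rewrite big_ord0.
  exact: measurable_cst.
have -> : (fun w => \big[Num.max/0]_(k < m.+1) f k w) = (fun w => Num.max (f 0%N w) (\big[Num.max/0]_(k < m) f k.+1 w)).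
  by apply/funext => w; rewrite big_ord_recl.
apply: measurable_maxr; first exact: mf. by apply: (IH (fun k => f k.+1)) => k km; exact: mf.
Qed.

Variable D : R -> Omega -> R.
Hypothesis sD : forall t, 0 <= t <= T -> sqint P (D t).
Hypothesis cD : forall w, {within `[0, T], continuous (D ^~ w)}.
Hypothesis D0 : forall w, D 0 w = 0.
Variable C : R.
Hypothesis C0 : 0 <= C.
Hypothesis DC : forall a b, 0 <= a -> a <= b -> b <= T ->
  \int[P]_w (D b w - D a w) ^+ 2 <= C * ((b - a) * Num.sqrt (b - a)).

Definition mean_increments n : R := \sum_(k < (2 ^ n)%N) \int[P]_w (D (dyadic n k.+1) w - D (dyadic n k) w) ^+ 2.

Let sI n k : (k < 2 ^ n)%N -> sqint P (fun w => D (dyadic n k.+1) w - D (dyadic n k) w).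
Proof. by move=> kn; apply: sqintB; apply: sD; apply: (dyadic_bounds T0) => //; exact: ltnW. Qed.

Let mean_incrementsE n : L1 P (fun w => sqr_increments T (D ^~ w) n) /\
  mean_increments n = \int[P]_w sqr_increments T (D ^~ w) n.
Proof.
exact: (@Rintegral_sum _ _ _ P (2 ^ n) (fun k w => (D (dyadic n k.+1) w - D (dyadic n k) w) ^+ 2)
  (fun k kn => (sI kn).2)).
Qed.

Lemma mean_increments_ge0 n : 0 <= mean_increments n.
Proof. by apply: sumr_ge0 => k _; apply: Rintegral_ge0 => w _; exact: sqr_ge0. Qed.

(** At level n there are 2^n increments, of mean square at most a constant times 2^(-3n/2). Multiplied by 5/4,
    the square root of 1/2 stays below 25/28. *)
Let weighted_le n : (5 / 4) ^+ n * mean_increments n <= C * (T * Num.sqrt T) * (25 / 28) ^+ n.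
Proof.
have q0 : (0 : R) < 2 ^+ n by rewrite exprn_gt0. have sqrt2 : (7 / 5 : R) ^+ n <= Num.sqrt (2 ^+ n).
  have h : (0 : R) <= (7 / 5) ^+ n by apply: exprn_ge0; lra.
  rewrite -(ger0_norm h) -sqrtr_sqr ler_sqrt; last exact: ltW. by rewrite -exprM mulnC exprM lerXn2r ?nnegrE//; lra.
have s0 : (0 : R) < (7 / 5) ^+ n by apply: exprn_gt0; lra.
have h1 : mean_increments n <= 2 ^+ n * (C * (T / 2 ^+ n * Num.sqrt (T / 2 ^+ n))).
  apply: (@le_trans _ _ (\sum_(k < (2 ^ n)%N) C * (T / 2 ^+ n * Num.sqrt (T / 2 ^+ n)))).
    apply: ler_sum => k _; rewrite -(dyadicS T n k); apply: DC.
    - by have /andP[] := dyadic_bounds T0 (ltnW (ltn_ord k)).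
    - exact: (dyadicW T0).
    - by have /andP[] := dyadic_bounds T0 (ltn_ord k).
  by rewrite sumr_const card_ord -natrX mulr_natl.
have h2 : Num.sqrt (T / 2 ^+ n) <= Num.sqrt T / (7 / 5) ^+ n.
  rewrite sqrtrM ?(ltW T0)// sqrtrV ?(ltW q0)//; apply: ler_wpM2l; first exact: sqrtr_ge0.
  by rewrite lef_pV2 ?posrE// (lt_le_trans s0).
have p0 : (0 : R) <= (5 / 4) ^+ n by apply: exprn_ge0; lra. apply: le_trans (ler_wpM2l p0 h1) _.
have -> : (25 / 28 : R) ^+ n = (5 / 4) ^+ n / (7 / 5) ^+ n.
  by rewrite -exprVn -exprMn; congr (_ ^+ n); field.
have -> : (5 / 4) ^+ n * (2 ^+ n * (C * (T / 2 ^+ n * Num.sqrt (T / 2 ^+ n)))) =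
   (5 / 4) ^+ n * (C * T) * Num.sqrt (T / 2 ^+ n).
  by move: q0 (Num.sqrt _) ((5 / 4) ^+ n); move: (2 ^+ n) => q q0 r p; field; rewrite lt0r_neq0.
have -> : C * (T * Num.sqrt T) * ((5 / 4) ^+ n / (7 / 5) ^+ n) = (5 / 4) ^+ n * (C * T) * (Num.sqrt T / (7 / 5) ^+ n).
  by ring.
by apply: ler_wpM2l => //; apply: mulr_ge0 => //; apply: mulr_ge0 => //; exact: ltW.
Qed.

(** The levels below m are kept as they are, since they are small in the application; the others are bounded by
    28/3 (25/28)^m, the sum of a geometric series. *)
Lemma sup_sqr_mean m : [/\ measT (fun w => sup_sqr T (D ^~ w)), L1 P (fun w => sup_sqr T (D ^~ w)) &
  \int[P]_w sup_sqr T (D ^~ w) <= 5 * (\sum_(n < m) (5 / 4) ^+ n * mean_increments n +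
     C * (T * Num.sqrt T) * (10 * (25 / 28) ^+ m))].
Proof.
set B := C * (T * Num.sqrt T). have B0 : 0 <= B by rewrite /B !mulr_ge0 ?sqrtr_ge0// ltW.
have e0 n : 0 <= (5 / 4) ^+ n * mean_increments n.
  by apply: mulr_ge0; [apply: exprn_ge0; lra|exact: mean_increments_ge0].
have q0 n : (0 : R) <= (25 / 28) ^+ n by apply: exprn_ge0; lra.
have tail N : \sum_(n < N) (5 / 4) ^+ n * mean_increments n <=
    \sum_(n < m) (5 / 4) ^+ n * mean_increments n + B * (10 * (25 / 28) ^+ m).
  have [Nm|mN] := leqP N m.
    rewrite -(subnKC Nm) big_split_ord /= -addrA lerDl addr_ge0//; first by apply: sumr_ge0 => k _.
    by apply: mulr_ge0 => //; apply: mulr_ge0.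
  have : \sum_(n < m + (N - m)) (5 / 4) ^+ n * mean_increments n <=
    \sum_(n < m) (5 / 4) ^+ n * mean_increments n + B * (10 * ((25 / 28) ^+ m - (25 / 28) ^+ (m + (N - m)))).
    elim: (N - m)%N => [|j IH]; first by rewrite addn0 subrr !mulr0 addr0.
    rewrite addnS big_ord_recr /=; apply: le_trans (lerD IH (weighted_le _)) _.
    rewrite -/B -addrA lerD2l -mulrDr; apply: ler_wpM2l => //.
    by have := q0 (m + j)%N; rewrite exprS; move: ((25 / 28) ^+ (m + j)) => q; lra.
  rewrite subnKC ?(ltnW mN)// => h; apply: le_trans h _; rewrite lerD2l. by apply: ler_wpM2l => //; have := q0 N; lra.
have mM N : measT (fun w => max_sqr T (D ^~ w) N).
  by apply: measurable_max_sqr => t tT; case: (sD tT).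
pose W N w := \sum_(n < N.+1) (5 / 4) ^+ n * sqr_increments T (D ^~ w) n.
have iW' n : L1 P (fun w => (5 / 4) ^+ n * sqr_increments T (D ^~ w) n).
  by have := intZ ((5 / 4) ^+ n) (mean_incrementsE n).1.
have iW N : L1 P (W N) /\ \int[P]_w W N w = \sum_(n < N.+1) (5 / 4) ^+ n * mean_increments n.
  have [h <-] := @Rintegral_sum _ _ _ P N.+1 (fun n w => (5 / 4) ^+ n * sqr_increments T (D ^~ w) n) (fun n _ => iW' n).
  split => //; apply: eq_bigr => n _; have [i e] := mean_incrementsE n. by rewrite e (RintZ i).
have i5 N : L1 P (fun w => 5 * W N w).
  by have := intZ 5 (iW N).1.
have MW N w : `|max_sqr T (D ^~ w) N| <= 5 * W N w.
  by rewrite ger0_norm ?max_sqr_ge0//; exact: max_sqr_le_increments.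
have lim w : max_sqr T (D ^~ w) N @[N --> \oo] --> sup_sqr T (D ^~ w) := (sup_sqrP T0 (@cD w)).1.
have ms : measT (fun w => sup_sqr T (D ^~ w)) by exact: (measurable_fun_cvg mM (fun w _ => lim w)).
have [] := @Rintegral_fatou _ _ _ P setT (fun N w => max_sqr T (D ^~ w) N) (fun w => sup_sqr T (D ^~ w))
  (5 * (\sum_(n < m) (5 / 4) ^+ n * mean_increments n + B * (10 * (25 / 28) ^+ m))) measurableT mM => //.
- by move=> N w _; exact: max_sqr_ge0.
- by move=> N; apply: (integrable_dominated P (fun w => 5 * W N w)) => // w _.
- move=> N; apply: le_trans (ler_norm _) _.
  apply: le_trans (@le_normr_Rintegral_dominated _ _ _ P setT _ (fun w => 5 * W N w) measurableT (mM N) (fun w _ => MW N w) (i5 N)) _.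
  by rewrite (RintZ (iW N).1) (iW N).2 ler_pM2l.
Qed.

End chaining_bound.

(** * Uniform limit of a family of continuous processes *)

Section summable.
Context {R : realType} {d : measure_display} {Omega : measurableType d}.
Variable P : probability Omega R.

Lemma ae_summable (r : nat -> Omega -> R) : (forall j w, 0 <= r j w) -> (forall j, L1 P (r j)) ->
  (forall j, \int[P]_w r j w <= 1 / (2 ^ (j + 1))%:R) -> {ae P, forall w, (\sum_(j <oo) (r j w)%:E < +oo)%E}.
Proof.
move=> r0 ir br. have mr j : measT (fun w => (r j w)%:E) := measurable_int _ (ir j).
have mS : measT (fun w => (\sum_(j <oo) (r j w)%:E)%E).
  by apply: ge0_emeasurable_sum => [j w _ _|j _]; rewrite ?lee_fin.
have S0 w : (0 <= \sum_(j <oo) (r j w)%:E)%E by apply: nneseries_ge0 => j _ _; rewrite lee_fin.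
have iS : P.-integrable setT (fun w => (\sum_(j <oo) (r j w)%:E)%E).
  apply/integrableP; split => //; under eq_integral do rewrite gee0_abs//.
  rewrite integral_nneseries//; last by move=> j w _; rewrite lee_fin.
  apply: (@le_lt_trans _ _ (\sum_(j <oo) (1 / (2 ^ (j + 1))%:R)%:E)%E).
    apply: lee_nneseries => [j _ _|j _].
      by apply: integral_ge0 => w _; rewrite lee_fin.
    by rewrite -[leLHS](fineK (integrable_fin_num measurableT (ir j))) lee_fin; exact: br.
  by have /cvg_lim := @cvg_geometric_eseries_half R 1 0; rewrite expr0 divr1 => ->//; rewrite ltry.
have := integrable_ae measurableT iS; apply: filterS => w /(_ I); rewrite fin_numE => /andP[_ h]. by rewrite ltey.
Qed.

Lemma summable_tail (r : nat -> R) : (forall j, 0 <= r j) -> (\sum_(j <oo) (r j)%:E < +oo)%E ->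
  exists tau : nat -> R, [/\ tau n @[n --> \oo] --> 0, forall n, r n <= tau n &
    forall j m, \sum_(i < m) r (j + i)%N <= tau j].
Proof.
move=> r0 fin; set A := (\sum_(j <oo) _)%E in fin.
have A0 : (0 <= A)%E by apply: nneseries_ge0 => j _ _; rewrite lee_fin.
have fA : A \is a fin_num by rewrite ge0_fin_numE. pose s n := \sum_(i < n) r i. have sA n : s n <= fine A.
  have := @nneseries_lim_ge R (fun k => (r k)%:E) xpredT 0 n (fun k _ => _).
  rewrite -/A -(fineK fA) big_mkord sumEFin lee_fin => h. by apply: h => k; rewrite lee_fin.
have nd : nondecreasing_seq s.
  by apply/nondecreasing_seqP => n; rewrite /s big_ord_recr /= lerDl.
have cs : cvgn s by apply: nondecreasing_is_cvgn => //; exists (fine A) => _ [n _ <-].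
have sl n : s n <= limn s := nondecreasing_cvgn_le nd cs n. have part j m : \sum_(i < m) r (j + i)%N <= limn s - s j.
  rewrite lerBrDr; apply: le_trans (sl (j + m)%N). by rewrite /s big_split_ord /= addrC.
exists (fun n => limn s - s n); split => [|n|//].
  apply: (cvg_eqr (limn s - limn s)); last by rewrite subrr. by apply: cvgB => //; exact: cvg_cst.
by have := part n 1%N; rewrite big_ord1 addn0.
Qed.

End summable.

Section limit_process.
Context {R : realType} {d : measure_display} {Omega : measurableType d}.
Variable P : probability Omega R.
Variable T : R.
Hypothesis T0 : 0 < T.
Variable X : R -> R -> Omega -> R.
Hypothesis X0 : forall e w, X e 0 w = 0.
Hypothesis cX : forall e, 0 < e -> continuous_process T (X e).
Hypothesis sX : forall e t, 0 < e -> 0 <= t <= T -> sqint P (X e t).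
Variable K : R.
Hypothesis K0 : 0 <= K.
Hypothesis XK : forall e a b, 0 < e -> 0 <= a -> a <= b -> b <= T ->
  \int[P]_w (X e b w - X e a w) ^+ 2 <= K * ((b - a) * Num.sqrt (b - a)).
Hypothesis XC : forall (e1 e2 : nat -> R) t, (forall n, 0 < e1 n) -> (forall n, 0 < e2 n) ->
  e1 n @[n --> \oo] --> 0 -> e2 n @[n --> \oo] --> 0 -> 0 <= t <= T ->
  \int[P]_w (X (e1 n) t w - X (e2 n) t w) ^+ 2 @[n --> \oo] --> 0.

Let D e e' t w : R := X e t w - X e' t w.

Let sD e e' t : 0 < e -> 0 < e' -> 0 <= t <= T -> sqint P (D e e' t).
Proof. by move=> e0 e0' tT; apply: sqintB; exact: sX. Qed.

Let D0 e e' w : D e e' 0 w = 0. Proof. by rewrite /D !X0 subrr. Qed.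

Let cD e e' w : 0 < e -> 0 < e' -> {within `[0, T], continuous (D e e' ^~ w)}.
Proof.
move=> e0 e0'; have [_ c1] := cX e0; have [_ c2] := cX e0'. by move=> t; apply: cvgB; [exact: c1|exact: c2].
Qed.

Lemma Rintegral_sqrB_le (A B : Omega -> R) : sqint P A -> sqint P B ->
  \int[P]_w (A w - B w) ^+ 2 <= 2 * \int[P]_w A w ^+ 2 + 2 * \int[P]_w B w ^+ 2.
Proof.
move=> [mA iA] [mB iB]; have [i1 <-] := @Rintegral_linear2 _ _ _ P 2 2 _ _ iA iB.
apply: le_Rintegral => //; first by case: (sqintB (conj mA iA) (conj mB iB)).
by move=> w _; have := sqr_add_le (A w) (- B w); rewrite sqrrN.
Qed.

Let DK e e' a b : 0 < e -> 0 < e' -> 0 <= a -> a <= b -> b <= T ->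
  \int[P]_w (D e e' b w - D e e' a w) ^+ 2 <= (4 * K) * ((b - a) * Num.sqrt (b - a)).
Proof.
move=> e0 e0' a0 ab bT. have aT : 0 <= a <= T by rewrite a0 (le_trans ab).
have bT' : 0 <= b <= T by rewrite (le_trans a0 ab). have -> : \int[P]_w (D e e' b w - D e e' a w) ^+ 2 =
    \int[P]_w ((X e b w - X e a w) - (X e' b w - X e' a w)) ^+ 2.
  by apply: eq_Rintegral => w _; rewrite /D; ring.
apply: le_trans (Rintegral_sqrB_le (sqintB (sX e0 bT') (sX e0 aT)) (sqintB (sX e0' bT') (sX e0' aT))) _.
have := XK e0 a0 ab bT; have := XK e0' a0 ab bT. by move: (\int[P]_w _) (\int[P]_w _) ((b - a) * _) => x y z; lra.
Qed.

Let S e e' w : R := sup_sqr T (fun t => D e e' t w).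

(** The high levels of the chaining are small uniformly in e and e', and the finitely many increments of the low
    levels vanish with e and e'. *)
Lemma sup_dist_cauchy eta : 0 < eta -> exists2 dl : R, 0 < dl & forall e e', 0 < e <= dl -> 0 < e' <= dl ->
    L1 P (S e e') /\ \int[P]_w S e e' w <= eta.
Proof.
move=> eta0; apply: contrapT => H.
have /choice[p Hp] n : exists p : R * R, [/\ 0 < p.1 <= n.+1%:R^-1, 0 < p.2 <= n.+1%:R^-1 &
    eta < \int[P]_w S p.1 p.2 w].
  apply: contrapT => Hn; apply: H; exists n.+1%:R^-1; first by rewrite invr_gt0.
  move=> e e' he he'; have /andP[e0 _] := he; have /andP[e0' _] := he'.
  have [_ iS _] := sup_sqr_mean T0 (fun t => @sD e e' t e0 e0') (fun w => @cD e e' w e0 e0') (D0 e e')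
    (mulr_ge0 (ler0n R 4) K0) (fun a b => @DK e e' a b e0 e0') 0.
  split => //; rewrite leNgt; apply/negP => h; apply: Hn; exists (e, e'); split => //.
have p1 n : 0 < (p n).1 by have [/andP[]] := Hp n. have p2 n : 0 < (p n).2 by have [_ /andP[]] := Hp n.
have c1 : (p n).1 @[n --> \oo] --> 0.
  by apply: cvg0_harmonic => n; rewrite (ltW (p1 n)); have [/andP[]] := Hp n.
have c2 : (p n).2 @[n --> \oo] --> 0.
  by apply: cvg0_harmonic => n; rewrite (ltW (p2 n)); have [_ /andP[]] := Hp n.
set B := 4 * K * (T * Num.sqrt T). have [m Hm] : exists m, 5 * (B * (10 * (25 / 28) ^+ m)) <= eta / 2.
  have c3 : 5 * (B * (10 * (25 / 28) ^+ m)) @[m --> \oo] --> 0.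
    apply: (cvg_eqr (5 * (B * (10 * 0)))); last by rewrite !mulr0. do 3 (apply: cvgM; first exact: cvg_cst).
    by apply: cvg_expr; rewrite ger0_norm; lra.
  have e2 : 0 < eta / 2 by rewrite divr_gt0. move/cvgr0Pnorm_le : c3 => /(_ _ e2)[m _ /(_ m (leqnn _)) h].
  by exists m; exact: le_trans (ler_norm _) h.
pose F n := 5 * \sum_(k < m) (5 / 4) ^+ k * mean_increments P T (D (p n).1 (p n).2) k.
have DD t : 0 <= t <= T -> \int[P]_w D (p n).1 (p n).2 t w ^+ 2 @[n --> \oo] --> 0.
  by move=> tT; exact: (@XC (fun n => (p n).1) (fun n => (p n).2)).
have sum0 (I : nat) (f : nat -> nat -> R) : (forall k, (k < I)%N -> f k n @[n --> \oo] --> 0) ->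
    \sum_(k < I) f k n @[n --> \oo] --> 0.
  elim: I => [|I IH] hf.
    by under eq_fun do rewrite big_ord0; exact: cvg_cst.
  under eq_fun do rewrite big_ord_recr /=. apply: (cvg_eqr (0 + 0)); last by rewrite addr0.
  by apply: cvgD; [apply: IH => k kI; apply: hf; exact: ltnW|exact: hf].
have cF : F n @[n --> \oo] --> 0.
  apply: (cvg_eqr (5 * 0)); last by rewrite mulr0. apply: cvgM; first exact: cvg_cst.
  apply: (sum0 m (fun k n => (5 / 4) ^+ k * mean_increments P T (D (p n).1 (p n).2) k)) => k _; apply: (cvg_eqr ((5 / 4) ^+ k * 0)); last by rewrite mulr0.
  apply: cvgM; first exact: cvg_cst.
  apply: (sum0 _ (fun l n => \int[P]_w (D (p n).1 (p n).2 (dyadic T k l.+1) w - D (p n).1 (p n).2 (dyadic T k l) w) ^+ 2)) => l lk.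
  have t1 := dyadic_bounds T0 lk; have t2 := dyadic_bounds T0 (ltnW lk).
  apply: (cvg_dist_le (fun n => 2 * \int[P]_w D (p n).1 (p n).2 (dyadic T k l.+1) w ^+ 2 +
     2 * \int[P]_w D (p n).1 (p n).2 (dyadic T k l) w ^+ 2)).
    move=> n; rewrite subr0 ger0_norm; last by apply: Rintegral_ge0 => w _; exact: sqr_ge0.
    by apply: Rintegral_sqrB_le; exact: sD.
  apply: (cvg_eqr (2 * 0 + 2 * 0)); last by rewrite mulr0 addr0.
  by apply: cvgD; apply: cvgM; (exact: cvg_cst || exact: DD).
have e2 : 0 < eta / 2 by rewrite divr_gt0. move/cvgr0Pnorm_le : cF => /(_ _ e2)[N _ /(_ N (leqnn _)) HN].
have [_ _] := Hp N; rewrite ltNge => /negP; apply.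
have [_ _ h] := sup_sqr_mean T0 (fun t => @sD (p N).1 (p N).2 t (p1 N) (p2 N)) (fun w => @cD (p N).1 (p N).2 w (p1 N) (p2 N))
  (D0 (p N).1 (p N).2) (mulr_ge0 (ler0n R 4) K0) (fun a b => @DK (p N).1 (p N).2 a b (p1 N) (p2 N)) m.
apply: le_trans h _; rewrite mulrDr [leRHS]splitr; apply: lerD => //. exact: le_trans (ler_norm _) HN.
Qed.

Let r e e' w : R := Num.sqrt (S e e' w).

Let rP e e' t w : 0 < e -> 0 < e' -> 0 <= t <= T -> `|X e t w - X e' t w| <= r e e' w.
Proof.
move=> e0 e0' tT; have [_ h] := sup_sqrP T0 (@cD e e' w e0 e0').
by rewrite -sqrtr_sqr ler_sqrt ?h//; apply: le_trans (h t tT); exact: sqr_ge0.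
Qed.

Let rate (j : nat) : R := (1 / (2 ^ (j + 1))%:R) ^+ 2.

(** Below these scales the mean uniform distance is at most 2^(-j-1), which is summable. *)
Let good_scale (dl : nat -> R) := forall j e e', 0 < e <= dl j -> 0 < e' <= dl j ->
    L1 P (r e e') /\ \int[P]_w r e e' w <= 1 / (2 ^ (j + 1))%:R.

Let good_scale_exists : exists2 x : nat -> R, good_scale x & forall j, [/\ 0 < x j, x j.+1 <= x j & x j <= j.+1%:R^-1].
Proof.
have rate0 j : 0 < rate j by rewrite exprn_gt0// divr_gt0// ltr0n expn_gt0.
have /choice[dl Hdl] j : exists dl : R, 0 < dl /\ forall e e', 0 < e <= dl -> 0 < e' <= dl ->
    L1 P (S e e') /\ \int[P]_w S e e' w <= rate j.
  by have [dl] := sup_dist_cauchy (rate0 j); exists dl.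
pose x := fix x j := if j is k.+1 then Num.min (x k) (Num.min (dl k.+1) k.+2%:R^-1) else Num.min (dl 0%N) 1.
have x0 j : 0 < x j.
  elim: j => [|j IH] /=; first by rewrite lt_min (Hdl 0%N).1 ltr01. by rewrite !lt_min IH (Hdl j.+1).1 invr_gt0 ltr0n.
have xd j : x j <= dl j by case: j => [|j] /=; rewrite !ge_min lexx ?orbT.
exists x => [j e e' /andP[e0 ex] /andP[e0' ex']|j]; last first.
  split => //=; first by rewrite ge_min lexx. by case: j => [|j] /=; rewrite !ge_min ?invr1 lexx ?orbT.
have [iS bS] := (Hdl j).2 e e' (introT andP (conj e0 (le_trans ex (xd j)))) (introT andP (conj e0' (le_trans ex' (xd j)))).
have S0 w : 0 <= S e e' w.
  have [_ h] := sup_sqrP T0 (@cD e e' w e0 e0'). by apply: le_trans (sqr_ge0 _) (h 0 _); rewrite lexx ltW.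
have mr : measT (r e e').
  apply: (measurableT_comp (continuous_measurable_fun (@sqrt_continuous R))).
  by apply/measurable_EFinP; exact: measurable_int iS.
have sr : sqint P (r e e').
  split => //; suff -> : (fun w => r e e' w ^+ 2) = S e e' by []. by apply/funext => w; rewrite sqr_sqrtr.
split; first exact: sqint_integrable.
have n0 : 0 <= \int[P]_w r e e' w by apply: Rintegral_ge0 => w _; exact: sqrtr_ge0.
rewrite -(@ler_pXn2r _ 2)// ?nnegrE//; apply: le_trans bS.
have := Rintegral_norm_sqr sr; under eq_Rintegral do rewrite ger0_norm ?sqrtr_ge0//.
by move=> h; apply: le_trans h _; apply: le_Rintegral => //; first (by case: sr); move=> w _; rewrite sqr_sqrtr.
Qed.

(** Along the scales x the uniform distances are summable almost surely; on the exceptional event the limit is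
    set to 0. Scales y below x stay at summable distances from x, hence give the same limit. *)
Lemma limit_process : exists (Z : R -> Omega -> R) (x : nat -> R),
  [/\ (forall j, 0 < x j <= j.+1%:R^-1), continuous_process T Z, (forall w, Z 0 w = 0) &
    forall y : nat -> R, (forall j, 0 < y j <= x j) -> {ae P, forall w, exists tau : nat -> R,
      tau n @[n --> \oo] --> 0 /\ forall n t, 0 <= t <= T -> `|X (y n) t w - Z t w| <= tau n}].
Proof.
have [x Hx xP] := good_scale_exists. have x0 j : 0 < x j by have [] := xP j.
have xx j : 0 < x j <= x j by rewrite x0 lexx. have xS j : 0 < x j.+1 <= x j by rewrite x0; have [] := xP j.
pose q j w := r (x j.+1) (x j) w. pose A w := (\sum_(j <oo) (q j w)%:E)%E.
have q0 j w : 0 <= q j w by exact: sqrtr_ge0. have qI j : L1 P (q j) := (Hx j _ _ (xS j) (xx j)).1.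
have qb j : \int[P]_w q j w <= 1 / (2 ^ (j + 1))%:R := (Hx j _ _ (xS j) (xx j)).2. have Afin := ae_summable q0 qI qb.
pose good w : bool := (A w < +oo)%E. have mgood : measT good.
  apply: measurable_fun_lte; last exact: measurable_cst.
  by apply: ge0_emeasurable_sum => [j w _ _|j _]; rewrite ?lee_fin//; exact: measurable_int (qI j).
pose V j t w := X (x j) (clamp T t) w * ind (good w). have cl t : 0 <= clamp T t <= T := clamp_itv (ltW T0) t.
have Vtail w : good w -> exists tau : nat -> R, tau n @[n --> \oo] --> 0 /\
    forall j m t, `|V (j + m)%N t w - V j t w| <= tau j.
  move=> gw; have [tau [tau0 _ ht]] := summable_tail (q0 ^~ w) gw; exists tau; split => // j m t.
  rewrite /V /ind gw !mulr1; apply: le_trans (ht j m).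
  elim: m => [|m IH]; first by rewrite addn0 subrr normr0 big_ord0. rewrite big_ord_recr /= addnS.
  have -> : X (x (j + m).+1) (clamp T t) w - X (x j) (clamp T t) w =
    (X (x (j + m)%N) (clamp T t) w - X (x j) (clamp T t) w) +
    (X (x (j + m).+1) (clamp T t) w - X (x (j + m)%N) (clamp T t) w) by ring.
  by apply: le_trans (ler_normD _ _) _; apply: lerD => //; exact: rP.
pose Z t w := lim (V j t w @[j --> \oo]). have VZ t w : V j t w @[j --> \oo] --> Z t w.
  case gw : (good w); last first.
    have e : (fun j => V j t w) = (fun=> 0) by apply/funext => j; rewrite /V /ind gw mulr0.
    by rewrite /Z e; exact: is_cvg_cst.
  have [tau [tau0 ht]] := Vtail w gw. apply: R_complete; apply: cauchy_exP => e e0.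
  have e2 : 0 < e / 2 by rewrite divr_gt0. move/cvgr0Pnorm_le : tau0 => /(_ _ e2)[N _ /(_ N (leqnn _)) HN].
  exists (V N t w); exists N => // m /= Nm; rewrite /ball /= distrC -(subnKC Nm).
  apply: le_lt_trans (ht N (m - N)%N t) _; apply: le_lt_trans (ler_norm _) _.
  by apply: le_lt_trans HN _; rewrite ltr_pdivrMr// ltr_pMr// ltr1n.
have VZle w : good w -> exists tau : nat -> R, tau n @[n --> \oo] --> 0 /\ forall j t, `|V j t w - Z t w| <= tau j.
  move=> gw; have [tau [tau0 ht]] := Vtail w gw; exists tau; split => // j t.
  have c1 : `|V j t w - V (m + j)%N t w| @[m --> \oo] --> `|V j t w - Z t w|.
    apply: cvg_norm; apply: cvgB; first exact: cvg_cst. by rewrite (cvg_shiftn j (fun m => V m t w)); exact: VZ.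
  by apply: (cvg_le_lim c1) => m; rewrite distrC addnC.
have cV j w : continuous (V j ^~ w).
  have [_ c1] := cX (x0 j); have c2 := within_clamp (ltW T0) (c1 w).
  by move=> t; apply: cvgM; [exact: c2|exact: cvg_cst].
have cZ w : continuous (Z ^~ w).
  case gw : (good w); last first.
    have -> : Z ^~ w = (fun=> 0); last exact: cst_continuous.
    apply/funext => t; apply: (cvgr_unique (VZ t w) (cvg_cst 0)) => j. by rewrite /V /ind gw mulr0.
  have [tau [tau0 ht]] := VZle w gw. move=> t; apply/cvgrPdist_le => e e0. have e3 : 0 < e / 3 by rewrite divr_gt0.
  move/cvgr0Pnorm_le : tau0 => /(_ _ e3)[N _ /(_ N (leqnn _)) HN].
  have tauN : tau N <= e / 3 := le_trans (ler_norm _) HN.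
  have /cvgrPdist_le /(_ _ e3) := cV N w t; apply: filterS => s hs.
  have -> : Z t w - Z s w = (Z t w - V N t w) + (V N t w - V N s w) + (V N s w - Z s w) by ring.
  have h1 := ht N t; have h2 := ht N s; rewrite distrC in h1.
  apply: le_trans (ler_normD _ _) _; apply: le_trans (lerD (ler_normD _ _) (lexx _)) _.
  by move: hs h1 h2 tauN; move: (`|_|) (`|_|) (`|_|) => a b c' *; lra.
exists Z, x; split.
- by move=> j; rewrite x0; have [] := xP j.
- split=> [t tT|w]; last exact: continuous_subspaceT.
  apply: (@measurable_fun_cvg _ _ _ setT (fun j => V j t)) => [j|w _]; last exact: VZ.
  apply: measurable_funM; last exact: measurable_ind. by case: (sX (x0 j) (cl t)).
- move=> w; apply: (cvgr_unique (VZ 0 w) (cvg_cst 0)) => j. by rewrite /V clamp_id ?X0 ?mul0r// in_itv/= lexx ltW.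
- move=> y Hy. have y0 j : 0 < y j by have /andP[] := Hy j.
  have rI j : L1 P (r (y j) (x j)) := (Hx j _ _ (Hy j) (xx j)).1.
  have rb j : \int[P]_w r (y j) (x j) w <= 1 / (2 ^ (j + 1))%:R := (Hx j _ _ (Hy j) (xx j)).2.
  have Bfin := ae_summable (fun j w => sqrtr_ge0 _) rI rb; near=> w. have gw : good w by near: w.
  have Bw : (\sum_(j <oo) (r (y j) (x j) w)%:E < +oo)%E by near: w.
  have [sg [sg0 hs _]] := summable_tail (fun j => sqrtr_ge0 _) Bw. have [tau [tau0 ht]] := VZle w gw.
  exists (fun n => sg n + tau n); split.
    by apply: (cvg_eqr (0 + 0)); [exact: cvgD|rewrite addr0].
  move=> n t tT; have -> : X (y n) t w - Z t w = (X (y n) t w - X (x n) t w) + (V n t w - Z t w).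
    by rewrite /V /ind gw mulr1 clamp_id ?in_itv//; ring.
  apply: le_trans (ler_normD _ _) _; apply: lerD; last exact: ht. by apply: le_trans (hs n); exact: rP.
Unshelve. all: by end_near. Qed.

End limit_process.

(** * Convergence in distribution of continuous processes *)

Section path_functional.
Context {R : realType}.
Variable T : R.
Hypothesis T0 : 0 < T.
Variable Phi : {uniform` `[0, T]%classic -> R} -> R.
Hypothesis cPhi : {within C0T T, continuous Phi}.

Lemma path_functional_cvg (f_ : nat -> R -> R) (f : R -> R) : (forall n, C0T T (f_ n)) -> C0T T f ->
  (forall e : R, 0 < e -> \forall n \near \oo, forall t, 0 <= t <= T -> `|f_ n t - f t| <= e) ->
  Phi (f_ n) @[n --> \oo] --> Phi f.
Proof.
move=> cf_ cf cu. have /subspace_continuousP /(_ f cf) h := cPhi.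
suff c1 : (f_ n : {uniform` `[0, T]%classic -> R}) @[n --> \oo] --> within (C0T T) (nbhs (f : {uniform` `[0, T]%classic -> R})).
  exact: cvg_comp c1 h.
move=> Q; rewrite /within /= => /uniform_nbhs[E [entE EQ]]. move: entE; rewrite -entourage_ballE => -[e /= e0 eE].
have e2 : 0 < e / 2 by rewrite divr_gt0. apply: filterS (cu _ e2) => n hn. apply: (EQ (f_ n)); last exact: cf_.
move=> t /=; rewrite in_itv/= => tT; apply: eE; rewrite /ball /= distrC.
by apply: le_lt_trans (hn t tT) _; rewrite ltr_pdivrMr// ltr_pMr// ltr1n.
Qed.

Let dl n : R := T / n.+1%:R.
Let node n k : R := grid 0 T n k.
Let hat n k t : R := Num.max 0 (2 * dl n - `|t - node n k|).

(** Averages with tent functions of half width two meshes: each time is covered, and only the nodes close to it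
    count. *)
Definition interpolation n (a : nat -> R) t : R := (\sum_(k < n.+2) a k * hat n k t) / \sum_(k < n.+2) hat n k t.

Let dl0 n : 0 < dl n. Proof. by rewrite divr_gt0// ltr0n. Qed.

Let hat0 n k t : 0 <= hat n k t. Proof. by rewrite le_max lexx. Qed.

Let nodeE n k : node n k = k%:R * dl n. Proof. by rewrite /node /grid /dl subr0 add0r. Qed.

Let hat_sum n t : 0 <= t <= T -> 0 < \sum_(k < n.+2) hat n k t.
Proof.
move=> /andP[t0 tT]; pose k := Num.trunc (t / dl n).
have /andP[k1 k2] : k%:R <= t / dl n < k.+1%:R by apply: truncn_itv; rewrite divr_ge0// ltW. have kn : (k < n.+2)%N.
  rewrite ltnS -(ler_nat R); apply: le_trans k1 _; rewrite ler_pdivrMr//. by rewrite /dl mulrC divfK// pnatr_eq0.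
rewrite (bigD1 (Ordinal kn)) //=; apply: ltr_pwDl; last by apply: sumr_ge0 => i _.
rewrite /hat lt_max; apply/orP; right; rewrite subr_gt0 nodeE.
move: k1 k2; rewrite ler_pdivlMr// ltr_pdivrMr// -natr1 => k1 k2. by rewrite ger0_norm ?subr_ge0//; have := dl0 n; lra.
Qed.

Lemma interpolation_continuous n a : C0T T (interpolation n a).
Proof.
apply: continuous_in_subspaceT => t; rewrite inE /= in_itv/= => tT. have ch k : continuous (hat n k).
  move=> s; apply: (@continuous_max _ _ (cst 0) (fun s => 2 * dl n - `|s - node n k|)); first exact: cvg_cst.
  apply: cvgB; first exact: cvg_cst. by apply: cvg_norm; apply: cvgB; [exact: cvg_id|exact: cvg_cst].
have cs (b : nat -> R) : continuous (fun s => \sum_(k < n.+2) b k * hat n k s).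
  elim: n.+2 => [|m IH].
    have -> : (fun s => \sum_(k < 0) b k * hat n k s) = (fun=> 0) by apply/funext => s; rewrite big_ord0.
    exact: cst_continuous.
  have -> : (fun s => \sum_(k < m.+1) b k * hat n k s) = (fun s => \sum_(k < m) b k * hat n k s + b m * hat n m s).
    by apply/funext => s; rewrite big_ord_recr.
  by move=> s; apply: cvgD; [exact: IH|apply: cvgM; [exact: cvg_cst|exact: ch]].
apply: cvgM; first exact: cs. apply: cvgV; first by rewrite lt0r_neq0// hat_sum. have := cs (fun=> 1) t.
have -> // : (fun s => \sum_(k < n.+2) 1 * hat n k s) = (fun s => \sum_(k < n.+2) hat n k s).
by apply/funext => s; apply: eq_bigr => k _; rewrite mul1r.
Qed.

Lemma interpolation_dist n a t (y e : R) : 0 <= t <= T ->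
  (forall k, (k <= n.+1)%N -> `|t - node n k| < 2 * dl n -> `|a k - y| <= e) -> `|interpolation n a t - y| <= e.
Proof.
move=> tT h; have S0 := @hat_sum n t tT. rewrite /interpolation; set S := \sum_(k < _) hat n k t in S0 *.
have -> : (\sum_(k < n.+2) a k * hat n k t) / S - y = (\sum_(k < n.+2) (a k - y) * hat n k t) / S.
  under [in RHS]eq_bigr do rewrite mulrBl. by rewrite sumrB -mulr_sumr -/S mulrBl mulfK// lt0r_neq0.
rewrite normrM [X in _ * X]gtr0_norm ?invr_gt0// ler_pdivrMr// mulr_sumr.
apply: le_trans (ler_norm_sum _ _ _) _; apply: ler_sum => k _. rewrite normrM (ger0_norm (hat0 _ _ _)).
have [kt|kt] := ltP `|t - node n k| (2 * dl n).
  by apply: ler_wpM2r => //; apply: h => //; rewrite -ltnS.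
by rewrite /hat max_l ?mulr0// subr_le0.
Qed.

Section measurable_functional.
Context {d : measure_display} {Omega : measurableType d}.

Lemma measurable_seq_eq (f : nat -> Omega -> int) (l : seq nat) (c : seq int) :
  (forall k a, k \in l -> measurable [set w | f k w = a]) -> measurable [set w | [seq f k w | k <- l] = c].
Proof.
elim: l c => [|k l IH] [|a c] mf /=.
- by have -> : [set _ : Omega | [::] = [::] :> seq int] = setT by apply/seteqP; split.
- by have -> : [set _ : Omega | [::] = a :: c] = set0 by apply/seteqP; split.
- by have -> : [set w : Omega | f k w :: [seq f j w | j <- l] = [::]] = set0 by apply/seteqP; split.
have -> : [set w | f k w :: [seq f j w | j <- l] = a :: c] = [set w | f k w = a] `&` [set w | [seq f j w | j <- l] = c].
  by apply/seteqP; split=> w /= => [[-> ->]|[-> ->]].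
by apply: measurableI; [apply: mf; rewrite mem_head|apply: IH => j b jl; apply: mf; rewrite inE jl orbT].
Qed.

(** The functional is a limit of its values at interpolations of the path rounded at finitely many times, which
    take countably many values. *)
Lemma measurable_path_functional (X : R -> Omega -> R) : continuous_process T X -> measT (fun w => Phi (X ^~ w)).
Proof.
move=> [mX cX]. pose z n w := [seq Num.floor (n.+1%:R * X (node n k) w) | k <- iota 0 n.+2].
pose G n (c : seq int) := Phi (interpolation n (fun k => (nth 0 c k)%:~R / n.+1%:R)).
have nodeT n k : (k <= n.+1)%N -> 0 <= node n k <= T by move=> kn; exact: (grid_itv (ltW T0) kn).
apply: (@measurable_fun_cvg _ _ _ setT (fun n w => G n (z n w))) => [n _ B mB|w _].
  rewrite setTI; have -> : (fun w => G n (z n w)) @^-1` B =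
      \bigcup_(c : seq int) ([set w | z n w = c] `&` [set _ | B (G n c)]).
    apply/seteqP; split=> [w Bw|w [c _ [/= <-]]] //. by exists (z n w).
  apply: countable_bigcupT_measurable => [|c]; first exact: countableP. have [Bc|Bc] := pselect (B (G n c)); last first.
    by have -> : [set w | z n w = c] `&` [set _ | B (G n c)] = set0 by apply/seteqP; split=> w [].
  have -> : [set w | z n w = c] `&` [set _ | B (G n c)] = [set w | z n w = c] by apply/seteqP; split=> w // [].
  apply: measurable_seq_eq => k a; rewrite mem_iota /= add0n ltnS => kn.
  by apply: measurable_floor_eq; apply: mX; rewrite in_itv/= nodeT.
apply: path_functional_cvg; [by move=> n; exact: interpolation_continuous|exact: cX|].
move=> e e0; have cg := within_clamp (ltW T0) (cX w). have e2 : 0 < e / 2 by rewrite divr_gt0.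
have [r r0 hr] := modulus 0 T cg e2. have r2 : 0 < r / 2 by rewrite divr_gt0. have mesh := mesh_small 0 T r2.
have inv := @cvg_harmonic R; move/cvgr0Pnorm_le : inv => /(_ _ e2) inv.
near=> n; move=> t tT; apply: interpolation_dist => // k kn kt. have kT := nodeT n k kn.
rewrite (nth_map 0%N) ?size_iota// nth_iota// add0n. set y := X (node n k) w.
have h1 : `|(Num.floor (n.+1%:R * y))%:~R / n.+1%:R - y| <= e / 2.
  by apply: le_trans (floor_grid_dist n y) _; apply: le_trans (ler_norm _) _; near: n.
have h2 : `|y - X t w| <= e / 2.
  have := hr (node n k) t kT; rewrite !clamp_id ?in_itv// => h3; apply/ltW/h3.
  rewrite distrC; apply: lt_trans kt _; near: n. apply: filterS mesh => n hn; have := le_lt_trans (ler_norm _) hn.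
  by rewrite subr0 -/(dl n); lra.
have -> : (Num.floor (n.+1%:R * y))%:~R / n.+1%:R - X t w =
  ((Num.floor (n.+1%:R * y))%:~R / n.+1%:R - y) + (y - X t w) by ring.
by apply: le_trans (ler_normD _ _) _; rewrite [leRHS]splitr lerD.
Unshelve. all: by end_near. Qed.

End measurable_functional.

End path_functional.

Section convergence_in_distribution.
Context {R : realType} {d : measure_display} {Omega : measurableType d}.
Variable P : probability Omega R.
Variable T : R.
Hypothesis T0 : 0 < T.
Variables (X : R -> R -> Omega -> R) (Z : R -> Omega -> R) (x : nat -> R).
Hypothesis cX : forall e, 0 < e -> continuous_process T (X e).
Hypothesis cZ : continuous_process T Z.
Hypothesis x0 : forall j, 0 < x j.
Hypothesis XZ : forall y : nat -> R, (forall j, 0 < y j <= x j) -> {ae P, forall w, exists tau : nat -> R,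
  tau n @[n --> \oo] --> 0 /\ forall n t, 0 <= t <= T -> `|X (y n) t w - Z t w| <= tau n}.

(** If convergence failed, it would fail along some scales below the x j, where almost sure uniform convergence
    and dominated convergence apply. *)
Lemma uniform_cvg_distribution : cvg_distribution_C0T T 0^'+ P X P Z.
Proof.
split=> [|//|Phi cPhi [C HC]].
  by near=> e; apply: cX; near: e; exact: nbhs_right_gt.
have mPhi (W : R -> Omega -> R) : continuous_process T W -> measT (fun w => Phi (W ^~ w)).
  exact: measurable_path_functional.
have bPhi W w : continuous_process T W -> `|Phi (W ^~ w)| <= C by move=> [_ cW]; exact: HC.
have iPhi W : continuous_process T W -> L1 P (fun w => Phi (W ^~ w)).
  by move=> cW; apply: (integrable_bounded P C); [exact: mPhi|move=> w; exact: bPhi].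
have EE W : continuous_process T W -> ('E_P[fun w => Phi (W ^~ w)])%E = (\int[P]_w Phi (W ^~ w))%:E.
  by move=> cW; rewrite unlock /Rintegral fineK//; exact: (integrable_fin_num measurableT (iPhi W cW)).
rewrite EE//. suff h : \int[P]_w Phi (X e ^~ w) @[e --> 0^'+] --> \int[P]_w Phi (Z ^~ w).
  have h' : (\int[P]_w Phi (X e ^~ w))%:E @[e --> 0^'+] --> (\int[P]_w Phi (Z ^~ w))%:E.
    by apply: cvg_EFin => //; exact: nearW.
  apply: cvg_trans h'; apply: near_eq_cvg; near=> e; rewrite EE//; apply: cX. by near: e; exact: nbhs_right_gt.
apply/cvgrPdist_le => rho rho0; apply: contrapT => H.
have /choice[y Hy] j : exists e, 0 < e <= x j /\ rho < `|\int[P]_w Phi (Z ^~ w) - \int[P]_w Phi (X e ^~ w)|.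
  apply: contrapT => Hj; apply: H; near=> e; rewrite leNgt; apply/negP => h; apply: Hj; exists e; split => //.
  by apply/andP; split; near: e; [exact: nbhs_right_gt|exact: nbhs_right_le].
have y0 j : 0 < y j by have [/andP[]] := Hy j. have cY n := cX (y0 n).
have cE : {ae P, forall w, setT w -> (Phi (X (y n) ^~ w))%:E @[n --> \oo] --> (Phi (Z ^~ w))%:E}.
  have := XZ (fun j => (Hy j).1); apply: filterS => w [tau [tau0 ht]] _. apply: cvg_EFin; first exact: nearW.
  apply: path_functional_cvg => //; [by move=> n; exact: (cY n).2|exact: cZ.2|].
  move=> e e0; move/cvgr0Pnorm_le : tau0 => /(_ _ e0); apply: filterS => n hn t tT.
  exact: le_trans (ht n t tT) (le_trans (ler_norm _) hn).
have bE : {ae P, forall w n, setT w -> (`|(Phi (X (y n) ^~ w))%:E| <= (EFin \o cst C) w)%E}.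
  by apply: aeW => w n _; rewrite lee_fin; exact: bPhi.
have iC : L1 P (cst C) by exact: finite_measure_integrable_cst.
have [_ _ c1] := @dominated_convergence _ _ _ P setT measurableT (fun n w => (Phi (X (y n) ^~ w))%:E)
   (fun w => (Phi (Z ^~ w))%:E) (EFin \o cst C) (fun n => (measurable_EFinP _ _).2 (mPhi _ (cY n)))
   ((measurable_EFinP _ _).2 (mPhi _ cZ)) cE iC bE.
have c2 : \int[P]_w Phi (X (y n) ^~ w) @[n --> \oo] --> \int[P]_w Phi (Z ^~ w).
  by apply: fine_cvg; rewrite fineK//; exact: (integrable_fin_num measurableT (iPhi Z cZ)).
move/cvgrPdist_le : c2 => /(_ _ rho0)[N _ /(_ N (leqnn _))]. by rewrite leNgt (Hy N).2.
Unshelve. all: by end_near. Qed.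

End convergence_in_distribution.

(** * The law of a random vector *)

Section vector_law.
Context {R : realType} {d : measure_display} {Omega : measurableType d}.
Variable P : probability Omega R.
Variable n : nat.
Implicit Types (A B : 'I_n -> Omega -> R) (a c : 'I_n -> R) (l : seq 'I_n) (j : 'I_n).

Let lincomb c A w : R := \sum_(i < n) c i * A i w.
Let weight l a A w : R := \prod_(i <- l) (a i < A i w)%R%:R.
Let shift c j (t : R) : 'I_n -> R := fun i => c i + (if i == j then t else 0).

Let lincomb_shift c j t A w : lincomb (shift c j t) A w = lincomb c A w + t * A j w.
Proof.
rewrite /lincomb /shift; under eq_bigr do rewrite mulrDl.
rewrite big_split /=; congr (_ + _); rewrite (bigD1 j) //= eqxx big1 ?addr0// => i /negbTE ->. by rewrite mul0r.
Qed.

Let weight01 l a A w : `|weight l a A w| <= 1.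
Proof.
rewrite /weight; elim: l => [|i l IH]; first by rewrite big_nil normr1.
by rewrite big_cons normrM -[leRHS]mulr1 ler_pM//; case: (_ < _)%R; rewrite ?normr1 ?normr0.
Qed.

Let mlin A c : (forall i, measT (A i)) -> measT (lincomb c A).
Proof. by move=> mA; apply: measurable_sum => i; exact: measurable_funM. Qed.

Let mweight A l a : (forall i, measT (A i)) -> measT (weight l a A).
Proof.
move=> mA; elim: l => [|i l IH].
  have -> : weight [::] a A = (fun=> 1) by apply/funext => w; rewrite /weight big_nil. exact: measurable_cst.
have -> : weight (i :: l) a A = (fun w => ind (a i < A i w) * weight l a A w).
  by apply/funext => w; rewrite /weight big_cons /ind; case: (a i < A i w).
by apply: measurable_funM => //; apply: measurable_ind; exact: measurable_fun_ltr.
Qed.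

(** Product formulas absorb a sine or cosine of the j-th coordinate into a shift of the j-th coefficient. *)
Let product_formulas A l a c j t : (forall i, measT (A i)) ->
  let I f t := \int[P]_w (weight l a A w * f (lincomb (shift c j t) A w)) in
  [/\ \int[P]_w (weight l a A w * cos (lincomb c A w) * cos (t * A j w)) = 1 / 2 * I cos t + 1 / 2 * I cos (- t),
      \int[P]_w (weight l a A w * cos (lincomb c A w) * sin (t * A j w)) = 1 / 2 * I sin t + - (1 / 2) * I sin (- t),
      \int[P]_w (weight l a A w * sin (lincomb c A w) * cos (t * A j w)) = 1 / 2 * I sin t + 1 / 2 * I sin (- t) &
      \int[P]_w (weight l a A w * sin (lincomb c A w) * sin (t * A j w)) = - (1 / 2) * I cos t + 1 / 2 * I cos (- t)].
Proof.
move=> mA I. have iT (f : R -> R) s : measT f -> (forall x, `|f x| <= 1) ->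
    L1 P (fun w => weight l a A w * f (lincomb (shift c j s) A w)).
  move=> mf f1; apply: (integrable_bounded P 1).
    by apply: measurable_funM; [exact: mweight|apply: measurableT_comp mf _; exact: mlin].
  by move=> w; rewrite normrM -[leRHS]mulr1 ler_pM.
have ic s := iT cos s (@measurable_cos R) (@norm_cos_le1 R); have is' s := iT sin s (@measurable_sin R) (@norm_sin_le1 R).
have trig (x y : R) : [/\ cos x * cos y = 1 / 2 * cos (x + y) + 1 / 2 * cos (x - y),
    cos x * sin y = 1 / 2 * sin (x + y) - 1 / 2 * sin (x - y),
    sin x * cos y = 1 / 2 * sin (x + y) + 1 / 2 * sin (x - y) &
    sin x * sin y = - (1 / 2) * cos (x + y) + 1 / 2 * cos (x - y)].
  by rewrite cosD sinD cosB sinB; split; field.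
split; [have [_ <-] := Rintegral_linear2 (1 / 2) (1 / 2) (ic t) (ic (- t))
  |have [_ <-] := Rintegral_linear2 (1 / 2) (- (1 / 2)) (is' t) (is' (- t))
  |have [_ <-] := Rintegral_linear2 (1 / 2) (1 / 2) (is' t) (is' (- t))
  |have [_ <-] := Rintegral_linear2 (- (1 / 2)) (1 / 2) (ic t) (ic (- t))];
  apply: eq_Rintegral => w _; rewrite (lincomb_shift c j (- t)) (lincomb_shift c j t) [- t * _]mulNr -mulrA;
  have [t1 t2 t3 t4] := trig (lincomb c A w) (t * A j w); rewrite ?t1 ?t2 ?t3 ?t4; ring.
Qed.

Variables A B : 'I_n -> Omega -> R.
Hypothesis mA : forall i, measT (A i).
Hypothesis mB : forall i, measT (B i).
Hypothesis cosE : forall c, \int[P]_w cos (\sum_(i < n) c i * A i w) = \int[P]_w cos (\sum_(i < n) c i * B i w).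
Hypothesis sinE : forall c, \int[P]_w sin (\sum_(i < n) c i * A i w) = \int[P]_w sin (\sum_(i < n) c i * B i w).

(** One coordinate at a time, the characteristic function is inverted with respect to the measure weighted by
    the indicators of the preceding coordinates. *)
Let weighted_characteristic_function l a c :
  \int[P]_w (weight l a A w * cos (lincomb c A w)) = \int[P]_w (weight l a B w * cos (lincomb c B w)) /\
  \int[P]_w (weight l a A w * sin (lincomb c A w)) = \int[P]_w (weight l a B w * sin (lincomb c B w)).
Proof.
elim: l c => [|j l IH] c.
  by split; rewrite /weight; under eq_Rintegral do rewrite big_nil mul1r;
    under [RHS]eq_Rintegral do rewrite big_nil mul1r; [exact: cosE|exact: sinE].
have bA (f : R -> R) (V : 'I_n -> Omega -> R) w : (forall x, `|f x| <= 1) -> `|weight l a V w * f (lincomb c V w)| <= 1.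
  by move=> f1; rewrite normrM -[leRHS]mulr1 ler_pM.
have mW (f : R -> R) (V : 'I_n -> Omega -> R) : (forall i, measT (V i)) -> measT f ->
    measT (fun w => weight l a V w * f (lincomb c V w)).
  by move=> mV mf; apply: measurable_funM; [exact: mweight|apply: measurableT_comp mf _; exact: mlin].
have split_last f (V : 'I_n -> Omega -> R) : \int[P]_w (weight (j :: l) a V w * f (lincomb c V w)) =
    \int[P]_w (weight l a V w * f (lincomb c V w) * (a j < V j w)%R%:R).
  by apply: eq_Rintegral => w _; rewrite /weight big_cons; ring.
by split; rewrite !split_last;
  [apply: (@agree_gt _ _ _ _ _ P P (A j) (fun w => weight l a A w * cos (lincomb c A w)) (B j)
    (fun w => weight l a B w * cos (lincomb c B w)) 1 (mA j) (mW cos A mA (@measurable_cos R))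
    (mB j) (mW cos B mB (@measurable_cos R)) (fun w => bA cos A w (@norm_cos_le1 R)) (fun w => bA cos B w (@norm_cos_le1 R)))
  |apply: (@agree_gt _ _ _ _ _ P P (A j) (fun w => weight l a A w * sin (lincomb c A w)) (B j)
    (fun w => weight l a B w * sin (lincomb c B w)) 1 (mA j) (mW sin A mA (@measurable_sin R))
    (mB j) (mW sin B mB (@measurable_sin R)) (fun w => bA sin A w (@norm_sin_le1 R)) (fun w => bA sin B w (@norm_sin_le1 R)))];
  move=> t; have [a1 a2 a3 a4] := product_formulas l a c j t mA; have [b1 b2 b3 b4] := product_formulas l a c j t mB;
  rewrite /agree ?a1 ?a2 ?a3 ?a4 ?b1 ?b2 ?b3 ?b4 ?(IH _).1 ?(IH _).2.
Qed.

Let box a : set (n.-tuple R) := [set x | forall i, a i < tnth x i].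

Let box_law a : P ((fun w => [tuple A i w | i < n]) @^-1` box a) = P ((fun w => [tuple B i w | i < n]) @^-1` box a).
Proof.
have mbox (V : 'I_n -> Omega -> R) : (forall i, measT (V i)) ->
    measurable ((fun w => [tuple V i w | i < n]) @^-1` box a).
  move=> mV; have -> : (fun w => [tuple V i w | i < n]) @^-1` box a = \bigcap_(i in [set: 'I_n]) (V i @^-1` `]a i, +oo[).
    apply/seteqP; split=> w h i.
      by move=> _ /=; rewrite in_itv/= andbT; have := h i; rewrite tnth_mktuple.
    by rewrite tnth_mktuple; have := h i I; rewrite /= in_itv/= andbT.
  apply: fin_bigcap_measurable => // i _. by rewrite -[X in measurable X]setTI; apply: mV.
have e (V : 'I_n -> Omega -> R) : (forall i, measT (V i)) ->
    \int[P]_w (weight (index_enum 'I_n) a V w * cos (lincomb (fun=> 0) V w)) =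
    fine (P ((fun w => [tuple V i w | i < n]) @^-1` box a)).
  move=> mV; have h w : weight (index_enum 'I_n) a V w * cos (lincomb (fun=> 0) V w) =
      \1_((fun w => [tuple V i w | i < n]) @^-1` box a) w.
    have -> : lincomb (fun=> 0) V w = 0 by apply: big1 => i _; rewrite mul0r.
    rewrite cos0 mulr1 indicE /weight; have [/forallP ha|/forallPn[i hi]] := boolP [forall i, a i < V i w].
      by rewrite big1 ?mem_set//= => i; rewrite ?tnth_mktuple ?ha.
    rewrite (bigD1 i) //= (negbTE hi) mul0r memNset// => /(_ i). by rewrite tnth_mktuple; exact/negP.
  under eq_Rintegral do rewrite h. by rewrite /Rintegral integral_indic ?setIT//; exact: mbox.
have f V : (forall i, measT (V i)) -> P ((fun w => [tuple V i w | i < n]) @^-1` box a) \is a fin_num.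
  by move=> mV; apply: fin_num_measure; exact: mbox.
by rewrite -(fineK (f A mA)) -(fineK (f B mB)) -(e A mA) -(e B mB) (weighted_characteristic_function _ _ _).1.
Qed.

Let boxes : set (set (n.-tuple R)) := [set E | exists a, E = box a].

Let boxes_generate : @measurable _ (n.-tuple R) = <<s boxes >>.
Proof.
apply/seteqP; split => [E mE|]; last first.
  apply: smallest_sub; first exact: sigma_algebra_measurable.
  move=> _ [a ->]; have -> : box a = \bigcap_(i in [set: 'I_n]) ((@tnth n R ^~ i) @^-1` `]a i, +oo[).
    apply/seteqP; split=> x h i; first by move=> _ /=; rewrite in_itv/= andbT; exact: h.
    by have := h i I; rewrite /= in_itv/= andbT.
  apply: fin_bigcap_measurable => // i _. by rewrite -[X in measurable X]setTI; exact: measurable_tnth.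
have mid : measT (id : g_sigma_algebraType boxes -> n.-tuple R).
  apply/measurable_fun_tnthP => i.
  apply: (@measurability _ _ _ _ _ _ (@RGenOInfty.G R) (RGenOInfty.measurableE R)) => _ [_ [b ->] <-]. rewrite setTI.
  have -> : ((@tnth n R ^~ i) \o (id : g_sigma_algebraType boxes -> n.-tuple R)) @^-1` `]b, +oo[ =
      \bigcup_k box (fun j => if j == i then b else - k%:R).
    apply/seteqP; split=> x; rewrite /= in_itv/= andbT; last by move=> [k _ /(_ i)]; rewrite eqxx.
    move=> bx; exists (Num.bound (\sum_j `|tnth x j|)) => // j; case: eqP => [-> //|_].
    rewrite ltrNl; apply: le_lt_trans (archi_boundP _); last by apply: sumr_ge0.
    rewrite (bigD1 j)//= -[leLHS]addr0; apply: lerD; first by rewrite -normrN ler_norm. exact: sumr_ge0.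
  apply: bigcup_measurable => k _; apply: sub_sigma_algebra; by eexists.
by have := mid measurableT E mE; rewrite setTI.
Qed.

Lemma vector_law (E : set (n.-tuple R)) : measurable E ->
  P ((fun w => [tuple A i w | i < n]) @^-1` E) = P ((fun w => [tuple B i w | i < n]) @^-1` E).
Proof.
move=> mE. have mt (V : 'I_n -> Omega -> R) : (forall i, measT (V i)) -> measT (fun w => [tuple V i w | i < n]).
  move=> mV; apply/measurable_fun_tnthP => i; have := mV i; congr measurable_fun.
  by apply/funext => w /=; rewrite tnth_mktuple.
have mtA := mt A mA; have mtB := mt B mB.
pose m1 := pushforward P (fun w => [tuple A i w | i < n]); pose m2 := pushforward P (fun w => [tuple B i w | i < n]).
apply: (@measure_unique _ R _ boxes (fun k => box (fun=> - k%:R)) boxes_generate _ _ _ m1 m2) => //.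
- move=> _ _ [a ->] [b ->]; exists (fun i => Num.max (a i) (b i)).
  apply/seteqP; split => x /=; first by move=> [h1 h2] i; rewrite gt_max h1 h2.
  by move=> h; split => i; have := h i; rewrite gt_max => /andP[].
- by move=> k; eexists.
- apply/seteqP; split => // x _; exists (Num.bound (\sum_j `|tnth x j|)) => // j.
  rewrite ltrNl; apply: le_lt_trans (archi_boundP _); last by apply: sumr_ge0.
  rewrite (bigD1 j)//= -[leLHS]addr0; apply: lerD; first by rewrite -normrN ler_norm. exact: sumr_ge0.
- by move=> _ [a ->]; exact: box_law.
- by move=> k; rewrite /m1 /pushforward ltey_eq fin_num_measure// -[X in measurable X]setTI; apply: mtA => //; rewrite boxes_generate; apply: sub_sigma_algebra; eexists.
Qed.

End vector_law.

(** * Two summation identities *)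

Lemma second_moment_sum {R : realType} {d : measure_display} {Omega : measurableType d}
    (P : probability Omega R) (I : finType) (A B : I -> Omega -> R) (c : I -> R) (l : seq I) :
  (forall i, sqint P (A i)) -> (forall i, sqint P (B i)) ->
  (forall i j, \int[P]_w (A i w * A j w) = \int[P]_w (B i w * B j w)) ->
  \int[P]_w (\sum_(i <- l) c i * A i w) ^+ 2 = \int[P]_w (\sum_(i <- l) c i * B i w) ^+ 2.
Proof.
move=> sA sB AB. have sS V : (forall i, sqint P (V i)) -> forall k, sqint P (fun w => \sum_(i <- k) c i * V i w).
  move=> sV; elim=> [|i k IH].
    have -> : (fun w => \sum_(i <- [::]) c i * V i w) = (fun=> 0) by apply/funext => w; rewrite big_nil.
    by apply: (@sqint_bounded _ _ _ P _ 0) => // w; rewrite normr0.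
  by under eq_fun do rewrite big_cons; apply: sqintD => //; exact: sqintZ.
have mixed k j : \int[P]_w ((\sum_(i <- k) c i * A i w) * A j w) = \int[P]_w ((\sum_(i <- k) c i * B i w) * B j w).
  have step V i k' : (forall i, sqint P (V i)) -> \int[P]_w ((\sum_(i <- i :: k') c i * V i w) * V j w) =
      c i * \int[P]_w (V i w * V j w) + 1 * \int[P]_w ((\sum_(i <- k') c i * V i w) * V j w).
    move=> sV; have i1 := sqint_integrable_mul (sV i) (sV j); have i2 := sqint_integrable_mul (sS V sV k') (sV j).
    have [_ <-] := @Rintegral_linear2 _ _ _ P (c i) 1 _ _ i1 i2. by apply: eq_Rintegral => w _; rewrite big_cons; ring.
  elim: k => [|i k IH]; last by rewrite !step// AB IH.
  by under eq_Rintegral do rewrite big_nil mul0r; under [RHS]eq_Rintegral do rewrite big_nil mul0r.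
have step V i k : (forall i, sqint P (V i)) -> \int[P]_w (\sum_(i <- i :: k) c i * V i w) ^+ 2 =
    c i ^+ 2 * \int[P]_w (V i w * V i w) + 2 * c i * \int[P]_w ((\sum_(i <- k) c i * V i w) * V i w) +
    \int[P]_w (\sum_(i <- k) c i * V i w) ^+ 2.
  move=> sV; have i1 := sqint_integrable_mul (sV i) (sV i); have i2 := sqint_integrable_mul (sS V sV k) (sV i).
  have [_ i3] := sS V sV k; have [i4 <-] := @Rintegral_linear2 _ _ _ P (c i ^+ 2) (2 * c i) _ _ i1 i2.
  rewrite -(RintD i4 i3); apply: eq_Rintegral => w _; rewrite big_cons. by move: (\sum_(i <- k) _) => S; ring.
elim: l => [|i l IH]; last by rewrite !step// AB mixed IH.
by under eq_Rintegral do rewrite big_nil; under [RHS]eq_Rintegral do rewrite big_nil.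
Qed.

(** Pairs are sorted by their difference; the diagonal is counted in both sums. *)
Lemma double_sum {R : realType} (A B : nat -> R) N :
  \sum_(k < N) \sum_(l < N) (if (l <= k)%N then A (k - l)%N else B (l - k)%N) =
  \sum_(j < N) (N - j)%:R * A j + \sum_(j < N) (N - j)%:R * B j - N%:R * B 0%N.
Proof.
have rev (f : nat -> R) m : \sum_(k < m) f (m - k)%N = \sum_(j < m) f j.+1.
  rewrite (reindex_inj rev_ord_inj) /=; apply: eq_bigr => k _. by rewrite subKn.
have weight (f : nat -> R) m : \sum_(j < m.+1) (m.+1 - j)%:R * f j =
    \sum_(j < m) (m - j)%:R * f j + \sum_(j < m.+1) f j.
  rewrite [LHS]big_ord_recr /= [X in _ = _ + X]big_ord_recr /= addrA -big_split /=.
  rewrite subSnn mul1r; congr (_ + _); apply: eq_bigr => j _. by rewrite subSn ?(ltnW (ltn_ord j))// -natr1; ring.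
elim: N => [|N IH]; first by rewrite !big_ord0 mul0r subr0 addr0. rewrite big_ord_recr /=. under eq_bigr => k _.
  rewrite big_ord_recr /= leqNgt ltn_ord /=. over.
rewrite big_split /= IH rev !weight.
have -> : \sum_(l < N.+1) (if (l <= N)%N then A (N - l)%N else B (l - N)%N) = \sum_(j < N.+1) A j.
  rewrite (reindex_inj rev_ord_inj) /=; apply: eq_bigr => j _. by rewrite subSS leq_subr subKn// -ltnS.
rewrite [\sum_(j < N.+1) B j]big_ord_recl -natr1 /=.
move: (\sum_(j < N) _) (\sum_(j < N) _) (\sum_(j < N) _) (\sum_(j < N.+1) _) => a b x y. by ring.
Qed.

(** * The stationary Ornstein-Uhlenbeck process *)

Section ornstein_uhlenbeck_law.
Context {R : realType} {d : measure_display} {Omega : measurableType d}.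
Variable P : probability Omega R.
Variables (c v T : R) (Y : R -> Omega -> tempered R).
Hypothesis T0 : 0 < T.
Hypothesis c0 : 0 <= c.
Hypothesis HY : stationary_OU_solution P T (1 / 2) v (Num.sqrt c) Y.
Local Notation mu := (@lebesgue_measure R).
Local Notation heat := (heat v).
Local Notation gen := (gen v).
Local Notation F := (natural_filtration Y).
Implicit Types (u h phi psi : schwartz R) (w : Omega) (a b r s t alpha : R).

Section finite_dimensional_laws.
Lemma measurable_ou t u : 0 <= t <= T -> measT (fun w => Y t w u).
Proof. by move=> tT; have [[H _ _] _] := HY; apply: H; rewrite in_itv. Qed.

Lemma continuous_ou w : {within `[0, T], continuous (Y ^~ w)}.
Proof. by have [[_ H _] _] := HY; exact: H. Qed.

Lemma filtration_id t : <<s F t >> = F t.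
Proof. by apply: sigma_algebra_id; exact: smallest_sigma_algebra. Qed.

Lemma filtration_measurable t : t <= T -> F t `<=` measurable.
Proof.
move=> tT; apply: smallest_sub; first exact: sigma_algebra_measurable. move=> E [s [u [B [sT mB ->]]]].
have sT' : 0 <= s <= T.
  by move: sT; rewrite in_itv/= => /andP[s0 st]; rewrite s0 (le_trans st).
by have := measurable_ou u sT' measurableT mB; rewrite setTI.
Qed.

Lemma filtration_mono s t : s <= t -> F s `<=` F t.
Proof.
move=> st; apply: smallest_sub; first exact: smallest_sigma_algebra.
move=> E [r [u [B [rT mB ->]]]]; apply: sub_sigma_algebra.
exists r, u, B; split => //; move: rT; rewrite !in_itv/= => /andP[-> rs] /=. exact: le_trans st.
Qed.

Lemma gmeas_ou s t u : 0 <= s <= t -> gmeas (F t) (fun w => Y s w u).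
Proof.
move=> st _ B mB; rewrite setTI; apply: sub_sigma_algebra; apply: sub_sigma_algebra.
by exists s, u, B; split => //; rewrite in_itv.
Qed.

Lemma martingale_ext (G : R -> set (set Omega)) (N N' : R -> Omega -> R) :
  (forall t, 0 <= t <= T -> N t = N' t) -> martingale P G T N -> martingale P G T N'.
Proof.
move=> NN [ad iN mN]; split.
- by move=> t tT; rewrite -NN; [exact: ad|move: tT; rewrite in_itv].
- by move=> t tT; rewrite -NN; [exact: iN|move: tT; rewrite in_itv].
- move=> s t s0 st tT E GE; rewrite -!NN ?(le_trans s0)//; first exact: mN. exact: le_trans tT.
Qed.

(** The martingale of the equation for a test function that is constant in time. *)
Let M u t w := Y t w u - Y 0 w u - \int[mu]_(r in `[0, t]) Y r w (gen u).

Let M_OU u : OU_martingale (1 / 2) v Y (fun=> u) (fun=> 0) = M u.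
Proof.
by apply/funext => t; apply/funext => w; rewrite /OU_martingale /M add0r.
Qed.

Let mart u : martingale P F T (M u) /\ martingale P F T (fun t w => M u t w ^+ 2 - c * ip (sgrad u) (sgrad u) * t).
Proof.
have [[_ _ H] _] := HY. have D0 (x : schwartz R) : is_time_derivative T (fun=> x) (fun=> 0).
  move=> t _; under eq_fun do rewrite subrr scaler0; exact: cvg_cst.
have [|m1 [_ _ _ _ m2]] := H (fun=> u) (fun=> 0) _ (D0 u).
  exists (fun n => if n is 0%N then fun=> u else fun=> 0); split => // -[|n] //; exact: D0.
rewrite M_OU in m1 m2; split => //. apply: martingale_ext m2 => t /andP[t0 tT]; apply/funext => w.
by rewrite sqr_sqrtr// Rintegral_itv_cst// L2sq_ip subr0 mulrA.
Qed.

Let gM u t : 0 <= t <= T -> gmeas (F t) (M u t).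
Proof.
move=> tT _ B mB; rewrite setTI; have [[ad _ _] _] := mart u.
by apply: sub_sigma_algebra; apply: ad => //; rewrite in_itv.
Qed.

Let incrE u s t w : 0 <= s -> s <= t -> t <= T -> incr v (Y ^~ w) u s t = M u t w - M u s w.
Proof.
move=> s0 st tT; rewrite /incr /M. rewrite (@Rintegral_itv_cat _ _ 0 s t)//; first by ring.
by apply: (@integrable_pairing _ T _ (ltW T0) (@continuous_ou w)).
Qed.

Lemma gmeas_incr u s t : 0 <= s -> s <= t -> t <= T -> gmeas (F t) (fun w => incr v (Y ^~ w) u s t).
Proof.
move=> s0 st tT; have -> : (fun w => incr v (Y ^~ w) u s t) = (fun w => M u t w - M u s w).
  by apply/funext => w; exact: incrE.
apply: measurable_funB; first by apply: gM; rewrite tT (le_trans s0).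
have h : F s `<=` <<s F t >> by rewrite filtration_id; exact: filtration_mono.
by apply: (gmeas_sub h); apply: gM; rewrite s0 (le_trans st).
Qed.

Lemma ou_levy u s t alpha (xi : Omega -> R) : 0 <= s -> s <= t -> t <= T ->
  gmeas (F s) xi -> (forall w, `|xi w| <= 1) -> \int[P]_w (xi w * cos (incr v (Y ^~ w) u s t + alpha)) =
  expR (- (c * ip (sgrad u) (sgrad u) * (t - s) / 2)) * cos alpha * \int[P]_w xi w.
Proof.
move=> s0 st tT gxi xi1; have [m1 m2] := mart u. have cM w : {within `[0, T], continuous (M u ^~ w)}.
  have cu h := @pairing_within _ T _ (@continuous_ou w) h.
  have ci : {within `[0, T], continuous (fun t => \int[mu]_(r in `[0, t]) Y r w (gen u))}.
    apply: (parameterized_integral_continuous (ltW T0)). exact: (@integrable_pairing _ T _ (ltW T0) (@continuous_ou w)).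
  move=> x; apply: cvgB; last exact: ci. apply: cvgB; first exact: cu. exact: cvg_cst.
have k0 : 0 <= c * ip (sgrad u) (sgrad u) by rewrite mulr_ge0// ip_ge0.
have := @levy _ _ _ P F T _ (M u) (ltW T0) k0 filtration_measurable filtration_id
  filtration_mono cM m1 m2 s t 1 alpha xi s0 st tT gxi xi1.
rewrite expr1n !mul1r => <-. by apply: eq_Rintegral => w _; rewrite incrE// mul1r.
Qed.

(** After expansion of cos (X + A), the factors cos A and sin A join the weight. *)
Lemma split_increment (G : set (set Omega)) (X A : Omega -> R) (e : R) (xi : Omega -> R) :
  G `<=` measurable -> measT X -> gmeas G A -> gmeas G xi -> (forall w, `|xi w| <= 1) ->
  (forall eta alpha, gmeas G eta -> (forall w, `|eta w| <= 1) ->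
    \int[P]_w (eta w * cos (X w + alpha)) = e * cos alpha * \int[P]_w eta w) ->
  \int[P]_w (xi w * cos (X w + A w)) = e * \int[P]_w (xi w * cos (A w)).
Proof.
move=> Gm mX gA gxi xi1 H. have gc : gmeas G (fun w => xi w * cos (A w)).
  by apply: measurable_funM => //; exact: measurableT_comp measurable_cos gA.
have gs : gmeas G (fun w => xi w * sin (A w)).
  by apply: measurable_funM => //; exact: measurableT_comp measurable_sin gA.
have bc w : `|xi w * cos (A w)| <= 1 by rewrite normrM mulr_ile1// norm_cos_le1.
have bs w : `|xi w * sin (A w)| <= 1 by rewrite normrM mulr_ile1// norm_sin_le1.
have h1 := H _ 0 gc bc; have h2 := H _ (- (pi / 2)) gs bs.
have ib (f : Omega -> R) a : gmeas G f -> (forall w, `|f w| <= 1) -> L1 P (fun w => f w * cos (X w + a)).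
  move=> gf f1; apply: (integrable_bounded P 1).
    apply: measurable_funM; first exact: gmeas_measurable gf.
    by apply: measurableT_comp measurable_cos _; exact: measurable_funD.
  by move=> w; rewrite normrM mulr_ile1// norm_cos_le1.
have i1 := ib _ 0 gc bc; have i2 := ib _ (- (pi / 2)) gs bs. have -> : \int[P]_w (xi w * cos (X w + A w)) =
  \int[P]_w (xi w * cos (A w) * cos (X w + 0) - xi w * sin (A w) * cos (X w + - (pi / 2))).
  apply: eq_Rintegral => w _. by rewrite -[- (pi / 2)]add0r cos_shift addr0 cosD; ring.
rewrite (RintB i1 i2) h1 h2 cos0 cosN cos_pihalf; ring.
Qed.

Let chain_sum (a b : R) n (f : nat -> schwartz R) m w :=
  \sum_(k < m) incr v (Y ^~ w) (f k) (grid a b n k) (grid a b n k.+1).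

Let gmeas_chain a b n f m : 0 <= a -> a <= b -> b <= T -> (m <= n.+1)%N ->
  gmeas (F (grid a b n m)) (chain_sum a b n f m).
Proof.
move=> a0 ab bT; elim: m => [|m IH] mn.
  have -> : chain_sum a b n f 0 = cst 0 by apply/funext => w; rewrite /chain_sum big_ord0. exact: measurable_cst.
have -> : chain_sum a b n f m.+1 = (fun w => chain_sum a b n f m w +
    incr v (Y ^~ w) (f m) (grid a b n m) (grid a b n m.+1)).
  by apply/funext => w; rewrite /chain_sum big_ord_recr.
have gg : grid a b n m <= grid a b n m.+1 by exact: grid_mono.
have /andP[h1 h2] := grid_itv ab (ltnW mn); have /andP[h3 h4] := grid_itv ab mn.
apply: measurable_funD; last by apply: gmeas_incr; rewrite ?(le_trans a0)// (le_trans h4).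
apply: (@gmeas_sub _ _ _ (F (grid a b n m))); last by apply: IH; exact: ltnW.
by rewrite filtration_id; exact: filtration_mono.
Qed.

Let chain_levy a b n f m alpha (xi : Omega -> R) : 0 <= a -> a <= b -> b <= T -> (m <= n.+1)%N ->
  gmeas (F a) xi -> (forall w, `|xi w| <= 1) -> \int[P]_w (xi w * cos (chain_sum a b n f m w + alpha)) =
  expR (- (\sum_(k < m) c * ip (sgrad (f k)) (sgrad (f k)) * ((b - a) / n.+1%:R) / 2)) * cos alpha * \int[P]_w xi w.
Proof.
move=> a0 ab bT mn gxi xi1. have Fma : F a `<=` measurable by apply: filtration_measurable; exact: le_trans bT.
elim: m mn => [|m IH] mn.
  rewrite big_ord0 oppr0 expR0 mul1r. under eq_Rintegral do rewrite /chain_sum big_ord0 add0r mulrC.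
  by rewrite RintegralZl//; apply: integrable_bounded _ _ _ xi1; exact: gmeas_measurable gxi.
have /andP[h1 h2] := grid_itv ab (ltnW mn); have /andP[h3 h4] := grid_itv ab mn.
have gg : grid a b n m <= grid a b n m.+1 by exact: grid_mono. have G0 : 0 <= grid a b n m by rewrite (le_trans a0).
have GT : grid a b n m.+1 <= T by rewrite (le_trans h4). have Fmm : F (grid a b n m) `<=` measurable.
  by apply: filtration_measurable; rewrite (le_trans h2).
have := @split_increment (F (grid a b n m)) (fun w => incr v (Y ^~ w) (f m) (grid a b n m) (grid a b n m.+1))
  (fun w => chain_sum a b n f m w + alpha)
  (expR (- (c * ip (sgrad (f m)) (sgrad (f m)) * (grid a b n m.+1 - grid a b n m) / 2))) xi Fmm.
have -> : \int[P]_w (xi w * cos (chain_sum a b n f m.+1 w + alpha)) =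
  \int[P]_w (xi w * cos (incr v (Y ^~ w) (f m) (grid a b n m) (grid a b n m.+1) + (chain_sum a b n f m w + alpha))).
  apply: eq_Rintegral => w _; rewrite addrA; congr (_ * cos (_ + _)). by rewrite /chain_sum big_ord_recr /= addrC.
move=> ->; first last.
- by move=> eta al geta eta1; exact: ou_levy.
- exact: xi1.
- apply: (@gmeas_sub _ _ _ (F a)) => //. by rewrite filtration_id; exact: filtration_mono.
- by apply: measurable_funD => //; apply: gmeas_chain => //; exact: ltnW.
- apply: gmeas_measurable (gmeas_incr _ _ _ _) => //. by apply: filtration_measurable.
rewrite IH ?(ltnW mn)// big_ord_recr /= gridS opprD expRD. by move: (expR _) (expR _) (\int[P]_w _) => e1 e2 e3; ring.
Qed.

(** By [energy_step], each term is nearly the energy lost by the semigroup over one interval, and these losses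
    telescope. *)
Let variance_cvg a b u : 0 <= a -> a <= b -> b <= T ->
  \sum_(k < n.+1) c * ip (sgrad (heat (b - grid a b n k.+1) u)) (sgrad (heat (b - grid a b n k.+1) u)) *
     ((b - a) / n.+1%:R) / 2 @[n --> \oo] --> c * (ip u u - ip (heat (b - a) u) (heat (b - a) u)) / 2.
Proof.
move=> a0 ab bT.
have [B [B0 HB]] : exists B : R, 0 <= B /\ forall r, [set r | 0 <= r <= T] r -> pnorm 5 (heat r u) <= B * 1.
  apply: (@pnorm_family _ _ _ (fun r => heat r u) (fun=> 1)) => k n.
  have [C [C0 H]] := wnorm_heat_le v (ltW T0) k n u. by exists C; split => // r rT; rewrite mulr1; exact: H.
have [C [C0 HC]] := energy_step v T B. pose D n : R := (b - a) / n.+1%:R.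
have D0 n : 0 <= D n by rewrite /D divr_ge0// subr_ge0.
have sD : C * (b - a) * Num.sqrt (D n) * c / 2 @[n --> \oo] --> 0.
  apply: (cvg_eqr (C * (b - a) * Num.sqrt 0 * c / 2)); last by rewrite sqrtr0 mulr0 !mul0r.
  apply: cvgM; last exact: cvg_cst; apply: cvgM; last exact: cvg_cst. apply: cvgM; first exact: cvg_cst.
  exact: (continuous_cvg _ (@sqrt_continuous R 0) (mesh_cvg a b)).
apply: cvg_dist_le _ sD => n. have DT : D n <= T.
  rewrite /D ler_pdivrMr//; apply: le_trans (_ : T * 1 <= _); last by rewrite ler_wpM2l ?(ltW T0)// ler1n.
  by rewrite mulr1 lerBlDr (le_trans bT)// lerDl.
pose w k := heat (b - grid a b n k) u. have wT k : (k <= n.+1)%N -> 0 <= b - grid a b n k <= T.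
  move=> kn; have /andP[h1 h2] := grid_itv ab kn. by rewrite subr_ge0 h2 /= lerBlDr (le_trans bT)// lerDl (le_trans a0).
have tele : ip u u - ip (heat (b - a) u) (heat (b - a) u) = \sum_(k < n.+1) (ip (w k.+1) (w k.+1) - ip (w k) (w k)).
  have := @telescope_sumr _ 0 n.+1 (fun k => ip (w k) (w k)) (leq0n _).
  by rewrite big_mkord => ->; rewrite /w grid0 grid_last subrr heat0.
have step (k : 'I_n.+1) : `|ip (sgrad (w k.+1)) (sgrad (w k.+1)) * D n -
    (ip (w k.+1) (w k.+1) - ip (w k) (w k))| <= C * (D n * Num.sqrt (D n)).
  have kn := ltn_ord k; have w1 := wT _ kn; have /andP[w10 _] := w1. have -> : w k = heat (D n) (w k.+1).
    rewrite /w heat_heat//; congr (heat _ u); rewrite /D -(gridS a b n k); ring.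
  have := HC (D n) (w k.+1); rewrite D0 DT => /(_ isT) H. apply: le_trans (H _).
    rewrite le_eqVlt; apply/orP; left; apply/eqP; congr `|_|. by move: (ip _ _) (ip _ _) (ip _ _) => x y z; ring.
  move=> i j i2 j5; apply: le_trans (wnorm_le_pnorm (w k.+1) (leq_trans i2 _) j5) _ => //.
  by have := HB _ w1; rewrite mulr1.
have -> : \sum_(k < n.+1) c * ip (sgrad (heat (b - grid a b n k.+1) u)) (sgrad (heat (b - grid a b n k.+1) u)) *
     ((b - a) / n.+1%:R) / 2 - c * (ip u u - ip (heat (b - a) u) (heat (b - a) u)) / 2 =
  c / 2 * \sum_(k < n.+1) (ip (sgrad (w k.+1)) (sgrad (w k.+1)) * D n - (ip (w k.+1) (w k.+1) - ip (w k) (w k))).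
  rewrite sumrB -tele [RHS]mulrBr mulr_sumr; congr (_ - _); last first.
    by move: (ip _ _) (ip _ _) => x y; ring.
  by apply: eq_bigr => k _; rewrite /w /D; ring.
have c2 : 0 <= c / 2 by rewrite divr_ge0. rewrite normrM (ger0_norm c2).
have -> : C * (b - a) * Num.sqrt (D n) * c / 2 = c / 2 * (C * (b - a) * Num.sqrt (D n)) by ring.
apply: ler_wpM2l => //; apply: le_trans (ler_norm_sum _ _ _) _. apply: le_trans (ler_sum _ (fun k _ => step k)) _.
rewrite sumr_const card_ord -[leLHS]mulr_natr. have De : D n * n.+1%:R = b - a by rewrite /D divfK ?pnatr_eq0.
by rewrite -De; move: (D n) (Num.sqrt _) n.+1%:R => x y z; rewrite le_eqVlt; apply/orP; left; apply/eqP; ring.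
Qed.

Lemma measurable_duhamel s t u : 0 <= s -> s <= t -> t <= T -> measT (fun w => Y t w u - Y s w (heat (t - s) u)).
Proof.
move=> s0 st tT; apply: measurable_funB; apply: measurable_ou; first by rewrite tT (le_trans s0).
by rewrite s0 (le_trans st).
Qed.

(** The sum over a grid in [duhamel_path] consists of successive increments, each independent of its past; their
    variances add up. *)
Lemma ou_duhamel s t u alpha (xi : Omega -> R) : 0 <= s -> s <= t -> t <= T ->
  gmeas (F s) xi -> (forall w, `|xi w| <= 1) -> \int[P]_w (xi w * cos (Y t w u - Y s w (heat (t - s) u) + alpha)) =
  expR (- (c * (ip u u - ip (heat (t - s) u) (heat (t - s) u)) / 2)) * cos alpha * \int[P]_w xi w.
Proof.
move=> s0 st tT gxi xi1. have mxi : measT xi.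
  by apply: gmeas_measurable gxi; apply: filtration_measurable; exact: le_trans tT.
pose f n k := heat (t - grid s t n k.+1) u.
have H1 : \int[P]_w (xi w * cos (chain_sum s t n (f n) n.+1 w + alpha)) @[n --> \oo] -->
    \int[P]_w (xi w * cos (Y t w u - Y s w (heat (t - s) u) + alpha)).
  apply: (Rintegral_bounded_cvg P 1).
  - move=> n; apply: measurable_funM => //; apply: measurableT_comp measurable_cos _.
    apply: measurable_funD => //; apply: gmeas_measurable (gmeas_chain _ s0 st tT (leqnn _)).
    by rewrite grid_last; apply: filtration_measurable.
  - move=> w; apply: cvgM; first exact: cvg_cst.
    apply: (continuous_cvg _ (@continuous_cos R _)); apply: cvgD; last exact: cvg_cst.
    exact: (@duhamel_path R v T (Y ^~ w) (ltW T0) (@continuous_ou w) u s t s0 st tT).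
  - by move=> n w; rewrite normrM mulr_ile1// norm_cos_le1.
have H2 : expR (- (\sum_(k < n.+1) c * ip (sgrad (f n k)) (sgrad (f n k)) * ((t - s) / n.+1%:R) / 2)) *
    cos alpha * \int[P]_w xi w @[n --> \oo] -->
  expR (- (c * (ip u u - ip (heat (t - s) u) (heat (t - s) u)) / 2)) * cos alpha * \int[P]_w xi w.
  apply: cvgM; last exact: cvg_cst; apply: cvgM; last exact: cvg_cst.
  by apply: (continuous_cvg _ (@continuous_expR R _)); apply: cvgN; exact: variance_cvg.
apply: (cvgr_unique H1 H2) => n. exact: chain_levy.
Qed.

Lemma ou_initial u : centered_gaussian P (fun w => Y 0 w u) (c * ip u u).
Proof.
apply/centered_gaussianP; have [_ /(_ u)] := HY. have -> : 2 * (1 / 2) = 1 :> R by field.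
by rewrite divr1 L2sq_ip sqr_sqrtr.
Qed.

Definition ysum (l : seq (R * schwartz R)) w : R := \sum_(p <- l) Y p.1 w p.2.

(** Variance of Y_t(u) + ysum l, for a list l of times that decrease from t: Y_t(u) is Y_s(S_(t-s) u) plus a
    term independent of the past of s, and Y_s(S_(t-s) u) joins the next term of l. *)
Fixpoint ysum_var t u (l : seq (R * schwartz R)) : R := if l is (s, h) :: l' then
    c * (ip u u - ip (heat (t - s) u) (heat (t - s) u)) + ysum_var s (h + heat (t - s) u) l' else c * ip u u.

Let later (p q : R * schwartz R) := q.1 <= p.1.

Let all_past t (l : seq (R * schwartz R)) := all (fun q => 0 <= q.1 <= t) l.

Let gmeas_ysum t l : all_past t l -> gmeas (F t) (ysum l).
Proof.
elim: l => [_|p l IH /= /andP[pt lt]].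
  have -> : ysum [::] = cst 0 by apply/funext => w; rewrite /ysum big_nil. exact: measurable_cst.
have -> : ysum (p :: l) = (fun w => Y p.1 w p.2 + ysum l w).
  by apply/funext => w; rewrite /ysum big_cons.
by apply: measurable_funD; [exact: gmeas_ou|exact: IH].
Qed.

Let path_past t u l : 0 <= t -> path later (t, u) l -> all (fun q => 0 <= q.1) l -> all_past t l.
Proof.
move=> t0; elim: l t u t0 => // -[s h] l IH t u t0 /= /andP[st pl] /andP[s0 al].
rewrite /later /= in st; rewrite s0 st /=. by apply: sub_all (IH s h s0 pl al) => q /andP[-> /le_trans ->].
Qed.

Lemma ysum_cos t u l alpha : 0 <= t <= T -> path later (t, u) l -> all (fun q => 0 <= q.1) l ->
  \int[P]_w cos (Y t w u + ysum l w + alpha) = expR (- (ysum_var t u l / 2)) * cos alpha.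
Proof.
elim: l t u alpha => [|[s h] l IH] t u alpha tT pl al.
  have /andP[t0 tT'] := tT. have F0 : F 0 `<=` measurable by apply: filtration_measurable; exact: ltW.
  have := @split_increment (F 0) (fun w => Y t w u - Y 0 w (heat (t - 0) u)) (fun w => Y 0 w (heat (t - 0) u) + alpha)
    (expR (- (c * (ip u u - ip (heat (t - 0) u) (heat (t - 0) u)) / 2))) (fun=> 1) F0.
  have -> : \int[P]_w cos (Y t w u + ysum [::] w + alpha) =
    \int[P]_w (1 * cos (Y t w u - Y 0 w (heat (t - 0) u) + (Y 0 w (heat (t - 0) u) + alpha))).
    by apply: eq_Rintegral => w _; rewrite /ysum big_nil mul1r addrA subrK addr0.
  move=> ->; first last.
  - by move=> eta al' ge e1; exact: ou_duhamel.
  - by move=> w; rewrite normr1.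
  - exact: measurable_cst.
  - by apply: measurable_funD => //; apply: gmeas_ou; rewrite lexx.
  - exact: measurable_duhamel.
  set w0 := heat (t - 0) u; have [m0 _ H] := ou_initial w0; have := H 1. rewrite expr1n mul1r => -[Hc Hs].
  have ic : L1 P (fun w => cos alpha * cos (1 * Y 0 w w0)).
    apply: (integrable_bounded P `|cos alpha|).
      by apply: measurable_funM => //; exact: measurable_cosM.
    by move=> w; rewrite normrM ler_piMr// norm_cos_le1.
  have is' : L1 P (fun w => sin alpha * sin (1 * Y 0 w w0)).
    apply: (integrable_bounded P `|sin alpha|).
      by apply: measurable_funM => //; exact: measurable_sinM.
    by move=> w; rewrite normrM ler_piMr// norm_sin_le1.
  have -> : \int[P]_w (1 * cos (Y 0 w w0 + alpha)) =
    \int[P]_w (cos alpha * cos (1 * Y 0 w w0) - sin alpha * sin (1 * Y 0 w w0)).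
    by apply: eq_Rintegral => w _; rewrite !mul1r cosD; ring.
  rewrite (RintB ic is') !RintegralZl//; first last.
  - by apply: (integrable_bounded P 1); [exact: measurable_cosM|move=> w; exact: norm_cos_le1].
  - by apply: (integrable_bounded P 1); [exact: measurable_sinM|move=> w; exact: norm_sin_le1].
  rewrite Hc Hs mulr0 subr0 mulrCA mulrC -expRD; congr (expR _ * _) => /=. by rewrite -/w0; ring.
move: pl al => /= /andP[]; rewrite {1}/later /= => st pl /andP[s0 al]. have /andP[t0 tT'] := tT.
have sT : 0 <= s <= T by rewrite s0 (le_trans st).
have Fms : F s `<=` measurable by apply: filtration_measurable; exact: le_trans tT'. have past := path_past s0 pl al.
have := @split_increment (F s) (fun w => Y t w u - Y s w (heat (t - s) u))
  (fun w => Y s w (h + heat (t - s) u) + ysum l w + alpha)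
  (expR (- (c * (ip u u - ip (heat (t - s) u) (heat (t - s) u)) / 2))) (fun=> 1) Fms.
have -> : \int[P]_w cos (Y t w u + ysum ((s, h) :: l) w + alpha) =
  \int[P]_w (1 * cos (Y t w u - Y s w (heat (t - s) u) + (Y s w (h + heat (t - s) u) + ysum l w + alpha))).
  apply: eq_Rintegral => w _; rewrite /ysum big_cons mul1r linearD; congr cos => /=.
  by move: (Y t w u) (Y s w h) (Y s w _) => x y z; ring.
move=> ->; first last.
- by move=> eta al' ge e1; exact: ou_duhamel.
- by move=> w; rewrite normr1.
- exact: measurable_cst.
- apply: measurable_funD => //; apply: measurable_funD; last exact: gmeas_ysum. by apply: gmeas_ou; rewrite s0 lexx.
- exact: measurable_duhamel.
under eq_Rintegral do rewrite mul1r. have pl' : path later (s, h + heat (t - s) u) l by case: (l) pl => // q l' /=.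
rewrite (IH s (h + heat (t - s) u) alpha sT pl' al) mulrA -expRD; congr (expR _ * _).
by move: (ysum_var _ _ _) => V; ring.
Qed.

Let scale (a : R) (l : seq (R * schwartz R)) := [seq (p.1, a *: p.2) | p <- l].

Let ysum_varZ a t u l : 0 <= t -> path later (t, u) l -> all (fun q => 0 <= q.1) l ->
  ysum_var t (a *: u) (scale a l) = a ^+ 2 * ysum_var t u l.
Proof.
elim: l t u => [|[s h] l IH] t u t0 /=; first by move=> _ _; rewrite ipZl ipZr; ring.
rewrite {1}/later /= => /andP[st pl] /andP[s0 al]. have ts0 : 0 <= t - s by rewrite subr_ge0.
have pl' : path later (s, h + heat (t - s) u) l by case: (l) pl => // q l' /=.
rewrite heatZ// -scalerDr (IH s _ s0 pl' al) !ipZl !ipZr. by move: (ysum_var _ _ _) (ip _ _) (ip _ _) => V x y; ring.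
Qed.

Let ysumZ a l w : ysum (scale a l) w = a * ysum l w.
Proof. by rewrite /ysum big_map mulr_sumr; apply: eq_bigr => p _ /=; rewrite linearZ. Qed.

Lemma ysum_gaussian_sorted t u l : 0 <= t <= T -> path later (t, u) l -> all (fun q => 0 <= q.1) l ->
  centered_gaussian P (fun w => Y t w u + ysum l w) (ysum_var t u l).
Proof.
move=> tT pl al; have /andP[t0 tT'] := tT. have cosE th alpha : \int[P]_w cos (th * (Y t w u + ysum l w) + alpha) =
    expR (- (th ^+ 2 * ysum_var t u l / 2)) * cos alpha.
  have ps : path later (t, th *: u) (scale th l).
    have := pl; rewrite (_ : path later (t, u) l = path later (t, th *: u) (scale th l))//.
    by clear; elim: l t u => //= -[s h] l IH t u; rewrite (IH s h).
  have als : all (fun q => 0 <= q.1) (scale th l) by rewrite all_map.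
  rewrite -(ysum_varZ th t0 pl al) -(ysum_cos alpha tT ps als).
  by apply: eq_Rintegral => w _; rewrite ysumZ linearZ mulrDr.
have past := path_past t0 pl al. have mX : measT (fun w => Y t w u + ysum l w).
  apply: measurable_funD; first exact: measurable_ou.
  by apply: gmeas_measurable (gmeas_ysum past); exact: filtration_measurable.
split => //.
  have := cosE 1 0; rewrite expr1n mul1r cos0 mulr1 => e. have : expR (- (ysum_var t u l / 2)) <= 1.
    rewrite -e; apply: le_trans (ler_norm _) _. rewrite -[leRHS](Rintegral_probability_cst P 1).
    apply: (@le_normr_Rintegral_dominated _ _ _ P setT _ (fun=> 1)) => //.
    - apply: measurableT_comp measurable_cos _; apply: measurable_funD => //. exact: measurable_funM.
    - by move=> w _; exact: norm_cos_le1.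
    - by apply: (integrable_bounded P 1) => // w; rewrite normr1.
  by rewrite -expR0 ler_expR oppr_le0 pmulr_lge0// invr_gt0.
move=> th; split.
  have := cosE th 0; rewrite cos0 mulr1 => <-. by apply: eq_Rintegral => w _; rewrite addr0.
have := cosE th (0 - pi / 2); rewrite sub0r cosN cos_pihalf mulr0 => <-.
by apply: eq_Rintegral => w _; rewrite -[- (pi / 2)]add0r cos_shift addr0.
Qed.

Lemma ysum_gaussian l : all (fun q => 0 <= q.1 <= T) l -> exists V, centered_gaussian P (ysum l) V.
Proof.
move=> lT; pose l' := sort later l. have pl : perm_eq l l' by rewrite perm_sym perm_sort.
have lT' : all (fun q => 0 <= q.1 <= T) l' by rewrite -(perm_all _ pl).
have ls : sorted later l' by apply: sort_sorted => p q; exact: le_total. have ps : path later (T, 0) l'.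
  rewrite path_min_sorted// ; apply: sub_all lT' => q /andP[]//.
have al : all (fun q => 0 <= q.1) l' by apply: sub_all lT' => q /andP[].
have TT : 0 <= T <= T by rewrite (ltW T0) lexx. exists (ysum_var T 0 l'); have := ysum_gaussian_sorted TT ps al.
congr (centered_gaussian P _ _); apply/funext => w. by rewrite linear0 add0r /ysum (perm_big _ pl).
Qed.

Lemma ou_gaussian t u : 0 <= t <= T -> centered_gaussian P (fun w => Y t w u) (c * ip u u).
Proof.
move=> tT; have := @ysum_gaussian_sorted t u [::] tT isT isT.
by congr (centered_gaussian P _ _); apply/funext => w; rewrite /ysum big_nil addr0.
Qed.

Lemma ou_sqint t u : 0 <= t <= T -> sqint P (fun w => Y t w u).
Proof.
move=> tT; have g := ou_gaussian u tT; have [m _ _] := g. by split => //; have [] := centered_gaussian_variance g.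
Qed.

Lemma ou_variance t u : 0 <= t <= T -> \int[P]_w Y t w u ^+ 2 = c * ip u u.
Proof. by move=> tT; have [] := centered_gaussian_variance (ou_gaussian u tT). Qed.

(** Polarisation of the variance of Y_t(u) + Y_s(h). *)
Lemma ou_covariance s t u h : 0 <= s -> s <= t -> t <= T -> \int[P]_w (Y s w h * Y t w u) = c * ip h (heat (t - s) u).
Proof.
move=> s0 st tT. have tT' : 0 <= t <= T by rewrite tT (le_trans s0).
have sT : 0 <= s <= T by rewrite s0 (le_trans st). have pl : path later (t, u) [:: (s, h)] by rewrite /= andbT.
have al : all (fun q : R * schwartz R => 0 <= q.1) [:: (s, h)] by rewrite /= s0.
have [_ V] := centered_gaussian_variance (ysum_gaussian_sorted tT' pl al).
have [_ i1] := ou_sqint u tT'; have [_ i2] := ou_sqint h sT.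
have i3 := sqint_integrable_mul (ou_sqint h sT) (ou_sqint u tT'). have i4 := intZ 2 i3.
have i5 := intD i1 i2. have e : \int[P]_w (Y t w u + ysum [:: (s, h)] w) ^+ 2 =
    \int[P]_w (Y t w u ^+ 2 + Y s w h ^+ 2 + 2 * (Y s w h * Y t w u)).
  by apply: eq_Rintegral => w _; rewrite /ysum big_seq1 /=; ring.
move: V; rewrite e (RintD i5 i4) (RintD i1 i2). rewrite (RintZ i3) !ou_variance//= ipDl !ipDr (ipC _ h).
move: (\int[P]_w _) (ip u u) (ip h h) (ip h _) (ip _ _) => I x y z q; lra.
Qed.

End finite_dimensional_laws.

(** * Time integrals of the process *)

Section time_integrals.

Definition ou_span : set (Omega -> R) := [set X | exists2 l, all (fun q => 0 <= q.1 <= T) l & X = ysum l].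

Lemma ou_span_gaussian X : ou_span X -> exists V, centered_gaussian P X V.
Proof. by move=> [l lT ->]; exact: (ysum_gaussian lT). Qed.

Lemma ou_span_lin a b X X' : ou_span X -> ou_span X' -> ou_span (fun w => a * X w + b * X' w).
Proof.
move=> [l lT ->] [l' lT' ->]. exists ([seq (p.1, a *: p.2) | p <- l] ++ [seq (p.1, b *: p.2) | p <- l']).
  by rewrite all_cat !all_map; apply/andP.
apply/funext => w; rewrite /ysum big_cat /= !big_map !mulr_sumr.
by congr (_ + _); apply: eq_bigr => p _ /=; rewrite linearZ.
Qed.

Definition ou_space := gclos P ou_span.

Lemma ou_space_pairing t u : 0 <= t <= T -> ou_space (fun w => Y t w u).
Proof.
move=> tT; apply: (gclos_base ou_span_gaussian); exists [:: (t, u)]; first by rewrite /= andbT.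
by apply/funext => w; rewrite /ysum big_seq1.
Qed.

Definition tint u a b w : R := \int[mu]_(r in `[a, b]) Y r w u.

Let rsum u a b n w : R := \sum_(k < n.+1) (b - a) / n.+1%:R * Y (grid a b n k) w u.

Let rsum_span u a b n : 0 <= a -> a <= b -> b <= T -> ou_span (rsum u a b n).
Proof.
move=> a0 ab bT. exists [seq (grid a b n k, ((b - a) / n.+1%:R) *: u) | k <- iota 0 n.+1].
  rewrite all_map; apply/allP => k; rewrite mem_iota /= add0n => kn.
  by have /andP[h1 h2] := grid_itv ab (ltnW kn); rewrite (le_trans a0)// (le_trans h2).
apply/funext => w; rewrite /rsum /ysum big_map -[iota 0 n.+1]/(index_iota 0 n.+1) big_mkord.
by apply: eq_bigr => k _ /=; rewrite linearZ.
Qed.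

Let pair_clamp_continuous u w : continuous (fun r => Y (clamp T r) w u).
Proof.
have cY : {within `[0, T], continuous (Y ^~ w)} by exact: (@continuous_ou w).
exact: (@pairing_clamp R T (Y ^~ w) (ltW T0) cY u).
Qed.

Let rsum_cvg u a b w : 0 <= a -> a <= b -> b <= T -> rsum u a b n w @[n --> \oo] --> tint u a b w.
Proof.
move=> a0 ab bT. have := @riemann_cvg _ _ a b ab (@pair_clamp_continuous u w).
have -> : \int[mu]_(x in `[a, b]) Y (clamp T x) w u = tint u a b w.
  apply: eq_Rintegral => x; rewrite inE /= in_itv/= => /andP[ax xb].
  by rewrite clamp_id// in_itv/= (le_trans a0)// (le_trans xb).
have -> : (fun n => \sum_(k < n.+1) (b - a) / n.+1%:R * Y (clamp T (grid a b n k)) w u) = (fun n => rsum u a b n w).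
  apply/funext => n; apply: eq_bigr => k _; rewrite clamp_id// in_itv/=.
  have /andP[h1 h2] := grid_itv ab (ltnW (ltn_ord k)). by rewrite (le_trans a0)// (le_trans h2).
by [].
Qed.

Lemma tint_space u a b : 0 <= a -> a <= b -> b <= T ->
  ou_space (tint u a b) /\ \int[P]_w (rsum u a b n w - tint u a b w) ^+ 2 @[n --> \oo] --> 0.
Proof.
move=> a0 ab bT. have gr n : ou_space (rsum u a b n) by apply: (gclos_base ou_span_gaussian); exact: rsum_span.
have mt : measT (tint u a b).
  have mr n : measT (rsum u a b n) by case: (gr n).
  have cr w : setT w -> rsum u a b n w @[n --> \oo] --> tint u a b w by move=> _; exact: rsum_cvg.
  exact: measurable_fun_cvg mr cr.
apply: (gclos_pointwise ou_span_gaussian ou_span_lin gr mt) => w; exact: rsum_cvg.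
Qed.

Lemma ip_heat_continuous phi psi : continuous (fun s => ip phi (heat (clamp T s) psi)).
Proof.
have [C [C0 HC]] := wnorm_heat_lip v T 0 0 psi.
have lip s t : `|ip phi (heat (clamp T s) psi) - ip phi (heat (clamp T t) psi)| <=
    wnorm 2 0 phi * C * pi * Num.sqrt `|s - t|.
  wlog st : s t / clamp T s <= clamp T t.
    move=> H; case: (leP (clamp T s) (clamp T t)) => [/H//|/ltW /H]. by rewrite distrC (distrC s).
  have /andP[s0 sT] := clamp_itv (ltW T0) s; have /andP[t0 tT] := clamp_itv (ltW T0) t.
  have := HC (clamp T s, clamp T t) (conj s0 (conj st tT)) => /= h.
  rewrite distrC -ipNr -ipDr; apply: le_trans (ip_le _ _) _. have w0 : 0 <= wnorm 2 0 phi := wnorm_ge0 2 0 phi.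
  have p0 : 0 <= pi :> R by exact: pi_ge0.
  have -> : wnorm 2 0 phi * C * pi * Num.sqrt `|s - t| = wnorm 2 0 phi * (C * Num.sqrt `|s - t|) * pi by ring.
  apply: ler_wpM2r => //; apply: ler_wpM2l => //; apply: le_trans h _; apply: ler_wpM2l => //.
  rewrite ler_sqrt//; apply: le_trans (ler_norm _) _. by rewrite distrC; exact: clamp_lip.
set K := wnorm 2 0 phi * C * pi in lip.
have K0 : 0 <= K by apply: mulr_ge0; [apply: mulr_ge0 => //; exact: wnorm_ge0|exact: pi_ge0].
move=> s; apply/cvgrPdist_le => e e0. have dl0 : 0 < (e / (K + 1)) ^+ 2 by rewrite exprn_gt0// divr_gt0// ltr_pwDr.
near=> t; apply: le_trans (lip s t) _. have h : Num.sqrt `|s - t| <= e / (K + 1).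
  rewrite -(ler_pXn2r (n := 2))// ?nnegrE ?sqrtr_ge0//; last by rewrite divr_ge0 ?(ltW e0)// addr_ge0.
  by rewrite sqr_sqrtr//; near: t; exact: cvgr_dist_le.
apply: le_trans (ler_wpM2l K0 h) _. by rewrite mulrCA ger_pMr// ler_pdivrMr ?mul1r ?lerDl// ltr_pwDr.
Unshelve. all: by end_near. Qed.

Let kern phi psi (h s : R) : R := (h - s) * (c * ip psi (heat (clamp T s) phi) + c * ip phi (heat (clamp T s) psi)).

Let kern_continuous phi psi (h : R) : continuous (kern phi psi h).
Proof.
move=> s; apply: cvgM; first by apply: cvgB; [exact: cvg_cst|exact: cvg_id].
by apply: cvgD; apply: cvgM; [exact: cvg_cst|exact: ip_heat_continuous|exact: cvg_cst|exact: ip_heat_continuous].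
Qed.

(** The covariance of the values at two times depends on their distance, by which [double_sum] groups the pairs.
    *)
Let rsum_cov phi psi a b n : 0 <= a -> a <= b -> b <= T -> \int[P]_w (rsum phi a b n w * rsum psi a b n w) =
  \sum_(k < n.+1) (b - a - 0) / n.+1%:R * kern phi psi (b - a) (grid 0 (b - a) n k) -
  (b - a) * ((b - a) / n.+1%:R * (c * ip phi psi)).
Proof.
move=> a0 ab bT; set D := (b - a) / n.+1%:R. have gT k : (k <= n.+1)%N -> 0 <= grid a b n k <= T.
  by move=> kn; have /andP[h1 h2] := grid_itv ab kn; rewrite (le_trans a0)// (le_trans h2).
have gT' k : (k < n.+1)%N -> 0 <= grid a b n k <= T by move=> kn; apply: gT; exact: ltnW.
have sq k u : (k < n.+1)%N -> sqint P (fun w => Y (grid a b n k) w u).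
  by move=> kn; exact: (ou_sqint u (gT' k kn)).
have i1 (k l : nat) : (k < n.+1)%N -> (l < n.+1)%N -> L1 P (fun w => Y (grid a b n k) w phi * Y (grid a b n l) w psi).
  by move=> kn ln; exact: (sqint_integrable_mul (sq k phi kn) (sq l psi ln)).
pose A j := c * ip psi (heat (j%:R * D) phi); pose B j := c * ip phi (heat (j%:R * D) psi).
have gsub k l : (l <= k)%N -> grid a b n k - grid a b n l = (k - l)%:R * D.
  by move=> lk; rewrite /grid -/D natrB//; ring.
have E1 k l : (k < n.+1)%N -> (l < n.+1)%N -> \int[P]_w (Y (grid a b n k) w phi * Y (grid a b n l) w psi) =
    if (l <= k)%N then A (k - l)%N else B (l - k)%N.
  move=> kn ln; have /andP[k0 kT] := gT' k kn; have /andP[l0 lT] := gT' l ln.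
  case: ifPn => [lk|]; last rewrite -ltnNge => /ltnW kl.
    under eq_Rintegral do rewrite mulrC. rewrite (ou_covariance) ?gsub//. by apply: grid_mono.
  rewrite (ou_covariance) ?gsub//. by apply: grid_mono.
have lin : \int[P]_w (rsum phi a b n w * rsum psi a b n w) =
    \sum_(k < n.+1) \sum_(l < n.+1) D ^+ 2 * (if (l <= k)%N then A (k - l)%N else B (l - k)%N).
  have -> : \int[P]_w (rsum phi a b n w * rsum psi a b n w) =
    \int[P]_w \sum_(k < n.+1) \sum_(l < n.+1) D ^+ 2 * (Y (grid a b n k) w phi * Y (grid a b n l) w psi).
    apply: eq_Rintegral => w _; rewrite /rsum mulr_suml; apply: eq_bigr => k _.
    by rewrite mulr_sumr; apply: eq_bigr => l _; rewrite -/D; ring.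
  have i2 (k l : nat) : (k < n.+1)%N -> (l < n.+1)%N ->
      L1 P (fun w => D ^+ 2 * (Y (grid a b n k) w phi * Y (grid a b n l) w psi)).
    by move=> kn ln; have := intZ (D ^+ 2) (i1 k l kn ln).
  pose f (k : nat) w := \sum_(l < n.+1) D ^+ 2 * (Y (grid a b n k) w phi * Y (grid a b n l) w psi).
  have [_ <-] := @Rintegral_sum _ _ _ P n.+1 f (fun k kn =>
     (@Rintegral_sum _ _ _ P n.+1 (fun l w => D ^+ 2 * (Y (grid a b n k) w phi * Y (grid a b n l) w psi))
       (fun l ln => i2 k l kn ln)).1).
  apply: eq_bigr => k _.
  have [_ <-] := @Rintegral_sum _ _ _ P n.+1 (fun l w => D ^+ 2 * (Y (grid a b n k) w phi * Y (grid a b n l) w psi))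
       (fun l ln => i2 k l (ltn_ord k) ln).
  apply: eq_bigr => l _; rewrite (RintZ (i1 k l (ltn_ord k) (ltn_ord l))). by rewrite E1.
rewrite lin; under eq_bigr do rewrite -mulr_sumr. rewrite -mulr_sumr double_sum mulrBr mulrDr; congr (_ - _).
  rewrite !mulr_sumr -big_split /=; apply: eq_bigr => j _. have jn := ltnW (ltn_ord j).
  have gj : grid 0 (b - a) n j = j%:R * D by rewrite /grid subr0 add0r. rewrite /kern gj subr0 -/D natrB// clamp_id.
    have De : b - a = n.+1%:R * D by rewrite /D mulrC divfK// pnatr_eq0.
    rewrite /A /B De; move: (ip _ _) (ip _ _) => x y; ring.
  have h0 : 0 <= b - a by rewrite subr_ge0. have /andP[g1 g2] := grid_itv (n := n) h0 jn.
  by rewrite in_itv/= -gj g1 /= (le_trans g2)// lerBlDr (le_trans bT)// lerDl.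
have De : b - a = n.+1%:R * D by rewrite /D mulrC divfK// pnatr_eq0.
by rewrite /B mul0r heat0 [in RHS]De; move: (ip _ _) => x; ring.
Qed.

Lemma tint_covariance phi psi a b : 0 <= a -> a <= b -> b <= T -> \int[P]_w (tint phi a b w * tint psi a b w) =
  \int[mu]_(s in `[0, b - a]) ((b - a - s) * (c * ip psi (heat s phi) + c * ip phi (heat s psi))).
Proof.
move=> a0 ab bT. have [g1 c1] := tint_space phi a0 ab bT; have [g2 c2] := tint_space psi a0 ab bT.
have sq X : ou_space X -> sqint P X by exact: (gclos_sqint ou_span_gaussian). have sr u n : sqint P (rsum u a b n).
  by apply: sq; apply: (gclos_base ou_span_gaussian); exact: rsum_span.
have H1 := L2_cvg_mul (sr phi) (sr psi) (sq _ g1) (sq _ g2) c1 c2. have h0 : 0 <= b - a by rewrite subr_ge0.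
have H2 : \sum_(k < n.+1) (b - a - 0) / n.+1%:R * kern phi psi (b - a) (grid 0 (b - a) n k) -
    (b - a) * ((b - a) / n.+1%:R * (c * ip phi psi)) @[n --> \oo] -->
    \int[mu]_(s in `[0, b - a]) kern phi psi (b - a) s.
  apply: (cvg_eqr (\int[mu]_(s in `[0, b - a]) kern phi psi (b - a) s - (b - a) * (0 * (c * ip phi psi)))).
    apply: cvgB; first by apply: riemann_cvg => //; exact: kern_continuous.
    apply: cvgM; first exact: cvg_cst; apply: cvgM; last exact: cvg_cst. exact: mesh_cvg.
  by rewrite mul0r mulr0 subr0.
rewrite (cvgr_unique H1 H2 (fun n => rsum_cov phi psi n a0 ab bT)).
apply: eq_Rintegral => s; rewrite inE /= in_itv/= => /andP[s0 sh]; rewrite /kern clamp_id//.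
by rewrite in_itv/= s0 /= (le_trans sh)// lerBlDr (le_trans bT)// lerDl.
Qed.

Lemma integrable_open_itv (g : R -> R) (h : R) : continuous g -> mu.-integrable `]0, h] (EFin \o g).
Proof.
move=> cg; have mI := measurable_itvR `]0, h].
apply: (@integrableS _ _ _ mu `[0, h]%classic) => //; first exact: subset_itv_oc_cc. exact: integrable_itv_continuous.
Qed.

Let tint_covariance_open phi psi a b : 0 <= a -> a <= b -> b <= T -> \int[P]_w (tint phi a b w * tint psi a b w) =
  \int[mu]_(s in `]0, b - a]) kern phi psi (b - a) s.
Proof.
move=> a0 ab bT.
have e := @Rintegral_itv_obnd_cbnd R 0 (BRight (b - a)) _ (integrable_open_itv (b - a) (@kern_continuous phi psi (b - a))).
rewrite e (tint_covariance phi psi a0 ab bT).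
apply: eq_Rintegral => s; rewrite inE /= in_itv/= => /andP[s0 sh]; rewrite /kern clamp_id//.
by rewrite in_itv/= s0 /= (le_trans sh)// lerBlDr (le_trans bT)// lerDl.
Qed.

Let q : R := (Num.sqrt (pi *+ 2))^-1.

Let q_ge0 : 0 <= q. Proof. by rewrite invr_ge0 sqrtr_ge0. Qed.

Let kern_bound phi psi e1 e2 n1 n2 (h s : R) : mollifier e1 n1 phi -> mollifier e2 n2 psi ->
  0 < s <= h -> h <= T -> `|kern phi psi h s| <= h * (2 * c * q) * (Num.sqrt s)^-1.
Proof.
move=> bphi bpsi /andP[s0 sh] hT.
have phi0 x : 0 <= phi x := mollifier_ge0 x bphi; have psi0 x : 0 <= psi x := mollifier_ge0 x bpsi.
have m1 := mollifier_le1 bphi; have m2 := mollifier_le1 bpsi.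
rewrite /kern clamp_id; last by rewrite in_itv/= (ltW s0) (le_trans sh).
have := ip_heat_bounds v s0 phi0 psi0 m1 m2; have := ip_heat_bounds v s0 psi0 phi0 m2 m1.
rewrite normal_peak_sqrt// -/q => /andP[x0 xb] /andP[y0 yb]. have hs0 : 0 <= h - s by rewrite subr_ge0.
rewrite -mulrDr ger0_norm; last by rewrite !mulr_ge0// addr_ge0.
have -> : h * (2 * c * q) * (Num.sqrt s)^-1 = h * (c * (q * (Num.sqrt s)^-1 + q * (Num.sqrt s)^-1)) by ring.
apply: ler_pM => //; first by rewrite mulr_ge0// addr_ge0.
  by rewrite lerBlDr lerDl ltW.
by apply: ler_wpM2l => //; exact: lerD.
Qed.

(** The kernel is at most (2 pi s)^(-1/2), whose integral over [0, h] is of order sqrt h. *)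
Lemma tint_bound phi e1 n1 a b : mollifier e1 n1 phi -> 0 <= a -> a <= b -> b <= T ->
  \int[P]_w tint phi a b w ^+ 2 <= 4 * c * q * ((b - a) * Num.sqrt (b - a)).
Proof.
move=> bphi a0; rewrite le_eqVlt => /orP[/eqP <- aT|ab bT].
  have -> : \int[P]_w tint phi a a w ^+ 2 = \int[P]_w 0.
    by apply: eq_Rintegral => w _; rewrite /tint set_itv1 Rintegral_set1 expr0n.
  by rewrite Rintegral_probability_cst subrr mul0r mulr0.
have h0 : 0 < b - a by rewrite subr_gt0. have hT : b - a <= T by rewrite lerBlDr (le_trans bT)// lerDl.
have -> : \int[P]_w tint phi a b w ^+ 2 = \int[P]_w (tint phi a b w * tint phi a b w).
  by apply: eq_Rintegral => w _; rewrite expr2.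
rewrite (tint_covariance_open phi phi a0 (ltW ab) bT). have [i1 i2] := integral_inverse_sqrt h0.
have mI := measurable_itvR `]0, b - a].
have i3 := integrableZl mI ((b - a) * (2 * c * q)) i1. apply: le_trans (ler_norm _) _.
apply: (@le_trans _ _ (\int[mu]_(s in `]0, b - a]) ((b - a) * (2 * c * q) * (Num.sqrt s)^-1))).
  apply: (@le_normr_Rintegral_dominated _ _ _ mu `]0, b - a]%classic _
    (fun s => (b - a) * (2 * c * q) * (Num.sqrt s)^-1)) => //.
  - by apply: measurable_funTS; apply: continuous_measurable_fun; exact: kern_continuous.
  - by move=> s; rewrite /= in_itv/=; move=> sh; exact: (kern_bound bphi bphi).
rewrite (RintegralZl _ mI i1).
have -> : 4 * c * q * ((b - a) * Num.sqrt (b - a)) = (b - a) * (2 * c * q) * (2 * Num.sqrt (b - a)) by ring.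
by apply: ler_wpM2l => //; rewrite !mulr_ge0// ltW.
Qed.

(** Two times at distance s have covariance c times the return density at s, and pairs in an interval of length
    h have distances distributed with density 2 (h - s). *)
Definition limit_variance (h : R) : R := \int[mu]_(s in `]0, h]) ((h - s) * (2 * c * return_density v s)).

Lemma tint_limit (phi psi : nat -> schwartz R) (e1 e2 n1 n2 : nat -> R) a b : 0 <= a -> a <= b -> b <= T ->
  (forall n, mollifier (e1 n) (n1 n) (phi n)) -> (forall n, mollifier (e2 n) (n2 n) (psi n)) ->
  e1 n @[n --> \oo] --> 0 -> e2 n @[n --> \oo] --> 0 -> n1 n @[n --> \oo] --> 0 -> n2 n @[n --> \oo] --> 0 ->
  \int[P]_w (tint (phi n) a b w * tint (psi n) a b w) @[n --> \oo] --> limit_variance (b - a).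
Proof.
move=> a0 ab bT bphi bpsi e10 e20 n10 n20. have -> : (fun n => \int[P]_w (tint (phi n) a b w * tint (psi n) a b w)) =
    (fun n => \int[mu]_(s in `]0, b - a]) kern (phi n) (psi n) (b - a) s).
  by apply/funext => n; exact: tint_covariance_open.
move: ab; rewrite le_eqVlt => /orP[/eqP ab|ab].
  have e (g : R -> R) : \int[mu]_(s in `]0, b - a]) g s = 0.
    by rewrite ab subrr set_itv_ge ?bnd_simp ?ltxx// Rintegral_set0.
  rewrite /limit_variance e; have -> : (fun n => \int[mu]_(s in `]0, b - a]) kern (phi n) (psi n) (b - a) s) = (fun=> 0).
    by apply/funext => n; exact: e.
  exact: cvg_cst.
have h0 : 0 < b - a by rewrite subr_gt0. have hT : b - a <= T by rewrite lerBlDr (le_trans bT)// lerDl.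
have [i1 i2] := integral_inverse_sqrt h0. have mI := measurable_itvR `]0, b - a].
have i3 := integrableZl mI ((b - a) * (2 * c * q)) i1.
have mk n : measurable_fun `]0, b - a] (kern (phi n) (psi n) (b - a)).
  by apply: measurable_funTS; apply: continuous_measurable_fun; exact: kern_continuous.
have ck s : `]0, b - a]%classic s -> kern (phi n) (psi n) (b - a) s @[n --> \oo] -->
    (b - a - s) * (2 * c * return_density v s).
  rewrite /= in_itv/= => /andP[s0 sh]. have e1' := @ip_heat_cvg R v s phi psi e1 e2 n1 n2 s0 bphi bpsi e10 e20 n10 n20.
  have e2' := @ip_heat_cvg R v s psi phi e2 e1 n2 n1 s0 bpsi bphi e20 e10 n20 n10.
  apply: (cvg_eqr ((b - a - s) * (c * return_density v s + c * return_density v s))); last by ring.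
  rewrite /kern clamp_id; last by rewrite in_itv/= (ltW s0) (le_trans sh). apply: cvgM; first exact: cvg_cst.
  by apply: cvgD; (apply: cvgM; first exact: cvg_cst).
have [] := @Rintegral_dominated_cvg _ _ _ mu `]0, b - a]%classic
  (fun n => kern (phi n) (psi n) (b - a)) (fun s => (b - a - s) * (2 * c * return_density v s))
  (fun s => (b - a) * (2 * c * q) * (Num.sqrt s)^-1) mI mk ck i3 _ => //.
by move=> n s; rewrite /= in_itv/= => sh; exact: (kern_bound (bphi n) (bpsi n)).
Qed.

End time_integrals.

(** * Extension to square-integrable functions *)

Section extension.

Variable f : R -> R.
Hypothesis mf : measT f.
Hypothesis if2 : L1 mu (fun x => f x ^+ 2).
Hypothesis f_approx : forall e : R, 0 < e -> exists u : schwartz R, \int[mu]_x (u x - f x) ^+ 2 <= e.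

Definition L2dist u : R := \int[mu]_x (u x - f x) ^+ 2.

Let sp := ou_space.
Let gauss := ou_span_gaussian.
Let lin := ou_span_lin.

Let mu_ u : measT (u : R -> R). Proof. exact: (measurable_schwartz u 0). Qed.

Lemma integrable_L2dist u : L1 mu (fun x => (u x - f x) ^+ 2).
Proof.
have i1 : L1 mu (fun x => u x ^+ 2).
  by have := integrable_ip u u; under eq_fun do rewrite -expr2.
have [i2 _] := @Rintegral_linear2 _ _ _ mu 2 2 _ _ i1 if2.
apply: (integrable_dominated mu (fun x => 2 * u x ^+ 2 + 2 * f x ^+ 2)) => //.
  by apply: measurable_funX; exact: (measurable_funB (mu_ u) mf).
move=> x _; rewrite ger0_norm ?sqr_ge0//. by have := sqr_add_le (u x) (- f x); rewrite sqrrN.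
Qed.

Lemma L2dist_ge0 u : 0 <= L2dist u.
Proof. by apply: Rintegral_ge0 => x _; exact: sqr_ge0. Qed.

(** At each time the process is a white noise, hence an isometry up to the factor c. *)
Lemma ou_increment_le t u psi : 0 <= t <= T -> \int[P]_w (Y t w u - Y t w psi) ^+ 2 <= 2 * c * (L2dist u + L2dist psi).
Proof.
move=> tT; have -> : \int[P]_w (Y t w u - Y t w psi) ^+ 2 = c * ip (u - psi) (u - psi).
  rewrite -(ou_variance _ tT); apply: eq_Rintegral => w _. by rewrite linearB.
rewrite [2 * c]mulrC -mulrA; apply: ler_wpM2l => //. have i1 := integrable_L2dist u; have i2 := integrable_L2dist psi.
rewrite mulrDr; have [i3 <-] := @Rintegral_linear2 _ _ _ mu 2 2 _ _ i1 i2.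
apply: le_Rintegral => //; first exact: integrable_ip.
move=> x _; have -> : (u - psi) x * (u - psi) x = ((u x - f x) + - (psi x - f x)) ^+ 2.
  by rewrite -[(u - psi) x]/(u x - psi x) expr2; ring.
by have := sqr_add_le (u x - f x) (- (psi x - f x)); rewrite sqrrN.
Qed.

(** The limit does not depend on the approximating sequence, hence the bound for every u. *)
Lemma limit_in_space t (psi : nat -> schwartz R) (W : Omega -> R) : 0 <= t <= T ->
  measT W -> L2dist (psi n) @[n --> \oo] --> 0 -> pdist P (fun w => Y t w (psi n)) W @[n --> \oo] --> 0 ->
  sp W /\ forall u, \int[P]_w (Y t w u - W w) ^+ 2 <= 2 * c * L2dist u.
Proof.
move=> tT mW dpsi cW. have gY u : sp (fun w => Y t w u) := ou_space_pairing u tT.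
have gW : sp W by exact: (gclos_cvg gauss (fun n => gY (psi n)) mW cW).
have L2 := gclos_L2 gauss lin (fun n => gY (psi n)) gW cW.
have sq X : sp X -> sqint P X by exact: (gclos_sqint gauss). split => // u.
have gd n : sp (fun w => Y t w u - Y t w (psi n)) by exact: (gclosB gauss lin (gY u) (gY (psi n))).
have gd' : sp (fun w => Y t w u - W w) by exact: (gclosB gauss lin (gY u) gW).
have c1 : \int[P]_w ((Y t w u - Y t w (psi n)) - (Y t w u - W w)) ^+ 2 @[n --> \oo] --> 0.
  have -> : (fun n => \int[P]_w ((Y t w u - Y t w (psi n)) - (Y t w u - W w)) ^+ 2) =
      (fun n => \int[P]_w (Y t w (psi n) - W w) ^+ 2).
    by apply/funext => n; apply: eq_Rintegral => w _; ring.
  exact: L2.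
have H1 := L2_cvg_mul (fun n => sq _ (gd n)) (fun n => sq _ (gd n)) (sq _ gd') (sq _ gd') c1 c1.
have H2 : 2 * c * (L2dist u + L2dist (psi n)) @[n --> \oo] --> 2 * c * L2dist u.
  apply: (cvg_eqr (2 * c * (L2dist u + 0))); last by rewrite addr0.
  by apply: cvgM; [exact: cvg_cst|apply: cvgD; [exact: cvg_cst|]].
under eq_Rintegral do rewrite expr2. rewrite -subr_ge0; apply: (cvg_ge_lim (cvgB H2 H1)) => n.
rewrite subr_ge0; under eq_Rintegral do rewrite -expr2; exact: ou_increment_le.
Qed.

Lemma approximating_sequence (e : nat -> R) : (forall n, 0 < e n) ->
  exists psi : nat -> schwartz R, forall n, L2dist (psi n) <= e n.
Proof. by move=> e0; have /choice[psi h] n := f_approx (e0 n); exists psi. Qed.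

(** Approximating sequences disappear: the extension is the element of the Gaussian space that satisfies the
    isometric bound. *)
Lemma L2_extensionP t (W : Omega -> R) : 0 <= t <= T -> L2_extension P (Y t) f W <->
  sp W /\ forall u, \int[P]_w (Y t w u - W w) ^+ 2 <= 2 * c * L2dist u.
Proof.
move=> tT. have sY u : sqint P (fun w => Y t w u) := ou_sqint u tT.
have [psi hpsi] := @approximating_sequence (fun n => n.+1%:R^-1) (fun n => ltac:(by rewrite invr_gt0)).
have dpsi : L2dist (psi n) @[n --> \oo] --> 0.
  by apply: cvg0_harmonic => n; rewrite L2dist_ge0 hpsi.
split=> [[mW HW]|[gW HW]].
- have := HW psi ((Lnorm2_cvg0 (fun n => integrable_L2dist (psi n))).2 dpsi) => cN.
  have /fine_cvgP [[N _ HN] _] := cN. have iN n : L1 P (fun w => (Y t w (psi (n + N)%N) - W w) ^+ 2).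
    apply: Lnorm2_lty; first by apply: measurable_funB => //; case: (sY (psi (n + N)%N)).
    by rewrite ltey_eq HN//= leq_addl.
  have cN' : ('N[P]_2%:E[EFin \o (fun w => (Y t w (psi (n + N)%N) - W w)%R)])%E @[n --> \oo] --> 0%E.
    by rewrite (cvg_shiftn N (fun n => 'N[P]_2%:E[EFin \o (fun w => (Y t w (psi n) - W w)%R)])%E).
  have c2 := (Lnorm2_cvg0 iN).1 cN'. apply: (@limit_in_space t (fun n => psi (n + N)%N)) => //.
    by rewrite (cvg_shiftn N (fun n => L2dist (psi n))).
  apply: sqr_cvg0 c2 => n; apply: pdist_sqr_le; split => //.
  by apply: measurable_funB => //; case: (sY (psi (n + N)%N)).
- have [mW _] := gW; split => // u_ cu. have sW : sqint P W by exact: (gclos_sqint gauss).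
  have du := (Lnorm2_cvg0 (fun n => integrable_L2dist (u_ n))).1 cu.
  apply: (Lnorm2_cvg0 _).2 => [n|]; first by have [] := sqintB (sY (u_ n)) sW.
  apply: (cvg_dist_le (fun n => 2 * c * L2dist (u_ n))).
    move=> n; rewrite subr0 ger0_norm//. by apply: Rintegral_ge0 => w _; exact: sqr_ge0.
  by apply: (cvg_eqr (2 * c * 0)); [apply: cvgM => //; exact: cvg_cst|rewrite mulr0].
Qed.

(** Rapid approximations of f make the successive distances summable, as [jointly_measurable_limit] requires. *)
Lemma L2_version_exists : exists V, L2_version P T Y f V.
Proof.
(* The factor 4^n makes the mean distance of successive approximations at most 2^(-n-1). *)
pose e n : R := (4 ^+ n.+2 * (c + 1))^-1. have e0 n : 0 < e n by rewrite invr_gt0 mulr_gt0 ?exprn_gt0// ltr_pwDr.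
have [psi hpsi] := approximating_sequence e0. have cl s : 0 <= clamp T s <= T := clamp_itv (ltW T0) s.
pose X m s w := Y (clamp T s) w (psi m). have sY u s : sqint P (fun w => Y (clamp T s) w u) := ou_sqint u (cl s).
have mX m s : measT (X m s) by case: (sY (psi m) s). have cX m w : continuous (X m ^~ w).
  have cY : {within `[0, T], continuous (Y ^~ w)} by exact: (@continuous_ou w).
  exact: (@pairing_clamp R T (Y ^~ w) (ltW T0) cY (psi m)).
have dX m s : L1 P (fun w => X m.+1 s w - X m s w) /\ \int[P]_w `|X m.+1 s w - X m s w| <= 1 / (2 ^ (m + 1))%:R.
  have sD : sqint P (fun w => X m.+1 s w - X m s w) by exact: (sqintB (sY (psi m.+1) s) (sY (psi m) s)).
  split; first exact: sqint_integrable.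
  rewrite -(@ler_pXn2r _ 2)// ?nnegrE ?divr_ge0//; last by apply: Rintegral_ge0 => w _.
  apply: le_trans (Rintegral_norm_sqr sD) _. apply: le_trans (ou_increment_le (psi m.+1) (psi m) (cl s)) _.
  have q0 : (0 : R) < 4 ^+ m.+1 by rewrite exprn_gt0. have -> : (1 / (2 ^ (m + 1))%:R) ^+ 2 = (4 ^+ m.+1)^-1 :> R.
    rewrite addn1 natrX div1r exprVn -exprM mulnC exprM. by have -> : (2%:R : R) ^+ 2 = 4 by ring.
  have := hpsi m; have := hpsi m.+1; rewrite /e. have -> : (4 : R) ^+ m.+3 = 16 * 4 ^+ m.+1 by rewrite !exprS; ring.
  have -> : (4 : R) ^+ m.+2 = 4 * 4 ^+ m.+1 by rewrite exprS. move: (4 ^+ m.+1) q0 => q q0 h1 h2.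
  have c10 : 0 < c + 1 by rewrite ltr_pwDr.
  apply: (@le_trans _ _ (2 * c * ((16 * q * (c + 1))^-1 + (4 * q * (c + 1))^-1))).
    by apply: ler_wpM2l; [exact: mulr_ge0|exact: lerD].
  have -> : 2 * c * ((16 * q * (c + 1))^-1 + (4 * q * (c + 1))^-1) = q^-1 * (5 / 8 * (c / (c + 1))).
    by field; rewrite !lt0r_neq0.
  have h : c / (c + 1) <= 1 by rewrite ler_pdivrMr// mul1r lerDl. by rewrite ger_pMr ?invr_gt0//; lra.
have [V [mV iV cV]] := jointly_measurable_limit T mX cX dX. have mI := measurable_itvR `[0, T]. exists V; split.
- by apply: measurable_funTS.
- exact: iV.
- move=> t tT; have tT' : 0 <= t <= T by move: tT; rewrite in_itv. apply/(L2_extensionP _ tT').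
  have mVt : measT (V t) by exact: measurableT_comp mV (pair1_measurable t). apply: (@limit_in_space t psi) => //.
    apply: cvg0_harmonic => n; rewrite L2dist_ge0 (le_trans (hpsi n))//.
    have p0 : 0 < (4 : R) ^+ n.+2 * (c + 1) by apply: mulr_gt0; [exact: exprn_gt0|rewrite ltr_pwDr].
    rewrite lef_pV2 ?posrE ?ltr0n//. have : (n.+1%:R : R) <= 4 ^+ n.+2.
      by rewrite -[4 ^+ n.+2]natrX ler_nat ltnW// ltnW// ltn_expl.
    have q0 : (0 : R) <= 4 ^+ n.+2 by rewrite exprn_ge0. move: (4 ^+ n.+2) q0 => q q0 h; have := mulr_ge0 q0 c0; lra.
  apply: pdist_ae => //; first by move=> n; case: (ou_sqint (psi n) tT').
  by have := cV t tT; apply: filterS => w; rewrite /X clamp_id.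
Qed.

End extension.

Section integrated_extension.

Variable f : R -> R.
Hypothesis mf : measT f.
Hypothesis if2 : L1 mu (fun x => f x ^+ 2).
Hypothesis f_approx : forall e : R, 0 < e -> exists u : schwartz R, \int[mu]_x (u x - f x) ^+ 2 <= e.
Variable V : R -> Omega -> R.
Hypothesis HV : L2_version P T Y f V.

Definition Zint t w : R := \int[mu]_(s in `[0, t]) V s w.

Let mI a b : measurable (`[a, b]%classic : set (measurableTypeR R)). Proof. exact: measurable_itv. Qed.

Let Vi w : mu.-integrable `[0, T] (EFin \o (V ^~ w)). Proof. by have [_ iV _] := HV; exact: (iV w). Qed.

Let VT (p : R * Omega) : R := ((fun p : R * Omega => V p.1 p.2) \_ (`[0, T]%classic `*` [set: Omega])) p.

Let mVT : measT VT.
Proof.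
have [mV _ _] := HV; apply: (measurable_restrictT _ _).1 mV. by apply: measurableX => //; exact: (mI 0 T).
Qed.

Let inab a b (s : R) : R := \1_(`[a, b]%classic : set (measurableTypeR R)) s.

Let minab a b : measT (fun p : R * Omega => inab a b p.1).
Proof.
apply: (measurableT_comp (f := inab a b)); last exact: measurable_fst. by apply: measurable_indic; exact: mI.
Qed.

Let VTE s w : 0 <= s <= T -> VT (s, w) = V s w.
Proof. by move=> sT; rewrite /VT patchE mem_set//=; split => //; rewrite /= in_itv. Qed.

Let int_inab a b (g : R -> R) : \int[mu]_(s in `[a, b]) g s = \int[mu]_s (g s * inab a b s).
Proof.
rewrite Rintegral_mkcond; apply: eq_Rintegral => s _; rewrite patchE /inab indicE.
by case: (_ \in _); rewrite ?mulr1 ?mulr0.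
Qed.

Lemma Zint_continuous w : {within `[0, T], continuous (Zint ^~ w)}.
Proof. exact: (parameterized_integral_continuous (ltW T0) (Vi w)). Qed.

Lemma Zint_increment a b w : 0 <= a -> a <= b -> b <= T -> Zint b w - Zint a w = \int[mu]_(s in `[a, b]) V s w.
Proof.
move=> a0 ab bT; rewrite /Zint. have ib : mu.-integrable `[0, b] (EFin \o (V ^~ w)).
  apply: (@integrableS _ _ _ mu `[0, T]%classic `[0, b]%classic _ (mI 0 T) (mI 0 b) _ (Vi w)).
  by apply: subset_itvl; rewrite bnd_simp.
by rewrite (Rintegral_itv_cat a0 ab ib) addrAC subrr add0r.
Qed.

Lemma measurable_Zint t : t <= T -> measT (Zint t).
Proof.
move=> tT; have -> : Zint t = (fun w => \int[mu]_s (VT (s, w) * inab 0 t s)).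
  apply/funext => w; rewrite /Zint int_inab; apply: eq_Rintegral => s _.
  rewrite /inab indicE; case: (boolP (s \in _)); rewrite ?mulr0// inE /= in_itv/= => /andP[s0 st].
  by rewrite VTE// s0 (le_trans st).
by apply: (@measurable_Rintegral_fst _ _ _ (fun p => VT p * inab 0 t p.1)); exact: (measurable_funM mVT (minab 0 t)).
Qed.

Let sVY s u : 0 <= s <= T -> sqint P (fun w => V s w - Y s w u) /\
  \int[P]_w `|V s w - Y s w u| <= Num.sqrt (2 * c * L2dist f u).
Proof.
move=> sT; have [_ _ /(_ s)] := HV; rewrite in_itv/= => /(_ sT).
move=> /(L2_extensionP mf if2 f_approx _ sT)[gV /(_ u)].
have sV : sqint P (V s) by exact: (gclos_sqint (ou_span_gaussian) gV).
have sD := sqintB sV (ou_sqint u sT) => h; split => //.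
have e : \int[P]_w (Y s w u - V s w) ^+ 2 = \int[P]_w (V s w - Y s w u) ^+ 2.
  by apply: eq_Rintegral => w _; rewrite -sqrrN opprB.
have n0 : 0 <= \int[P]_w `|V s w - Y s w u| by apply: Rintegral_ge0 => w _.
rewrite -(ger0_norm n0) -sqrtr_sqr ler_sqrt; last first.
  by apply: mulr_ge0; [exact: mulr_ge0|exact: L2dist_ge0].
by apply: le_trans (Rintegral_norm_sqr sD) _; rewrite -e.
Qed.

Let mY u : measT (fun p : R * Omega => Y (clamp T p.1) p.2 u).
Proof.
apply: (@measurable_continuous_fst _ _ _ (fun s w => Y (clamp T s) w u)) => [s|w].
  by case: (ou_sqint u (clamp_itv (ltW T0) s)).
have cY : {within `[0, T], continuous (Y ^~ w)} by exact: (@continuous_ou w).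
exact: (@pairing_clamp R T (Y ^~ w) (ltW T0) cY u).
Qed.

(** By Fubini's theorem, the mean of the absolute difference is at most the time integral of the means. *)
Lemma Zint_tint_le a b u : 0 <= a -> a <= b -> b <= T ->
  pdist P (fun w => Zint b w - Zint a w) (tint u a b) <= (b - a) * Num.sqrt (2 * c * L2dist f u).
Proof.
move=> a0 ab bT; set K := Num.sqrt _.
have sT s : a <= s <= b -> 0 <= s <= T by move=> /andP[h1 h2]; rewrite (le_trans a0)// (le_trans h2).
pose g (p : R * Omega) := (VT p - Y (clamp T p.1) p.2 u) * inab a b p.1. have mg : measT g.
  by apply: (measurable_funM _ (minab a b)); exact: (measurable_funB mVT (mY u)).
have gE s w : g (s, w) = (V s w - Y s w u) * inab a b s.
  rewrite /g /inab /= indicE; case: (boolP (s \in _)); rewrite ?mulr0// inE /= in_itv/= => /sT h.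
  by rewrite VTE// clamp_id// in_itv.
have ZE w : Zint b w - Zint a w - tint u a b w = \int[mu]_s g (s, w).
  rewrite (Zint_increment w a0 ab bT) /tint. have i1 : mu.-integrable `[a, b] (EFin \o (V ^~ w)).
    apply: (@integrableS _ _ _ mu `[0, T]%classic _ _ (mI 0 T) (mI a b) _ (Vi w)).
    by apply: subset_itv; rewrite bnd_simp.
  have i2 : mu.-integrable `[a, b] (EFin \o (fun s => Y s w u)).
    have cY : {within `[0, T], continuous (Y ^~ w)} by exact: (@continuous_ou w).
    exact: (@integrable_pairing _ T _ (ltW T0) cY).
  rewrite -(@RintegralB _ _ _ mu _ _ _ (mI a b) i1 i2) int_inab. by apply: eq_Rintegral => s _; rewrite gE.
have mag : measT (fun p => `|g p|%:E) by apply/measurable_EFinP; exact: measurableT_comp.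
have mZ t : t <= T -> measT (Zint t) := @measurable_Zint t. have [gt _] := tint_space u a0 ab bT.
have mdiff : measT (fun w => Zint b w - Zint a w - tint u a b w).
  by apply: measurable_funB; [apply: measurable_funB; apply: mZ => //; exact: le_trans ab bT|case: gt].
rewrite -lee_fin /pdist; set X := fun w => _. have iX : L1 P X by exact: integrable_cap1.
rewrite /Rintegral fineK ?(integrable_fin_num measurableT iX)//.
apply: (@le_trans _ _ (\int[P]_w \int[mu]_s `|g (s, w)|%:E)%E).
  apply: ge0_le_integral => //.
  - by move=> w _; rewrite lee_fin; case/andP: (cap1_itv (Zint b w - Zint a w - tint u a b w)).
  - exact: measurable_int iX.
  - exact: (@measurable_fun_fubini_tonelli_G _ _ _ _ _ mu _ mag (fun p => normr_ge0 (g p))).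
  - move=> w _; apply: (@le_trans _ _ `|Zint b w - Zint a w - tint u a b w|%:E).
      by rewrite lee_fin; exact: cap1_le.
    rewrite ZE.
    have [h|] := boolP (\int[mu]_s `|g (s, w)|%:E < +oo)%E; last by rewrite -leNgt leye_eq => /eqP ->; rewrite leey.
    have mgw : measT (EFin \o (fun s => g (s, w))).
      by apply/measurable_EFinP; exact: measurableT_comp mg (pair2_measurable w).
    have ig : L1 mu (fun s => g (s, w)) by apply/integrableP. have := le_abse_integral mu measurableT mgw.
    by rewrite -(fineK (integrable_fin_num measurableT ig)).
rewrite -(@fubini_tonelli _ _ _ _ _ mu P _ mag (fun p => normr_ge0 (g p))).
apply: (@le_trans _ _ (\int[mu]_s (inab a b s * K)%:E)%E).
  apply: ge0_le_integral => //.
  - by move=> s _; apply: integral_ge0 => w _; rewrite lee_fin.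
  - exact: (@measurable_fun_fubini_tonelli_F _ _ _ _ _ P _ mag (fun p => normr_ge0 (g p))).
  - by apply/measurable_EFinP; apply: measurable_funM => //; apply: measurable_indic; exact: mI.
  - move=> s _; rewrite /inab; under eq_integral do rewrite gE /inab.
    rewrite indicE; case: (boolP (s \in _)) => [|_]; last first.
      by rewrite mul0r; under eq_integral do rewrite mulr0 normr0; rewrite integral0.
    rewrite inE /= in_itv/= => /sT sT'; rewrite mul1r; under eq_integral do rewrite mulr1.
    have [sD bD] := sVY u sT'; have i2 := integrable_norm (sqint_integrable sD).
    by rewrite -[leLHS](fineK (integrable_fin_num measurableT i2)) lee_fin.
under eq_integral do rewrite mulrC EFinM. rewrite ge0_integralZl_EFin ?sqrtr_ge0//; last 2 first.
- by move=> s _; rewrite lee_fin /inab indicE.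
- by apply/measurable_EFinP; apply: measurable_indic; exact: mI.
rewrite /inab integral_indic// setIT; have := @lebesgue_measure_itv R `[a, b]; rewrite /= lte_fin => ->.
have -> : (if (a < b)%R then b%:E + (- a)%:E else 0)%E = (b - a)%:E.
  move: ab; rewrite le_eqVlt => /orP[/eqP <-|->]; first by rewrite ltxx subrr. by rewrite EFinB.
by rewrite -EFinM lee_fin mulrC.
Qed.

Lemma Zint_space a b : 0 <= a -> a <= b -> b <= T -> ou_space (fun w => Zint b w - Zint a w) /\
  forall psi : nat -> schwartz R, L2dist f (psi n) @[n --> \oo] --> 0 ->
    \int[P]_w (tint (psi n) a b w - (Zint b w - Zint a w)) ^+ 2 @[n --> \oo] --> 0.
Proof.
move=> a0 ab bT; have gauss := ou_span_gaussian; have lin := ou_span_lin.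
have gt u : ou_space (tint u a b) := (tint_space u a0 ab bT).1. have mZ : measT (fun w => Zint b w - Zint a w).
  by apply: measurable_funB; apply: measurable_Zint => //; exact: le_trans ab bT.
have dpsi (psi : nat -> schwartz R) : L2dist f (psi n) @[n --> \oo] --> 0 ->
    pdist P (tint (psi n) a b) (fun w => Zint b w - Zint a w) @[n --> \oo] --> 0.
  move=> d0; apply: (cvg_dist_le (fun n => (b - a) * Num.sqrt (2 * c * L2dist f (psi n)))).
    by move=> n; rewrite subr0 ger0_norm ?pdist_ge0// pdistC; exact: Zint_tint_le.
  apply: (cvg_eqr ((b - a) * Num.sqrt (2 * c * 0))); last by rewrite mulr0 sqrtr0 mulr0.
  apply: cvgM; first exact: cvg_cst.
  have c1 : 2 * c * L2dist f (psi n) @[n --> \oo] --> 2 * c * 0 by apply: cvgM => //; exact: cvg_cst.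
  exact: (cvg_comp _ _ c1 (@sqrt_continuous R _)).
have [psi hpsi] := approximating_sequence f_approx (fun n => ltac:(by rewrite invr_gt0) : 0 < n.+1%:R^-1).
have d0 : L2dist f (psi n) @[n --> \oo] --> 0.
  by apply: cvg0_harmonic => n; rewrite L2dist_ge0 hpsi.
have gZ := gclos_cvg gauss (fun n => gt (psi n)) mZ (dpsi psi d0).
by split => // phi dphi; exact: (gclos_L2 gauss lin (fun n => gt (phi n)) gZ (dpsi phi dphi)).
Qed.

End integrated_extension.

(** * The processes Z^eps *)

Section Z_eps.
Local Notation Z := (Z_eps P T Y).

Let i_eps_sqr eps : 0 < eps -> L1 mu (fun x => i_eps eps x ^+ 2).
Proof.
move=> e0; have [i1 _] := i_eps_integral e0. apply: (integrable_dominated mu (fun x => eps^-1 * i_eps eps x)) => //.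
- by apply: measurable_funX; exact: measurable_i_eps.
- move=> x _; have /andP[h0 h1] := i_eps_bounds e0 x. by rewrite ger0_norm ?sqr_ge0// expr2; apply: ler_wpM2r.
- by have := intZ eps^-1 i1.
Qed.

Let i_eps_approx eps : 0 < eps ->
  forall e : R, 0 < e -> exists u : schwartz R, \int[mu]_x (u x - i_eps eps x) ^+ 2 <= e.
Proof. by move=> h e /(mollifier_exists h)[u [_ h1 _]]; exists u. Qed.

Let L2_processP eps : 0 < eps -> L2_version P T Y (i_eps eps) (L2_process P T Y (i_eps eps)).
Proof.
move=> e0; have [V HV] := L2_version_exists (@measurable_i_eps R eps) (i_eps_sqr e0) (i_eps_approx e0).
exact: (@xgetPex _ (fun _ _ => 0) [set V | L2_version P T Y (i_eps eps) V] (ex_intro _ V HV)).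
Qed.

Lemma Z_eps0 eps w : Z eps 0 w = 0.
Proof. by rewrite /Z_eps set_itv1 Rintegral_set1. Qed.

Lemma Z_eps_process eps : 0 < eps -> continuous_process T (Z eps).
Proof.
move=> e0; have HV := L2_processP e0; split=> [t|w].
  by rewrite in_itv/= => /andP[_ tT]; exact: (measurable_Zint HV).
exact: (Zint_continuous HV).
Qed.

Lemma Z_eps_space eps a b : 0 < eps -> 0 <= a -> a <= b -> b <= T -> ou_space (fun w => Z eps b w - Z eps a w).
Proof.
move=> e0 a0 ab bT.
exact: (Zint_space (@measurable_i_eps R eps) (i_eps_sqr e0) (i_eps_approx e0) (L2_processP e0) a0 ab bT).1.
Qed.

Let sq X : ou_space X -> sqint P X.
Proof. exact: (gclos_sqint (ou_span_gaussian)). Qed.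

Lemma Z_eps_mollifier eps a b (e : R) : 0 < eps -> 0 <= a -> a <= b -> b <= T -> 0 < e ->
  exists2 u, mollifier eps e u & \int[P]_w (tint u a b w - (Z eps b w - Z eps a w)) ^+ 2 <= e.
Proof.
move=> e0 a0 ab bT he. pose eta n : R := Num.min e n.+1%:R^-1.
have eta0 n : 0 < eta n by rewrite lt_min he invr_gt0 ltr0n. have /choice[psi Hpsi] n := mollifier_exists e0 (eta0 n).
have d0 : L2dist (i_eps eps) (psi n) @[n --> \oo] --> 0.
  apply: cvg0_harmonic => n; rewrite L2dist_ge0; have [_ h _] := Hpsi n. by apply: le_trans h _; rewrite /eta ge_min lexx orbT.
have [_ /(_ psi d0)] := Zint_space (@measurable_i_eps R eps) (i_eps_sqr e0) (i_eps_approx e0) (L2_processP e0) a0 ab bT.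
move=> /cvgr0Pnorm_le /(_ _ he)[N _ /(_ N (leqnn _)) HN]. exists (psi N); last exact: le_trans (ler_norm _) HN.
have [h1 h2 /andP[h3 h4]] := Hpsi N. have etae : eta N <= e by rewrite ge_min lexx.
split => //; first exact: le_trans h2 etae. by rewrite h4 andbT; apply: le_trans h3; rewrite lerD2l lerN2.
Qed.

Let K : R := 4 * c * (Num.sqrt (pi *+ 2))^-1.

Lemma Z_eps_increment_le eps a b : 0 < eps -> 0 <= a -> a <= b -> b <= T ->
  \int[P]_w (Z eps b w - Z eps a w) ^+ 2 <= K * ((b - a) * Num.sqrt (b - a)).
Proof.
move=> e0 a0 ab bT; set X := fun w => Z eps b w - Z eps a w. have n0 n : (0 : R) < n.+1%:R^-1 by rewrite invr_gt0.
have /choice[u Hu] n : exists u, mollifier eps n.+1%:R^-1 u /\ \int[P]_w (tint u a b w - X w) ^+ 2 <= n.+1%:R^-1.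
  by have [u] := Z_eps_mollifier e0 a0 ab bT (n0 n); exists u.
have sX : sqint P X by apply: sq; exact: Z_eps_space.
have st n : sqint P (tint (u n) a b) := sq (tint_space (u n) a0 ab bT).1.
have c1 : \int[P]_w (tint (u n) a b w - X w) ^+ 2 @[n --> \oo] --> 0.
  apply: cvg0_harmonic => n; rewrite (Hu n).2 andbT. by apply: Rintegral_ge0 => w _; exact: sqr_ge0.
under eq_Rintegral do rewrite expr2. apply: (cvg_le_lim (L2_cvg_mul st st sX sX c1 c1)) => n.
by under eq_Rintegral do rewrite -expr2; exact: (tint_bound (Hu n).1 a0 ab bT).
Qed.

Lemma Z_eps_covariance_cvg (e1 e2 : nat -> R) a b : (forall n, 0 < e1 n) -> (forall n, 0 < e2 n) ->
  e1 n @[n --> \oo] --> 0 -> e2 n @[n --> \oo] --> 0 -> 0 <= a -> a <= b -> b <= T ->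
  \int[P]_w ((Z (e1 n) b w - Z (e1 n) a w) * (Z (e2 n) b w - Z (e2 n) a w)) @[n --> \oo] --> limit_variance (b - a).
Proof.
move=> e10 e20 c1 c2 a0 ab bT. have n0 n : (0 : R) < n.+1%:R^-1 by rewrite invr_gt0.
have ex (e : nat -> R) : (forall n, 0 < e n) -> exists u : nat -> schwartz R, forall n,
    mollifier (e n) n.+1%:R^-1 (u n) /\ \int[P]_w (tint (u n) a b w - (Z (e n) b w - Z (e n) a w)) ^+ 2 <= n.+1%:R^-1.
  move=> e0; have /choice[u Hu] n : exists u, mollifier (e n) n.+1%:R^-1 u /\
      \int[P]_w (tint u a b w - (Z (e n) b w - Z (e n) a w)) ^+ 2 <= n.+1%:R^-1.
    by have [u] := Z_eps_mollifier (e0 n) a0 ab bT (n0 n); exists u.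
  by exists u.
have [u1 H1] := ex _ e10; have [u2 H2] := ex _ e20. have harm := @cvg_harmonic R.
have lim0 := tint_limit a0 ab bT (fun n => (H1 n).1) (fun n => (H2 n).1) c1 c2 harm harm.
pose X1 n w := Z (e1 n) b w - Z (e1 n) a w; pose X2 n w := Z (e2 n) b w - Z (e2 n) a w.
have sX1 n : sqint P (X1 n) by apply: sq; exact: Z_eps_space.
have sX2 n : sqint P (X2 n) by apply: sq; exact: Z_eps_space.
have st u : sqint P (tint u a b) := sq (tint_space u a0 ab bT).1.
have cv (e : nat -> R) (u : nat -> schwartz R) (X : nat -> Omega -> R) :
    (forall n, \int[P]_w (tint (u n) a b w - X n w) ^+ 2 <= n.+1%:R^-1) ->
    \int[P]_w (tint (u n) a b w - X n w) ^+ 2 @[n --> \oo] --> 0.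
  move=> h; apply: cvg0_harmonic => n; rewrite h andbT. by apply: Rintegral_ge0 => w _; exact: sqr_ge0.
have d1 := cv e1 u1 X1 (fun n => (H1 n).2); have d2 := cv e2 u2 X2 (fun n => (H2 n).2).
have sD1 n : sqint P (fun w => tint (u1 n) a b w - X1 n w) := sqintB (st (u1 n)) (sX1 n).
have sD2 n : sqint P (fun w => tint (u2 n) a b w - X2 n w) := sqintB (st (u2 n)) (sX2 n).
have l1 := cauchy_schwarz_cvg0 sD1 sX2 d1 (fun n => Z_eps_increment_le (e20 n) a0 ab bT).
have l2 := cauchy_schwarz_cvg0 sD2 (fun n => st (u1 n)) d2 (fun n => tint_bound (H1 n).1 a0 ab bT).
have -> : (fun n => \int[P]_w ((Z (e1 n) b w - Z (e1 n) a w) * (Z (e2 n) b w - Z (e2 n) a w))) = (fun n => \int[P]_w (tint (u1 n) a b w * tint (u2 n) a b w) -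
   \int[P]_w ((tint (u2 n) a b w - X2 n w) * tint (u1 n) a b w) -
   \int[P]_w ((tint (u1 n) a b w - X1 n w) * X2 n w)); last first.
  apply: (cvg_eqr (limit_variance (b - a) - 0 - 0)); last by rewrite !subr0. by apply: cvgB => //; exact: cvgB.
apply/funext => n. exact: (Rintegral_mul_split (sX1 n) (sX2 n) (st (u1 n)) (st (u2 n))).
Qed.

(** The square expands into covariances that all have the same limit. *)
Lemma Z_eps_dist_cvg0 (e1 e2 : nat -> R) t : (forall n, 0 < e1 n) -> (forall n, 0 < e2 n) ->
  e1 n @[n --> \oo] --> 0 -> e2 n @[n --> \oo] --> 0 -> 0 <= t <= T ->
  \int[P]_w (Z (e1 n) t w - Z (e2 n) t w) ^+ 2 @[n --> \oo] --> 0.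
Proof.
move=> e10 e20 c1 c2 /andP[t0 tT].
have h f1 f2 p1 p2 q1 q2 := @Z_eps_covariance_cvg f1 f2 0 t p1 p2 q1 q2 (lexx 0) t0 tT.
have -> : (fun n => \int[P]_w (Z (e1 n) t w - Z (e2 n) t w) ^+ 2) = (fun n =>
  \int[P]_w ((Z (e1 n) t w - Z (e1 n) 0 w) * (Z (e1 n) t w - Z (e1 n) 0 w)) +
  \int[P]_w ((Z (e2 n) t w - Z (e2 n) 0 w) * (Z (e2 n) t w - Z (e2 n) 0 w)) +
  (- (\int[P]_w ((Z (e1 n) t w - Z (e1 n) 0 w) * (Z (e2 n) t w - Z (e2 n) 0 w))) +
   - (\int[P]_w ((Z (e1 n) t w - Z (e1 n) 0 w) * (Z (e2 n) t w - Z (e2 n) 0 w))))); last first.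
  apply: (cvg_eqr (limit_variance (t - 0) + limit_variance (t - 0) +
    (- limit_variance (t - 0) + - limit_variance (t - 0)))); last by rewrite -opprD subrr.
  apply: cvgD; first by apply: cvgD; exact: h.
  have hN : - (\int[P]_w ((Z (e1 n) t w - Z (e1 n) 0 w) * (Z (e2 n) t w - Z (e2 n) 0 w))) @[n --> \oo] --> - limit_variance (t - 0).
    by apply: cvgN; exact: h.
  by apply: (cvgD hN).
apply/funext => n.
have s1 := sq (Z_eps_space (e10 n) (lexx 0) t0 tT); have s2 := sq (Z_eps_space (e20 n) (lexx 0) t0 tT).
move: (Z (e1 n)) (Z (e2 n)) s1 s2 (Z_eps0 (e1 n)) (Z_eps0 (e2 n)) => A B s1 s2 A0 B0.
rewrite -(Rintegral_sqrB s1 s2); apply: eq_Rintegral => w _. by rewrite A0 B0 !subr0.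
Qed.

End Z_eps.

Lemma limit_varianceE (t : R) : 0 <= t -> limit_variance t = c * Num.sqrt (2 / pi) *
    \int[lebesgue_measure]_(s in `[0, t]) ((t - s) * expR (- (v ^+ 2 * s / 2)) / Num.sqrt s).
Proof.
set mu := @lebesgue_measure R; rewrite le_eqVlt => /orP[/eqP <-|t0].
  by rewrite /limit_variance set_itv_ge ?bnd_simp ?ltxx// Rintegral_set0 set_itv1 Rintegral_set1 mulr0.
have mI := measurable_itvR `]0, t]. have [i1 _] := integral_inverse_sqrt t0.
have i2 : mu.-integrable `]0, t] (EFin \o (fun s => (t - s) * expR (- (v ^+ 2 * s / 2)) / Num.sqrt s)).
  have i3 := integrableZl mI t i1. apply: (integrable_dominated mu (fun s => t * (Num.sqrt s)^-1)) => //.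
    apply: measurable_funM.
      apply: measurable_funTS; apply: continuous_measurable_fun => s; apply: cvgM.
        by apply: cvgB; [exact: cvg_cst|exact: cvg_id].
      have c1 : - (v ^+ 2 * r / 2) @[r --> s] --> - (v ^+ 2 * s / 2).
        by apply: cvgN; apply: cvgM; [apply: cvgM; [exact: cvg_cst|exact: cvg_id]|exact: cvg_cst].
      exact: (cvg_comp _ _ c1 (@continuous_expR R _)).
    by apply/measurable_EFinP; exact: measurable_int i1.
  move=> s; rewrite /= in_itv/= => /andP[s0 st]. have ts : 0 <= t - s by rewrite subr_ge0.
  have e1 : expR (- (v ^+ 2 * s / 2)) <= 1.
    rewrite -expR0 ler_expR oppr_le0; apply: divr_ge0 => //; apply: mulr_ge0; [exact: sqr_ge0|exact: ltW].
  rewrite ger0_norm; last by rewrite !mulr_ge0 ?expR_ge0 ?invr_ge0 ?sqrtr_ge0.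
  apply: ler_wpM2r; first by rewrite invr_ge0 sqrtr_ge0. rewrite -[leRHS]mulr1; apply: ler_pM => //.
  by rewrite lerBlDr lerDl ltW.
have <- := @Rintegral_itv_obnd_cbnd R 0 (BRight t) _ i2.
rewrite -(RintegralZl _ mI i2); apply: eq_Rintegral => s; rewrite inE /= in_itv/= => /andP[s0 st].
rewrite return_densityE//. have p0 : 0 < pi :> R by exact: pi_gt0.
(* The density contributes (2 pi)^(-1/2), and the two orders of a pair of times the factor 2. *)
have -> : Num.sqrt (2 / pi) = 2 * (Num.sqrt (pi *+ 2))^-1 :> R.
  have q0 : 0 <= 2 * (Num.sqrt (pi *+ 2))^-1 :> R by rewrite mulr_ge0// invr_ge0 sqrtr_ge0.
  rewrite -[RHS]ger0_norm// -sqrtr_sqr exprMn exprVn sqr_sqrtr; last by rewrite mulrn_wge0// ltW.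
  congr Num.sqrt; rewrite -mulr_natr; move: (lt0r_neq0 p0). by move: (pi : R) => z z0; field.
by move: (expR _) (Num.sqrt _)^-1 (Num.sqrt _)^-1 => x y z; ring.
Qed.

(** * The law of the limit process *)

Section limit_law.
Variables (Z : R -> Omega -> R) (x : nat -> R).
Hypothesis x0 : forall j, 0 < x j <= j.+1%:R^-1.
Hypothesis cZ : continuous_process T Z.
Hypothesis Z0 : forall w, Z 0 w = 0.
Hypothesis XZ : {ae P, forall w, exists tau : nat -> R,
  tau n @[n --> \oo] --> 0 /\ forall n t, 0 <= t <= T -> `|Z_eps P T Y (x n) t w - Z t w| <= tau n}.
Local Notation sp := (ou_space).
Local Notation lv := (limit_variance).

Let gauss := ou_span_gaussian.
Let lin := ou_span_lin.
Let sq X : sp X -> sqint P X. Proof. exact: (gclos_sqint gauss). Qed.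

Lemma limit_increment a b : 0 <= a -> a <= b -> b <= T ->
  sp (fun w => Z b w - Z a w) /\ \int[P]_w (Z b w - Z a w) ^+ 2 = lv (b - a).
Proof.
move=> a0 ab bT. have xp j : 0 < x j by have /andP[] := x0 j. have xc : x n @[n --> \oo] --> 0.
  by apply: cvg0_harmonic => n; rewrite (ltW (xp n)); have /andP[] := x0 n.
have [mZ _] := cZ. have aT : 0 <= a <= T by rewrite a0 (le_trans ab). have bT' : 0 <= b <= T by rewrite (le_trans a0).
pose X n w := Z_eps P T Y (x n) b w - Z_eps P T Y (x n) a w.
have gX n : sp (X n) by exact: (Z_eps_space (xp n) a0 ab bT). have mD : measT (fun w => Z b w - Z a w).
  by apply: measurable_funB; apply: mZ; rewrite in_itv.
have dX : pdist P (X n) (fun w => Z b w - Z a w) @[n --> \oo] --> 0.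
  apply: pdist_ae => //; first by move=> n; case: (gX n). apply: filterS XZ => w [tau [tau0 ht]].
  have c1 t : 0 <= t <= T -> Z_eps P T Y (x n) t w @[n --> \oo] --> Z t w.
    by move=> tT; apply: (cvg_dist_le tau) => // n; exact: ht.
  by apply: cvgB; exact: c1.
have gZ := gclos_cvg gauss gX mD dX; split => //. have L2 := gclos_L2 gauss lin gX gZ dX.
have sX n := sq (gX n); have sZ := sq gZ. under eq_Rintegral do rewrite expr2.
apply: (cvgr_unique (L2_cvg_mul sX sX sZ sZ L2 L2) _ (fun n => erefl)).
exact: (Z_eps_covariance_cvg xp xp xc xc a0 ab bT).
Qed.

Lemma limit_space t : 0 <= t <= T -> sp (Z t).
Proof.
move=> /andP[t0 tT]; have [+ _] := limit_increment (lexx 0) t0 tT. by under eq_fun do rewrite Z0 subr0.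
Qed.

Let sp0 : sp (fun=> 0).
Proof.
have h : 0 <= (0 : R) <= T by rewrite lexx ltW. by have := ou_space_pairing 0 h; under eq_fun do rewrite linear0.
Qed.

Let sp_sum (I : finType) (k : I -> R) (A : I -> Omega -> R) (l : seq I) : (forall i, sp (A i)) ->
  sp (fun w => \sum_(i <- l) k i * A i w).
Proof.
move=> gA; elim: l => [|i l IH]; first by under eq_fun do rewrite big_nil.
have -> : (fun w => \sum_(j <- i :: l) k j * A j w) = (fun w => k i * A i w + \sum_(j <- l) k j * A j w).
  by apply/funext => w; rewrite big_cons.
exact: (gclosD gauss lin (gclosZ gauss lin (k i) (gA i)) IH).
Qed.

Lemma limit_gaussian : gaussian_process P T Z.
Proof.
move=> n t k tT; pose S w := \sum_(i < n) k i * Z (t i) w. have gS : sp S.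
  by apply: sp_sum => i; apply: limit_space; have := tT i; rewrite in_itv.
exists 0, (\int[P]_w S w ^+ 2); apply/centered_gaussianP. exact: (gclos_variance gauss gS).
Qed.

(** Polarisation, from the variances of all increments. *)
Let covariance (h s t : R) : 0 <= h -> 0 <= s -> 0 <= t -> s + h <= T -> t + h <= T ->
  \int[P]_w ((Z (s + h) w - Z h w) * (Z (t + h) w - Z h w)) = (lv s + lv t - lv `|s - t|) / 2.
Proof.
move=> h0 s0 t0 sT tT.
have inc r : 0 <= r -> r + h <= T -> sp (fun w => Z (r + h) w - Z h w) /\ \int[P]_w ((Z (r + h) w - Z h w) * (Z (r + h) w - Z h w)) = lv r.
  move=> r0 rT; have hr : h <= r + h by rewrite lerDr.
  have [g e] := limit_increment h0 hr rT; split => //; rewrite addrK in e.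
  by rewrite -e; apply: eq_Rintegral => w _; rewrite expr2.
have [g1 e1] := inc s s0 sT; have [g2 e2] := inc t t0 tT. have E := Rintegral_sqrB (sq g1) (sq g2); rewrite e1 e2 in E.
have D : \int[P]_w (Z (s + h) w - Z h w - (Z (t + h) w - Z h w)) ^+ 2 = lv `|s - t|.
  have [st|/ltW ts] := leP s t.
    have [_ e] := @limit_increment (s + h) (t + h) (addr_ge0 s0 h0) (lerD st (lexx h)) tT.
    have -> : `|s - t| = t + h - (s + h) by rewrite ler0_norm ?subr_le0//; ring.
    by rewrite -e; apply: eq_Rintegral => w _; ring.
  have [_ e] := @limit_increment (t + h) (s + h) (addr_ge0 t0 h0) (lerD ts (lexx h)) sT.
  have -> : `|s - t| = s + h - (t + h) by rewrite ger0_norm ?subr_ge0//; ring.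
  by rewrite -e; apply: eq_Rintegral => w _; ring.
rewrite D in E; move: E; move: (\int[P]_w _) (lv _) (lv _) (lv _) => C p q r; lra.
Qed.

(** Centred Gaussian vectors with the same covariances have the same law. *)
Lemma limit_stationary_increments : stationary_increments P T Z.
Proof.
move=> h n t h0 tT E mE. have t0 i : 0 <= t i by have [] := tT i. have htT i : t i + h <= T by have [] := tT i.
have t0T i : t i + 0 <= T by rewrite addr0; apply: le_trans (htT i); rewrite lerDl.
pose A (r : R) (i : 'I_n) w := Z (t i + r) w - Z r w. have gA r i : 0 <= r -> t i + r <= T -> sp (A r i).
  by move=> r0 rT; apply: (limit_increment r0 _ rT).1; rewrite lerDr.
have gh i := gA h i h0 (htT i); have g0 i := gA 0 i (lexx 0) (t0T i).
have cov i j : \int[P]_w (A h i w * A h j w) = \int[P]_w (A 0 i w * A 0 j w).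
  by rewrite /A !covariance.
have mom k : \int[P]_w (\sum_(i < n) k i * A h i w) ^+ 2 = \int[P]_w (\sum_(i < n) k i * A 0 i w) ^+ 2.
  exact: (second_moment_sum _ (index_enum 'I_n) (fun i => sq (gh i)) (fun i => sq (g0 i)) cov).
have cf r k : (forall i, sp (A r i)) ->
    \int[P]_w cos (\sum_(i < n) k i * A r i w) = expR (- (1 ^+ 2 * (\int[P]_w (\sum_(i < n) k i * A r i w) ^+ 2) / 2)) /\
    \int[P]_w sin (\sum_(i < n) k i * A r i w) = 0.
  move=> gr; have gS : sp (fun w => \sum_(i < n) k i * A r i w) by exact: sp_sum.
  have [_ _ /(_ 1)[e1 e2]] := gclos_variance gauss gS.
  by split; [apply: etrans e1|apply: etrans e2]; apply: eq_Rintegral => w _; rewrite mul1r.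
have mA i : measT (A h i) by case: (gh i). have mB i : measT (A 0 i) by case: (g0 i). have := vector_law mA mB _ _ mE.
have -> : (fun w => [tuple Z (t i) w - Z 0 w | i < n]) = (fun w => [tuple A 0 i w | i < n]).
  by apply/funext => w; apply: eq_mktuple => i; rewrite /A addr0.
by apply=> k; [rewrite (cf h k gh).1 (cf 0 k g0).1 mom|rewrite (cf h k gh).2 (cf 0 k g0).2].
Qed.

Lemma limit_second_moment t : 0 <= t <= T -> ('E_P[fun w => (Z t w ^+ 2)%R])%E = (lv t)%:E.
Proof.
move=> tT; have [_ i] := sq (limit_space tT); have /andP[t0 tle] := tT.
have [_ e] := limit_increment (lexx 0) t0 tle; rewrite subr0 in e; rewrite -e unlock.
have -> : \int[P]_w (Z t w - Z 0 w) ^+ 2 = \int[P]_w Z t w ^+ 2.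
  by apply: eq_Rintegral => w _; rewrite Z0 subr0.
by rewrite /Rintegral fineK//; exact: (integrable_fin_num measurableT i).
Qed.

End limit_law.

End ornstein_uhlenbeck_law.

Theorem theorem6p3 (R : realType) (d : measure_display)
    (Omega : measurableType d) (P : probability Omega R)
    (rho a T : R) (Y : R -> Omega -> tempered R) :
  0 < rho -> rho < 1 -> 0 < T ->
  stationary_OU_solution P T (1 / 2) (a * (1 - 2 * rho)) (Num.sqrt (chi rho)) Y ->
  exists (d' : measure_display) (Omega' : measurableType d')
         (P' : probability Omega' R) (Z : R -> Omega' -> R),
    [/\ cvg_distribution_C0T T 0^'+ P (Z_eps P T Y) P' Z,
        gaussian_process P' T Z,
        stationary_increments P' T Z &
        forall t, t \in `[0, T] ->
          ('E_P'[fun w => (Z t w ^+ 2)%R])%E =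
            (chi rho * Num.sqrt (2 / pi) *
             \int[lebesgue_measure]_(s in `[0, t])
               ((t - s) * expR (- ((a * (1 - 2 * rho)) ^+ 2 * s / 2))
                / Num.sqrt s))%:E].
Proof.
move=> rho0 rho1 T0 HY. have c0 : 0 <= chi rho by rewrite /chi mulr_ge0 ?subr_ge0// ltW.
have sX e t : 0 < e -> 0 <= t <= T -> sqint P (Z_eps P T Y e t).
  move=> e0 /andP[t0 tT]; have := Z_eps_space T0 c0 HY e0 (lexx 0) t0 tT.
  move=> /(gclos_sqint (ou_span_gaussian T0 c0 HY)). by under eq_fun do rewrite Z_eps0 subr0.
have K0 : 0 <= 4 * chi rho * (Num.sqrt (pi *+ 2))^-1 by apply: mulr_ge0; [exact: mulr_ge0|rewrite invr_ge0 sqrtr_ge0].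
have [Z [x [x0 cZ Z0 XZ]]] := limit_process T0 (@Z_eps0 _ _ _ P T Y)
  (Z_eps_process T0 c0 HY) sX K0 (Z_eps_increment_le T0 c0 HY) (Z_eps_dist_cvg0 T0 c0 HY).
have xp j : 0 < x j by have /andP[] := x0 j. have Zx := XZ x (fun j => introT andP (conj (xp j) (lexx (x j)))).
exists d, Omega, P, Z; split.
- exact: (uniform_cvg_distribution T0 (Z_eps_process T0 c0 HY) cZ xp XZ).
- exact: (limit_gaussian T0 c0 HY x0 cZ Z0 Zx).
- exact: (limit_stationary_increments T0 c0 HY x0 cZ Zx).
- move=> t; rewrite in_itv/= => tT; have /andP[t0 _] := tT.
  by rewrite (limit_second_moment T0 c0 HY x0 cZ Z0 Zx tT) limit_varianceE.
Qed.
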